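(* Let $\nu_n\ge1$ and let $X_1,\dots,X_n$ be iid mean zero random vectors in $\mathbb{R}^p$ with covariance matrix $\Sigma\in\mathcal{G}(r,\zeta_p)$, $r\in[0,1)$, such that $X_{ik}\sim\mathrm{subgaussian}(\nu_n^2)$ for all $k=1,\dots,p$. Suppose that there exist constants $C_1,C_2,C_3>0$ such that $\Gamma_{(j,k),(j,k)}\ge C_1$ for all $j,k=1,\dots,p$, $\xi_6\le C_2\nu_n^{1/3}$ and $\xi_8\le C_3\nu_n^{1/2}$. Let $\alpha,\beta,K\in(0,1)$ and $\tau_*=\beta^{-1}a_{\bar T_n^\sharp}(1-\alpha)$. If $\nu_n^4\log^7(np)\le C_4n^{1-K}$ for a constant $C_4>0$, then $$\|\hat\Sigma(\tau_* )-\Sigma\|_2\le\left[\frac{3+2\beta}{\beta^{1-r}}+\left(\frac{\beta}{1-\beta}\right)^r\right]\zeta_p\,a_{\bar T_n^\sharp}^{1-r}(1-\alpha),$$ $$\frac1p|\hat\Sigma(\tau_* )-\Sigma|_F^2\le2\left[\frac{4+3\beta^2}{\beta^{2-r}}+2\left(\frac{\beta}{1-\beta}\right)^r\right]\zeta_p\,a_{\bar T_n^\sharp}^{2-r}(1-\alpha)$$ hold with probability at least $1-\alpha-Cn^{-K/6}$ for some constant $C>0$ depending only on $C_1,\dots,C_4$. In addition, $\mathbb{E}[a_{\bar T_n^\sharp}(1-\alpha)]\le C'\xi_4^2(\log(p)/n)^{1/2}$ and $$\mathbb{E}[\tau_*]\le C'\beta^{-1}\xi_4^2(\log(p)/n)^{1/2},$$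 where $C'>0$ is a constant depending only on $\alpha$ and $C_1,\dots,C_4$.
   Context: Throughout $n\ge4$ and $d=p^2\ge3$; $p$ and the distribution of $X_i$ may depend on $n$. A random variable $X$ is subgaussian with mean zero and variance factor $\nu^2$, written $X\sim\mathrm{subgaussian}(\nu^2)$, if $\mathbb{E}[\exp(X^2/\nu^2)]\le\sqrt2$. For $q>0$, $\xi_q=\max_{1\le k\le p}\|X_{1k}\|_q$ with $\|X\|_q=(\mathbb{E}|X|^q)^{1/q}$. For $r\in[0,1)$ and $\zeta_p>0$, $\mathcal{G}(r,\zeta_p)$ is the class of $p\times p$ covariance matrices $\Sigma=\{\sigma_{mk}\}$ with $\max_{1\le m\le p}\sum_{k=1}^p|\sigma_{mk}|^r\le\zeta_p$ (for $r=0$, $|\sigma|^0$ means $\mathbf 1\{\sigma\ne0\}$). Covariance kernel: $h(x_1,x_2)=(x_1-x_2)(x_1-x_2)^\top/2\in\mathbb{R}^{p\times p}$; the corresponding U-statistic $\frac1{n(n-1)}\sum_{i\ne j}h(X_i,X_j)$ is the sample covariance matrix $\hat S_n=\{\hat s_{mk}\}=(n-1)^{-1}\sum_{i=1}^n(X_i-\bar X_n)(X_i-\bar X_n)^\top$. Here $g(x)=\mathbb{E}[h(x,X_1)]-\Sigma=(xx^\top-\Sigma)/2$ and $\Gamma=\mathrm{Cov}(g(X_1))$ is indexed by pairs, so $\Gamma_{(j,k),(j,k)}=\mathrm{Var}(g_{jk}(X_1))$. Thresholded estimator: $\hat\Sigma(\tau)=\{\hat s_{mk}\mathbf 1\{|\hat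 s_{mk}|>\tau\}\}_{m,k=1}^p$. Bootstrap: $e_1,\dots,e_n$ are iid $N(0,1)$ independent of $X_1^n=(X_1,\dots,X_n)$, $T_n^\sharp=\frac1{\sqrt n}\sum_{i=1}^n[\frac1{n-1}\sum_{j\ne i}h(X_i,X_j)-\hat S_n]e_i$, $\bar T_n^\sharp=2n^{-1/2}\max_{1\le m,k\le p}|T^\sharp_{n,mk}|$, and $a_{\bar T_n^\sharp}(\alpha)=\inf\{t\in\mathbb{R}:\mathbb{P}_e(\bar T_n^\sharp\le t)\ge\alpha\}$, where $\mathbb{P}_e$ is the probability with respect to $e_1,\dots,e_n$ only (conditional on $X_1^n$). $\|\cdot\|_2$ is the spectral norm and $|\cdot|_F$ the Frobenius norm; $a^{s}(1-\alpha)$ denotes the $s$-th power of $a(1-\alpha)$. *)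

(* Defs.v *)
From HB Require Import structures.
From mathcomp Require Import all_boot all_order all_algebra.
From mathcomp Require Import all_classical all_reals all_analysis.

Set Implicit Arguments.
Unset Strict Implicit.
Unset Printing Implicit Defensive.

Import Order.TTheory GRing.Theory Num.Theory.
Import numFieldNormedType.Exports.

Local Open Scope classical_set_scope.
Local Open Scope ring_scope.

Section Matrices.
Context {R : realType} {p : nat}.
Implicit Types (A S : 'M[R]_p) (r zeta tau : R).

Definition euclidean_norm (x : 'cV[R]_p) : R :=
  Num.sqrt (\sum_k x k 0 ^+ 2).

Definition spectral_norm A : R :=
  sup [set euclidean_norm (A *m x) | x in [set x | euclidean_norm x <= 1]].

Definition frobenius_norm A : R :=
  Num.sqrt (\sum_m \sum_k A m k ^+ 2).

Definition max_abs_entry A : R :=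
  \big[Num.max/0]_m \big[Num.max/0]_k `|A m k|.

Definition covariance_matrix S : Prop :=
  S^T = S /\ forall x : 'cV[R]_p, 0 <= (x^T *m S *m x) 0 0.

(* The restriction to nonzero entries only matters for r = 0, where
   [0 `^ 0 = 1] while the convention here is that |0|^0 = 0. *)
Definition sparse_class r zeta : set 'M[R]_p :=
  [set S | covariance_matrix S /\
     \big[Num.max/0]_m \sum_(k | S m k != 0) `|S m k| `^ r <= zeta].

Definition threshold tau A : 'M[R]_p :=
  \matrix_(m, k) (if tau < `|A m k| then A m k else 0).

Definition cov_kernel (x y : 'cV[R]_p) : 'M[R]_p :=
  2^-1 *: ((x - y) *m (x - y)^T).

End Matrices.

Section Sample.
Context {R : realType} {n p : nat}.
Implicit Types (x : 'I_n -> 'cV[R]_p) (e : 'I_n -> R).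

Definition sample_mean x : 'cV[R]_p := n%:R^-1 *: \sum_i x i.

Definition sample_cov x : 'M[R]_p :=
  n.-1%:R^-1 *:
    \sum_i ((x i - sample_mean x) *m (x i - sample_mean x)^T).

Definition boot_matrix x e : 'M[R]_p :=
  (Num.sqrt n%:R)^-1 *:
    \sum_i e i *: (n.-1%:R^-1 *: (\sum_(j | j != i) cov_kernel (x i) (x j))
                   - sample_cov x).

Definition boot_max x e : R :=
  2 * (Num.sqrt n%:R)^-1 * max_abs_entry (boot_matrix x e).

End Sample.

Section Probability.
Local Open Scope ereal_scope.
Context {d : measure_display} {T : measurableType d} {R : realType}.
Variable P : probability T R.

Definition mutually_independent d1 (T1 : measurableType d1) (I : finType)
    (U : I -> T -> T1) : Prop :=
  forall (J : {set I}) (B : I -> set T1),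
    (forall i, measurable (B i)) ->
    P (\bigcap_(i in [set` J]) (U i @^-1` B i)) =
    \prod_(i in J) P (U i @^-1` B i).

Definition independent2 d1 (T1 : measurableType d1) d2 (T2 : measurableType d2)
    (U : T -> T1) (V : T -> T2) : Prop :=
  forall A B, measurable A -> measurable B ->
    P (U @^-1` A `&` V @^-1` B) = P (U @^-1` A) * P (V @^-1` B).

Definition iid d1 (T1 : measurableType d1) (I : finType)
    (U : I -> {RV P >-> T1}) : Prop :=
  mutually_independent U /\
  forall i j B, measurable B ->
    distribution P (U i) B = distribution P (U j) B.

Definition standard_normal (Z : {RV P >-> R}) : Prop :=
  forall B, measurable B -> distribution P Z B = normal_prob 0%R 1%R B.

Definition subgaussian (v : R) (Y : T -> R) : Prop :=
  'E_P[fun w => expR (Y w ^+ 2 / v)] <= (Num.sqrt 2)%:E.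

Section RandomVector.
Context {p : nat}.
Implicit Types (Y : T -> p.-tuple R).

Definition vec (y : p.-tuple R) : 'cV[R]_p := \col_k tnth y k.

Definition max_moment Y (q : R) : \bar R :=
  \big[maxe/0]_(k < p) Lnorm P q%:E (fun w => (tnth (Y w) k)%:E).

Definition cov_mx Y : 'M[R]_p :=
  \matrix_(m, k)
    fine (covariance P (fun w => tnth (Y w) m) (fun w => tnth (Y w) k)).

Definition hajek Y (x : 'cV[R]_p) : 'M[R]_p :=
  ((\matrix_(j, k) fine 'E_P[fun w => cov_kernel x (vec (Y w)) j k]) - cov_mx Y)%R.

Definition hajek_cov Y (a b : 'I_p * 'I_p) : \bar R :=
  covariance P (fun w => hajek Y (vec (Y w)) a.1 a.2)
               (fun w => hajek Y (vec (Y w)) b.1 b.2).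

End RandomVector.

(* The multiplier probability: the sample [x] is frozen and only the
   multipliers [e] vary with the outcome. For [e] independent of the data and
   [x] the observed data, this is the conditional probability given the data. *)
Definition boot_quantile n p (x : 'I_n -> 'cV[R]_p) (e : 'I_n -> T -> R)
    (a : R) : R :=
  inf [set t : R | a%:E <= P [set w | (boot_max x (fun i => e i w) <= t)%R]].

End Probability.

(* Main.v *)
(* The matrix bounds are deterministic consequences of |S_hat - Sigma| <= a entrywise (Schur test on
   the rows), so the first part amounts to P(max |S_hat - Sigma| > a) <= alpha + C n^(-K/6). Up to a
   quadratic remainder this maximum is that of a sum of independent vectors, which is compared with
   the Gaussian multiplier sum of a fixed good sample.

   The comparison is a Lindeberg replacement for g o F, where F is the soft-max of the coordinates and
   g a logistic function of slope phi. Each replacement costs at most eta times (w o F), w = g (1 - g);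
   as w o F itself has small replacement error, the total cost is O(n eta) times the Gaussian mean of
   w o F. That mean is O(sqrt(log p) / phi) by anti-concentration, proved by comparing the soft-plus of
   F at the Gaussian vectors Y and sqrt(1 + s^2) Y and letting s tend to 0. With l = ln(n p) and
   phi ~ sqrt l (nu^4 l^7 / n)^(-1/6) the error is (nu^4 l^7 / n)^(1/6).

   For the second part, a Gaussian union bound gives a <= sqrt(2 V ln(2 p^2 / alpha) / n), with V a
   multiple of the largest empirical fourth moment, whose mean is O(xi_4^4) by a truncated exponential
   moment and the lower bound on Gamma. *)
Require Import Defs.
From HB Require Import structures.
From mathcomp Require Import all_boot all_order all_algebra.
From mathcomp Require Import ring lra.
From mathcomp Require Import all_classical all_reals all_analysis measurable_realfun.
Import Order.TTheory GRing.Theory Num.Theory.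
Import numFieldNormedType.Exports.
Local Open Scope classical_set_scope.
Local Open Scope ring_scope.
Set Implicit Arguments.
Unset Strict Implicit.
Unset Printing Implicit Defensive.

(** * Calculus of one real variable *)

Section Calculus.
Context {R : realType}.
Implicit Types (f g : R -> R) (x : R).

(** Anti-concentration is available for the Gaussian sum only, while replacement errors arise at
    mixed sums of data and Gaussian increments. Hence every error is measured in units of w o F at
    the current point. Averaging over one data increment (A) and over one Gaussian increment (B) are
    convolutions and commute, so A^n is compared with B^n by an induction whose bounds involve only
    B^k g and B^k w, and anti-concentration is invoked once, for the single Gaussian vector that B^n
    represents.

    The scale comes from a balance. The soft-max exponent is 2 l phi, which makes its bias at most 1
    / phi. With u = nu^(2/3), the moment hypotheses give E X^6 = O(u^3) and E X^8 = O(u^6), and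
    interpolation gives E X^4 = O(u^2) and E X^2 = O(u). The total third-order cost is of order
    phi^3 l^2 u^3 / sqrt n, and the cost of estimating covariances is of order phi^2 l u^3 sqrt(l /
    n). Taking phi = c0 sqrt l / rho with rho^6 = nu^4 l^7 / n bounds both, and the final error sqrt
    l / phi is a multiple of rho. *)

Lemma is_derive_bigsum (I : Type) (r : seq I) (h : I -> R -> R) (dh : I -> R) x :
  (forall i, is_derive x 1 (h i) (dh i)) ->
  is_derive x 1 (fun s : R => \sum_(i <- r) h i s) (\sum_(i <- r) dh i).
Proof.
move=> dhh; elim: r => [|i r IH].
  rewrite big_nil (_ : (fun _ => _) = cst 0); last by apply/funext => s; rewrite big_nil.
  exact: is_derive_cst.
rewrite big_cons (_ : (fun _ => _) = h i + (fun s : R => \sum_(i <- r) h i s)).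
  exact: is_deriveD.
by apply/funext => s; rewrite big_cons.
Qed.

Lemma is_derive_mul f g x df dg : is_derive x 1 f df -> is_derive x 1 g dg ->
  is_derive x 1 (fun s : R => f s * g s) (df * g x + f x * dg).
Proof.
move=> hf hg; have := is_deriveM hf hg.
by move=> h; apply: is_derive_eq h _; rewrite /GRing.scale/= addrC [g x * df]mulrC.
Qed.

Lemma is_derive_add f g x df dg : is_derive x 1 f df -> is_derive x 1 g dg ->
  is_derive x 1 (fun s : R => f s + g s) (df + dg).
Proof. by move=> hf hg; exact: is_deriveD. Qed.

Lemma is_derive_sub f g x df dg : is_derive x 1 f df -> is_derive x 1 g dg ->
  is_derive x 1 (fun s : R => f s - g s) (df - dg).
Proof. by move=> hf hg; exact: is_deriveB. Qed.

Lemma is_derive_comp f g x a b : is_derive (g x) 1 f a -> is_derive x 1 g b ->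
  is_derive x 1 (fun s : R => f (g s)) (a * b).
Proof. by move=> hf hg; exact (is_derive1_comp hf hg). Qed.

Lemma is_derive_const (c : R) x : is_derive x 1 (fun _ : R => c) 0.
Proof. exact: is_derive_cst. Qed.

Lemma is_derive_scale (c : R) f x df : is_derive x 1 f df ->
  is_derive x 1 (fun s : R => c * f s) (c * df).
Proof.
by move=> hf; apply: is_derive_eq (is_derive_mul (is_derive_const c x) hf) _; rewrite mul0r add0r.
Qed.

Lemma is_derive_inv f x df : f x != 0 -> is_derive x 1 f df ->
  is_derive x 1 (fun s : R => (f s)^-1) (- df / f x ^+ 2).
Proof.
move=> f0 hf; have := is_deriveV f0 hf.
by move=> h; apply: is_derive_eq h _; rewrite /GRing.scale/=; field.
Qed.

Lemma is_derive_within_continuous f (df : R -> R) (a b : R) :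
  (forall x : R, is_derive x 1 f (df x)) -> {within `[a, b], continuous f}.
Proof.
move=> hf; apply: continuous_subspaceT => x.
apply: differentiable_continuous; apply/derivable1_diffP.
by have := hf x; case.
Qed.

Lemma mean_value f (df : R -> R) : (forall x : R, is_derive x 1 f (df x)) ->
  forall a b, a <= b -> exists2 c, a <= c <= b & f b - f a = df c * (b - a).
Proof.
move=> hf a b ab.
have [c cab h] := MVT_segment ab (fun x _ => hf x) (is_derive_within_continuous hf).
by exists c => //; move: cab; rewrite in_itv.
Qed.

(** The mean value theorem is applied to [q2], to [q1] minus its linear part and to [q] minus its
    quadratic part. Each increment has length at most 1, so [K] is carried along without the factor
    1/6. *)
Lemma taylor3 (q q1 q2 q3 : R -> R) (K : R) :
  (forall s : R, is_derive s 1 q (q1 s)) -> (forall s : R, is_derive s 1 q1 (q2 s)) ->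
  (forall s : R, is_derive s 1 q2 (q3 s)) ->
  (forall s, 0 <= s <= 1 -> `|q3 s| <= K) ->
  `|q 1 - q 0 - q1 0 - 2^-1 * q2 0| <= K.
Proof.
move=> h0 h1 h2 hK.
have K0 : 0 <= K by apply: le_trans (hK 0 _); rewrite ?normr_ge0 ?lexx ?ler01.
have did (s : R) : is_derive s 1 (@id R) 1 by exact: is_derive_id.
have b2 s : 0 <= s <= 1 -> `|q2 s - q2 0| <= K.
  move=> /andP[s0 s1]; have [c /andP[c0 cs] ->] := mean_value h2 s0.
  rewrite normrM subr0 (ger0_norm s0) -[leRHS]mulr1 ler_pM// hK// c0/=.
  exact: le_trans cs s1.
have b1 s : 0 <= s <= 1 -> `|q1 s - q1 0 - q2 0 * s| <= K.
  move=> /andP[s0 s1].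
  have hd (t : R) : is_derive t 1 (fun s : R => q1 s - q2 0 * s) (q2 t - q2 0 * 1).
    exact (is_derive_sub (h1 t) (is_derive_scale (q2 0) (did t))).
  have [c /andP[c0 cs]] := mean_value hd s0.
  rewrite mulr0 subr0 addrAC => ->.
  rewrite mulr1 subr0 normrM (ger0_norm s0) -[leRHS]mulr1 ler_pM// b2// c0/=.
  exact: le_trans cs s1.
have hd (t : R) : is_derive t 1 (fun s : R => q s - (q1 0 * s + 2^-1 * (q2 0 * (s * s))))
    (q1 t - (q1 0 * 1 + 2^-1 * (q2 0 * (1 * t + t * 1)))).
  exact (is_derive_sub (h0 t) (is_derive_add (is_derive_scale (q1 0) (did t))
    (is_derive_scale 2^-1 (is_derive_scale (q2 0) (is_derive_mul (did t) (did t)))))).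
have [c c01] := mean_value hd ler01.
rewrite !mulr0 !addr0 !subr0 !mulr1 => E.
have -> : q 1 - q 0 - q1 0 - 2^-1 * q2 0 = q1 c - q1 0 - q2 0 * c.
  have -> : q1 c - q1 0 - q2 0 * c = q1 c - (q1 0 + 2^-1 * (q2 0 * (1 * c + c))) by field.
  by rewrite -E; ring.
exact: b1.
Qed.

End Calculus.

(** * Soft-max smoothing *)

Section SoftMax.
Context {R : realType} {J : finType}.
Variables (beta : R) (j0 : J).
Hypothesis beta0 : 0 < beta.
Implicit Types (x xi : J -> R) (N : R).

Definition expsum x : R := \sum_j expR (beta * x j).
Definition softmax x : R := beta^-1 * ln (expsum x).
(** The Gibbs weights, which are the partial derivatives of [softmax]. The moments of a direction
    under these weights express all directional derivatives. *)
Definition softweight x j : R := expR (beta * x j) / expsum x.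
Definition softmoment k x xi : R := \sum_j softweight x j * xi j ^+ k.

Lemma expsum_gt0 x : 0 < expsum x.
Proof.
rewrite /expsum (bigD1 j0)//=; apply: ltr_pwDl; first exact: expR_gt0.
by apply: sumr_ge0 => j _; exact: expR_ge0.
Qed.

Lemma softweight_ge0 x j : 0 <= softweight x j.
Proof. by rewrite divr_ge0 ?expR_ge0// ltW// expsum_gt0. Qed.

Lemma softweight_sum x : \sum_j softweight x j = 1.
Proof. by rewrite -mulr_suml divff// gt_eqF// expsum_gt0. Qed.

Lemma softmax_ge x j : x j <= softmax x.
Proof.
rewrite /softmax mulrC ler_pdivlMr// mulrC -[leLHS](expRK (beta * x j)).
rewrite ler_ln ?posrE ?expR_gt0 ?expsum_gt0//.
rewrite /expsum (bigD1 j)//= lerDl.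
by apply: sumr_ge0 => i _; exact: expR_ge0.
Qed.

Lemma softmax_le x N : (forall j, x j <= N) ->
  softmax x <= N + beta^-1 * ln #|J|%:R.
Proof.
move=> xN; have J0 : 0 < #|J|%:R :> R by rewrite ltr0n; apply/card_gt0P; exists j0.
rewrite /softmax -{1}[N](mulKf (lt0r_neq0 beta0)) -mulrDr ler_pM2l ?invr_gt0//.
rewrite -{1}[beta * N]expRK -lnM ?posrE ?expR_gt0// ler_ln ?posrE ?expsum_gt0//; last first.
  by rewrite mulr_gt0 ?expR_gt0.
rewrite /expsum mulr_natr -sumr_const; apply: ler_sum => j _.
by rewrite ler_expR ler_pM2l.
Qed.

Lemma expsum_shift x xi N : (forall j, `|xi j| <= N) ->
  expsum (fun j => x j + xi j) <= expR (beta * N) * expsum x.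
Proof.
move=> xiN; rewrite /expsum mulr_sumr; apply: ler_sum => j _.
rewrite mulrDr expRD mulrC ler_wpM2r ?expR_ge0// ler_expR ler_pM2l//.
exact: le_trans (ler_norm _) (xiN j).
Qed.

Lemma softmax_shift x xi N : (forall j, `|xi j| <= N) ->
  softmax (fun j => x j + xi j) <= softmax x + N.
Proof.
move=> xiN; rewrite /softmax.
rewrite -[N](mulKf (lt0r_neq0 beta0)) -mulrDr ler_pM2l ?invr_gt0//.
rewrite -[beta * N]expRK -lnM ?posrE ?expR_gt0 ?expsum_gt0//.
rewrite ler_ln ?posrE ?expsum_gt0 ?mulr_gt0 ?expR_gt0 ?expsum_gt0// mulrC.
exact: expsum_shift.
Qed.

Lemma softmax_shiftN x xi N : (forall j, `|xi j| <= N) ->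
  softmax x <= softmax (fun j => x j + xi j) + N.
Proof.
move=> xiN.
have := @softmax_shift (fun j => x j + xi j) (fun j => - xi j) N.
have -> : (fun j => x j + xi j + - xi j) = x by apply/funext => j; rewrite addrK.
by apply=> j; rewrite normrN.
Qed.

(** One factor [expR (beta * N)] is lost in the numerator and another in the normalising sum. *)
Lemma softweight_shift x xi N j : (forall j, `|xi j| <= N) ->
  softweight (fun j => x j + xi j) j <= expR (2 * beta * N) * softweight x j.
Proof.
move=> xiN; rewrite /softweight.
have E : expsum x <= expR (beta * N) * expsum (fun j => x j + xi j).
  have := @expsum_shift (fun j => x j + xi j) (fun j => - xi j) N.
  have -> : (fun j => x j + xi j + - xi j) = x by apply/funext => i; rewrite addrK.
  by apply=> i; rewrite normrN.
rewrite ler_pdivrMr ?expsum_gt0// mulrA -[leRHS]mulrA [_ * expsum _]mulrC.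
rewrite mulrA ler_pdivlMr ?expsum_gt0//.
apply: (@le_trans _ _ (expR (beta * N) * expR (beta * x j) *
    (expR (beta * N) * expsum (fun j => x j + xi j)))).
  rewrite ler_pM ?expR_ge0 ?(ltW (expsum_gt0 _))//.
  rewrite mulrDr expRD mulrC ler_wpM2r ?expR_ge0// ler_expR ler_pM2l//.
  exact: le_trans (ler_norm _) (xiN j).
have -> : 2 * beta * N = beta * N + beta * N by ring.
by rewrite expRD le_eqVlt; apply/orP; left; apply/eqP; ring.
Qed.

Section Line.
Variables (x xi : J -> R).
Let line (s : R) := fun j => x j + s * xi j.
(** Unnormalised moments along the line: differentiation raises the order by one, and the quotients
    by [ek 0] are the soft moments. *)
Let ek k (s : R) := \sum_j xi j ^+ k * expR (beta * (x j + s * xi j)).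

Let is_derive_ek k (s : R) : is_derive s 1 (ek k) (beta * ek k.+1 s).
Proof.
have h j : is_derive s 1 (fun s : R => xi j ^+ k * expR (beta * (x j + s * xi j)))
    (xi j ^+ k * (expR (beta * (x j + s * xi j)) * (beta * (0 + (1 * xi j + s * 0))))).
  exact (is_derive_scale _ (is_derive_comp (is_derive_expR _) (is_derive_scale _
    (is_derive_add (is_derive_const (x j) s)
      (is_derive_mul (is_derive_id s 1) (is_derive_const (xi j) s)))))).
apply: (is_derive_eq (is_derive_bigsum _ h)).
rewrite mulr_sumr; apply: eq_bigr => j _.
by rewrite exprS; ring.
Qed.

Let ek0 s : ek 0 s = expsum (line s).
Proof. by apply: eq_bigr => j _; rewrite expr0 mul1r. Qed.

Let ek_mom k s : ek k s / ek 0 s = softmoment k (line s) xi.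
Proof.
by rewrite ek0 /ek mulr_suml; apply: eq_bigr => j _; rewrite -mulrA mulrC.
Qed.

(** Quotient rule for [ek k / ek 0]: up to [beta], the derivative is the covariance of the [k]-th
    power of [xi] with [xi] under the Gibbs weights. *)
Lemma is_derive_softmoment k (s : R) :
  is_derive s 1 (fun s => softmoment k (line s) xi)
   (beta * (softmoment k.+1 (line s) xi -
            softmoment k (line s) xi * softmoment 1 (line s) xi)).
Proof.
have e0 : ek 0 s != 0 by rewrite ek0 gt_eqF// expsum_gt0.
have := is_derive_mul (is_derive_ek k s) (is_derive_inv e0 (is_derive_ek 0 s)).
rewrite (_ : (fun _ => _) = (fun s => softmoment k (line s) xi)); last first.
  by apply/funext => t; rewrite ek_mom.
move=> h; apply: (is_derive_eq h); rewrite -!ek_mom; field; exact: e0.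
Qed.

Lemma is_derive_softmax (s : R) :
  is_derive s 1 (fun s => softmax (line s)) (softmoment 1 (line s) xi).
Proof.
have e0 : 0 < ek 0 s by rewrite ek0 expsum_gt0.
have := is_derive_scale beta^-1 (is_derive_comp (is_derive1_ln e0) (is_derive_ek 0 s)).
rewrite (_ : (fun _ => _) = (fun s => softmax (line s))); last first.
  by apply/funext => t; rewrite ek0.
move=> h; apply: (is_derive_eq h); rewrite -!ek_mom; field.
by rewrite gt_eqF//= gt_eqF.
Qed.

End Line.

Section Jensen.
Variables (x : J -> R) (a : J -> R).
Hypothesis a0 : forall j, 0 <= a j.

Lemma softmoment_ge0 k : 0 <= softmoment k x a.
Proof. by apply: sumr_ge0 => j _; rewrite mulr_ge0 ?softweight_ge0// exprn_ge0. Qed.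

(** Jensen: the cube lies above its tangent at the mean [t], with gap [(a - t)^2 (a + 2 t)]. *)
Lemma softmoment_cube : softmoment 1 x a ^+ 3 <= softmoment 3 x a.
Proof.
set t := softmoment 1 x a; have t0 : 0 <= t by exact: softmoment_ge0.
have E : \sum_j softweight x j * (t ^+ 3 + 3 * t ^+ 2 * (a j - t)) = t ^+ 3.
  transitivity (\sum_j ((t ^+ 3 - 3 * t ^+ 3) * softweight x j +
     3 * t ^+ 2 * (softweight x j * a j ^+ 1))).
    by apply: eq_bigr => j _; rewrite expr1; ring.
  rewrite big_split/= -!mulr_sumr softweight_sum -/(softmoment 1 x a) -/t; ring.
rewrite -E; apply: ler_sum => j _; rewrite ler_wpM2l ?softweight_ge0//.
rewrite -subr_ge0; have -> : a j ^+ 3 - (t ^+ 3 + 3 * t ^+ 2 * (a j - t)) =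
  (a j - t) ^+ 2 * (a j + 2 * t) by ring.
by rewrite mulr_ge0 ?sqr_ge0// addr_ge0 ?a0// mulr_ge0.
Qed.

(** Young's inequality [t a^2 <= t^3 / 3 + 2 a^3 / 3] is averaged over the weights, and [t^3] is
    bounded by [softmoment_cube]. *)
Lemma softmoment_12 : softmoment 1 x a * softmoment 2 x a <= softmoment 3 x a.
Proof.
set t := softmoment 1 x a; have t0 : 0 <= t by exact: softmoment_ge0.
have h : t * softmoment 2 x a <= 3^-1 * t ^+ 3 + 3^-1 * (2 * softmoment 3 x a).
  have -> : 3^-1 * t ^+ 3 + 3^-1 * (2 * softmoment 3 x a) =
    \sum_j softweight x j * (3^-1 * t ^+ 3 + 3^-1 * (2 * a j ^+ 3)).
    transitivity (\sum_j (3^-1 * t ^+ 3 * softweight x j +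
      3^-1 * (2 * (softweight x j * a j ^+ 3)))).
      by rewrite big_split/= -!mulr_sumr softweight_sum mulr1.
    by apply: eq_bigr => j _; ring.
  rewrite mulr_sumr; apply: ler_sum => j _; rewrite mulrCA ler_wpM2l ?softweight_ge0//.
  rewrite -subr_ge0; have -> : 3^-1 * t ^+ 3 + 3^-1 * (2 * a j ^+ 3) - t * a j ^+ 2 =
    (a j - t) ^+ 2 * (2 * a j + t) / 3 by field.
  by rewrite divr_ge0// mulr_ge0 ?sqr_ge0// addr_ge0// mulr_ge0.
by have := softmoment_cube; rewrite -/t => h3; lra.
Qed.

End Jensen.

Lemma softmoment_abs k x xi :
  `|softmoment k x xi| <= softmoment k x (fun j => `|xi j|).
Proof.
apply: le_trans (ler_norm_sum _ _ _) _; apply: ler_sum => j _.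
by rewrite normrM normrX (ger0_norm (softweight_ge0 _ _)).
Qed.

(* Third cumulants of [xi] under the soft-max weights, up to the factor
   coming from the outer function, are controlled by the third absolute moment. *)
Lemma third_order_bound x xi (c1 c2 c3 W phi : R)
  (m := fun k => softmoment k x xi) :
  0 <= phi <= beta -> 0 <= W ->
  `|c1| <= phi * W -> `|c2| <= phi ^+ 2 * W -> `|c3| <= 2 * phi ^+ 3 * W ->
  `|c3 * m 1 ^+ 3 + 3 * (c2 * (beta * (m 1 * (m 2 - m 1 ^+ 2))))
    + c1 * (beta ^+ 2 * (m 3 - 3 * (m 1 * m 2) + 2 * m 1 ^+ 3))| <=
  17 * phi * beta ^+ 2 * W * softmoment 3 x (fun j => `|xi j|).
Proof.
move=> /andP[p0 pb] W0 h1 h2 h3.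
set M := softmoment 3 x _.
pose a j := `|xi j|; have a0 j : 0 <= a j by exact: normr_ge0.
have M0 : 0 <= M by apply: softmoment_ge0.
have b0 := ltW beta0.
have n1 : `|m 1 ^+ 3| <= M.
  rewrite normrX; apply: le_trans (softmoment_cube x a0).
  by rewrite lerXn2r ?nnegrE ?normr_ge0 ?softmoment_ge0// softmoment_abs.
have n12 : `|m 1 * m 2| <= M.
  rewrite normrM; apply: le_trans (softmoment_12 x a0).
  by rewrite ler_pM// softmoment_abs.
have n3 : `|m 3| <= M by exact: softmoment_abs.
have k3 : `|m 3 - 3 * (m 1 * m 2) + 2 * m 1 ^+ 3| <= 6 * M.
  rewrite (le_trans (ler_normD _ _))// (_ : 6 = 1 + 3 + 2 :> R); last by ring.
  have -> : (1 + 3 + 2) * M = M + 3 * M + 2 * M by ring.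
  apply: lerD; last by rewrite normrM ger0_norm// ler_wpM2l.
  rewrite (le_trans (ler_normB _ _))// lerD//.
  by rewrite normrM ger0_norm// ler_wpM2l.
have k2 : `|m 1 * (m 2 - m 1 ^+ 2)| <= 2 * M.
  rewrite mulrBr -exprS (le_trans (ler_normB _ _))// (_ : 2 * M = M + M); last by ring.
  by rewrite lerD.
have t1 : `|c3 * m 1 ^+ 3| <= 2 * phi * beta ^+ 2 * W * M.
  rewrite normrM ler_pM// (le_trans h3)// ler_wpM2r// exprS mulrA ler_wpM2l ?mulr_ge0//.
  by rewrite lerXn2r ?nnegrE.
have t2 : `|3 * (c2 * (beta * (m 1 * (m 2 - m 1 ^+ 2))))| <= 6 * phi * beta ^+ 2 * W * M.
  rewrite normrM ger0_norm// normrM normrM (ger0_norm b0).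
  have -> : 6 * phi * beta ^+ 2 * W * M = 3 * ((phi * beta * W) * (beta * (2 * M))) by ring.
  rewrite ler_wpM2l// ler_pM// ?mulr_ge0//; last by rewrite ler_wpM2l.
  by rewrite (le_trans h2)// ler_wpM2r// expr2 ler_wpM2l.
have t3 : `|c1 * (beta ^+ 2 * (m 3 - 3 * (m 1 * m 2) + 2 * m 1 ^+ 3))| <=
    6 * phi * beta ^+ 2 * W * M.
  rewrite normrM normrM (ger0_norm (sqr_ge0 _)).
  have -> : 6 * phi * beta ^+ 2 * W * M = (phi * W) * (beta ^+ 2 * (6 * M)) by ring.
  by rewrite ler_pM// ?mulr_ge0 ?sqr_ge0// ler_wpM2l// sqr_ge0.
(* The three terms contribute 2, 6 and 6 times this quantity; 17 leaves room. *)
have B0 : 0 <= phi * beta ^+ 2 * W * M by rewrite !mulr_ge0// sqr_ge0.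
rewrite (le_trans (ler_normD _ _))// (le_trans (lerD (ler_normD _ _) (lexx _)))//.
by lra.
Qed.

Section Outer.
Variables (phi : R) (G G1 G2 G3 W : R -> R).
Hypothesis phi0 : 0 <= phi <= beta.
Hypotheses (dG : forall u : R, is_derive u 1 G (G1 u))
  (dG1 : forall u : R, is_derive u 1 G1 (G2 u))
  (dG2 : forall u : R, is_derive u 1 G2 (G3 u)).
Hypotheses (W0 : forall u, 0 <= W u)
  (G1W : forall u, `|G1 u| <= phi * W u)
  (G2W : forall u, `|G2 u| <= phi ^+ 2 * W u)
  (G3W : forall u, `|G3 u| <= 2 * phi ^+ 3 * W u)
  (Wstable : forall u v N, `|v - u| <= N -> W v <= expR (phi * N) * W u).

(** Second derivative at [s = 0] of [G (softmax (x + s * xi))]. *)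
Definition hess x xi : R :=
  G2 (softmax x) * softmoment 1 x xi ^+ 2 +
  G1 (softmax x) * (beta * (softmoment 2 x xi - softmoment 1 x xi ^+ 2)).

(** The third derivative is bounded at each point of the segment by [third_order_bound], and both
    factors are brought back to [x]: [W] costs [expR (phi * N)] and the weights cost
    [expR (2 * beta * N)], together at most [expR (3 * beta * N)] because [phi <= beta]. *)
Lemma softmax_taylor x xi N : (forall j, `|xi j| <= N) ->
  `|G (softmax (fun j => x j + xi j)) - G (softmax x)
    - G1 (softmax x) * softmoment 1 x xi - 2^-1 * hess x xi| <=
  17 * phi * beta ^+ 2 * (W (softmax x) *
    \sum_j softweight x j * (`|xi j| ^+ 3 * expR (3 * beta * N))).
Proof.
move=> xiN; have N0 : 0 <= N by apply: le_trans (xiN j0); exact: normr_ge0.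
pose l (s : R) := fun j => x j + s * xi j.
pose m k s := softmoment k (l s) xi.
pose F s := softmax (l s).
have dm k (s : R) : is_derive s 1 (m k) (beta * (m k.+1 s - m k s * m 1 s)).
  exact: is_derive_softmoment.
have dF (s : R) : is_derive s 1 F (m 1 s) by exact: is_derive_softmax.
pose q s := G (F s).
pose q1 s := G1 (F s) * m 1 s.
pose q2 s := G2 (F s) * (m 1 s * m 1 s) + G1 (F s) * (beta * (m 2 s - m 1 s * m 1 s)).
pose q3 s := G3 (F s) * m 1 s ^+ 3 + 3 * (G2 (F s) * (beta * (m 1 s * (m 2 s - m 1 s ^+ 2))))
    + G1 (F s) * (beta ^+ 2 * (m 3 s - 3 * (m 1 s * m 2 s) + 2 * m 1 s ^+ 3)).
have d0 (s : R) : is_derive s 1 q (q1 s) by exact (is_derive_comp (dG _) (dF s)).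
have d1 (s : R) : is_derive s 1 q1 (q2 s).
  apply: (is_derive_eq (is_derive_mul (is_derive_comp (dG1 _) (dF s)) (dm 1%N s))).
  by rewrite /q2; ring.
have d2 (s : R) : is_derive s 1 q2 (q3 s).
  have dmm := is_derive_mul (dm 1%N s) (dm 1%N s).
  apply: (is_derive_eq (is_derive_add
    (is_derive_mul (is_derive_comp (dG2 _) (dF s)) dmm)
    (is_derive_mul (is_derive_comp (dG1 _) (dF s))
       (is_derive_scale beta (is_derive_sub (dm 2%N s) dmm))))).
  by rewrite /q3; ring.
have l0 : l 0 = x by apply/funext => j; rewrite /l mul0r addr0.
have l1 : l 1 = (fun j => x j + xi j) by apply/funext => j; rewrite /l mul1r.
set K := (X in _ <= X).
have := @taylor3 R q q1 q2 q3 K d0 d1 d2.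
rewrite /q /q1 /q2 /F /m l0 l1 /hess -expr2; apply => s /andP[s0 s1].
have sN j : `|s * xi j| <= N.
  by rewrite normrM ger0_norm// -[leRHS]mul1r ler_pM.
have := @third_order_bound (l s) xi (G1 (F s)) (G2 (F s)) (G3 (F s)) (W (F s)) phi
  phi0 (W0 _) (G1W _) (G2W _) (G3W _).
rewrite -/(q3 s) => /le_trans; apply.
case/andP: phi0 => p0 pb.
rewrite /K -mulrA ler_wpM2l ?mulr_ge0 ?sqr_ge0 ?(ltW beta0)//.
have WF : W (F s) <= expR (phi * N) * W (softmax x).
  apply: Wstable.
  by rewrite ler_distl lerBlDr softmax_shiftN//= softmax_shift.
have wl j : softweight (l s) j <= expR (2 * beta * N) * softweight x j.
  by apply: softweight_shift.
rewrite /softmoment !mulr_sumr; apply: ler_sum => j _.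
have -> : W (softmax x) * (softweight x j * (`|xi j| ^+ 3 * expR (3 * beta * N))) =
   expR (3 * beta * N) * W (softmax x) * softweight x j * `|xi j| ^+ 3 by ring.
rewrite mulrA ler_wpM2r ?exprn_ge0//.
apply: le_trans (ler_pM (W0 _) (softweight_ge0 _ _) WF (wl j)) _.
rewrite mulrACA -expRD -[leRHS]mulrA ler_wpM2r ?(mulr_ge0 (W0 _)) ?softweight_ge0//.
by rewrite ler_expR -mulrDl ler_wpM2r//; lra.
Qed.

End Outer.

End SoftMax.

(** * Quadratic form of the smoothed maximum *)

Section Hessian.
Context {R : realType} {J : finType}.
Variables (beta : R) (j0 : J) (phi : R) (G1 G2 W : R -> R).
Hypothesis beta0 : 0 < beta.
Hypothesis phi0 : 0 <= phi <= beta.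
Hypotheses (W0 : forall u, 0 <= W u)
  (G1W : forall u, `|G1 u| <= phi * W u)
  (G2W : forall u, `|G2 u| <= phi ^+ 2 * W u).
Implicit Types (x xi : J -> R).

(** The Hessian matrix of [G] composed with [softmax]: a multiple of the rank-one matrix of the
    weights plus a diagonal part. *)
Definition hess_coef x (j k : J) : R :=
  let F := softmax beta x in
  let pi := softweight beta x in
  (G2 F - beta * G1 F) * (pi j * pi k) + beta * G1 F * (pi j * (j == k)%:R).

Lemma hess_coefE x (c : J -> J -> R) :
  \sum_j \sum_k hess_coef x j k * c j k =
  (G2 (softmax beta x) - beta * G1 (softmax beta x)) *
    (\sum_j \sum_k softweight beta x j * softweight beta x k * c j k)
  + beta * G1 (softmax beta x) * \sum_j softweight beta x j * c j j.
Proof.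
rewrite !mulr_sumr -big_split/=; apply: eq_bigr => j _.
have -> : softweight beta x j * c j j = \sum_k softweight beta x j * (j == k)%:R * c j k.
  rewrite (bigD1 j)//= eqxx mulr1 big1 ?addr0// => k kj.
  by rewrite eq_sym (negbTE kj) mulr0 mul0r.
rewrite !mulr_sumr -big_split/=; apply: eq_bigr => k _.
by rewrite /hess_coef; ring.
Qed.

Lemma hessE x xi : hess beta G1 G2 x xi =
  \sum_j \sum_k hess_coef x j k * (xi j * xi k).
Proof.
rewrite hess_coefE /hess.
have -> : \sum_j \sum_k softweight beta x j * softweight beta x k * (xi j * xi k) =
   softmoment beta 1 x xi ^+ 2.
  rewrite expr2 /softmoment mulr_suml; apply: eq_bigr => j _.
  by rewrite mulr_sumr; apply: eq_bigr => k _; rewrite !expr1; ring.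
have -> : \sum_j softweight beta x j * (xi j * xi j) = softmoment beta 2 x xi.
  by apply: eq_bigr => j _; rewrite expr2.
ring.
Qed.

(** Since the weights sum to 1, the rank-one part contributes [|G2| + beta |G1|] and the diagonal
    part [beta |G1|]; each of these three terms is at most [beta * phi * W]. *)
Lemma hess_coef_le x (c : J -> J -> R) (D : R) : (forall j k, `|c j k| <= D) ->
  `|\sum_j \sum_k hess_coef x j k * c j k| <= 3 * beta * phi * W (softmax beta x) * D.
Proof.
move=> cD; have D0 : 0 <= D by apply: le_trans (cD j0 j0).
have b0 := ltW beta0; case/andP: phi0 => p0 pb.
set F := softmax beta x; set pi := softweight beta x.
have pi0 j : 0 <= pi j by exact: softweight_ge0.
have pi1 : \sum_j pi j = 1 by exact: softweight_sum.
rewrite hess_coefE -/F -/pi.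
have s2 : `|\sum_j \sum_k pi j * pi k * c j k| <= D.
  apply: le_trans (ler_norm_sum _ _ _) _.
  apply: (@le_trans _ _ (\sum_j pi j * D)); last by rewrite -mulr_suml pi1 mul1r.
  apply: ler_sum => j _; apply: le_trans (ler_norm_sum _ _ _) _.
  apply: (@le_trans _ _ (\sum_k pi j * D * pi k)); last by rewrite -mulr_sumr pi1 mulr1.
  apply: ler_sum => k _; rewrite normrM ger0_norm ?(mulr_ge0 (pi0 _) (pi0 _))//.
  by rewrite mulrAC ler_wpM2r ?pi0// ler_wpM2l ?pi0.
have s1 : `|\sum_j pi j * c j j| <= D.
  apply: le_trans (ler_norm_sum _ _ _) _.
  apply: (@le_trans _ _ (\sum_j pi j * D)); last by rewrite -mulr_suml pi1 mul1r.
  apply: ler_sum => i _; rewrite normrM ger0_norm ?pi0//.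
  by rewrite ler_wpM2l ?pi0.
have k1 : beta * `|G1 F| <= beta * phi * W F by rewrite -mulrA ler_wpM2l.
have k2 : `|G2 F| <= beta * phi * W F.
  by rewrite (le_trans (G2W F))// ler_wpM2r// expr2 ler_wpM2r.
have -> : 3 * beta * phi * W F * D = (beta * phi * W F + beta * phi * W F) * D
   + beta * phi * W F * D by ring.
apply: le_trans (ler_normD _ _) _; rewrite !normrM (ger0_norm b0).
apply: lerD; last by rewrite ler_pM// mulr_ge0.
rewrite ler_pM//; apply: le_trans (ler_normB _ _) _.
by rewrite normrM (ger0_norm b0) lerD.
Qed.

(* The trace term is where unit variances enter: off-diagonal covariances are
   at most [1], so the curvature of the soft maximum can only help. *)
Lemma hess_coef_ge x (c : J -> J -> R) : (forall j k, c j k <= 1) ->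
  (forall j, c j j = 1) -> G2 (softmax beta x) <= beta * G1 (softmax beta x) ->
  G2 (softmax beta x) <= \sum_j \sum_k hess_coef x j k * c j k.
Proof.
move=> c1 cd G12; rewrite hess_coefE.
set F := softmax beta x; set pi := softweight beta x.
have pi0 j : 0 <= pi j by exact: softweight_ge0.
have pi1 : \sum_j pi j = 1 by exact: softweight_sum.
have -> : \sum_j pi j * c j j = 1.
  by rewrite -pi1; apply: eq_bigr => j _; rewrite cd mulr1.
have a1 : \sum_j \sum_k pi j * pi k * c j k <= 1.
  rewrite -[leRHS]pi1; apply: ler_sum => j _.
  rewrite -[leRHS]mulr1 -pi1 mulr_sumr; apply: ler_sum => k _.
  by rewrite -[leRHS]mulr1 ler_wpM2l ?(mulr_ge0 (pi0 _) (pi0 _)).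
set a := \sum_j _ in a1 *.
rewrite mulr1 -subr_ge0.
have -> : (G2 F - beta * G1 F) * a + beta * G1 F - G2 F = (1 - a) * (beta * G1 F - G2 F).
  by ring.
by rewrite mulr_ge0// subr_ge0.
Qed.

End Hessian.

(** * The logistic function, its derivative and its primitive as test functions *)

Section Logistic.
Context {R : realType}.
Variable phi : R.
Hypothesis phi0 : 0 < phi.
Implicit Types u v : R.

Definition logistic u : R := (1 + expR (- (phi * u)))^-1.
(** The derivative of [logistic] divided by [phi]. *)
Definition logistic_w u : R := logistic u * (1 - logistic u).
(** A primitive of [logistic]. It serves the anti-concentration argument because its second
    derivative is [phi * logistic_w]. *)
Definition softplus u : R := phi^-1 * ln (1 + expR (phi * u)).

Let den_gt0 u : 0 < 1 + expR u.
Proof. by rewrite addr_gt0// expR_gt0. Qed.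

Lemma logistic_gt0 u : 0 < logistic u.
Proof. by rewrite invr_gt0. Qed.

Lemma logistic_lt1 u : logistic u < 1.
Proof. by rewrite invf_lt1// ltrDl expR_gt0. Qed.

Lemma logisticN u : logistic (- u) = 1 - logistic u.
Proof.
rewrite /logistic mulrN opprK expRN.
by field; rewrite !gt_eqF ?addr_gt0 ?expR_gt0.
Qed.

Lemma logistic_w_gt0 u : 0 < logistic_w u.
Proof. by rewrite mulr_gt0 ?logistic_gt0// subr_gt0 logistic_lt1. Qed.

Lemma logistic_w_le u : logistic_w u <= 4^-1.
Proof.
rewrite /logistic_w -subr_ge0.
have -> : 4^-1 - logistic u * (1 - logistic u) = (logistic u - 2^-1) ^+ 2 by field.
exact: sqr_ge0.
Qed.

Lemma le_logistic u v : u <= v -> logistic u <= logistic v.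
Proof.
by move=> uv; rewrite lef_pV2 ?posrE// lerD2l ler_expR lerN2 ler_pM2l.
Qed.

Let logistic_growth u v : u <= v -> logistic v <= expR (phi * (v - u)) * logistic u.
Proof.
move=> uv; rewrite /logistic ler_pdivlMr// mulrC ler_pdivrMr// mulrDr mulr1.
rewrite -expRD; apply: lerD.
  by rewrite -[leLHS]expR0 ler_expR mulr_ge0 ?subr_ge0// ltW.
by rewrite ler_expR mulrBr; lra.
Qed.

(** As [logistic_w u] is [logistic u * logistic (- u)], moving [u] makes one factor grow by at most
    [expR (phi * N)] while the other does not increase. *)
Lemma logistic_w_stable u v N : `|v - u| <= N ->
  logistic_w v <= expR (phi * N) * logistic_w u.
Proof.
move=> uvN.
have key a b : a <= b -> b - a <= N ->
   (logistic_w b <= expR (phi * N) * logistic_w a) /\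
   (logistic_w a <= expR (phi * N) * logistic_w b).
  move=> ab bN.
  have ab' : - b <= - a by rewrite lerN2.
  have ge0 := fun t => ltW (logistic_gt0 t).
  have grow c c' : c <= c' -> c' - c <= N ->
      logistic c' <= expR (phi * N) * logistic c.
    move=> cc' cN; rewrite (le_trans (logistic_growth cc'))// ler_wpM2r//.
    by rewrite ler_expR ler_wpM2l// ltW.
  rewrite /logistic_w -!logisticN; split.
    by rewrite mulrA ler_pM ?ge0 ?grow ?le_logistic.
  rewrite mulrCA ler_pM ?ge0 ?le_logistic// grow//.
  by rewrite opprK addrC.
have [uv|vu] := leP u v.
  by case: (key u v uv (le_trans (ler_norm _) uvN)).
by rewrite distrC in uvN; case: (key v u (ltW vu) (le_trans (ler_norm _) uvN)).
Qed.

Lemma is_derive_logistic u : is_derive u 1 logistic (phi * logistic_w u).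
Proof.
have d : is_derive u 1 (fun u => 1 + expR ((- phi) * u)) (0 + expR ((- phi) * u) * (- phi * 1)).
  exact (is_derive_add (is_derive_const 1 u) (is_derive_comp (is_derive_expR _)
     (is_derive_scale (- phi) (is_derive_id u 1)))).
have n0 : 1 + expR ((- phi) * u) != 0 by rewrite gt_eqF.
have := @is_derive_inv _ (fun u => 1 + expR (- phi * u)) u _ n0 d.
rewrite (_ : (fun _ => _) = logistic); last first.
  by apply/funext => v; rewrite /logistic mulNr.
move=> h; apply: (is_derive_eq h); rewrite /logistic_w /logistic -mulNr.
by field.
Qed.

Lemma is_derive_logistic_w u :
  is_derive u 1 logistic_w (phi * ((1 - 2 * logistic u) * logistic_w u)).
Proof.
have d := is_derive_logistic u.
apply: (is_derive_eq (is_derive_mul d (is_derive_sub (is_derive_const 1 u) d))).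
by rewrite /logistic_w; ring.
Qed.

(** Successive derivatives of [logistic_w] up to powers of [phi]. Each is [logistic_w] times a
    factor that stays bounded because [logistic] lies in (0, 1) and [logistic_w] in (0, 1/4], so one
    weight controls all orders. *)
Let w1 u := (1 - 2 * logistic u) * logistic_w u.
Let w2 u := (1 - 6 * logistic_w u) * logistic_w u.
Let w3 u := (1 - 12 * logistic_w u) * ((1 - 2 * logistic u) * logistic_w u).

Let dw1 u : is_derive u 1 w1 (phi * w2 u).
Proof.
have d := is_derive_logistic u.
apply: (is_derive_eq (is_derive_mul (is_derive_sub (is_derive_const 1 u)
  (is_derive_scale 2 d)) (is_derive_logistic_w u))).
by rewrite /w2 /logistic_w; ring.
Qed.

Let dw2 u : is_derive u 1 w2 (phi * w3 u).
Proof.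
have d := is_derive_logistic_w u.
apply: (is_derive_eq (is_derive_mul (is_derive_sub (is_derive_const 1 u)
  (is_derive_scale 6 d)) d)).
by rewrite /w3; ring.
Qed.

Let w1_le u : `|w1 u| <= logistic_w u.
Proof.
have := logistic_gt0 u; have := logistic_lt1 u; have := logistic_w_gt0 u => w0 g1 g0.
rewrite normrM (gtr0_norm w0) -[leRHS]mul1r ler_wpM2r ?(ltW w0)// ler_norml; lra.
Qed.

Let w2_le u : `|w2 u| <= logistic_w u.
Proof.
have := logistic_w_le u; have := logistic_w_gt0 u => w0 w4.
rewrite normrM (gtr0_norm w0) -[leRHS]mul1r ler_wpM2r ?(ltW w0)// ler_norml; lra.
Qed.

Let w3_le u : `|w3 u| <= 2 * logistic_w u.
Proof.
have := logistic_w_le u; have := logistic_w_gt0 u => w0 w4.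
have h : `|1 - 12 * logistic_w u| <= 2 by rewrite ler_norml; lra.
by rewrite normrM; apply: ler_pM h (w1_le u).
Qed.

Section Taylor.
Context {J : finType}.
Variables (beta : R) (j0 : J).
Hypothesis phib : phi <= beta.
Let beta0 : 0 < beta := lt_le_trans phi0 phib.
Let phi0b : 0 <= phi <= beta.
Proof. by rewrite ltW. Qed.
Let W0 u : 0 <= logistic_w u := ltW (logistic_w_gt0 u).
Let scaled (f : R -> R) (k : nat) (u : R) := phi ^+ k * f u.

Let scaled_le f k c : (forall u, `|f u| <= c * logistic_w u) ->
  forall u, `|scaled f k u| <= c * phi ^+ k * logistic_w u.
Proof.
move=> fc u; have pk : 0 <= phi ^+ k by rewrite exprn_ge0// ltW.
rewrite /scaled normrM ger0_norm// (_ : c * _ * _ = phi ^+ k * (c * logistic_w u)).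
  by rewrite ler_wpM2l.
by ring.
Qed.

(* [f] ranges over the two test functions; each one is carried with the
   bounds that its derivatives satisfy relative to the weight [logistic_w]. *)
Definition controlled (f f1 f2 f3 : R -> R) : Prop :=
  [/\ forall u : R, is_derive u 1 f (f1 u), forall u : R, is_derive u 1 f1 (f2 u) &
      forall u : R, is_derive u 1 f2 (f3 u)] /\
  [/\ forall u, `|f1 u| <= phi * logistic_w u,
      forall u, `|f2 u| <= phi ^+ 2 * logistic_w u &
      forall u, `|f3 u| <= 2 * phi ^+ 3 * logistic_w u].

Lemma controlled_logistic : controlled logistic (fun u => phi * logistic_w u)
  (fun u => phi ^+ 2 * w1 u) (fun u => phi ^+ 3 * w2 u).
Proof.
split; split => u.
- exact: is_derive_logistic.
- apply: (is_derive_eq (is_derive_scale phi (is_derive_logistic_w u))).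
  by rewrite /w1; ring.
- apply: (is_derive_eq (is_derive_scale (phi ^+ 2) (dw1 u))); ring.
- by rewrite normrM !ger0_norm// ltW.
- by have := @scaled_le w1 2 1 _ u; rewrite mul1r; apply => v; rewrite mul1r.
- by apply: (@scaled_le w2 3 2 _ u) => v; apply: le_trans (w2_le v) _; have := W0 v; lra.
Qed.

Lemma controlled_logistic_w : controlled logistic_w (fun u => phi * w1 u)
  (fun u => phi ^+ 2 * w2 u) (fun u => phi ^+ 3 * w3 u).
Proof.
split; split => u.
- exact: is_derive_logistic_w.
- apply: (is_derive_eq (is_derive_scale phi (dw1 u))); ring.
- apply: (is_derive_eq (is_derive_scale (phi ^+ 2) (dw2 u))); ring.
- by have := @scaled_le w1 1 1 _ u; rewrite mul1r; apply => v; rewrite mul1r.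
- by have := @scaled_le w2 2 1 _ u; rewrite mul1r; apply => v; rewrite mul1r.
- exact: (@scaled_le w3 3 2 _ u).
Qed.

Lemma controlled_taylor f f1 f2 f3 (x xi : J -> R) N : controlled f f1 f2 f3 ->
  (forall j, `|xi j| <= N) ->
  `|f (softmax beta (fun j => x j + xi j)) - f (softmax beta x)
    - f1 (softmax beta x) * softmoment beta 1 x xi - 2^-1 * hess beta f1 f2 x xi| <=
  17 * phi * beta ^+ 2 * (logistic_w (softmax beta x) *
    \sum_j softweight beta x j * (`|xi j| ^+ 3 * expR (3 * beta * N))).
Proof.
move=> [[h0 h1 h2] [b1 b2 b3]] xiN.
exact: (softmax_taylor j0 beta0 phi0b h0 h1 h2 W0 b1 b2 b3 logistic_w_stable).
Qed.

Lemma is_derive_softplus u : is_derive u 1 softplus (logistic u).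
Proof.
have d : is_derive u 1 (fun u => 1 + expR (phi * u)) (0 + expR (phi * u) * (phi * 1)).
  exact (is_derive_add (is_derive_const 1 u) (is_derive_comp (is_derive_expR _)
     (is_derive_scale phi (is_derive_id u 1)))).
have := is_derive_scale phi^-1 (@is_derive_comp _ (@ln R) (fun u => 1 + expR (phi * u)) u _ _ (is_derive1_ln (den_gt0 (phi * u))) d).
move=> h; apply: (is_derive_eq h); rewrite /logistic expRN.
by field; rewrite !gt_eqF ?addr_gt0 ?expR_gt0.
Qed.

(** The weight is the constant [phi^-1], since the slope [logistic] tends to 1 at infinity and is
    not controlled by [logistic_w]. The error is therefore absolute and not relative, which is
    harmless where the step tends to 0. *)
Lemma softplus_taylor (x xi : J -> R) N : (forall j, `|xi j| <= N) ->
  `|softplus (softmax beta (fun j => x j + xi j)) - softplus (softmax beta x)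
    - logistic (softmax beta x) * softmoment beta 1 x xi
    - 2^-1 * hess beta logistic (fun u => phi * logistic_w u) x xi| <=
  17 * phi * beta ^+ 2 * (phi^-1 *
    \sum_j softweight beta x j * (`|xi j| ^+ 3 * expR (3 * beta * N))).
Proof.
apply: (@softmax_taylor _ _ beta j0 beta0 phi softplus logistic
  (fun u => phi * logistic_w u) (fun u => phi ^+ 2 * w1 u) (fun _ => phi^-1) phi0b).
- exact: is_derive_softplus.
- exact: is_derive_logistic.
- move=> u; apply: (is_derive_eq (is_derive_scale phi (is_derive_logistic_w u))).
  by rewrite /w1; ring.
- by move=> _; rewrite invr_ge0 ltW.
- move=> u; rewrite divff ?gt_eqF// gtr0_norm ?logistic_gt0//.
  exact/ltW/logistic_lt1.
- move=> u; rewrite ger0_norm ?(mulr_ge0 (ltW phi0) (W0 _))// expr2 mulfK ?gt_eqF//.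
  by rewrite ger_pMr//; have := logistic_w_le u; lra.
- move=> u; rewrite normrM ger0_norm ?exprn_ge0 ?(ltW phi0)//.
  have -> : 2 * phi ^+ 3 * phi^-1 = phi ^+ 2 * 2 by field; rewrite gt_eqF.
  rewrite ler_wpM2l ?exprn_ge0 ?(ltW phi0)// (le_trans (w1_le u))//.
  by have := logistic_w_le u; lra.
- move=> u v N' uvN; rewrite -[leLHS]mul1r ler_wpM2r ?invr_ge0 ?(ltW phi0)//.
  by rewrite -[leLHS]expR0 ler_expR mulr_ge0 ?(ltW phi0) ?(le_trans _ uvN).
Qed.

End Taylor.

(** The gap is [(2 g - 1) (1 - g)] with [g >= 1/2]. A sharp indicator is thus dominated without
    shifting the threshold, at the price of two units of [logistic_w]. *)
Lemma indicator_le_logistic u : 0 < u -> 1 <= logistic u + 2 * logistic_w u.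
Proof.
move=> u0.
have h : 2^-1 <= logistic u.
  have := le_logistic (ltW u0); apply: le_trans.
  by rewrite /logistic mulr0 oppr0 expR0.
have := logistic_lt1 u; set g := logistic u in h * => g1.
rewrite /logistic_w -/g -subr_ge0.
have -> : g + 2 * (g * (1 - g)) - 1 = (2 * g - 1) * (1 - g) by ring.
by rewrite mulr_ge0; lra.
Qed.

(** [logistic] equals [logistic_w] divided by [1 - logistic], and on [u <= c] this denominator is
    smallest at [c]. *)
Lemma logistic_le_indicator c u : u <= c ->
  logistic u <= (1 + expR (phi * c)) * logistic_w u.
Proof.
move=> uc; rewrite /logistic_w mulrCA -[leLHS]mulr1 ler_wpM2l ?(ltW (logistic_gt0 _))//.
rewrite -logisticN mulrC -ler_pdivrMr// mul1r.
have := @le_logistic (- c) (- u); rewrite lerN2 => /(_ uc).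
by rewrite {1}/logistic mulrN opprK.
Qed.

End Logistic.

(** * Averaging operators and independent sums *)

Section Averaging.
Context {R : realType} {J : finType}.
Local Open Scope ereal_scope.
Implicit Types (u v : (J -> R) -> \bar R) (x : J -> R).

(* Test functions are required to be measurable along every measurable family of
   coordinates, which spares a sigma-algebra on [J -> R]. *)
Definition coord_measurable u : Prop :=
  forall d (T : measurableType d) (v : T -> J -> R),
    (forall j, measurable_fun setT (fun t => v t j)) ->
    measurable_fun setT (fun t => u (v t)).

Definition test_fun u : Prop := coord_measurable u /\ forall x, 0 <= u x.

Definition coords_measurable d (T : measurableType d) (xi : T -> J -> R) : Prop :=
  forall j, measurable_fun setT (fun t => xi t j).

(** Convolution of [u] with the law of [xi]. Extended real values let Tonelli's theorem apply to
    nonnegative test functions without integrability checks. *)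
Definition avg d (T : measurableType d) (P : probability T R) (xi : T -> J -> R)
    u x : \bar R :=
  \int[P]_w u (fun j => x j + xi w j)%R.

Lemma measurable_translate d (T : measurableType d) (xi : T -> J -> R) u x :
  coord_measurable u -> coords_measurable xi ->
  measurable_fun setT (fun w => u (fun j => x j + xi w j)%R).
Proof. by move=> mu mxi; apply: mu => j; exact: measurable_funD. Qed.

Lemma test_fun_avg d (T : measurableType d) (P : probability T R) (xi : T -> J -> R) u :
  coords_measurable xi -> test_fun u -> test_fun (avg P xi u).
Proof.
move=> mxi [mu u0]; split; last by move=> x; apply: integral_ge0 => w _; exact: u0.
move=> d' T' v mv.
apply: (@measurable_fun_fubini_tonelli_F _ _ T' T R P
  (fun z => u (fun j => v z.1 j + xi z.2 j)%R)) => //.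
apply: mu => j; apply: measurable_funD.
  by apply: measurableT_comp (mv j) _; exact: measurable_fst.
by apply: measurableT_comp (mxi j) _; exact: measurable_snd.
Qed.

(** Tonelli's theorem and commutativity of addition: the order in which independent increments are
    added never matters. *)
Lemma avg_comm d (T : measurableType d) (P : probability T R) (xi : T -> J -> R)
    d' (T' : measurableType d') (P' : probability T' R) (xi' : T' -> J -> R) u :
  coords_measurable xi -> coords_measurable xi' -> test_fun u ->
  avg P xi (avg P' xi' u) = avg P' xi' (avg P xi u).
Proof.
move=> mxi mxi' [mu u0]; apply/funext => x; rewrite /avg.
rewrite (@fubini_tonelli _ _ T T' R P P'
  (fun z => u (fun j => x j + xi z.1 j + xi' z.2 j)%R))//=.
  by apply: eq_integral => w _; apply: eq_integral => w' _; congr u; apply/funext => j; rewrite addrAC.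
apply: mu => j; apply: measurable_funD.
  apply: measurable_funD => //.
  by apply: measurableT_comp (mxi j) _; exact: measurable_fst.
by apply: measurableT_comp (mxi' j) _; exact: measurable_snd.
Qed.

Section OneLaw.
Context d (T : measurableType d) (P : probability T R) (xi : T -> J -> R).
Hypothesis mxi : coords_measurable xi.

Lemma le_avg u v : test_fun u -> test_fun v -> (forall x, u x <= v x) ->
  forall x, avg P xi u x <= avg P xi v x.
Proof.
move=> [mu u0] [mv v0] uv x; apply: ge0_le_integral => //.
- exact: measurable_translate.
- exact: measurable_translate.
Qed.

Lemma test_funD u v : test_fun u -> test_fun v -> test_fun (fun x => u x + v x).
Proof.
move=> [mu u0] [mv v0]; split => [d' T' w mw|x]; last exact: adde_ge0.
by apply: emeasurable_funD; [exact: mu|exact: mv].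
Qed.

Lemma test_funZ (c : R) u : (0 <= c)%R -> test_fun u -> test_fun (fun x => c%:E * u x).
Proof.
move=> c0 [mu u0]; split => [d' T' w mw|x]; last exact: mule_ge0.
by apply: measurable_funeM; exact: mu.
Qed.

Lemma avgD u v x : test_fun u -> test_fun v ->
  avg P xi (fun x => u x + v x) x = avg P xi u x + avg P xi v x.
Proof.
move=> [mu u0] [mv v0]; rewrite /avg ge0_integralD//.
- exact: measurable_translate.
- exact: measurable_translate.
Qed.

Lemma avgZ (c : R) u x : (0 <= c)%R -> test_fun u ->
  avg P xi (fun x => c%:E * u x) x = c%:E * avg P xi u x.
Proof.
move=> c0 [mu u0]; rewrite /avg ge0_integralZl_EFin//.
exact: measurable_translate.
Qed.

Lemma test_fun_iter k u : test_fun u -> test_fun (iter k (avg P xi) u).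
Proof. by move=> hu; elim: k => //= k IH; exact: test_fun_avg. Qed.

End OneLaw.

End Averaging.

(** * Product laws from mutual independence *)

Section Independence.
Local Open Scope ereal_scope.
Context {R : realType} {d : measure_display} {T : measurableType d} (P : probability T R).
Context {d1 : measure_display} {T1 : measurableType d1} {K : finType}.
Variable U : K -> {RV P >-> T1}.
Hypothesis indep : mutually_independent P (fun i => U i : T -> T1).

Definition subfamily (s : seq K) (w : T) : (size s).-tuple T1 :=
  [tuple U (tnth (in_tuple s) k) w | k < size s].

Lemma measurable_subfamily s : measurable_fun setT (subfamily s).
Proof.
apply/measurable_fun_tnthP => k.
rewrite (_ : _ \o _ = U (tnth (in_tuple s) k)); first exact: measurable_funPT.
by apply/funext => w; rewrite /= tnth_mktuple.
Qed.

(** A generating family stable under intersection, which determines finite measures on tuples. *)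
Definition rectangles (n : nat) : set (set (n.-tuple T1)) :=
  [set E | exists2 B : 'I_n -> set T1, (forall k, measurable (B k)) &
     E = \bigcap_(k in setT) (fun y => tnth y k) @^-1` B k].

Lemma rectangles_setI n : setI_closed (@rectangles n).
Proof.
move=> _ _ [B mB ->] [C mC ->]; exists (fun k => B k `&` C k).
  by move=> k; exact: measurableI.
by rewrite -bigcapI; apply: eq_bigcapr => k _.
Qed.

Lemma rectangles_setT n : rectangles [set: n.-tuple T1].
Proof. by exists (fun=> setT) => //; rewrite bigcapT. Qed.

Lemma measurable_rectangles n E : @rectangles n E -> measurable E.
Proof.
move=> [B mB ->]; apply: fin_bigcap_measurable => // k _.
by rewrite -[X in measurable X]setTI; exact: measurable_tnth.
Qed.

Lemma rectangles_gen n E : measurable (E : set (n.-tuple T1)) -> <<s @rectangles n >> E.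
Proof.
suff sub : (measurable : set (set (n.-tuple T1))) `<=` <<s @rectangles n >> by exact: sub.
clear E; apply: smallest_sub; first exact: smallest_sigma_algebra.
case: n => [|n]; first by rewrite big_ord0.
rewrite -bigcup_mkord_ord => _ [i /= ilt [B mB <-]].
apply: sub_sigma_algebra; rewrite setTI.
exists (fun k => if k == inord i then B else setT).
  by move=> k; case: ifP.
apply/seteqP; split=> [y /= By k _|y /(_ (inord i) I)/=]; last by rewrite eqxx.
by case: ifPn => // /eqP ->.
Qed.

(** A rectangle constrains the positions of [s], while independence speaks of indices in [K]; for a
    duplicate-free [s] the two correspond through [index]. *)
Lemma preimage_rectangle (s : seq K) (B : 'I_(size s) -> set T1) : uniq s ->
  let B' (j : K) := oapp B setT (insub (index j s)) in
  subfamily s @^-1` (\bigcap_(k in setT) (fun y => tnth y k) @^-1` B k) =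
  \bigcap_(j in [set` [set j in s]]) (U j @^-1` B' j).
Proof.
move=> us B'; apply/seteqP; split=> [w /= Bw j|w /= Bw k _].
  rewrite /= inE => js; rewrite /B'.
  have js' := js; rewrite -index_mem in js'; rewrite insubT/=.
  have := Bw (Ordinal js') I; rewrite /= tnth_mktuple.
  by rewrite (tnth_nth j)/= nth_index.
have := Bw (tnth (in_tuple s) k); rewrite /= inE mem_tnth => /(_ isT).
rewrite /B' (tnth_nth (tnth (in_tuple s) k)) index_uniq// insubT/= => [|h]; first exact: ltn_ord.
rewrite tnth_mktuple {2}(tnth_nth (tnth (in_tuple s) k)).
have E : Sub (nat_of_ord k) h = k :> 'I_(size s) by exact: val_inj.
by rewrite E.
Qed.

(** Both sides are finite measures in [E]: a restriction of [P] and a rescaling of [P], pushed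
    forward to tuples. They agree on rectangles by mutual independence of [i] together with [s],
    hence everywhere. *)
Lemma independent_subfamily (i : K) (s : seq K) (A : set T1) E :
  i \notin s -> uniq s -> measurable A -> measurable E ->
  P (U i @^-1` A `&` subfamily s @^-1` E) = P (U i @^-1` A) * P (subfamily s @^-1` E).
Proof.
move=> si us mA mE.
have mD : measurable (U i @^-1` A).
  by rewrite -[X in measurable X]setTI; exact: measurable_funPT.
have p0 : (0 <= fine (P (U i @^-1` A)))%R by exact: fine_ge0.
have ms := @measurable_subfamily s.
pose m1 := pushforward (mrestr P mD) (subfamily s).
pose m2 := pushforward (mscale (NngNum p0) P) (subfamily s).

have e1 : m1 E = P (U i @^-1` A `&` subfamily s @^-1` E) by rewrite setIC.
have e2 : m2 E = P (U i @^-1` A) * P (subfamily s @^-1` E).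
  by rewrite /m2 /pushforward /mscale/= fineK ?fin_num_measure.
rewrite -e1 -e2.
apply: (@g_sigma_algebra_measure_unique _ R _ (@rectangles (size s))
  (@measurable_rectangles _) (fun=> setT) (fun=> @rectangles_setT _)
  _ _ _ (@rectangles_setI _) _ _ _ (rectangles_gen mE)).
- by apply/seteqP; split => // y _; exists 0%N.
- move=> _ [B mB ->]; set F := \bigcap_(k in _) _.
  change (P (subfamily s @^-1` F `&` U i @^-1` A) =
    (fine (P (U i @^-1` A)))%:E * P (subfamily s @^-1` F)).
  rewrite fineK ?fin_num_measure// /F preimage_rectangle//; set B' := fun j : K => oapp B setT (insub (index j s)).
  have mB' j : measurable (B' j) by rewrite /B'; case: insubP => //= k _ _; exact: mB.
  (* The set [A] is inserted at the index [i], which does not occur in [s]. *)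
  pose B2 j := if j == i then A else B' j.
  have mB2 j : measurable (B2 j) by rewrite /B2; case: ifP.
  have E1 := indep [set j in s] mB'.
  have E2 := indep (i |: [set j in s]) mB2.
  rewrite E1 setIC.
  have -> : U i @^-1` A `&` \bigcap_(j in [set` [set j in s]]) U j @^-1` B' j =
     \bigcap_(j in [set` (i |: [set j in s])%SET]) U j @^-1` B2 j.
    apply/seteqP; split => [w [Ai Bw] j /=|w Bw].
      rewrite !inE /B2 => /orP[/eqP ->|js]; first by rewrite eqxx.
      have [ji|ji] := eqVneq j i; first by rewrite ji in js; rewrite js in si.
      by apply: Bw; rewrite /= inE.
    split; first by have := Bw i; rewrite /= !inE eqxx /B2 eqxx; exact.
    move=> j /=; rewrite inE => js; have := Bw j; rewrite /= !inE js orbT => /(_ isT).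
    by rewrite /B2; have [ji|//] := eqVneq j i; rewrite ji in js; rewrite js in si.
  rewrite E2 big_setU1 ?inE//= /B2 eqxx; congr (_ * _).
  apply: eq_bigr => j; rewrite inE => js.
  by have [ji|//] := eqVneq j i; rewrite ji in js; rewrite js in si.
- move=> _; change (P ([set: T] `&` U i @^-1` A) < +oo).
  by rewrite setTI ltey_eq fin_num_measure.
Qed.

(** The pair has the product law by uniqueness of the product measure; Tonelli's theorem separates
    the variables. *)
Lemma integral_independent_pair (i : K) (s : seq K) (f : T1 * (size s).-tuple T1 -> \bar R) :
  i \notin s -> uniq s -> measurable_fun setT f -> (forall z, 0 <= f z) ->
  \int[P]_w f (U i w, subfamily s w) = \int[P]_w \int[P]_w' f (U i w, subfamily s w').
Proof.
move=> si us mf f0.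
have ms := @measurable_subfamily s.
have mUi : measurable_fun setT (U i) by exact: measurable_funPT.
pose W : {RV P >-> (size s).-tuple T1} := mfun_Sub (mem_set ms).
have mZ : measurable_fun setT (fun w => (U i w, W w)).
  by apply/measurable_fun_pairP; split.
pose Z : {RV P >-> (T1 * (size s).-tuple T1)%type} := mfun_Sub (mem_set mZ).
transitivity (\int[distribution P Z]_z f z).
  by rewrite ge0_integral_distribution.
transitivity (\int[distribution P (U i) \x distribution P W]_z f z).
  apply: eq_measure_integral => /= E mE _; apply/esym.
  apply: product_measure_unique => // A B mA mB.
  rewrite /distribution /pushforward/=.
  rewrite -independent_subfamily//.
rewrite fubini_tonelli1//= ge0_integral_distribution//.
- apply: eq_integral => w _; rewrite /= /fubini_F ge0_integral_distribution//.
  by apply: measurableT_comp mf _; exact: measurable_pair1.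
- exact: measurable_fun_fubini_tonelli_F.
- by move=> y; apply: integral_ge0.
Qed.

(** Summands are peeled off from the head: the first is independent of the tuple of the others, so
    it contributes the outermost averaging operator. *)
Lemma avg_independent_sum (J : finType) (xi : K -> T1 -> J -> R)
    (s : seq K) (u : (J -> R) -> \bar R) x :
  (forall k, coords_measurable (xi k)) -> uniq s -> test_fun u ->
  \int[P]_w u (fun j => x j + \sum_(k <- s) xi k (U k w) j)%R =
  foldr (fun k v => avg P (fun w => xi k (U k w)) v) u s x.
Proof.
move=> mxi; elim: s u x => [|i s IH] u x /=.
  move=> _ _; transitivity (\int[P]_w cst (u x) w).
    apply: eq_integral => w _ /=; congr u; apply/funext => j.
    by rewrite big_nil addr0.
  by rewrite integral_cst//= probability_setT mule1.
move=> /andP[si us] hu.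
pose f (z : T1 * (size s).-tuple T1) : \bar R :=
  u (fun j => x j + xi i z.1 j + \sum_(k < size s) xi (tnth (in_tuple s) k) (tnth z.2 k) j)%R.
have mf : measurable_fun setT f.
  apply: hu.1 => j; apply: measurable_funD.
    apply: measurable_funD => //; apply: measurableT_comp (mxi i j) _; exact: measurable_fst.
  apply: measurable_sum => k.
  apply: measurableT_comp (mxi _ j) _.
  by apply: measurableT_comp (measurable_tnth k) _; exact: measurable_snd.
have E w w' : f (U i w, subfamily s w') =
    u (fun j => x j + xi i (U i w) j + \sum_(k <- s) xi k (U k w') j)%R.
  rewrite /f; congr u; apply/funext => j; congr (_ + _)%R.
  rewrite [RHS]big_tnth; apply: eq_bigr => k _.
  by rewrite /= tnth_mktuple.
transitivity (\int[P]_w f (U i w, subfamily s w)).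
  apply: eq_integral => w _; rewrite E; congr u; apply/funext => j.
  by rewrite big_cons addrA.
rewrite integral_independent_pair//; last by move=> z; exact: hu.2.
rewrite {1}/avg; apply: eq_integral => w _; rewrite -IH//.
by apply: eq_integral => w' _; rewrite E.
Qed.

End Independence.

(** * Expectations and Gaussian vectors *)

Section RealExpectation.
Context {R : realType} {d : measure_display} {T : measurableType d} (P : probability T R).
Implicit Types (f g : T -> R).

Definition integrableR f : Prop := P.-integrable setT (EFin \o f).
Definition expect f : R := \int[P]_w f w.

Lemma integrableR_measurable f : integrableR f -> measurable_fun setT f.
Proof. by move=> /measurable_int /measurable_EFinP. Qed.

Lemma integrableR_dom f g : measurable_fun setT f -> (forall w, `|f w| <= g w) ->
  integrableR g -> integrableR f.
Proof.
move=> mf fg ig; apply: le_integrable ig => //; first exact/measurable_EFinP.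
by move=> w _ /=; rewrite lee_fin (le_trans (fg w))// ler_norm.
Qed.

Lemma integrableR_ge0 f : measurable_fun setT f -> (forall w, 0 <= f w) ->
  (\int[P]_w (f w)%:E < +oo)%E -> integrableR f.
Proof.
move=> mf f0 fi; apply/integrableP; split; first exact/measurable_EFinP.
by under eq_integral do rewrite /= ger0_norm//.
Qed.

Lemma expectE f : integrableR f -> (\int[P]_w (f w)%:E = (expect f)%:E)%E.
Proof. by move=> fi; rewrite /expect /Rintegral fineK// integrable_fin_num. Qed.

Lemma expect_eq f (c : R) : (\int[P]_w (f w)%:E = c%:E)%E -> expect f = c.
Proof. by rewrite /expect /Rintegral => ->. Qed.

Lemma integrableR_cst (c : R) : integrableR (fun=> c).
Proof. exact: finite_measure_integrable_cst. Qed.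

Lemma expect_cst (c : R) : expect (fun=> c) = c.
Proof. by apply: expect_eq; rewrite integral_cst//= probability_setT mule1. Qed.

Lemma integrableRD f g : integrableR f -> integrableR g ->
  integrableR (fun w => f w + g w).
Proof. by move=> fi gi; exact: (integrableD measurableT fi gi). Qed.

Lemma integrableRZ (c : R) f : integrableR f -> integrableR (fun w => c * f w).
Proof. by move=> fi; exact: (integrableZl measurableT c fi). Qed.

Lemma integrableRN f : integrableR f -> integrableR (fun w => - f w).
Proof. by move=> fi; exact: (integrableN fi). Qed.

Lemma integrableRB f g : integrableR f -> integrableR g ->
  integrableR (fun w => f w - g w).
Proof. by move=> fi gi; apply: integrableRD => //; exact: integrableRN. Qed.

Lemma integrableR_sum (I : Type) (r : seq I) (f : I -> T -> R) :
  (forall i, integrableR (f i)) -> integrableR (fun w => \sum_(i <- r) f i w).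
Proof.
move=> fi; elim: r => [|i r IH].
  rewrite (_ : (fun _ => _) = fun=> 0); first exact: integrableR_cst.
  by apply/funext => w; rewrite big_nil.
rewrite (_ : (fun _ => _) = fun w => f i w + \sum_(i <- r) f i w).
  exact: integrableRD.
by apply/funext => w; rewrite big_cons.
Qed.

Lemma expectD f g : integrableR f -> integrableR g ->
  expect (fun w => f w + g w) = expect f + expect g.
Proof. by move=> fi gi; rewrite /expect RintegralD. Qed.

Lemma expectZ (c : R) f : integrableR f -> expect (fun w => c * f w) = c * expect f.
Proof. by move=> fi; rewrite /expect RintegralZl. Qed.

Lemma expectN f : integrableR f -> expect (fun w => - f w) = - expect f.
Proof.
move=> fi; rewrite -mulN1r -expectZ//; congr expect.
by apply/funext => w; rewrite mulN1r.
Qed.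

Lemma expectB f g : integrableR f -> integrableR g ->
  expect (fun w => f w - g w) = expect f - expect g.
Proof. by move=> fi gi; rewrite expectD ?expectN//; exact: integrableRN. Qed.

Lemma expect_sum (I : Type) (r : seq I) (f : I -> T -> R) :
  (forall i, integrableR (f i)) ->
  expect (fun w => \sum_(i <- r) f i w) = \sum_(i <- r) expect (f i).
Proof.
move=> fi; elim: r => [|i r IH].
  rewrite big_nil -[RHS](expect_cst 0); congr expect.
  by apply/funext => w; rewrite big_nil.
rewrite big_cons -IH -expectD//; last exact: integrableR_sum.
by congr expect; apply/funext => w; rewrite big_cons.
Qed.

Lemma le_expect f g : integrableR f -> integrableR g -> (forall w, f w <= g w) ->
  expect f <= expect g.
Proof. by move=> fi gi fg; apply: le_Rintegral. Qed.

Lemma expect_ge0 f : (forall w, 0 <= f w) -> 0 <= expect f.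
Proof. by move=> f0; apply: Rintegral_ge0. Qed.

Lemma expect_norm f : integrableR f -> `|expect f| <= expect (fun w => `|f w|).
Proof. by move=> fi; exact: le_normr_Rintegral. Qed.

Lemma integrableR_norm f : integrableR f -> integrableR (fun w => `|f w|).
Proof. by move=> fi; exact: (integrable_norm fi). Qed.

End RealExpectation.

Section ExpBounds.
Context {R : realType}.
Implicit Types y : R.

Lemma expR_taylor2 y : `|expR y - 1 - y - 2^-1 * y ^+ 2| <= `|y| ^+ 3 * expR `|y|.
Proof.
have d (c : R) (s : R) : is_derive s 1 (fun s => c * expR (s * y)) (c * y * expR (s * y)).
  apply: (is_derive_eq (is_derive_scale c (@is_derive_comp _ expR (fun s => s * y) s _ _
    (is_derive_expR _) (is_derive_mul (is_derive_id s 1) (is_derive_const y s))))).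
  by ring.
have := @taylor3 R _ _ _ _ (`|y| ^+ 3 * expR `|y|) (d 1) (d (1 * y)) (d (1 * y * y)) _.
rewrite !mul0r !expR0 !mul1r !mulr1 expr2; apply => s /andP[s0 s1].
rewrite !normrM !exprS expr0 mulr1 mulrA (ger0_norm (expR_ge0 _)) ler_wpM2l ?mulr_ge0//.
rewrite ler_expR (le_trans (ler_norm _))// normrM (ger0_norm s0) -[leRHS]mul1r.
by rewrite ler_wpM2r.
Qed.

Lemma is_derive_expn k (s : R) : is_derive s 1 (fun s : R => s ^+ k.+1) (k.+1%:R * s ^+ k).
Proof.
elim: k => [|k IH].
  rewrite expr0 mulr1 (_ : (fun _ => _) = id); last by apply/funext => t; rewrite expr1.
  exact: is_derive_id.
rewrite (_ : (fun _ => _) = fun s : R => s * s ^+ k.+1); last first.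
  by apply/funext => t; rewrite exprS.
apply: (is_derive_eq (is_derive_mul (is_derive_id s 1) IH)).
by rewrite mul1r mulrCA -exprS -[k.+2%:R]natr1 mulrDl mul1r addrC.
Qed.

(** Induction on [k]: the derivative of [(k+1)! expR s - s^(k+1)] is [k + 1] times the difference
    for [k], hence nonnegative. *)
Lemma expR_ge_pow k y : 0 <= y -> y ^+ k <= k`!%:R * expR y.
Proof.
move=> y0; have h := @expR_ge1Dx R.
elim: k y y0 => [|k IH] y y0; first by rewrite expr0 mul1r -[leLHS]expR0 ler_expR.
pose q (s : R) := k.+1`!%:R * expR s - s ^+ k.+1.
have dq (s : R) : is_derive s 1 q (k.+1`!%:R * expR s - k.+1%:R * s ^+ k).
  exact (is_derive_sub (is_derive_scale _ (is_derive_expR s)) (is_derive_expn k s)).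
have [c /andP[c0 cy]] := mean_value dq y0.
rewrite subr0 => E.
have : 0 <= q y - q 0.
  rewrite E mulr_ge0// subr_ge0 factS natrM -mulrA ler_wpM2l//.
  exact: IH.
rewrite /q expr0n/= subr0 expR0 mulr1 => h1.
rewrite -subr_ge0; apply: le_trans h1 _.
by rewrite gerBl.
Qed.

Lemma expR_norm_le y : expR `|y| <= expR y + expR (- y).
Proof.
have [y0|y0] := leP 0 y; first by rewrite ger0_norm// lerDl expR_ge0.
by rewrite ltr0_norm// lerDr expR_ge0.
Qed.

End ExpBounds.

(** * Gaussian integrals on the line *)

Section GaussianIntegrals.
Context {R : realType}.
Local Notation mu := (@lebesgue_measure R).
Local Open Scope ereal_scope.
Implicit Types (f : R -> \bar R) (m s : R).

Lemma measurable_affine m s : measurable_fun setT (fun z : R => m + s * z)%R.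
Proof. by apply: measurable_funD => //; exact: measurable_funM. Qed.

(** Lebesgue measure is determined by its values on half-open intervals, and the rescaled image
    measure has these values. *)
Lemma lebesgue_affine m s (s0 : (0 < s)%R) (A : set R) : measurable A ->
  mu A = s%:E * mu ((fun z : R => (m + s * z)%R) @^-1` A).
Proof.
move=> mA; pose aff z : R := (m + s * z)%R.
have mf : measurable_fun setT (fun z : measurableTypeR R => (m + s * z)%R : measurableTypeR R).
  exact: measurable_affine.
pose nu := mscale (NngNum (ltW s0)) (pushforward mu (fun z : R => m + s * z : measurableTypeR R)%R).
suff -> : mu A = nu mf A by [].
apply: lebesgue_measure_unique => // _ [[a b] _ <-].
change (mu [set` `]a, b]%R] = s%:E * mu (aff @^-1` [set` `]a, b]%R])).
have -> : aff @^-1` [set` `]a, b]%R] = [set` `](a - m) / s, (b - m) / s]%R].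
  apply/seteqP; split => z /=; rewrite /aff !in_itv/= ltr_pdivrMr// ler_pdivlMr// => /andP[h1 h2];
    apply/andP; split; lra.
rewrite !lebesgue_measure_itv/= !lte_fin ltr_pM2r ?invr_gt0// ltrD2r.
case: ifP => ab; last by rewrite mule0.
by rewrite -!EFinD -EFinM; congr EFin; field; rewrite gt_eqF.
Qed.

Lemma integral_affine m s f : (0 < s)%R -> measurable_fun setT f -> (forall x, 0 <= f x) ->
  \int[mu]_x f x = s%:E * \int[mu]_z f (m + s * z)%R.
Proof.
move=> s0 mf f0.
have ma : measurable_fun setT (fun z : measurableTypeR R => (m + s * z)%R : measurableTypeR R).
  exact: measurable_affine.
pose nu := mscale (NngNum (ltW s0)) (pushforward mu (fun z : R => m + s * z : measurableTypeR R)%R).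
transitivity (\int[nu ma]_x f x).
  by apply: eq_measure_integral => A mA _; exact: lebesgue_affine.
rewrite ge0_integral_mscale//; congr (_ * _).
by rewrite ge0_integral_pushforward.
Qed.

(** The abstract Radon-Nikodym derivative agrees almost everywhere with the density, because both
    have the same integral over every measurable set. *)
Lemma integral_normal_prob m s f : measurable_fun setT f -> (forall x, 0 <= f x) ->
  \int[normal_prob m s]_x f x = \int[mu]_x (f x * (normal_pdf m s x)%:E).
Proof.
move=> mf f0.
have dom := @normal_prob_dominates R m s.
rewrite -(Radon_Nikodym_SigmaFinite.change_of_variables dom)//.
have mpdf : measurable_fun setT (fun x => (normal_pdf m s x)%:E).
  by apply/measurable_EFinP; exact: measurable_normal_pdf.
have irn := Radon_Nikodym_SigmaFinite.f_integrable dom.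
apply: ae_eq_integral => //.
- by apply: emeasurable_funM => //; exact: (measurable_int mu).
- exact: emeasurable_funM.
- apply: ae_eqe_mul2l; apply: integral_ae_eq => //.
  by move=> E _ mE; rewrite -Radon_Nikodym_SigmaFinite.f_integral.
Qed.

Lemma measurable_normal_pdf_EFin m s :
  measurable_fun setT (fun x : R => (normal_pdf m s x)%:E).
Proof. by apply/measurable_EFinP; exact: measurable_normal_pdf. Qed.

Lemma normal_peakM s : (0 < s)%R -> normal_peak s = (s^-1 * normal_peak 1)%R.
Proof.
move=> s0; rewrite /normal_peak -invfM expr1n mul1r; congr (_^-1)%R.
by rewrite -mulrnAr sqrtrM ?sqr_ge0// sqrtr_sqr gtr0_norm.
Qed.

Lemma integral_normal_affine m s f : (0 < s)%R -> measurable_fun setT f ->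
  (forall x, 0 <= f x) ->
  \int[normal_prob 0 1]_z f (m + s * z)%R = \int[normal_prob m s]_x f x.
Proof.
move=> s0 mf f0; have ma := measurable_affine m s.
rewrite (integral_normal_prob 0 1 (measurableT_comp mf ma)); last by move=> x; exact: f0.
rewrite [RHS](integral_normal_prob m s mf f0) /=.
rewrite [RHS](integral_affine m s0); last 2 first.
- by apply: emeasurable_funM mf _; exact: measurable_normal_pdf_EFin.
- by move=> x; rewrite mule_ge0// lee_fin normal_pdf_ge0.
rewrite -ge0_integralZl_EFin ?ltW//; last 2 first.
- by move=> x _; rewrite mule_ge0// lee_fin normal_pdf_ge0.
- apply: emeasurable_funM; first exact: measurableT_comp mf ma.
  exact: measurableT_comp (measurable_normal_pdf_EFin m s) ma.
apply: eq_integral => z _; rewrite muleCA; congr (_ * _); rewrite -EFinM; congr EFin.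
have sn : (s != 0)%R by rewrite gt_eqF.
suff -> : (normal_pdf m s (m + s * z) = s^-1 * normal_pdf 0 1 z)%R by rewrite mulVKf.
rewrite !normal_pdfE ?oner_neq0//= (normal_peakM s0) -mulrA; congr (_ * (_ * expR _))%R.
by field.
Qed.

(** The law of a sum of two independent centred Gaussian variables, computed with densities; as [f]
    is nonnegative, all exchanges of integrals are by Tonelli's theorem. *)
Lemma normal_stable (a b c : R) f : (0 < a)%R -> (0 < b)%R -> (0 < c)%R ->
  (a ^+ 2 + b ^+ 2 = c ^+ 2)%R -> measurable_fun setT f -> (forall x, 0 <= f x) ->
  \int[normal_prob 0 1]_y \int[normal_prob 0 1]_z f (a * y + b * z)%R =
  \int[normal_prob 0 1]_z f (c * z)%R.
Proof.
move=> a0 b0 c0 abc mf f0.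
have mpdf m s : measurable_fun setT (fun x : R => (normal_pdf m s x)%:E).
  by apply/measurable_EFinP; exact: measurable_normal_pdf.
transitivity (\int[normal_prob 0 1]_z f (0 + c * z)%R); last first.
  by apply: eq_integral => z _; rewrite add0r.
rewrite [RHS](integral_normal_affine 0 c0 mf f0) [RHS](integral_normal_prob 0 c mf f0).
transitivity (\int[normal_prob 0 1]_y \int[mu]_v (f v * (normal_pdf (a * y) b v)%:E)).
  apply: eq_integral => y _.
  by rewrite (integral_normal_affine (a * y) b0 mf f0) (integral_normal_prob (a * y) b mf f0).
have mnf : measurable_fun setT (fun p : R * R => normal_pdf (a * p.1) b p.2).
  rewrite (_ : (fun _ => _) = fun p : R * R => normal_peak b * normal_fun 0 b (p.2 - a * p.1))%R.
    apply: measurable_funM => //; apply: measurableT_comp.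
      exact: measurable_normal_fun.
    by apply: measurable_funB => //; exact: measurable_funM.
  by apply/funext => p; rewrite normal_pdfE ?gt_eqF//= /normal_fun subr0.
have mF : measurable_fun setT
    (fun p : R * R => f p.2 * (normal_pdf (a * p.1) b p.2)%:E).
  apply: emeasurable_funM; first exact: measurableT_comp.
  exact/measurable_EFinP.
have F0 (p : R * R) : 0 <= f p.2 * (normal_pdf (a * p.1) b p.2)%:E.
  by rewrite mule_ge0// lee_fin normal_pdf_ge0.
have mFF : measurable_fun setT (fun y : R => \int[mu]_v (f v * (normal_pdf (a * y) b v)%:E)).
  exact: (@measurable_fun_fubini_tonelli_F _ _ _ _ R mu _ mF F0).
have FF0 (y : R) : 0 <= \int[mu]_v (f v * (normal_pdf (a * y) b v)%:E).
  by apply: integral_ge0 => v _; exact: (F0 (y, v)).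
rewrite [LHS](integral_normal_prob 0 1 mFF FF0).
transitivity (\int[mu]_y \int[mu]_v (f v * (normal_pdf (a * y) b v * normal_pdf 0 1 y)%:E)).
  apply: eq_integral => y _; rewrite -ge0_integralZr//; last 3 first.
  - by apply: emeasurable_funM mf _; exact: measurable_normal_pdf_EFin.
  - by move=> v _; exact: (F0 (y, v)).
  - by rewrite lee_fin normal_pdf_ge0.
  by apply: eq_integral => v _; rewrite EFinM muleA.
have mG : measurable_fun setT
   (fun p : R * R => f p.2 * (normal_pdf (a * p.1) b p.2 * normal_pdf 0 1 p.1)%:E).
  apply: emeasurable_funM; first exact: measurableT_comp.
  apply/measurable_EFinP/measurable_funM => //.
  by apply: measurableT_comp => //; exact: measurable_normal_pdf.
have G0 (p : R * R) : 0 <= f p.2 * (normal_pdf (a * p.1) b p.2 * normal_pdf 0 1 p.1)%:E.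
  by rewrite mule_ge0// lee_fin mulr_ge0 ?normal_pdf_ge0.
rewrite (@fubini_tonelli _ _ _ _ R mu mu _ mG G0)/=.
apply: eq_integral => v _.
have bc0 : (0 < b / c)%R by rewrite divr_gt0.
(* Completing the square in [y]: the product of densities is the density of variance [c^2] at [v]
   times a Gaussian density in [y] of mean [a v / c^2] and deviation [b / c], which integrates to
   1. *)
transitivity (\int[mu]_y ((f v * (normal_pdf 0 c v)%:E) *
    (normal_pdf (a * v / c ^+ 2) (b / c) y)%:E)).
  apply: eq_integral => y _; rewrite -muleA -EFinM; congr (_ * _%:E).
  rewrite !normal_pdfE ?gt_eqF ?oner_neq0//= (normal_peakM b0) (normal_peakM c0) (normal_peakM bc0).
  rewrite /normal_fun [LHS]mulrACA [RHS]mulrACA -!expRD; congr (_ * expR _)%R.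
    by field; rewrite !gt_eqF.
  have -> : (b ^+ 2 = c ^+ 2 - a ^+ 2)%R by rewrite -abc addrC addKr.
  rewrite expr_div_n (_ : b ^+ 2 = c ^+ 2 - a ^+ 2)%R; last by rewrite -abc addrC addKr.
  have n1 : (c ^+ 2 - a ^+ 2 != 0)%R by rewrite -abc addrC addKr gt_eqF// exprn_gt0.
  by field; rewrite n1 gt_eqF.
rewrite ge0_integralZl//.
- by rewrite integral_normal_pdf mule1.
- exact: measurable_normal_pdf_EFin.
- by move=> y _; rewrite lee_fin normal_pdf_ge0.
- by rewrite mule_ge0// lee_fin normal_pdf_ge0.
Qed.

(** Tilting by [expR (l * z)] turns the standard density into the one of mean [l], up to the factor
    [expR (l ^+ 2 / 2)]. *)
Lemma normal_mgf (l : R) :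
  \int[normal_prob 0 1]_z (expR (l * z))%:E = (expR (l ^+ 2 / 2))%:E :> \bar R.
Proof.
have me : measurable_fun setT (fun z : R => (expR (l * z))%:E).
  by apply/measurable_EFinP; apply: measurableT_comp => //; exact: measurable_funM.
rewrite [LHS](integral_normal_prob 0 1 me); last by move=> x; rewrite lee_fin expR_ge0.
transitivity (\int[mu]_z ((expR (l ^+ 2 / 2))%:E * (normal_pdf l 1 z)%:E)).
  apply: eq_integral => z _; rewrite -!EFinM; congr EFin.
  rewrite !normal_pdfE ?oner_neq0//= /normal_fun mulrCA [RHS]mulrCA -!expRD.
  by congr (_ * expR _)%R; field.
rewrite ge0_integralZl_EFin ?expR_ge0//; last 2 first.
- by move=> z _; rewrite lee_fin normal_pdf_ge0.
- by apply/measurable_EFinP; exact: measurable_normal_pdf.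
by rewrite integral_normal_pdf mule1.
Qed.

End GaussianIntegrals.

(** Replaces a passage to the limit [l -> 0]: a positive [x] is contradicted by
    [l = x / (2 (K + x))]. *)
Lemma le0_of_le_scale {R : realType} (x K : R) :
  (forall l : R, 0 < l <= 1 -> x <= l * K) -> x <= 0.
Proof.
move=> h; rewrite leNgt; apply/negP => x0.
have K0 : 0 < K by have := h 1; rewrite ltr01 lexx mul1r => /(_ isT); exact: lt_le_trans.
have l0 : 0 < x / (2 * (K + x)) by rewrite divr_gt0// mulr_gt0// addr_gt0.
have := h (x / (2 * (K + x))); rewrite l0/= ler_pdivrMr ?mulr_gt0 ?addr_gt0//.
have -> : x <= 1 * (2 * (K + x)) by lra.
move=> /(_ isT); rewrite mulrAC ler_pdivlMr ?mulr_gt0 ?addr_gt0//.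
by rewrite leNgt => /negP; apply; rewrite ltr_pM2l//; lra.
Qed.

(** * Mean and variance from a moment generating function *)

Section MomentsFromMgf.
Context {R : realType} {d : measure_display} {T : measurableType d} (P : probability T R).
Variables (Y : T -> R) (v : R).
Hypothesis mY : measurable_fun setT Y.
Hypothesis v0 : 0 <= v.
Hypothesis mgf : forall l : R,
  (\int[P]_w (expR (l * Y w))%:E = (expR (l ^+ 2 / 2 * v))%:E)%E.

Lemma mgf_integrable (l : R) : integrableR P (fun w => expR (l * Y w)).
Proof.
apply: integrableR_ge0; last by rewrite mgf ltry.
- apply: measurableT_comp => //; exact: measurable_funM.
- by move=> w; exact: expR_ge0.
Qed.

Lemma mgf_expect (l : R) : expect P (fun w => expR (l * Y w)) = expR (l ^+ 2 / 2 * v).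
Proof. exact: expect_eq. Qed.

Lemma mgf_integrable_abs (l : R) : 0 <= l -> integrableR P (fun w => expR (l * `|Y w|)).
Proof.
move=> l0; apply: (@integrableR_dom _ _ _ _ _ (fun w => expR (l * Y w) + expR (- l * Y w))).
- apply: measurableT_comp => //; apply: measurable_funM => //.
  exact: measurableT_comp.
- move=> w; rewrite ger0_norm ?expR_ge0// -{1}(ger0_norm l0) -normrM mulNr.
  exact: expR_norm_le.
- by apply: integrableRD; exact: mgf_integrable.
Qed.

Lemma mgf_expect_abs (l : R) : 0 <= l ->
  expect P (fun w => expR (l * `|Y w|)) <= 2 * expR (l ^+ 2 / 2 * v).
Proof.
move=> l0; apply: le_trans (_ : expect P (fun w => expR (l * Y w) + expR (- l * Y w)) <= _).
  apply: le_expect; first exact: mgf_integrable_abs.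
    by apply: integrableRD; exact: mgf_integrable.
  move=> w; rewrite -{1}(ger0_norm l0) -normrM mulNr.
  exact: expR_norm_le.
rewrite expectD; [|exact: mgf_integrable|exact: mgf_integrable].
by rewrite !mgf_expect sqrrN mulr_natl mulr2n.
Qed.

Lemma mgf_integrable_pow k : integrableR P (fun w => Y w ^+ k).
Proof.
apply: (@integrableR_dom _ _ _ _ _ (fun w => k`!%:R * expR (1 * `|Y w|))).
- exact: measurable_funX.
- by move=> w; rewrite normrX mul1r expR_ge_pow.
- by apply: integrableRZ; exact: mgf_integrable_abs.
Qed.

Lemma mgf_integrable1 : integrableR P Y.
Proof. by have := mgf_integrable_pow 1; congr integrableR; apply/funext => w; rewrite expr1. Qed.

(** Dominates [|Y|^3 expR |l * Y|] for all [|l| <= 1], so that one expectation bounds every Taylor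
    remainder. *)
Let D w := 6 * expR (2 * `|Y w|).
Let m := expect P Y.
Let V := expect P (fun w => Y w ^+ 2).

Let iD : integrableR P D.
Proof. by apply: integrableRZ; exact: mgf_integrable_abs. Qed.

Let approx (l : R) : `|l| <= 1 ->
  `|expR (l ^+ 2 / 2 * v) - 1 - l * m - 2^-1 * (l ^+ 2 * V)| <= `|l| ^+ 3 * expect P D.
Proof.
move=> l1.
have i1 := integrableRZ l mgf_integrable1.
have i2 := integrableRZ 2^-1 (integrableRZ (l ^+ 2) (mgf_integrable_pow 2)).
have i0 := integrableRB (mgf_integrable l) (integrableR_cst P 1).
have i01 := integrableRB i0 i1.
have -> : expR (l ^+ 2 / 2 * v) - 1 - l * m - 2^-1 * (l ^+ 2 * V) =
  expect P (fun w => expR (l * Y w) - 1 - l * Y w - 2^-1 * (l ^+ 2 * Y w ^+ 2)).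
  rewrite expectB// expectB// expectB//; [|exact: mgf_integrable|exact: integrableR_cst].
  rewrite mgf_expect expect_cst expectZ; last exact: mgf_integrable1.
  by rewrite expectZ ?expectZ//; [exact: mgf_integrable_pow|apply: integrableRZ; exact: mgf_integrable_pow].
have i012 := integrableRB i01 i2.
apply: le_trans (expect_norm i012) _.
rewrite -expectZ//; apply: le_expect; [exact: integrableR_norm|exact: integrableRZ|].
move=> w; have := expR_taylor2 (l * Y w); rewrite exprMn => /le_trans; apply.
rewrite normrM exprMn -mulrA ler_wpM2l ?exprn_ge0//.
apply: (@le_trans _ _ (6 * expR `|Y w| * expR `|Y w|)).
  apply: ler_pM; [exact: exprn_ge0|exact: expR_ge0| |].
    by have := @expR_ge_pow R 3 `|Y w| (normr_ge0 _).
  by rewrite ler_expR -[leRHS]mul1r ler_wpM2r.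
by rewrite -mulrA -expRD /D (_ : _ + _ = 2 * `|Y w|)//; ring.
Qed.

Let exp_quad (l : R) : `|l| <= 1 ->
  `|expR (l ^+ 2 / 2 * v) - 1 - l ^+ 2 / 2 * v| <= `|l| ^+ 3 * (v ^+ 2 + v ^+ 3 * expR v).
Proof.
move=> l1; set t := l ^+ 2 / 2 * v.
have l2 : l ^+ 2 = `|l| ^+ 2 by rewrite real_normK ?num_real.
have al0 := normr_ge0 l.
have t0 : 0 <= t by rewrite mulr_ge0// divr_ge0// sqr_ge0.
have tv : t <= `|l| ^+ 2 * v.
  by rewrite /t l2 ler_wpM2r// ler_pdivrMr// ler_peMr ?exprn_ge0//; lra.
have tv1 : t <= v.
  apply: le_trans tv _; rewrite -[leRHS]mul1r ler_wpM2r//; exact: exprn_ile1.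
have h := expR_taylor2 t; rewrite !(ger0_norm t0) in h.
have p1 : t ^+ 2 <= `|l| ^+ 3 * v ^+ 2.
  apply: (@le_trans _ _ ((`|l| ^+ 2 * v) ^+ 2)).
    by apply: lerXn2r; rewrite ?nnegrE// mulr_ge0 ?exprn_ge0.
  rewrite exprMn ler_wpM2r ?exprn_ge0// -exprM (_ : (2 * 2)%N = 3.+1)// exprSr.
  by rewrite -[leRHS]mulr1 ler_wpM2l ?exprn_ge0.
have p2 : t ^+ 3 * expR t <= `|l| ^+ 3 * (v ^+ 3 * expR v).
  rewrite mulrA; apply: ler_pM; rewrite ?expR_ge0 ?exprn_ge0 ?ler_expR//.
  apply: (@le_trans _ _ ((`|l| ^+ 2 * v) ^+ 3)).
    by apply: lerXn2r; rewrite ?nnegrE// mulr_ge0 ?exprn_ge0.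
  rewrite exprMn ler_wpM2r ?exprn_ge0// -exprM (_ : (2 * 3)%N = (3 + 3)%N)// exprD.
  by rewrite -[leRHS]mulr1 ler_wpM2l ?exprn_ge0// exprn_ile1.
have -> : expR t - 1 - t = (expR t - 1 - t - 2^-1 * t ^+ 2) + 2^-1 * t ^+ 2 by ring.
apply: le_trans (ler_normD _ _) _.
rewrite mulrDr [X in _ + X]ger0_norm; last by rewrite mulr_ge0 ?exprn_ge0 ?invr_ge0.
have := exprn_ge0 2 t0; lra.
Qed.

Let K := expect P D + (v ^+ 2 + v ^+ 3 * expR v).

(** The generating function is expanded once through the moments of [Y] and once from its closed
    form; the two expansions agree up to order three. *)
Let close (l : R) : `|l| <= 1 ->
  `|l ^+ 2 / 2 * v - l * m - 2^-1 * (l ^+ 2 * V)| <= `|l| ^+ 3 * K.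
Proof.
move=> l1; have h1 := approx l1; have h2 := exp_quad l1; rewrite distrC in h2.
have -> : l ^+ 2 / 2 * v - l * m - 2^-1 * (l ^+ 2 * V) =
  (expR (l ^+ 2 / 2 * v) - 1 - l * m - 2^-1 * (l ^+ 2 * V)) +
  (l ^+ 2 / 2 * v - (expR (l ^+ 2 / 2 * v) - 1)) by ring.
by rewrite mulrDr (le_trans (ler_normD _ _))// lerD.
Qed.

(** Adding the expansions at [l] and [- l] cancels the mean; after division by [l^2] the error is of
    order [l]. *)
Lemma mgf_second_moment : expect P (fun w => Y w ^+ 2) = v.
Proof.
rewrite -/V; apply/eqP; rewrite eq_sym -subr_eq0 -normr_le0.
apply: (@le0_of_le_scale _ _ (2 * K)) => l /andP[l0 l1].
have h1 := @close l; have h2 := @close (- l); rewrite normrN sqrrN in h2.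
rewrite (gtr0_norm l0) l1 in h1 h2.
have H := lerD (h1 isT) (h2 isT).
have h : l ^+ 2 * `|v - V| <= l ^+ 2 * (l * (2 * K)).
  rewrite -[X in X * `|_|](ger0_norm (sqr_ge0 l)) -normrM.
  have -> : l ^+ 2 * (v - V) = (l ^+ 2 / 2 * v - l * m - 2^-1 * (l ^+ 2 * V)) +
     (l ^+ 2 / 2 * v - - l * m - 2^-1 * (l ^+ 2 * V)) by field.
  apply: le_trans (ler_normD _ _) _; apply: le_trans H _.
  by rewrite le_eqVlt; apply/orP; left; apply/eqP; ring.
by rewrite ler_pM2l ?exprn_gt0 in h.
Qed.

(** Once the variance terms cancel, [l * m] is of order [l^3]. *)
Lemma mgf_mean : expect P Y = 0.
Proof.
rewrite -/m; apply/eqP; rewrite -normr_le0.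
apply: (@le0_of_le_scale _ _ K) => l /andP[l0 l1].
have h1 := @close l; rewrite (gtr0_norm l0) l1 in h1; have := h1 isT.
rewrite /V mgf_second_moment.
have -> : l ^+ 2 / 2 * v - l * m - 2^-1 * (l ^+ 2 * v) = - (l * m) by field.
rewrite normrN normrM (gtr0_norm l0) => h.
have K0 : 0 <= K.
  have n1 : `|1 : R| <= 1 by rewrite normr1.
  by have := le_trans (normr_ge0 _) (close n1); rewrite normr1 expr1n mul1r.
rewrite -(ler_pM2l l0); apply: le_trans h _.
have -> : l ^+ 3 * K = l * (l * K) * l by ring.
by rewrite -[leRHS]mulr1 ler_wpM2l// !(mulr_ge0 (ltW l0)).
Qed.

End MomentsFromMgf.

(** * Gaussian vectors with deterministic coefficients *)

Section GaussianVector.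
Context {R : realType} {d : measure_display} {T : measurableType d} (P : probability T R).
Context {n : nat} (e : 'I_n -> {RV P >-> R}).
Hypothesis iid_e : iid e.
Hypothesis std_e : forall i, standard_normal (e i).
Local Open Scope ereal_scope.

Definition gvec {J : finType} (c : 'I_n -> J -> R) (w : T) (j : J) : R :=
  (\sum_(i < n) c i j * e i w)%R.

Lemma integral_std_normal i (f : R -> \bar R) : measurable_fun setT f ->
  (forall x, 0 <= f x) -> \int[P]_w f (e i w) = \int[normal_prob 0 1]_z f z.
Proof.
move=> mf f0.
have me' : measurable_fun setT (e i : T -> R) by exact: measurable_funPT.
have mei : measurable_fun setT (e i : T -> measurableTypeR R) by exact me'.
transitivity (\int[pushforward P (e i : T -> measurableTypeR R)]_z f z).
  by rewrite (ge0_integral_pushforward mei).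
by apply: eq_measure_integral => A mA _; exact: std_e.
Qed.

Section Vector.
Context {J : finType}.
Implicit Types (c : 'I_n -> J -> R) (u : (J -> R) -> \bar R).

Lemma coords_measurable_gvec c (s : R) : coords_measurable (fun w j => s * gvec c w j)%R.
Proof.
move=> j; apply: measurable_funM => //; apply: measurable_sum => i.
exact: measurable_funM.
Qed.

(** Gaussian average along a single direction. By independence, averaging over [gvec] is a
    composition of such operators, which commute. *)
Let ray (v : J -> R) := avg (normal_prob 0 1) (fun (z : R) j => v j * z)%R.

Let coords_measurable_ray (v : J -> R) : coords_measurable (fun (z : R) j => v j * z)%R.
Proof. by move=> j; exact: measurable_funM. Qed.

Lemma avg_gvecE c (s : R) u x : test_fun u ->
  avg P (fun w j => s * gvec c w j)%R u x =
  foldr (fun i v => ray (fun j => s * c i j)%R v) u (index_enum 'I_n) x.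
Proof.
move=> hu.
pose xi (i : 'I_n) (y : R) (j : J) := (s * c i j * y)%R.
have mxi i : coords_measurable (xi i) by move=> j; exact: measurable_funM.
have := @avg_independent_sum R _ _ P _ _ _ e iid_e.1 J xi (index_enum 'I_n) u x mxi
  (index_enum_uniq _) hu.
have -> : \int[P]_w u (fun j => x j + \sum_(k <- index_enum 'I_n) xi k (e k w) j)%R =
    avg P (fun w j => s * gvec c w j)%R u x.
  apply: eq_integral => w _; congr u; apply/funext => j; congr (_ + _)%R.
  by rewrite /gvec mulr_sumr; apply: eq_bigr => i _; rewrite /xi mulrA.
move=> ->; elim: (index_enum 'I_n) x => //= i r IH x.
have tr : test_fun (foldr (fun i v => ray (fun j => s * c i j)%R v) u r).
  by elim: r {IH} => //= k r IHr; apply: test_fun_avg IHr; exact: coords_measurable_ray.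
have -> : foldr (fun k v => avg P (fun w => xi k (e k w)) v) u r =
          foldr (fun i v => ray (fun j => s * c i j)%R v) u r by apply/funext.
set v := foldr _ _ _.
have := @integral_std_normal i (fun z => v (fun j => x j + s * c i j * z)%R); apply.
  by apply: tr.1 => j; apply: measurable_funD => //; exact: measurable_funM.
by move=> z; exact: tr.2.
Qed.

(** Direction by direction this is the one-dimensional [normal_stable]; as rays commute, those of
    scale [a] can be moved next to those of scale [b]. *)
Lemma avg_gvec_stable c (a b s : R) u : (0 < a)%R -> (0 < b)%R -> (0 < s)%R ->
  (a ^+ 2 + b ^+ 2 = s ^+ 2)%R -> test_fun u ->
  avg P (fun w j => a * gvec c w j)%R (avg P (fun w j => b * gvec c w j)%R u) =
  avg P (fun w j => s * gvec c w j)%R u.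
Proof.
move=> a0 b0 s0 abs hu; apply/funext => x.
have tf (t : R) r v : test_fun v -> test_fun (foldr (fun i v => ray (fun j => t * c i j)%R v) v r).
  move=> hv; elim: r => //= k r IHr; apply: test_fun_avg IHr; exact: coords_measurable_ray.
have hb : test_fun (avg P (fun w j => b * gvec c w j)%R u).
  by apply: test_fun_avg hu; exact: coords_measurable_gvec.
rewrite avg_gvecE// avg_gvecE//.
have -> : avg P (fun w j => b * gvec c w j)%R u =
    foldr (fun i v => ray (fun j => b * c i j)%R v) u (index_enum 'I_n).
  by apply/funext => y; exact: avg_gvecE.
have comm (v : J -> R) (t : R) r w : test_fun w ->
    foldr (fun i v => ray (fun j => t * c i j)%R v) (ray v w) r =
    ray v (foldr (fun i v => ray (fun j => t * c i j)%R v) w r).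
  move=> hw; elim: r => //= i r ->.
  by apply: avg_comm; [exact: coords_measurable_ray|exact: coords_measurable_ray|exact: tf].
congr (_ x).
elim: (index_enum 'I_n) => //= i r IH.
rewrite comm; last exact: tf.
rewrite IH; apply/funext => y; rewrite /ray /avg.
set v := foldr _ _ _; have hv : test_fun v by exact: tf.
have mf : measurable_fun setT (fun z : R => v (fun j => y j + c i j * z)%R).
  by apply: hv.1 => j; apply: measurable_funD => //; exact: measurable_funM.
have := normal_stable a0 b0 s0 abs mf (fun z => hv.2 _).
have -> : \int[normal_prob 0 1]_z v (fun j => y j + c i j * (s * z))%R =
  \int[normal_prob 0 1]_z v (fun j => y j + s * c i j * z)%R.
  by apply: eq_integral => z _; congr v; apply/funext => j; congr (_ + _)%R; ring.
move=> <-; apply: eq_integral => z _; apply: eq_integral => z' _.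
by congr v; apply/funext => j; ring.
Qed.

(** Gaussian steps merge into one whose scale grows like the square root of their number; [n] steps
    of scale [n^(-1/2)] thus give [gvec] itself. *)
Lemma iter_avg_gvec c (s : R) u k : (0 < s)%R -> test_fun u ->
  iter k.+1 (avg P (fun w j => s * gvec c w j)%R) u =
  avg P (fun w j => Num.sqrt k.+1%:R * s * gvec c w j)%R u.
Proof.
move=> s0 hu; elim: k => [|k IH].
  by rewrite /= (_ : (fun w j => Num.sqrt 1 * s * _)%R = (fun w j => s * gvec c w j)%R)//;
     apply/funext => w; apply/funext => j; rewrite sqrtr1 mul1r.
rewrite iterS IH; apply: avg_gvec_stable => //.
- by rewrite mulr_gt0// sqrtr_gt0.
- by rewrite mulr_gt0// sqrtr_gt0.
- by rewrite !exprMn !sqr_sqrtr ?ler0n// -[k.+2%:R]natr1; ring.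
Qed.

End Vector.

Section Coordinate.
Context {J : finType}.
Variables (c : 'I_n -> J -> R) (j : J).
Let v : R := (\sum_(i < n) c i j ^+ 2)%R.

Lemma measurable_gvec : measurable_fun setT (fun w => gvec c w j).
Proof. by apply: measurable_sum => i; exact: measurable_funM. Qed.

(** The averaging operators are used on a one-point index set, where each of them multiplies the
    exponential test function by a scalar generating function. *)
Lemma gvec_mgf (l : R) :
  \int[P]_w (expR (l * gvec c w j))%:E = (expR (l ^+ 2 / 2 * v))%:E.
Proof.
pose u (x : unit -> R) : \bar R := (expR (l * x tt))%:E.
have hu : test_fun u.
  split => [d' T' w mw|x]; last by rewrite lee_fin expR_ge0.
  by apply/measurable_EFinP; apply: measurableT_comp => //; exact: measurable_funM.
have := @avg_independent_sum R _ _ P _ _ _ e iid_e.1 unit (fun i y _ => c i j * y)%R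
  (index_enum 'I_n) u (fun=> 0%R) _ (index_enum_uniq _) hu.
rewrite (_ : (\int[P]_w _) = \int[P]_w (expR (l * gvec c w j))%:E); last first.
  by apply: eq_integral => w _; rewrite /u add0r.
move=> ->; last by move=> k t; exact: measurable_funM.
have step (r : seq 'I_n) x : foldr (fun k v0 => avg P (fun w _ => c k j * e k w)%R v0) u r x =
   (expR (l ^+ 2 / 2 * \sum_(i <- r) c i j ^+ 2))%:E * u x.
  elim: r x => [|i r IH] x /=; first by rewrite big_nil mulr0 expR0 mul1e.
  have -> : foldr (fun k v0 => avg P (fun w _ => c k j * e k w)%R v0) u r =
     (fun x => (expR (l ^+ 2 / 2 * \sum_(i <- r) c i j ^+ 2))%:E * u x) by apply/funext.
  rewrite avgZ ?expR_ge0//; last by move=> t; exact: measurable_funM.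
  rewrite big_cons mulrDr expRD EFinM.
  rewrite [X in X * u x]muleC -muleA; congr (_ * _).
  have mE : measurable_fun setT (fun z : R => (expR (l * (x tt + c i j * z)))%:E).
    apply/measurable_EFinP; apply: measurableT_comp => //; apply: measurable_funM => //.
    by apply: measurable_funD => //; exact: measurable_funM.
  rewrite /avg /u (@integral_std_normal i _ mE); last by move=> z; rewrite lee_fin expR_ge0.
  transitivity (\int[normal_prob 0 1]_z ((expR (l * x tt))%:E * (expR (l * c i j * z))%:E)).
    by apply: eq_integral => z _; rewrite -EFinM -expRD; congr (expR _)%:E; ring.
  rewrite ge0_integralZl_EFin ?expR_ge0//; last first.
    by apply/measurable_EFinP; apply: measurableT_comp => //; exact: measurable_funM.
  by rewrite normal_mgf muleC; congr (_%:E * _); congr expR; rewrite exprMn; ring.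
by rewrite step /u mulr0 expR0 mule1.
Qed.

End Coordinate.
End GaussianVector.

(** * Lindeberg replacement and anti-concentration *)

Lemma is_derive_measurable {R : realType} (f df : R -> R) :
  (forall x : R, is_derive x 1 f (df x)) -> measurable_fun setT f.
Proof.
move=> hf; apply: continuous_measurable_fun => x.
apply: differentiable_continuous; apply/derivable1_diffP.
by have := hf x; case.
Qed.

Section SecondOrder.
Context {R : realType} {d : measure_display} {T : measurableType d} (P : probability T R).
Context {J : finType}.
Implicit Types (xi : T -> J -> R).

(** What replacement needs of an increment: centring, second moments and an integrable bound for the
    Taylor remainder. As the exponential there involves the largest coordinate, each [D j] has to
    dominate for all [k] at once. *)
Record third_order (beta : R) xi (G : J -> J -> R) (M : R) : Prop := ThirdOrder {
  to_meas : coords_measurable xi;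
  to_int1 : forall j, integrableR P (fun w => xi w j);
  to_mean : forall j, expect P (fun w => xi w j) = 0;
  to_int2 : forall j k, integrableR P (fun w => xi w j * xi w k);
  to_cov : forall j k, expect P (fun w => xi w j * xi w k) = G j k;
  to_dom : exists D : J -> T -> R, forall j,
    [/\ integrableR P (D j), expect P (D j) <= M &
        forall k w, `|xi w j| ^+ 3 * expR (3 * beta * `|xi w k|) <= D j w] }.

(** A pointwise second-order expansion is integrated: the linear part vanishes, the quadratic part
    becomes the covariance, and [to_dom] bounds the remainder. *)
Lemma expect_quadratic beta xi G M (h : T -> R) (L : J -> R) (A : J -> J -> R)
    (pi : J -> R) (K : R) :
  third_order beta xi G M -> (exists j0 : J, True) -> measurable_fun setT h ->
  (forall j, 0 <= pi j) -> \sum_j pi j = 1 -> 0 <= K ->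
  (forall w N, (forall j, `|xi w j| <= N) ->
    `|h w - \sum_j L j * xi w j - 2^-1 * \sum_j \sum_k A j k * (xi w j * xi w k)|
     <= K * \sum_j pi j * (`|xi w j| ^+ 3 * expR (3 * beta * N))) ->
  integrableR P h /\
  `|expect P h - 2^-1 * \sum_j \sum_k A j k * G j k| <= K * M.
Proof.
move=> [mxi i1 m1 i2 m2 [D hD]] [j0 _] mh pi0 pi1 K0 hh.
pose S w := \sum_j pi j * D j w.
pose l1 w := \sum_j L j * xi w j.
pose l2 w := 2^-1 * \sum_j \sum_k A j k * (xi w j * xi w k).
have iS : integrableR P S.
  by apply: integrableR_sum => j; apply: integrableRZ; case: (hD j).
have il1 : integrableR P l1 by apply: integrableR_sum => j; exact: integrableRZ.
have il2 : integrableR P l2.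
  apply: integrableRZ; apply: integrableR_sum => j; apply: integrableR_sum => k.
  exact: integrableRZ.
have bound w : `|h w - l1 w - l2 w| <= K * S w.
  (* The largest coordinate serves as [N], so that the remainder involves a single index besides
     [j]. *)
  have [jm _ hm] := @arg_maxP _ _ J j0 predT (fun j => `|xi w j|) isT.
  apply: le_trans (hh w `|xi w jm| (fun j => hm j isT)) _.
  rewrite ler_wpM2l//; apply: ler_sum => j _; rewrite ler_wpM2l//.
  by case: (hD j).
have mr : measurable_fun setT (fun w => h w - l1 w - l2 w).
  by apply: measurable_funB; [apply: measurable_funB => //|];
     apply: integrableR_measurable; eassumption.
have ir : integrableR P (fun w => h w - l1 w - l2 w).
  by apply: integrableR_dom mr bound _; exact: integrableRZ.
have hE : h = fun w => (h w - l1 w - l2 w) + (l1 w + l2 w).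
  by apply/funext => w; ring.
have ih : integrableR P h by rewrite hE; apply: integrableRD => //; exact: integrableRD.
split=> //.
have e1 : expect P l1 = 0.
  rewrite expect_sum => [|j]; last exact: integrableRZ.
  by rewrite big1// => j _; rewrite expectZ// m1 mulr0.
have e2 : expect P l2 = 2^-1 * \sum_j \sum_k A j k * G j k.
  rewrite expectZ; last first.
    by apply: integrableR_sum => j; apply: integrableR_sum => k; exact: integrableRZ.
  congr (_ * _); rewrite expect_sum => [|j]; last first.
    by apply: integrableR_sum => k; exact: integrableRZ.
  apply: eq_bigr => j _; rewrite expect_sum => [|k]; last exact: integrableRZ.
  by apply: eq_bigr => k _; rewrite expectZ// m2.
have -> : expect P h - 2^-1 * \sum_j \sum_k A j k * G j k =
   expect P (fun w => h w - l1 w - l2 w).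
  rewrite expectB//; last exact: integrableRB.
  by rewrite expectB// e1 e2 subr0.
apply: le_trans (expect_norm ir) _.
apply: (@le_trans _ _ (expect P (fun w => K * S w))).
  by apply: le_expect => //; [exact: integrableR_norm|exact: integrableRZ].
rewrite expectZ// ler_wpM2l// expect_sum => [|j]; last by apply: integrableRZ; case: (hD j).
rewrite -[leRHS]mul1r -pi1 mulr_suml; apply: ler_sum => j _.
by have [i _ _] := hD j; rewrite expectZ// ler_wpM2l//; case: (hD j).
Qed.

End SecondOrder.

Section SoftMaxTest.
Context {R : realType} {J : finType}.
Variables (beta : R) (j0 : J).

Lemma measurable_softmax d (T : measurableType d) (v : T -> J -> R) :
  coords_measurable v -> measurable_fun setT (fun t => softmax beta (v t)).
Proof.
move=> mv; apply: measurable_funM => //; apply: measurableT_comp => //.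
apply: measurable_sum => j; apply: measurableT_comp => //.
exact: measurable_funM.
Qed.

Lemma test_fun_softmax (f : R -> R) : measurable_fun setT f -> (forall u, 0 <= f u) ->
  test_fun (fun x : J -> R => (f (softmax beta x))%:E).
Proof.
move=> mf f0; split=> [d T v mv|x]; last by rewrite lee_fin.
by apply/measurable_EFinP; apply: measurableT_comp mf _; exact: measurable_softmax.
Qed.

Variable phi : R.
Hypotheses (phi0 : 0 < phi) (phib : phi <= beta).

Lemma measurable_logistic : measurable_fun setT (logistic phi).
Proof. exact: is_derive_measurable (is_derive_logistic phi). Qed.

Lemma measurable_logistic_w : measurable_fun setT (logistic_w phi).
Proof. exact: is_derive_measurable (is_derive_logistic_w phi). Qed.

Lemma measurable_softplus : measurable_fun setT (softplus phi).
Proof. exact: is_derive_measurable (is_derive_softplus phi0). Qed.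

Definition test_g (x : J -> R) : \bar R := (logistic phi (softmax beta x))%:E.
Definition test_w (x : J -> R) : \bar R := (logistic_w phi (softmax beta x))%:E.
Definition test_s (x : J -> R) : \bar R := (softplus phi (softmax beta x))%:E.

Lemma test_fun_g : test_fun test_g.
Proof.
apply: test_fun_softmax measurable_logistic _ => u; exact/ltW/logistic_gt0.
Qed.

Lemma test_fun_w : test_fun test_w.
Proof.
apply: test_fun_softmax measurable_logistic_w _ => u; exact/ltW/logistic_w_gt0.
Qed.

Lemma softplus_ge0 u : 0 <= softplus phi u.
Proof. by rewrite mulr_ge0 ?invr_ge0 ?(ltW phi0)// ln_ge0// lerDl expR_ge0. Qed.

Lemma test_fun_s : test_fun test_s.
Proof. exact: test_fun_softmax measurable_softplus softplus_ge0. Qed.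

Context d (T : measurableType d) (P : probability T R).
Variables (xi : T -> J -> R) (G : J -> J -> R) (M : R).
Hypothesis hxi : third_order P beta xi G M.

Let pi0 x j : 0 <= softweight beta x j := softweight_ge0 beta j0 x j.
Let pi1 x : \sum_j softweight beta x j = 1 := softweight_sum beta j0 x.

Lemma expect_controlled f f1 f2 f3 x : controlled phi f f1 f2 f3 ->
  integrableR P (fun w => f (softmax beta (fun j => x j + xi w j))) /\
  `|expect P (fun w => f (softmax beta (fun j => x j + xi w j))) - f (softmax beta x)
    - 2^-1 * \sum_j \sum_k hess_coef beta f1 f2 x j k * G j k| <=
  17 * phi * beta ^+ 2 * M * logistic_w phi (softmax beta x).
Proof.
move=> cf; have [[d0 d1' d2] _] := cf.
have mf : measurable_fun setT f by exact: is_derive_measurable d0.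
pose h w := f (softmax beta (fun j => x j + xi w j)) - f (softmax beta x).
have mh : measurable_fun setT h.
  apply: measurable_funB => //; apply: measurableT_comp mf _; apply: measurable_softmax => j.
  by apply: measurable_funD => //; exact: (to_meas hxi).
have W0 := ltW (logistic_w_gt0 phi (softmax beta x)).
pose K := 17 * phi * beta ^+ 2 * logistic_w phi (softmax beta x).
have K0 : 0 <= K by rewrite mulr_ge0// mulr_ge0 ?sqr_ge0// mulr_ge0// ltW.
have [] := @expect_quadratic R _ _ P J beta xi G M h
  (fun j => f1 (softmax beta x) * softweight beta x j)
  (hess_coef beta f1 f2 x) (softweight beta x) K hxi (ex_intro _ j0 Logic.I) mh (pi0 x) (pi1 x) K0.
  move=> w N xiN; have := controlled_taylor phi0 j0 phib x cf xiN.
  rewrite hessE// /softmoment mulr_sumr.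
  under [in X in X -> _]eq_bigr do rewrite expr1 mulrA.
  by rewrite /K /h mulrA.
move=> ih hh; have iF : integrableR P (fun w => f (softmax beta (fun j => x j + xi w j))).
  rewrite (_ : (fun _ => _) = fun w => h w + f (softmax beta x)).
    by apply: integrableRD => //; exact: integrableR_cst.
  by apply/funext => w; rewrite /h subrK.
split=> //.
move: hh; rewrite /h (expectB iF (integrableR_cst P _)).
by rewrite expect_cst /K mulrAC.
Qed.

Lemma expect_softplus x :
  integrableR P (fun w => softplus phi (softmax beta (fun j => x j + xi w j))) /\
  `|expect P (fun w => softplus phi (softmax beta (fun j => x j + xi w j)))
    - softplus phi (softmax beta x)
    - 2^-1 * \sum_j \sum_k hess_coef beta (logistic phi) (fun u => phi * logistic_w phi u) x j k
       * G j k| <= 17 * beta ^+ 2 * M.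
Proof.
pose h w := softplus phi (softmax beta (fun j => x j + xi w j)) - softplus phi (softmax beta x).
have mh : measurable_fun setT h.
  apply: measurable_funB => //; apply: measurableT_comp measurable_softplus _.
  by apply: measurable_softmax => j; apply: measurable_funD => //; exact: (to_meas hxi).
pose K := 17 * beta ^+ 2.
have K0 : 0 <= K by rewrite mulr_ge0 ?sqr_ge0.
have [] := @expect_quadratic R _ _ P J beta xi G M h
  (fun j => logistic phi (softmax beta x) * softweight beta x j)
  (hess_coef beta (logistic phi) (fun u => phi * logistic_w phi u) x)
  (softweight beta x) K hxi (ex_intro _ j0 Logic.I) mh (pi0 x) (pi1 x) K0.
  move=> w N xiN; have := softplus_taylor phi0 j0 phib x xiN.
  rewrite hessE// /softmoment mulr_sumr.
  under [in X in X -> _]eq_bigr do rewrite expr1 mulrA.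
  have -> : 17 * phi * beta ^+ 2 * (phi^-1 * \sum_j softweight beta x j *
    (`|xi w j| ^+ 3 * expR (3 * beta * N))) = K * \sum_j softweight beta x j *
    (`|xi w j| ^+ 3 * expR (3 * beta * N)).
    by rewrite /K; field; rewrite gt_eqF.
  by [].
move=> ih hh.
have iF : integrableR P (fun w => softplus phi (softmax beta (fun j => x j + xi w j))).
  rewrite (_ : (fun _ => _) = fun w => h w + softplus phi (softmax beta x)).
    by apply: integrableRD => //; exact: integrableR_cst.
  by apply/funext => w; rewrite /h subrK.
split=> //.
have E : expect P h = expect P (fun w => softplus phi (softmax beta (fun j => x j + xi w j))) -
    softplus phi (softmax beta x).
  rewrite -[X in _ - X](expect_cst P).
  exact: (expectB iF (integrableR_cst P (softplus phi (softmax beta x)))).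
by rewrite -E.
Qed.

End SoftMaxTest.

Section GaussianThirdOrder.
Context {R : realType} {d : measure_display} {T : measurableType d} (P : probability T R).
Context {n : nat} (e : 'I_n -> {RV P >-> R}).
Hypothesis iid_e : iid e.
Hypothesis std_e : forall i, standard_normal (e i).
Context {J : finType}.
Variable c : 'I_n -> J -> R.
Hypothesis unit_c : forall j, \sum_(i < n) c i j ^+ 2 = 1.

Definition gcov (j k : J) : R := \sum_(i < n) c i j * c i k.

Lemma gcov_diag j : gcov j j = 1.
Proof. by rewrite -(unit_c j); apply: eq_bigr => i _; rewrite expr2. Qed.

(** Cauchy-Schwarz for unit vectors, from the sums of squares of [c i j - c i k] and
    [c i j + c i k]. *)
Lemma gcov_le1 j k : `|gcov j k| <= 1.
Proof.
have h (s : R) : s ^+ 2 = 1 -> s * gcov j k <= 1.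
  move=> s1; have : 0 <= \sum_(i < n) (c i j - s * c i k) ^+ 2.
    by apply: sumr_ge0 => i _; exact: sqr_ge0.
  have -> : \sum_(i < n) (c i j - s * c i k) ^+ 2 = 2 - 2 * (s * gcov j k); last by lra.
  transitivity (\sum_(i < n) (c i j ^+ 2 + c i k ^+ 2 - 2 * s * (c i j * c i k))).
    apply: eq_bigr => i _; have -> : (c i j - s * c i k) ^+ 2 =
      c i j ^+ 2 + s ^+ 2 * c i k ^+ 2 - 2 * s * (c i j * c i k) by ring.
    by rewrite s1 mul1r.
  rewrite sumrB big_split/= !unit_c -mulr_sumr -/(gcov j k); ring.
have h1 := h 1; have h2 := h (-1); rewrite expr1n mul1r in h1; rewrite sqrrN expr1n mulN1r in h2.
by rewrite ler_norml; have := h1 erefl; have := h2 erefl; lra.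
Qed.

Local Notation Y := (gvec e c).

Let mY j : measurable_fun setT (fun w => Y w j) := measurable_gvec e c j.

Let mgfY j (l : R) :
  (\int[P]_w (expR (l * Y w j))%:E = (expR (l ^+ 2 / 2 * 1))%:E)%E.
Proof. by rewrite gvec_mgf// unit_c. Qed.

Let comb j k (s : R) : (fun w => Y w j + s * Y w k) =
  (fun w => gvec e (fun i (_ : unit) => c i j + s * c i k) w tt).
Proof.
apply/funext => w; rewrite /gvec mulr_sumr -big_split/=.
by apply: eq_bigr => i _; ring.
Qed.

Let comb_sqr j k (s : R) : integrableR P (fun w => (Y w j + s * Y w k) ^+ 2) /\
  expect P (fun w => (Y w j + s * Y w k) ^+ 2) = \sum_(i < n) (c i j + s * c i k) ^+ 2.
Proof.
pose c' i (_ : unit) := c i j + s * c i k.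
have m' := measurable_gvec e c' tt.
have v0 : 0 <= \sum_(i < n) c' i tt ^+ 2 by apply: sumr_ge0 => i _; exact: sqr_ge0.
have g' := gvec_mgf iid_e std_e c' tt.
have E : (fun w => (Y w j + s * Y w k) ^+ 2) = (fun w => gvec e c' w tt ^+ 2).
  by apply/funext => w; rewrite -[gvec e c' w tt]/((fun w => gvec e c' w tt) w) -comb.
rewrite E; split; first exact: (mgf_integrable_pow m' g').
exact: (mgf_second_moment m' v0 g').
Qed.

(** Polarisation: the sum and the difference of two coordinates are again of the form [gvec], over a
    one-point index set, so their second moments are known. *)
Lemma gvec_second_order j k : integrableR P (fun w => Y w j * Y w k) /\
  expect P (fun w => Y w j * Y w k) = gcov j k.
Proof.
have [i1 e1] := comb_sqr j k 1; have [i2 e2] := comb_sqr j k (- 1).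
have E : (fun w => Y w j * Y w k) =
   fun w => 4^-1 * ((Y w j + 1 * Y w k) ^+ 2 - (Y w j + - 1 * Y w k) ^+ 2).
  by apply/funext => w; field.
have i12 := integrableRB i1 i2.
rewrite E; split; first exact: integrableRZ.
rewrite (expectZ _ i12) (expectB i1 i2) e1 e2 -sumrB mulr_sumr.
by apply: eq_bigr => i _; field.
Qed.

Let v1 : (0 : R) <= 1 := ler01.

Lemma gvec_exp_abs j (l : R) : 0 <= l ->
  integrableR P (fun w => expR (l * `|Y w j|)) /\
  expect P (fun w => expR (l * `|Y w j|)) <= 2 * expR (l ^+ 2 / 2).
Proof.
move=> l0; split; first exact: (mgf_integrable_abs (mY j) (mgfY j)).
have := mgf_expect_abs (mY j) (mgfY j) l0.
by rewrite mulr1.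
Qed.

(** The three summands bound the expectations of the three parts of the envelope [D] in
    [gvec_third_order]. *)
Definition gauss3 : R := 12 * expR 4 + 6 * expR 2 + 6 * expR 1.

(** Where [beta * s * |Y k| <= 1] the exponential is at most [expR 3]. Elsewhere its square is at
    most [expR (- L) * expR |Y k|]; the sum over [k] that makes the envelope independent of [k] is
    paid for by [expR (- L)]. *)
Lemma gvec_third_order (beta s L : R) : 0 < s -> 0 <= beta ->
  (6 + L) * (beta * s) <= 1 -> #|J|%:R <= expR L ->
  third_order P beta (fun w j => s * Y w j) (fun j k => s ^+ 2 * gcov j k) (s ^+ 3 * gauss3).
Proof.
move=> s0 b0 bsL JL.
have i1 j := mgf_integrable1 (mY j) (mgfY j).
have ea (l : R) j := @gvec_exp_abs j l.
have ee j : [/\ integrableR P (fun w => expR (1 * `|Y w j|)),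
   expect P (fun w => expR (1 * `|Y w j|)) <= 2 * expR 1,
   integrableR P (fun w => expR (2 * `|Y w j|)) &
   expect P (fun w => expR (2 * `|Y w j|)) <= 2 * expR 2].
  have [a1 b1] := ea 1 j ler01; have [a2 b2] := ea 2 j (ler0n R 2).
  split=> //.
    by apply: le_trans b1 _; rewrite ler_wpM2l// ler_expR expr1n; lra.
  by apply: le_trans b2 _; rewrite ler_wpM2l// ler_expR expr2; lra.
split.
- exact: coords_measurable_gvec.
- by move=> j; exact: integrableRZ.
- by move=> j; rewrite expectZ// (mgf_mean (mY j) v1 (mgfY j)) mulr0.
- move=> j k; have [i2 _] := gvec_second_order j k.
  rewrite (_ : (fun _ => _) = fun w => s ^+ 2 * (Y w j * Y w k)); first exact: integrableRZ.
  by apply/funext => w; ring.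
- move=> j k; have [i2 c2] := gvec_second_order j k.
  rewrite (_ : (fun _ => _) = fun w => s ^+ 2 * (Y w j * Y w k)); first by rewrite expectZ// c2.
  by apply/funext => w; ring.
pose E w := \sum_k expR (1 * `|Y w k|).
pose D j w := s ^+ 3 * (6 * expR 3 * expR (1 * `|Y w j|) +
   (3 * expR (2 * `|Y w j|) + 3 * expR (- L) * E w)).
have iE : integrableR P E by apply: integrableR_sum => k; case: (ee k).
exists D => j; have [a1 b1 a2 b2] := ee j.
have s3 : 0 <= s ^+ 3 by rewrite exprn_ge0// ltW.
have j1 := integrableRZ (6 * expR 3) a1; have j2 := integrableRZ 3 a2.
have j3 := integrableRZ (3 * expR (- L)) iE; have j23 := integrableRD j2 j3.
have j123 := integrableRD j1 j23.
split.
- exact: integrableRZ.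
- rewrite (expectZ _ j123) ler_wpM2l// (expectD j1 j23) (expectD j2 j3).
  rewrite (expectZ _ a1) (expectZ _ a2) (expectZ _ iE) expect_sum => [|k]; last by case: (ee k).
  have p1 : 6 * expR 3 * expect P (fun w => expR (1 * `|Y w j|)) <= 12 * expR 4.
    apply: le_trans (ler_wpM2l _ b1) _; first by rewrite mulr_ge0 ?expR_ge0.
    have -> : 6 * expR 3 * (2 * expR 1) = 12 * (expR 3 * expR 1) :> R by ring.
    by rewrite -expRD (_ : 3 + 1 = 4 :> R)//; ring.
  have p3 : 3 * expR (- L) * \sum_k expect P (fun w => expR (1 * `|Y w k|)) <= 6 * expR 1.
    apply: (@le_trans _ _ (3 * expR (- L) * \sum_(k : J) (2 * expR 1))).
      rewrite ler_wpM2l ?mulr_ge0 ?expR_ge0//; apply: ler_sum => k _; by case: (ee k).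
    rewrite (_ : \sum_(k : J) _ = #|J|%:R * (2 * expR 1)); last by rewrite sumr_const [RHS]mulr_natl.
    have -> : 3 * expR (- L) * (#|J|%:R * (2 * expR 1)) = 6 * expR 1 * (#|J|%:R * expR (- L)) by ring.
    rewrite -[leRHS]mulr1 ler_wpM2l ?mulr_ge0 ?expR_ge0//.
    by rewrite expRN ler_pdivrMr ?expR_gt0// mul1r.
  by rewrite /gauss3; lra.
move=> k w; have a0 := normr_ge0 (Y w j); have k0 := normr_ge0 (Y w k).
rewrite (_ : _ * expR _ = s ^+ 3 * (`|Y w j| ^+ 3 * expR (3 * beta * (s * `|Y w k|)))); last first.
  by rewrite !normrM (gtr0_norm s0) exprMn -[LHS]mulrA.
rewrite ler_wpM2l//.
have h1 : `|Y w j| ^+ 3 <= 6 * expR (1 * `|Y w j|) by rewrite mul1r; exact: expR_ge_pow.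
have E0 : expR (1 * `|Y w k|) <= E w.
  by rewrite /E (bigD1 k)//= lerDl; apply: sumr_ge0 => ? _; exact: expR_ge0.
have [small|big] := leP (beta * s * `|Y w k|) 1.
  apply: (@le_trans _ _ (6 * expR 3 * expR (1 * `|Y w j|))).
    have -> : 6 * expR 3 * expR (1 * `|Y w j|) = 6 * expR (1 * `|Y w j|) * expR 3 by ring.
    apply: ler_pM => //; rewrite ler_expR.
    have -> : 3 * beta * (s * `|Y w k|) = 3 * (beta * s * `|Y w k|) by ring.
    lra.
  by rewrite lerDl addr_ge0 ?mulr_ge0 ?expR_ge0// sumr_ge0// => ? _; exact: expR_ge0.
set A := expR (1 * `|Y w j|) in h1 *; set B := expR (3 * beta * (s * `|Y w k|)).
have A2 : expR (2 * `|Y w j|) = A ^+ 2 by rewrite -expRM_natl; congr expR; ring.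
(* The excess [beta * s * |Y k| > 1] bounds [L] by the part [L * (beta * s) * |Y k|] of the
   hypothesis on [6 + L]. *)
have B2 : B ^+ 2 <= expR (- L) * E w.
  apply: (@le_trans _ _ (expR (- L) * expR (1 * `|Y w k|))); last by rewrite ler_wpM2l ?expR_ge0.
  rewrite -expRM_natl -expRD ler_expR mul1r.
  have : (6 + L) * (beta * s) * `|Y w k| <= `|Y w k| by rewrite -[leRHS]mul1r ler_wpM2r.
  have L0 : 0 <= L.
    rewrite -ler_expR expR0; apply: le_trans JL; rewrite (_ : 1 = 1%:R)// ler_nat.
    by apply/card_gt0P; exists j.
  have : L <= L * (beta * s * `|Y w k|) by rewrite ler_peMr// ltW.
  have -> : (6 + L) * (beta * s) * `|Y w k| = 6 * (beta * s * `|Y w k|) + L * (beta * s * `|Y w k|) by ring.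
  have -> : 2%:R * (3 * beta * (s * `|Y w k|)) = 6 * (beta * s * `|Y w k|) by ring.
  lra.
have A0 : 0 <= A by exact: expR_ge0.
have B0 : 0 <= B by exact: expR_ge0.
apply: (@le_trans _ _ (6 * A * B)); first by rewrite ler_wpM2r.
have ab : 6 * A * B <= 3 * A ^+ 2 + 3 * B ^+ 2.
  rewrite -subr_ge0; have -> : 3 * A ^+ 2 + 3 * B ^+ 2 - 6 * A * B = 3 * (A - B) ^+ 2 by ring.
  by rewrite mulr_ge0 ?sqr_ge0.
have e0 : 0 <= 6 * expR 3 * A by rewrite !mulr_ge0 ?expR_ge0.
rewrite A2; lra.
Qed.

(** The envelope [2 l + q * S] with [l = sqrt L] exceeds every coordinate because [1 + z <= expR z],
    and [q] is small enough for [q * S] to have mean at most 2. *)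
Lemma gvec_max_le (L : R) : 1 <= L -> #|J|%:R <= expR L ->
  exists Mx : T -> R, [/\ integrableR P Mx, expect P Mx <= 4 * Num.sqrt L &
    forall w j, `|Y w j| <= Mx w].
Proof.
move=> L1 JL; set l := Num.sqrt L.
have L0 : 0 <= L by exact: le_trans L1.
have l1 : 1 <= l by rewrite -(@sqrtr1 R) ler_wsqrtr.
have l0 : 0 < l by exact: lt_le_trans l1.
have lL : l * l = L by rewrite -expr2 sqr_sqrtr.
pose S w := \sum_k expR (l * `|Y w k|).
have iS : integrableR P S.
  by apply: integrableR_sum => k; case: (@gvec_exp_abs k l (ltW l0)).
pose q := l^-1 * expR (- (2 * L)).
have q0 : 0 <= q by rewrite mulr_ge0 ?expR_ge0 ?invr_ge0 ?ltW.
have iq := integrableRZ q iS.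
exists (fun w => 2 * l + q * S w); split.
- by apply: integrableRD => //; exact: integrableR_cst.
- rewrite (expectD (integrableR_cst P (2 * l)) iq) (expectZ _ iS) (expect_cst P (2 * l)).
  rewrite expect_sum => [|k]; last by case: (@gvec_exp_abs k l (ltW l0)).
  have : q * \sum_k expect P (fun w => expR (l * `|Y w k|)) <= 2; last by lra.
  apply: (@le_trans _ _ (q * \sum_(k : J) (2 * expR L))).
    rewrite ler_wpM2l//; apply: ler_sum => k _.
    case: (@gvec_exp_abs k l (ltW l0)) => _ /le_trans; apply.
    by rewrite ler_wpM2l// ler_expR expr2 lL; lra.
  rewrite (_ : \sum_(k : J) _ = #|J|%:R * (2 * expR L)); last by rewrite sumr_const [RHS]mulr_natl.
  rewrite /q.
  have -> : l^-1 * expR (- (2 * L)) * (#|J|%:R * (2 * expR L)) =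
    l^-1 * (2 * (#|J|%:R * (expR L * expR (- (2 * L))))) by ring.
  rewrite -expRD (_ : L - 2 * L = - L); last by ring.
  apply: (@le_trans _ _ (1 * (2 * 1))); last by lra.
  apply: ler_pM; rewrite ?invr_ge0 ?(ltW l0) ?mulr_ge0 ?expR_ge0 ?invf_le1//.
  by rewrite ler_wpM2l// expRN ler_pdivrMr ?expR_gt0// mul1r.
move=> w j; have [h|h] := leP `|Y w j| (2 * l).
  by apply: le_trans h _; rewrite lerDl mulr_ge0// sumr_ge0// => ? _; exact: expR_ge0.
rewrite -lerBlDl; apply: (@le_trans _ _ (q * expR (l * `|Y w j|))); last first.
  by rewrite ler_wpM2l// /S (bigD1 j)//= lerDl sumr_ge0// => ? _; exact: expR_ge0.
rewrite /q -mulrA -expRD ler_pdivlMl//.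
have -> : - (2 * L) + l * `|Y w j| = l * (`|Y w j| - 2 * l) by rewrite -lL; ring.
have := @expR_ge1Dx R (l * (`|Y w j| - 2 * l)); lra.
Qed.

End GaussianThirdOrder.

(** * Gaussian anti-concentration *)

Section Nazarov.
Context {R : realType} {d : measure_display} {T : measurableType d} (P : probability T R).
Context {n : nat} (e : 'I_n -> {RV P >-> R}).
Hypothesis iid_e : iid e.
Hypothesis std_e : forall i, standard_normal (e i).
Context {J : finType} (j0 : J).
Variable c : 'I_n -> J -> R.
Hypothesis unit_c : forall j, \sum_(i < n) c i j ^+ 2 = 1.
Variables (beta phi L : R).
Hypotheses (phi0 : 0 < phi) (phib : phi <= beta).
Hypotheses (L1 : 1 <= L) (JL : #|J|%:R <= expR L).

Local Notation Y := (gvec e c).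
Let beta0 : 0 < beta := lt_le_trans phi0 phib.

Lemma softplus_lipschitz u v N : 0 <= N -> u <= v + N ->
  softplus phi u <= softplus phi v + N.
Proof.
move=> N0 uvN; have ds u' := is_derive_softplus phi0 u'.
have [uv|vu] := leP u v.
  have [c' _ E] := mean_value ds uv.
  have : 0 <= softplus phi v - softplus phi u.
    by rewrite E mulr_ge0 ?subr_ge0// ltW// logistic_gt0.
  by lra.
have [c' _ E] := mean_value ds (ltW vu).
have h : softplus phi u - softplus phi v <= u - v.
  rewrite E -[leRHS]mul1r ler_wpM2r ?subr_ge0 ?(ltW vu)//.
  exact/ltW/logistic_lt1.
by lra.
Qed.

(* Compare [softplus (F (x + sqrt (1 + s^2) Y))] with [softplus (F (x + Y))]:
   dilation costs at most [s^2 / 2 * E max |Y|], while adding the independent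
   increment [s Y'] gains the curvature term, which dominates [s^2 / 2 * phi * w]. *)
Theorem nazarov x :
  (avg P (fun w j => 1 * Y w j)%R (test_w beta phi) x <= (4 * Num.sqrt L / phi)%:E)%E.
Proof.
pose kappa := 4 * Num.sqrt L.
have [Mx [iM M4 YM]] := gvec_max_le iid_e std_e unit_c L1 JL.
have M0 w : 0 <= Mx w by apply: le_trans (YM w j0).
have m1 : coords_measurable (fun w j => 1 * Y w j) by exact: coords_measurable_gvec.
pose s (y : J -> R) := softplus phi (softmax beta y).
pose ww (y : J -> R) := logistic_w phi (softmax beta y).
pose XY w : J -> R := fun j => x j + 1 * Y w j.
have mXY : coords_measurable XY by move=> j; exact: measurable_funD.
have is_ : integrableR P (fun w => s (XY w)).
  apply: (@integrableR_dom _ _ _ _ _ (fun w => s x + Mx w)).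
  - by apply: measurableT_comp (measurable_softplus phi0) _; exact: measurable_softmax.
  - move=> w; rewrite ger0_norm ?softplus_ge0//; apply: softplus_lipschitz => //.
    by apply: softmax_shift => // j; rewrite mul1r.
  - by apply: integrableRD => //; exact: integrableR_cst.
have iw : integrableR P (fun w => ww (XY w)).
  apply: (@integrableR_dom _ _ _ _ _ (fun w => 4^-1)).
  - by apply: measurableT_comp (measurable_logistic_w phi) _; exact: measurable_softmax.
  - by move=> w; rewrite gtr0_norm ?logistic_w_gt0// logistic_w_le.
  - exact: integrableR_cst.
pose Es := expect P (fun w => s (XY w)); pose Ew := expect P (fun w => ww (XY w)).
have EwE : avg P (fun w j => 1 * Y w j)%R (test_w beta phi) x = Ew%:E.
  by rewrite /avg/= (expectE iw).
rewrite EwE lee_fin ler_pdivlMr// mulrC -subr_le0.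
pose K := 17 * beta ^+ 2 * gauss3.
have g30 : 0 <= @gauss3 R by rewrite /gauss3 !addr_ge0 ?mulr_ge0 ?expR_ge0.
have K0 : 0 <= K by rewrite mulr_ge0// mulr_ge0 ?sqr_ge0.
(* A step satisfying the smallness condition of [gvec_third_order]. The steps [l * d0] with [l] in
   (0, 1] are used, and [le0_of_le_scale] stands for [l -> 0]. *)
pose d0 := (1 + (6 + L) * beta)^-1.
have L0 : 0 <= L by exact: le_trans L1.
have Lb : 0 <= (6 + L) * beta by rewrite mulr_ge0 ?(ltW beta0)// addr_ge0.
have d00 : 0 < d0 by rewrite invr_gt0; apply: ltr_pwDl.
apply: (@le0_of_le_scale _ _ (2 * d0 * K)) => l /andP[l0 l1].
pose dl := l * d0.
have dl0 : 0 < dl by rewrite mulr_gt0.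
have dlL : (6 + L) * (beta * dl) <= 1.
  have h : (6 + L) * beta * d0 <= 1.
    by rewrite /d0 ler_pdivrMr ?mul1r ?lerDr// ltr_pwDl.
  rewrite mulrA /dl mulrCA -[leRHS]mul1r; apply: ler_pM h; rewrite ?(ltW l0)//.
  by rewrite mulr_ge0// ltW.
have to := gvec_third_order iid_e std_e unit_c dl0 (ltW beta0) dlL JL.
(* A Gaussian increment of scale [dl] gains at least [dl^2 / 2] times [phi * w], up to third order:
   this is where [hess_coef_ge] and the unit variances enter. *)
have step y : s y + dl ^+ 2 / 2 * (phi * ww y) <=
    expect P (fun w => s (fun j => y j + dl * Y w j)) + dl ^+ 3 * K.
  have [_] := expect_softplus j0 phi0 phib to y.
  set H := \sum_j \sum_k _; rewrite -/(s _).
  have -> : H = dl ^+ 2 * \sum_j \sum_k hess_coef beta (logistic phi)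
      (fun u => phi * logistic_w phi u) y j k * gcov c j k.
    rewrite /H mulr_sumr; apply: eq_bigr => j _; rewrite mulr_sumr.
    by apply: eq_bigr => k _; rewrite mulrCA.
  have := @hess_coef_ge _ _ beta j0 (logistic phi) (fun u => phi * logistic_w phi u) y
    (gcov c) (fun j k => le_trans (ler_norm _) (gcov_le1 unit_c j k)) (gcov_diag unit_c).
  set H' := \sum_j \sum_k _; rewrite -/(ww y) => Hge.
  have {}Hge : phi * ww y <= H'.
    apply: Hge; apply: ler_pM phib _; [exact: ltW|exact/ltW/logistic_w_gt0|].
    rewrite /logistic_w -[leRHS]mulr1 ler_wpM2l ?(ltW (logistic_gt0 _ _))//.
    by rewrite gerBl ltW// logistic_gt0.
  have {}Hge : dl ^+ 2 / 2 * (phi * ww y) <= dl ^+ 2 / 2 * H'.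
    by rewrite ler_wpM2l// divr_ge0// exprn_ge0// ltW.
  rewrite ler_norml => /andP[+ _].
  have -> : 17 * beta ^+ 2 * (dl ^+ 3 * gauss3) = dl ^+ 3 * K by rewrite /K; ring.
  have -> : 2^-1 * (dl ^+ 2 * H') = dl ^+ 2 / 2 * H' by ring.
  by lra.
have ml : coords_measurable (fun w j => dl * Y w j) by exact: coords_measurable_gvec.
have iy y : integrableR P (fun w => s (fun j => y j + dl * Y w j)).
  by case: (expect_softplus j0 phi0 phib to y).
pose sq := Num.sqrt (1 + dl ^+ 2).
have q0 : 0 < 1 + dl ^+ 2 by rewrite ltr_pwDl// sqr_ge0.
have sq0 : 0 < sq by rewrite sqrtr_gt0.
have sq2 : sq ^+ 2 = 1 + dl ^+ 2 by rewrite sqr_sqrtr// ltW.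
have sq1 : 1 <= sq by rewrite -(@sqrtr1 R) ler_wsqrtr// lerDl sqr_ge0.
have sqd : sq - 1 <= dl ^+ 2 / 2.
  have : 0 <= (sq - 1) ^+ 2 by exact: sqr_ge0.
  by rewrite sqrrB1 sq2 mulr2n; lra.
(* Independent increments of scales 1 and [dl] add up in law to one of scale [sqrt (1 + dl^2)]. *)
have stab := avg_gvec_stable iid_e std_e c ltr01 dl0 sq0 _ (@test_fun_s R J beta phi phi0).
have {}stab : avg P (fun w j => 1 * Y w j)%R (avg P (fun w j => dl * Y w j)%R (test_s beta phi)) =
   avg P (fun w j => sq * Y w j)%R (test_s beta phi) by apply: stab; rewrite sq2 expr1n.
have low : ((Es + dl ^+ 2 / 2 * (phi * Ew))%:E <=
    avg P (fun w j => 1 * Y w j)%R (avg P (fun w j => dl * Y w j)%R (test_s beta phi)) x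
     + (dl ^+ 3 * K)%:E)%E.
  have i2 : integrableR P (fun w => dl ^+ 2 / 2 * (phi * ww (XY w))).
    by apply: integrableRZ; exact: integrableRZ.
  have -> : Es + dl ^+ 2 / 2 * (phi * Ew) =
      expect P (fun w => s (XY w) + dl ^+ 2 / 2 * (phi * ww (XY w))).
    by rewrite (expectD is_ i2) (expectZ _ (integrableRZ phi iw)) (expectZ _ iw).
  rewrite -(expectE (integrableRD is_ i2)).
  have -> : (dl ^+ 3 * K)%:E = (\int[P]_w cst (dl ^+ 3 * K)%:E w)%E.
    by rewrite integral_cst//= probability_setT mule1.
  have hts := test_fun_avg P ml (@test_fun_s R J beta phi phi0).
  rewrite /avg -ge0_integralD//; last 3 first.
  - by move=> w _; exact: hts.2.
  - exact: (measurable_translate x hts.1 m1).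
  - by move=> w _; rewrite lee_fin mulr_ge0// exprn_ge0// ltW.
  apply: ge0_le_integral => //.
  - move=> w _; rewrite lee_fin addr_ge0 ?softplus_ge0// mulr_ge0 ?divr_ge0 ?sqr_ge0//.
    by rewrite mulr_ge0 ?ltW// logistic_w_gt0.
  - by apply/measurable_EFinP; apply: integrableR_measurable (integrableRD is_ i2).
  - by apply: emeasurable_funD => //; exact: (measurable_translate x hts.1 m1).
  - move=> w _ /=; rewrite -/(XY w) (expectE (iy (XY w))) -EFinD lee_fin.
    exact: step.
have up : (avg P (fun w j => sq * Y w j)%R (test_s beta phi) x <=
    (Es + dl ^+ 2 / 2 * kappa)%:E)%E.
  have i3 := integrableRZ (dl ^+ 2 / 2) iM.
  apply: (@le_trans _ _ (expect P (fun w => s (XY w) + dl ^+ 2 / 2 * Mx w))%:E); last first.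
    rewrite lee_fin (expectD is_ i3) (expectZ _ iM) lerD2l ler_wpM2l//.
    by rewrite divr_ge0// sqr_ge0.
  rewrite -(expectE (integrableRD is_ i3)).
  have msq : coords_measurable (fun w j => sq * Y w j) by exact: coords_measurable_gvec.
  apply: ge0_le_integral => //.
  - by move=> w _; exact: (test_fun_s beta phi0).2.
  - exact: (measurable_translate x (test_fun_s beta phi0).1 msq).
  - by apply/measurable_EFinP; apply: integrableR_measurable (integrableRD is_ i3).
  move=> w _; rewrite lee_fin; apply: softplus_lipschitz.
    by rewrite mulr_ge0// divr_ge0// sqr_ge0.
  (* The dilated vector differs from [XY] by [(sq - 1) * Y], in every coordinate at most
     [dl^2 / 2 * Mx]. *)
  have -> : (fun j => x j + sq * Y w j) = (fun j => XY w j + (sq - 1) * Y w j).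
    by apply/funext => j; rewrite /XY; ring.
  apply: softmax_shift => // j; rewrite normrM ger0_norm ?subr_ge0//.
  by apply: ler_pM; rewrite ?subr_ge0.
rewrite stab in low.
have := le_trans low (leeD2r _ up); rewrite -EFinD lee_fin => H.
have {}H : dl ^+ 2 / 2 * (phi * Ew - kappa) <= dl ^+ 2 / 2 * (2 * dl * K).
  have -> : dl ^+ 2 / 2 * (2 * dl * K) = dl ^+ 3 * K by field.
  by rewrite mulrBr; lra.
have p2 : 0 < dl ^+ 2 / 2 by rewrite divr_gt0// exprn_gt0.
rewrite ler_pM2l// in H; apply: le_trans H _.
by rewrite /dl le_eqVlt; apply/orP; left; apply/eqP; ring.
Qed.

End Nazarov.

(** * Replacement of increments *)

Section Lindeberg.
Context {R : realType} {J : finType} (j0 : J).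
Variables (beta phi : R).
Hypotheses (phi0 : 0 < phi) (phib : phi <= beta).
Context {dA : measure_display} {TA : measurableType dA} (PA : probability TA R).
Context {dB : measure_display} {TB : measurableType dB} (PB : probability TB R).
Variables (xA : TA -> J -> R) (xB : TB -> J -> R) (GA GB : J -> J -> R) (MA MB Delta V : R).
Hypotheses (hA : third_order PA beta xA GA MA) (hB : third_order PB beta xB GB MB).
Hypotheses (GAB : forall j k, `|GA j k - GB j k| <= Delta)
  (GBV : forall j k, `|GB j k| <= V).

(** Half of the bound [hess_coef_le] for the difference of covariances, plus the two Taylor
    remainders. *)
Definition swap_error : R :=
  3 / 2 * beta * phi * Delta + 17 * phi * beta ^+ 2 * (MA + MB).

Hypothesis smallB : 3 / 2 * beta * phi * V + 17 * phi * beta ^+ 2 * MB <= 2^-1.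

Local Notation A := (avg PA xA).
Local Notation B := (avg PB xB).
Local Notation g := (@test_g R J beta phi).
Local Notation w := (@test_w R J beta phi).

Let phi0b : 0 <= phi <= beta.
Proof. by rewrite ltW. Qed.
Let beta0 : 0 < beta := lt_le_trans phi0 phib.
Let mA := to_meas hA.
Let mB := to_meas hB.
Let w0 (x : J -> R) : 0 <= logistic_w phi (softmax beta x).
Proof. exact/ltW/logistic_w_gt0. Qed.

Let D0 : 0 <= Delta := le_trans (normr_ge0 _) (GAB j0 j0).
Let V0 : 0 <= V := le_trans (normr_ge0 _) (GBV j0 j0).

Let M_ge0 d (T : measurableType d) (P : probability T R) (xi : T -> J -> R) G M :
  third_order P beta xi G M -> 0 <= M.
Proof.
move=> [_ _ _ _ _ [D hD]]; have [i le d'] := hD j0; apply: le_trans le.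
apply: expect_ge0 => t; apply: le_trans (d' j0 t).
by rewrite mulr_ge0 ?exprn_ge0 ?expR_ge0.
Qed.

Lemma swap_error_ge0 : 0 <= swap_error.
Proof.
have a0 := M_ge0 hA; have b0 := M_ge0 hB; have p0 := ltW phi0; have be0 := ltW beta0.
apply: addr_ge0; first by rewrite mulr_ge0// mulr_ge0// mulr_ge0// divr_ge0.
by rewrite mulr_ge0 ?addr_ge0// mulr_ge0 ?sqr_ge0// mulr_ge0.
Qed.

(** Both averages have the same value of order zero at [x], so only the covariance gap and the
    third-order remainders survive, all proportional to the weight at [x]. *)
Let swap f f1 f2 f3 x : controlled phi f f1 f2 f3 ->
  (A (fun y => (f (softmax beta y))%:E) x <= B (fun y => (f (softmax beta y))%:E) x
    + swap_error%:E * w x)%E.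
Proof.
move=> cf.
have [iA eA] := expect_controlled j0 phi0 phib hA x cf.
have [iB eB] := expect_controlled j0 phi0 phib hB x cf.
rewrite /avg (expectE iA) (expectE iB) /test_w -EFinM -EFinD lee_fin.
have [_ [b1 b2 b3]] := cf.
have hc := @hess_coef_le _ _ beta j0 phi f1 f2 (logistic_w phi) beta0 phi0b
  (fun u => ltW (logistic_w_gt0 phi u)) b1 b2 x (fun j k => GA j k - GB j k) Delta GAB.
set SA := \sum_j \sum_k _ in eA; set SB := \sum_j \sum_k _ in eB.
have E : \sum_j \sum_k hess_coef beta f1 f2 x j k * (GA j k - GB j k) = SA - SB.
  rewrite /SA /SB -sumrB; apply: eq_bigr => j _; rewrite -sumrB.
  by apply: eq_bigr => k _; rewrite mulrBr.
rewrite E in hc; move: eA eB hc; rewrite !ler_norml.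
set W := logistic_w _ _ => /andP[_ h1] /andP[h2 _] /andP[_ h3].
have -> : swap_error * W = 2^-1 * (3 * beta * phi * W * Delta) +
   17 * phi * beta ^+ 2 * MA * W + 17 * phi * beta ^+ 2 * MB * W.
  by rewrite /swap_error; field.
by lra.
Qed.

Let swap_g x : (A g x <= B g x + swap_error%:E * w x)%E.
Proof. exact: swap (controlled_logistic phi0). Qed.

Let swap_w x : (A w x <= B w x + swap_error%:E * w x)%E.
Proof. exact: swap (controlled_logistic_w phi0). Qed.

(** By [smallB] a Gaussian step decreases the weight by at most one half. An error at [x] thus
    becomes an error after one more Gaussian step, which is the form that can be iterated. *)
Let B_w x : (w x <= 2%:E * B w x)%E.
Proof.
have cf := controlled_logistic_w phi0.
have [iB eB] := expect_controlled j0 phi0 phib hB x cf.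
rewrite /avg /test_w (expectE iB) -EFinM lee_fin.
have [_ [b1 b2 b3]] := cf.
have hc := @hess_coef_le _ _ beta j0 phi _ _ (logistic_w phi) beta0 phi0b
  (fun u => ltW (logistic_w_gt0 phi u)) b1 b2 x GB V GBV.
set S := \sum_j \sum_k _ in eB hc.
move: eB hc; rewrite !ler_norml.
set W := logistic_w phi (softmax beta x) => /andP[h2 _] /andP[h3 _].
have W0 : 0 <= W by exact: w0.
have := ler_wpM2r W0 smallB.
have -> : (3 / 2 * beta * phi * V + 17 * phi * beta ^+ 2 * MB) * W =
  2^-1 * (3 * beta * phi * W * V) + 17 * phi * beta ^+ 2 * MB * W by field.
by lra.
Qed.

Let tg : test_fun g := @test_fun_g R J beta phi.
Let tw : test_fun w := @test_fun_w R J beta phi.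
Let a := 1 + 2 * swap_error.
Let a1 : 1 <= a.
Proof. by rewrite lerDl mulr_ge0// swap_error_ge0. Qed.
Let a0 : 0 <= a := le_trans ler01 a1.

Let A_iterB k u : test_fun u -> A (iter k B u) = iter k B (A u).
Proof.
move=> hu; elim: k => //= k <-.
by apply: avg_comm => //; exact: test_fun_iter.
Qed.

Let tB k u : test_fun u -> test_fun (iter k B u).
Proof. exact: test_fun_iter. Qed.

Let le_iterB k u v : test_fun u -> test_fun v -> (forall x, u x <= v x)%E ->
  forall x, (iter k B u x <= iter k B v x)%E.
Proof.
by move=> hu hv uv; elim: k => //= k IH; apply: le_avg => //; exact: tB.
Qed.

Let iterBZ k (c : R) u : 0 <= c -> test_fun u ->
  iter k B (fun x => c%:E * u x)%E = (fun x => c%:E * iter k B u x)%E.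
Proof.
move=> c0 hu; elim: k => //= k ->; apply/funext => x.
by rewrite avgZ//; exact: tB.
Qed.

Let iterBD k u v : test_fun u -> test_fun v ->
  iter k B (fun x => u x + v x)%E = (fun x => iter k B u x + iter k B v x)%E.
Proof.
move=> hu hv; elim: k => //= k ->; apply/funext => x.
by rewrite avgD//; exact: tB.
Qed.

Let A_w x : (A w x <= a%:E * B w x)%E.
Proof.
apply: le_trans (swap_w x) _.
have tBw := tB 1 tw.
have s2 : 0 <= 2 * swap_error by rewrite mulr_ge0// swap_error_ge0.
have -> : (a%:E * B w x = B w x + (2 * swap_error)%:E * B w x)%E.
  by rewrite /a EFinD ge0_muleDl ?lee_fin// mul1e.
apply: leeD => //; rewrite EFinM -muleA muleCA; apply: lee_wpmul2l (B_w x).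
by rewrite lee_fin swap_error_ge0.
Qed.

(** Each exchange of a data step for a Gaussian step costs a factor [a]; commutation lets the
    remaining data step act directly on the weight. *)
Let iterA_w k x : (iter k A w x <= (a ^+ k)%:E * iter k B w x)%E.
Proof.
elim: k x => [|k IH] x; first by rewrite /= expr0 mul1e.
have tk := tB k tw; have ak : 0 <= a ^+ k by rewrite exprn_ge0.
rewrite iterS; apply: le_trans (le_avg PA mA (test_fun_iter PA mA k tw)
  (test_funZ ak tk) IH x) _.
rewrite avgZ// A_iterB// exprSr EFinM -muleA; apply: lee_wpmul2l; first by rewrite lee_fin.
apply: le_trans (le_iterB k (test_fun_avg PA mA tw) (test_funZ a0 (tB 1 tw)) A_w x) _.
by rewrite iterBZ//; last exact: (tB 1 tw); rewrite -iterSr.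
Qed.

(** The coefficients satisfy [(a^k - 1) a + (a - 1) = a^(k+1) - 1], so the errors of the single
    steps accumulate geometrically. *)
Let iterA_g k x : (iter k A g x <= iter k B g x + (a ^+ k - 1)%:E * iter k B w x)%E.
Proof.
elim: k x => [|k IH] x; first by rewrite /= expr0 subrr mul0e adde0.
have tgk := tB k tg; have twk := tB k tw.
have ak : 0 <= a ^+ k - 1 by rewrite subr_ge0 exprn_ege1.
rewrite iterS; apply: le_trans (le_avg PA mA (test_fun_iter PA mA k tg)
  (test_funD tgk (test_funZ ak twk)) IH x) _.
rewrite avgD//; last exact: test_funZ.
rewrite avgZ// !A_iterB//.
have tBg := tB 1 tg; have tBw := tB 1 tw.
have s2 : 0 <= 2 * swap_error by rewrite mulr_ge0// swap_error_ge0.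
have hg y : (A g y <= B g y + (2 * swap_error)%:E * B w y)%E.
  apply: le_trans (swap_g y) _; apply: leeD => //.
  rewrite EFinM -muleA muleCA; apply: lee_wpmul2l (B_w y).
  by rewrite lee_fin swap_error_ge0.
have h1 := le_iterB k (test_fun_avg PA mA tg) (test_funD tBg (test_funZ s2 tBw)) hg x.
have h2 := le_iterB k (test_fun_avg PA mA tw) (test_funZ a0 tBw) A_w x.
rewrite iterBD// ?iterBZ// in h1; last exact: test_funZ.
rewrite iterBZ// in h2.
rewrite -!iterSr in h1 h2.
apply: le_trans (leeD h1 (lee_wpmul2l _ h2)) _; first by rewrite lee_fin.
have p0 := (tB k.+1 tw).2 x.
rewrite -addeA; apply: leeD => //; rewrite muleA -EFinM -ge0_muleDl ?lee_fin//.
  by rewrite -EFinD lee_wpmul2r// lee_fin exprSr /a le_eqVlt; apply/orP; left; apply/eqP; ring.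
by rewrite mulr_ge0.
Qed.

(** The coefficient of the weight is [(a^k - 1) + 2 a^k], where the 2 is the price of dominating an
    indicator. *)
Theorem lindeberg k (C : R) x : (1 + 2 * swap_error) ^+ k <= C ->
  (iter k A (fun y => g y + 2%:E * w y) x <= iter k B g x + (3 * C)%:E * iter k B w x)%E.
Proof.
move=> aC.
have t2w : test_fun (fun y => 2%:E * w y)%E by exact: test_funZ.
have -> : iter k A (fun y => g y + 2%:E * w y)%E x =
    (iter k A g x + 2%:E * iter k A w x)%E.
  elim: k x {aC} => //= k IH x.
  have -> : iter k A (fun y => g y + 2%:E * w y)%E =
    (fun y => iter k A g y + 2%:E * iter k A w y)%E by apply/funext.
  rewrite avgD//; [|exact: test_fun_iter|apply: test_funZ => //; exact: test_fun_iter].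
  by rewrite avgZ//; exact: test_fun_iter.
apply: le_trans (leeD (iterA_g k x) (lee_wpmul2l _ (iterA_w k x))) _; first by rewrite lee_fin.
have p0 := (tB k tw).2 x.
have ak : 1 <= a ^+ k by rewrite exprn_ege1.
rewrite -addeA; apply: leeD => //; rewrite muleA -EFinM -ge0_muleDl ?lee_fin ?subr_ge0//.
  by rewrite -EFinD lee_wpmul2r// lee_fin; rewrite -/a in aC; lra.
by rewrite mulr_ge0// exprn_ge0.
Qed.

End Lindeberg.

(** * Tail comparison with a Gaussian vector *)

Section TailComparison.
Context {R : realType} {d : measure_display} {T : measurableType d} (P : probability T R).
Context {n' : nat}.
Let n := n'.+1.
Variable e : 'I_n -> {RV P >-> R}.
Hypothesis iid_e : iid e.
Hypothesis std_e : forall i, standard_normal (e i).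
Context {d1 : measure_display} {T1 : measurableType d1}.
Variables (U : 'I_n -> {RV P >-> T1}) (i1 : 'I_n).
Hypothesis iid_U : iid U.
Context {J : finType} (j0 : J).
Variable xi : T1 -> J -> R.
Hypothesis mxi : coords_measurable xi.
Variable c : 'I_n -> J -> R.
Hypothesis unit_c : forall j, \sum_(i < n) c i j ^+ 2 = 1.
Variables (phi L : R).
Hypotheses (phi0 : 0 < phi) (L1 : 1 <= L) (JL : #|J|%:R <= expR L).
(** With this exponent the soft-max bias [ln |J| / beta] is at most [phi^-1]. *)
Let beta := L * phi.
Variables (GA : J -> J -> R) (MA Delta : R).
Hypothesis hA : third_order P beta (fun w => xi (U i1 w)) GA MA.
Let s := (Num.sqrt n%:R : R)^-1.
Hypothesis GAB : forall j k, `|GA j k - s ^+ 2 * gcov c j k| <= Delta.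
Hypothesis small_step : (6 + L) * (beta * s) <= 1.
Hypothesis smallB : 3 / 2 * beta * phi * s ^+ 2 + 17 * phi * beta ^+ 2 * (s ^+ 3 * gauss3) <= 2^-1.
Hypothesis smallAB : n%:R * swap_error beta phi MA (s ^+ 3 * gauss3) Delta <= 1.

Local Notation Y := (gvec e c).

Let n0 : 0 < n%:R :> R. Proof. by rewrite ltr0n. Qed.
Let s0 : 0 < s. Proof. by rewrite invr_gt0 sqrtr_gt0. Qed.
Let phib : phi <= beta. Proof. by rewrite /beta ler_peMl// ltW. Qed.
Let beta0 : 0 < beta := lt_le_trans phi0 phib.

Let avg_same i u : test_fun u ->
  avg P (fun w => xi (U i w)) u = avg P (fun w => xi (U i1 w)) u.
Proof.
move=> hu; apply/funext => x.
pose f (y : T1) := u (fun j => x j + xi y j).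
have mf : measurable_fun setT f by exact: (measurable_translate x hu.1 mxi).
have f0 y : (0 <= f y)%E by exact: hu.2.
transitivity (\int[distribution P (U i)]_y f y)%E.
  by rewrite (ge0_integral_distribution (U i) mf f0).
transitivity (\int[distribution P (U i1)]_y f y)%E.
  by apply: eq_measure_integral => A mA _; exact: iid_U.2.
by rewrite (ge0_integral_distribution (U i1) mf f0).
Qed.

Let sum_iter (u : (J -> R) -> \bar R) (x : J -> R) : test_fun u ->
  (\int[P]_w u (fun j => x j + \sum_i xi (U i w) j)%R)%E =
  iter n (avg P (fun w => xi (U i1 w))) u x.
Proof.
move=> hu.
have := @avg_independent_sum R _ _ P _ _ _ U iid_U.1 J (fun=> xi) (index_enum 'I_n) u x
  (fun=> mxi) (index_enum_uniq _) hu.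
have E : size (index_enum 'I_n) = n by rewrite -sum1_size sum1_card card_ord.
move=> ->; rewrite -[in RHS]E.
have mU : coords_measurable (fun w => xi (U i1 w)).
  by move=> j; apply: measurableT_comp (mxi j) _; exact: measurable_funPT.
elim: (index_enum 'I_n) x => //= i r IH x.
have -> : foldr (fun k v => avg P (fun w => xi (U k w)) v) u r =
  iter (size r) (avg P (fun w => xi (U i1 w))) u by apply/funext.
by rewrite avg_same//; exact: test_fun_iter.
Qed.

(** [3 * expR 2] comes from the replacement, [1 + expR 2] from the return to an indicator, and the
    factor 4 from [nazarov]. *)
Definition tail_const : R := (1 + 4 * expR 2) * 4.

Let F := @softmax R J beta.

Lemma measurable_exists (v : T -> J -> R) (t : R) : coords_measurable v ->
  measurable [set w | exists j, t < v w j].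
Proof.
move=> mv; have -> : [set w | exists j, t < v w j] =
    \bigcup_(j in [set: J]) [set w | t < v w j].
  by apply/seteqP; split => [w [j h]|w [j _ h]]; exists j.
apply: fin_bigcup_measurable => [|j _]; first exact: finite_finset.
rewrite -[X in measurable X]setTI.
have -> : [set w | t < v w j] = (fun w => v w j) @^-1` [set` `]t, +oo[%R].
  by apply/seteqP; split => w /=; rewrite in_itv/= andbT.
exact: mv.
Qed.

(** On the data side the threshold is sharp, since [softmax] dominates the maximum and
    [indicator_le_logistic] needs no shift. On the Gaussian side, if no coordinate exceeds [phi^-1]
    then [softmax] is at most [2 / phi], where [logistic] is at most [1 + expR 2] times the
    weight. *)
Theorem tail_comparison (x : J -> R) :
  (P [set w | exists j, (0 < x j + \sum_i xi (U i w) j)%R] <=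
   P [set w | exists j, (phi^-1 < x j + Y w j)%R] + (tail_const * (Num.sqrt L / phi))%:E)%E.
Proof.
have mS : coords_measurable (fun w j => x j + \sum_i xi (U i w) j).
  move=> j; apply: measurable_funD => //; apply: measurable_sum => i.
  by apply: measurableT_comp (mxi j) _; exact: measurable_funPT.
have mY : coords_measurable (fun w j => x j + Y w j).
  by move=> j; apply: measurable_funD => //; exact: measurable_gvec.
have m1Y : coords_measurable (fun w j => 1 * Y w j) by exact: coords_measurable_gvec.
have tg := @test_fun_g R J beta phi; have tw := @test_fun_w R J beta phi.
have tgw := test_funD tg (test_funZ (ler0n R 2) tw).
have lnJ : beta^-1 * ln #|J|%:R <= phi^-1.
  have J0 : 0 < #|J|%:R :> R by rewrite ltr0n; apply/card_gt0P; exists j0.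
  rewrite mulrC ler_pdivrMr// /beta mulrC -mulrA divff ?gt_eqF// mulr1.
  by rewrite -[leRHS]expRK ler_ln ?posrE ?expR_gt0.
have step1 : (P [set w | exists j, (0 < x j + \sum_i xi (U i w) j)%R] <=
    \int[P]_w (test_g beta phi (fun j => x j + \sum_i xi (U i w) j)%R +
      2%:E * test_w beta phi (fun j => x j + \sum_i xi (U i w) j)%R))%E.
  have mE := measurable_exists 0 mS.
  have := @integral_indic _ T R P setT measurableT _ mE; rewrite setIT => <-.
  apply: ge0_le_integral => //.
  - by apply/measurable_EFinP; exact: measurable_indic.
  - exact: tgw.1.
  move=> w _; rewrite /test_g /test_w -EFinM -EFinD lee_fin indicE.
  set u := softmax _ _.
  have g0 := ltW (logistic_gt0 phi u); have w0 := ltW (logistic_w_gt0 phi u).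
  case: (boolP (w \in _)) => [|_]; last by apply: addr_ge0 => //; exact: mulr_ge0.
  rewrite inE => -[j hj]; apply: indicator_le_logistic => //.
  exact: lt_le_trans hj (softmax_ge j0 beta0 _ j).
apply: le_trans step1 _; rewrite (sum_iter x tgw).
have to := gvec_third_order iid_e std_e unit_c s0 (ltW beta0) small_step JL.
have GV j k : `|s ^+ 2 * gcov c j k| <= s ^+ 2.
  rewrite normrM ger0_norm ?sqr_ge0// -[leRHS]mulr1 ler_wpM2l ?sqr_ge0//.
  exact: gcov_le1.
have se0 := swap_error_ge0 j0 phi0 phib hA to GAB.
(* The total replacement cost is at most 1 by [smallAB], which bounds the accumulated factor by
   [expR 2]. *)
have pw : (1 + 2 * swap_error beta phi MA (s ^+ 3 * gauss3) Delta) ^+ n <= expR 2.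
  have sAB := smallAB; set se := swap_error _ _ _ _ _ in se0 sAB *.
  apply: (@le_trans _ _ (expR (2 * se) ^+ n)).
    by rewrite lerXn2r ?nnegrE ?expR_ge0 ?addr_ge0 ?mulr_ge0// expR_ge1Dx.
  rewrite -expRM_natl ler_expR mulrCA -[leRHS]mulr1 ler_wpM2l//.
apply: le_trans (lindeberg j0 phi0 phib hA to GAB GV smallB x pw) _.
rewrite (iter_avg_gvec iid_e std_e c n' s0 tg) (iter_avg_gvec iid_e std_e c n' s0 tw).
have sn : Num.sqrt n%:R * s = 1 by rewrite /s divff// gt_eqF// sqrtr_gt0.
rewrite -/n sn.
have naz := nazarov iid_e std_e j0 unit_c phi0 phib L1 JL x.
have step2 : (avg P (fun w j => 1 * Y w j)%R (test_g beta phi) x <=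
    P [set w | exists j, (phi^-1 < x j + Y w j)%R] +
    (1 + expR 2)%:E * avg P (fun w j => 1 * Y w j)%R (test_w beta phi) x)%E.
  have mE := measurable_exists phi^-1 mY.
  have := @integral_indic _ T R P setT measurableT _ mE; rewrite setIT => <-.
  have c0 : 0 <= 1 + expR 2 :> R by rewrite addr_ge0 ?expR_ge0.
  have tw2 := test_funZ c0 tw.
  rewrite -(avgZ P m1Y x c0 tw).
  rewrite /avg -ge0_integralD//; last 3 first.
  - by apply/measurable_EFinP; exact: measurable_indic.
  - by move=> w _; exact: tw2.2.
  - exact: (measurable_translate x tw2.1 m1Y).
  apply: ge0_le_integral => //.
  - by move=> w _; exact: tg.2.
  - exact: (measurable_translate x tg.1 m1Y).
  - apply: emeasurable_funD; last exact: (measurable_translate x tw2.1 m1Y).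
    by apply/measurable_EFinP; exact: measurable_indic.
  move=> w _; rewrite /test_g /test_w -EFinM -EFinD lee_fin indicE.
  set u := softmax _ _.
  have w0 := ltW (logistic_w_gt0 phi u).
  case: (boolP (w \in _)) => [_|].
    apply: (@le_trans _ _ 1); first exact/ltW/logistic_lt1.
    by rewrite lerDl mulr_ge0// addr_ge0 ?expR_ge0.
  rewrite notin_setE => hn; rewrite [X in X + _]mulr0n add0r.
  have -> : expR 2 = expR (phi * (2 / phi)) by congr expR; field; rewrite gt_eqF.
  apply: logistic_le_indicator => //.
  have : u <= phi^-1 + beta^-1 * ln #|J|%:R.
    apply: softmax_le => // j; rewrite mul1r leNgt; apply/negP => hj; apply: hn.
    by exists j.
  by move=> /le_trans; apply; rewrite (_ : 2 / phi = phi^-1 + phi^-1) ?lerD2l//; ring.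
apply: le_trans (leeD step2 (lexx _)) _.
rewrite -addeA; apply: leeD => //.
have aw0 : (0 <= avg P (fun w j => 1 * Y w j)%R (test_w beta phi) x)%E.
  exact: (test_fun_avg P m1Y tw).2.
rewrite -ge0_muleDl ?lee_fin ?addr_ge0 ?mulr_ge0 ?expR_ge0// -EFinD.
apply: le_trans (lee_wpmul2l _ naz) _.
  by rewrite lee_fin !addr_ge0 ?mulr_ge0 ?expR_ge0.
rewrite -EFinM lee_fin /tail_const le_eqVlt; apply/orP; left; apply/eqP.
by field; rewrite gt_eqF.
Qed.

End TailComparison.

(** * Deterministic bounds for thresholding *)

Section SpectralNorm.
Context {R : realType} {p : nat}.
Implicit Types (E : 'M[R]_p).

Lemma euclidean_norm_ge0 (x : 'cV[R]_p) : 0 <= euclidean_norm x.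
Proof. exact: sqrtr_ge0. Qed.

Lemma euclidean_norm_sqr (x : 'cV[R]_p) : euclidean_norm x ^+ 2 = \sum_k x k 0 ^+ 2.
Proof. by rewrite sqr_sqrtr// sumr_ge0// => k _; exact: sqr_ge0. Qed.

(* Schur test *)
Lemma mulmx_norm_le E (L : R) (x : 'cV[R]_p) : 0 <= L ->
  (forall m, \sum_k `|E m k| <= L) -> (forall k, \sum_m `|E m k| <= L) ->
  euclidean_norm (E *m x) <= L * euclidean_norm x.
Proof.
move=> L0 rows cols.
rewrite -(@ler_pXn2r _ 2) ?nnegrE ?mulr_ge0 ?euclidean_norm_ge0//.
rewrite exprMn !euclidean_norm_sqr.
apply: (@le_trans _ _ (\sum_m (L * \sum_k `|E m k| * x k 0 ^+ 2))).
  apply: ler_sum => m _; rewrite mxE.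
  pose S := \sum_k `|E m k|; pose Q := \sum_k `|E m k| * x k 0 ^+ 2.
  have S0 : 0 <= S by apply: sumr_ge0.
  have Q0 : 0 <= Q by apply: sumr_ge0 => k _; rewrite mulr_ge0 ?sqr_ge0.
  apply: (@le_trans _ _ (S * Q)); last by apply: ler_wpM2r => //; exact: rows.
  pose t := \sum_k `|E m k| * `|x k 0|.
  have ht : (\sum_j E m j * x j 0) ^+ 2 <= t ^+ 2.
    rewrite -real_normK ?num_real// lerXn2r ?nnegrE ?normr_ge0//.
      by apply: sumr_ge0 => k _; rewrite mulr_ge0.
    by apply: le_trans (ler_norm_sum _ _ _) _; apply: ler_sum => k _; rewrite normrM.
  apply: le_trans ht _.
  (* Cauchy-Schwarz: this quadratic in [l] is nonnegative and is evaluated at its minimiser [t / S];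
     the case [S = 0] is separate. *)
  have key (l : R) : 0 <= l ^+ 2 * S - 2 * l * t + Q.
    have -> : l ^+ 2 * S - 2 * l * t + Q = \sum_k `|E m k| * (l - `|x k 0|) ^+ 2.
      rewrite /S /t /Q !mulr_sumr -sumrB -big_split/=; apply: eq_bigr => k _.
      by rewrite -[in X in _ + X](real_normK (num_real (x k 0))); ring.
    by apply: sumr_ge0 => k _; rewrite mulr_ge0 ?sqr_ge0.
  have [S00|Sn] := eqVneq S 0.
    have -> : t = 0; last by rewrite expr0n/= S00 mul0r.
    rewrite /t big1// => k _; have : `|E m k| = 0; last by move=> ->; rewrite mul0r.
    apply/eqP; rewrite eq_le normr_ge0 andbT -S00 /S (bigD1 k)//= lerDl.
    exact: sumr_ge0.
  have Sp : 0 < S by rewrite lt0r Sn.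
  have := key (t / S).
  have -> : (t / S) ^+ 2 * S - 2 * (t / S) * t + Q = Q - t ^+ 2 / S by field.
  by rewrite subr_ge0 ler_pdivrMr// mulrC.
rewrite -mulr_sumr expr2 -mulrA ler_wpM2l// exchange_big/= mulr_sumr.
by apply: ler_sum => k _; rewrite -mulr_suml ler_wpM2r ?sqr_ge0.
Qed.

Lemma spectral_norm_le E (L : R) : 0 <= L ->
  (forall m, \sum_k `|E m k| <= L) -> (forall k, \sum_m `|E m k| <= L) ->
  spectral_norm E <= L.
Proof.
move=> L0 rows cols; apply: ge_sup.
  exists (euclidean_norm (E *m 0)); exists 0 => //=.
  by rewrite /euclidean_norm big1 ?sqrtr0// => k _; rewrite mxE expr0n.
move=> _ [x /= x1 <-]; apply: le_trans (mulmx_norm_le _ L0 rows cols) _.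
by rewrite -[leRHS]mulr1 ler_wpM2l.
Qed.

End SpectralNorm.

Section Thresholding.
Context {R : realType} {p : nat}.
Variables (S A : 'M[R]_p) (r zeta beta a : R).
Hypotheses (r01 : 0 <= r < 1) (beta01 : 0 < beta < 1) (a0 : 0 <= a).
Hypothesis hS : S \in sparse_class r zeta.
Hypothesis symA : A^T = A.
Hypothesis close : forall m k, `|A m k - S m k| <= a.

Let b0 : 0 < beta. Proof. by case/andP: beta01. Qed.
Let b1 : 0 < 1 - beta. Proof. by case/andP: beta01; rewrite subr_gt0. Qed.
Let r0 : 0 <= r. Proof. by case/andP: r01. Qed.
Let r1 : 0 < 1 - r. Proof. by case/andP: r01; rewrite subr_gt0. Qed.
Let tau := beta^-1 * a.
Let E := threshold tau A - S.
Let q := (beta / (1 - beta)) `^ r.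

Let row_sparse m : \sum_(k | S m k != 0) `|S m k| `^ r <= zeta.
Proof.
move/set_mem: hS => [_ h]; apply: le_trans h.
exact: (@le_bigmax_cond _ _ _ 0 m xpredT (fun m => \sum_(k | S m k != 0) `|S m k| `^ r)).
Qed.

Let symE : E^T = E.
Proof.
have symS : S^T = S by move/set_mem: hS => [[]].
apply/matrixP => i j; rewrite !mxE.
have -> : A j i = A i j by rewrite -[in LHS]symA mxE.
by have -> : S j i = S i j by rewrite -[in LHS]symS mxE.
Qed.

Let split_powR (x s : R) : 0 <= x -> 0 < s - r -> x `^ s = x `^ (s - r) * x `^ r.
Proof.
move=> x0 sr.
have sn : (s == 0) = false by rewrite gt_eqF//; move: sr r0; lra.
by rewrite -powRD subrK ?sn.
Qed.

(* Entries surviving the threshold are at least [(1 - beta) tau] in the target,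
   those killed are at most [(1 + beta) tau]. *)
Let entry_bound m k (s : R) : r < s ->
  (S m k = 0 -> E m k = 0) /\
  `|E m k| `^ s <= (q + ((1 + beta) / beta) `^ (s - r)) * a `^ (s - r) * `|S m k| `^ r.
Proof.
move=> rs; have sr : 0 < s - r by rewrite subr_gt0.
have s0 : 0 < s by exact: le_lt_trans r0 rs.
have Skp := powR_ge0 `|S m k| r; have ap := powR_ge0 a (s - r).
have q0 : 0 <= q by exact: powR_ge0.
have p2 : 0 <= ((1 + beta) / beta) `^ (s - r) by exact: powR_ge0.
(* For [a = 0] the threshold is 0 and [A = S] at this entry; the remaining argument relies on
   [tau > 0]. *)
have [az|an] := eqVneq a 0.
  have AS : A m k = S m k.
    by apply/eqP; rewrite -subr_eq0 -normr_le0; have := close m k; rewrite az.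
  have -> : E m k = 0.
    rewrite /E !mxE /tau az mulr0 AS; have [->|Sn] := eqVneq (S m k) 0.
      by rewrite normr0 ltxx subrr.
    by rewrite normr_gt0 Sn subrr.
  split=> //; rewrite normr0 powR0 ?gt_eqF//.
  by rewrite mulr_ge0// mulr_ge0// addr_ge0.
have ap0 : 0 < a by rewrite lt0r an.
have taup : 0 < tau by rewrite mulr_gt0// invr_gt0.
have atau : a = beta * tau by rewrite /tau mulVKf// gt_eqF.
have EE : E m k = (if tau < `|A m k| then A m k else 0) - S m k by rewrite /E !mxE.
split.
  move=> Sz; rewrite EE Sz subr0; case: ifP => // h.
  have := close m k; rewrite Sz subr0 => /(lt_le_trans h).
  have : a < tau by rewrite atau gtr_pMl//; case/andP: beta01.
  by move=> /lt_trans /[apply]; rewrite ltxx.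
rewrite EE; case: ifP => h.
  have h1 : (1 - beta) * tau <= `|S m k|.
    have := ler_normB (A m k) (A m k - S m k); rewrite subKr.
    have := ler_normD (A m k - S m k) (S m k); rewrite subrK.
    have := close m k; rewrite mulrBl mul1r -atau; lra.
  apply: (@le_trans _ _ (a `^ s)); first by apply: ge0_ler_powR => //; rewrite ?nnegrE// ltW.
  rewrite (split_powR a0 sr) mulrDl mulrDl -[leLHS]addr0; apply: lerD; last first.
    by rewrite !mulr_ge0.
  have -> : q * a `^ (s - r) * `|S m k| `^ r = a `^ (s - r) * (q * `|S m k| `^ r) by ring.
  rewrite ler_wpM2l//.
  (* [a] is [beta / (1 - beta)] times the least possible size [(1 - beta) * tau] of a target entry
     that survives, so the [r]-th power of [a] is at most [q] times that of the entry. *)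
  have -> : a = beta / (1 - beta) * ((1 - beta) * tau) by rewrite atau; field; rewrite gt_eqF.
  have t0 : 0 <= (1 - beta) * tau by rewrite mulr_ge0 ?(ltW b1) ?(ltW taup).
  have t1 : 0 <= beta / (1 - beta) by rewrite divr_ge0 ?(ltW b1) ?(ltW b0).
  rewrite (powRM _ t1 t0).
  have h2 : ((1 - beta) * tau) `^ r <= `|S m k| `^ r by apply: ge0_ler_powR; rewrite ?nnegrE.
  exact: ler_wpM2l q0 _ _ h2.
(* A killed entry leaves the error [- S m k], of size at most [tau + a]. *)
have Ak : `|A m k| <= tau by rewrite leNgt; exact: negbT h.
have h1 : `|S m k| <= (1 + beta) / beta * a.
  have -> : (1 + beta) / beta * a = tau + a by rewrite /tau; field; rewrite gt_eqF.
  by have := ler_normB (A m k) (A m k - S m k); rewrite subKr; have := close m k; lra.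
rewrite sub0r normrN (split_powR (normr_ge0 _) sr) ler_wpM2r//.
rewrite mulrDl -[leLHS]add0r; apply: lerD; first by rewrite mulr_ge0.
have t0 : 0 <= (1 + beta) / beta by rewrite divr_ge0 ?addr_ge0 ?(ltW b0).
rewrite -(powRM _ t0 a0).
by apply: ge0_ler_powR; rewrite ?nnegrE ?(ltW sr)// mulr_ge0.
Qed.

Let row_bound m (s : R) : r < s -> 0 < s ->
  \sum_k `|E m k| `^ s <= (q + ((1 + beta) / beta) `^ (s - r)) * zeta * a `^ (s - r).
Proof.
move=> rs s0.
set c := q + _; have c0 : 0 <= c by rewrite addr_ge0 ?powR_ge0.
rewrite (bigID (fun k => S m k != 0))/= [X in _ + X]big1 ?addr0; last first.
  move=> k; rewrite negbK => /eqP Sz; have [h _] := @entry_bound m k s rs.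
  by rewrite h// normr0 powR0// gt_eqF.
apply: (@le_trans _ _ (\sum_(k | S m k != 0) c * a `^ (s - r) * `|S m k| `^ r)).
  by apply: ler_sum => k _; case: (@entry_bound m k s rs).
by rewrite -mulr_sumr mulrAC ler_wpM2r ?powR_ge0// ler_wpM2l.
Qed.

Let rescale (s : R) : 0 <= s -> ((1 + beta) / beta) `^ s = (1 + beta) `^ s / beta `^ s.
Proof.
move=> s0; rewrite powRM ?invr_ge0 ?addr_ge0 ?(ltW b0)//.
by rewrite -[in LHS]powR_inv1 ?(ltW b0)// -powRrM mulN1r powRN.
Qed.

(** Row bound with exponent 1, where [(1 + beta)^(1 - r) <= 1 + beta <= 3 + 2 beta]; columns follow
    by symmetry of the error. *)
Theorem threshold_spectral : 0 <= zeta -> spectral_norm E <=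
  ((3 + 2 * beta) / beta `^ (1 - r) + q) * zeta * a `^ (1 - r).
Proof.
move=> z0; set L := (X in _ <= X).
have bp : 0 < beta `^ (1 - r) by exact: powR_gt0.
have L0 : 0 <= L.
  rewrite /L !mulr_ge0 ?powR_ge0// addr_ge0 ?powR_ge0// divr_ge0 ?powR_ge0//.
  by rewrite addr_ge0// mulr_ge0// ltW.
have rows m : \sum_k `|E m k| <= L.
  have r1' : r < 1 by case/andP: r01.
  have := @row_bound m 1 r1' ltr01.
  under eq_bigr do rewrite powRr1//.
  move/le_trans; apply; rewrite /L ler_wpM2r ?powR_ge0// ler_wpM2r//.
  rewrite addrC lerD2r rescale ?(ltW r1)// ler_wpM2r ?invr_ge0 ?powR_ge0//.
  apply: (@le_trans _ _ ((1 + beta) `^ 1)).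
    by apply: ler_powR; [rewrite lerDl ltW|move: r0; lra].
  by rewrite powRr1 ?addr_ge0 ?(ltW b0)//; have := b0; lra.
apply: spectral_norm_le => // k.
rewrite (eq_bigr (fun m => `|E k m|)) => [|m _]; first exact: rows.
by rewrite -[in LHS]symE mxE.
Qed.

(** Row bound with exponent 2, where [(1 + beta)^(2 - r) <= 4], averaged over the rows. *)
Theorem threshold_frobenius : 0 <= zeta -> p%:R^-1 * frobenius_norm E ^+ 2 <=
  2 * ((4 + 3 * beta ^+ 2) / beta `^ (2 - r) + 2 * q) * zeta * a `^ (2 - r).
Proof.
move=> z0; set L := (X in _ <= X).
have bp : 0 < beta `^ (2 - r) by exact: powR_gt0.
have L0 : 0 <= L.
  rewrite /L !mulr_ge0 ?powR_ge0// addr_ge0 ?mulr_ge0 ?invr_ge0 ?powR_ge0//.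
  by rewrite addr_ge0// mulr_ge0// sqr_ge0.
have rows m : \sum_k E m k ^+ 2 <= L.
  have r2 : r < 2 by case/andP: r01 => _ /lt_trans; apply; rewrite ltr1n.
  have := @row_bound m 2 r2 (ltr0n _ 2).
  have e2 k : `|E m k| `^ 2 = E m k ^+ 2 by rewrite powR_mulrn// real_normK ?num_real.
  under eq_bigr do rewrite e2.
  move/le_trans; apply; rewrite /L ler_wpM2r ?powR_ge0// ler_wpM2r//.
  have h : (1 + beta) `^ (2 - r) <= 4.
    apply: (@le_trans _ _ ((1 + beta) `^ 2%:R)).
      by apply: ler_powR; [rewrite lerDl ltW|rewrite gerBl].
    rewrite powR_mulrn ?addr_ge0 ?(ltW b0)//.
    have -> : 4 = 2 ^+ 2 :> R by ring.
    by rewrite lerXn2r ?nnegrE ?addr_ge0 ?(ltW b0)//; have := b1; lra.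
  have iv : 0 <= (beta `^ (2 - r))^-1 by rewrite invr_ge0 ltW.
  have h2 : (1 + beta) `^ (2 - r) / beta `^ (2 - r) <= (4 + 3 * beta ^+ 2) / beta `^ (2 - r).
    by rewrite ler_wpM2r// (le_trans h)// lerDl mulr_ge0// sqr_ge0.
  have q0 : 0 <= q by exact: powR_ge0.
  have h3 : 0 <= (4 + 3 * beta ^+ 2) / beta `^ (2 - r).
    by rewrite mulr_ge0// addr_ge0// mulr_ge0// sqr_ge0.
  rewrite rescale; last by move: r1; lra.
  by lra.
rewrite sqr_sqrtr; last by apply: sumr_ge0 => m _; apply: sumr_ge0 => k _; exact: sqr_ge0.
have [->|pn] := eqVneq (p%:R : R) 0; first by rewrite invr0 mul0r.
rewrite mulrC ler_pdivrMr ?lt0r ?pn ?ler0n//.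
apply: (@le_trans _ _ (\sum_(m < p) L)); first exact: ler_sum.
by rewrite sumr_const card_ord -[X in X <= _]mulr_natr.
Qed.

End Thresholding.

(** * Sample covariance and multiplier coefficients *)

Section SampleAlgebra.
Context {R : realType} {n p : nat}.
Hypothesis n2 : (2 <= n)%N.
Implicit Types (x : 'I_n -> 'cV[R]_p) (e : 'I_n -> R) (j k l m : 'I_p).

Definition emp_mean x j : R := n%:R^-1 * \sum_i x i j 0.
Definition emp_prod x j k : R := n%:R^-1 * \sum_i x i j 0 * x i k 0.
Definition centered x i j : R := x i j 0 - emp_mean x j.
Definition bessel : R := n%:R / n.-1%:R.
(** Twice the entry of the kernel average around [x i] minus the sample covariance, made explicit in
    terms of centred data; [boot_matrixE] shows the identity. *)
Definition boot_coef x i j k : R :=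
  bessel * (centered x i j * centered x i k) - sample_cov x j k.

Let n0 : n%:R != 0 :> R.
Proof. by rewrite pnatr_eq0 -lt0n (leq_trans _ n2). Qed.

Let n10 : n.-1%:R != 0 :> R.
Proof. by rewrite pnatr_eq0; case: n n2 => [|[]]. Qed.

Lemma sample_meanE x j : sample_mean x j 0 = emp_mean x j.
Proof. by rewrite /sample_mean !mxE summxE. Qed.

Lemma centeredE x i j : (x i - sample_mean x) j 0 = centered x i j.
Proof. by rewrite mxE [X in _ + X]mxE sample_meanE. Qed.

Lemma sum_centered x j : \sum_i centered x i j = 0.
Proof.
rewrite /centered sumrB sumr_const card_ord -[_ *+ n]mulr_natl /emp_mean mulrA divff// mul1r.
by rewrite subrr.
Qed.

Lemma outerE (u v : 'cV[R]_p) j k : (u *m v^T) j k = u j 0 * v k 0.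
Proof. by rewrite mxE big_ord1 mxE. Qed.

Lemma sample_cov_sum x j k :
  sample_cov x j k = n.-1%:R^-1 * \sum_i centered x i j * centered x i k.
Proof.
rewrite /sample_cov mxE summxE; congr (_ * _); apply: eq_bigr => i _.
by rewrite outerE !centeredE.
Qed.

Lemma sum_centered_prod x j k : \sum_i centered x i j * centered x i k =
  n%:R * (emp_prod x j k - emp_mean x j * emp_mean x k).
Proof.
transitivity (\sum_i (x i j 0 * x i k 0 - emp_mean x j * x i k 0 - centered x i j * emp_mean x k)).
  by apply: eq_bigr => i _; rewrite /centered; ring.
rewrite sumrB sumrB -mulr_suml sum_centered mul0r subr0 -mulr_sumr mulrBr.
by rewrite /emp_prod mulVKf// mulrCA [n%:R * _]mulVKf.
Qed.

Lemma sample_covE x j k :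
  sample_cov x j k = bessel * (emp_prod x j k - emp_mean x j * emp_mean x k).
Proof. by rewrite sample_cov_sum sum_centered_prod mulrA [_^-1 * _]mulrC. Qed.

Lemma sample_cov_sym x : (sample_cov x)^T = sample_cov x.
Proof.
apply/matrixP => j k; rewrite mxE !sample_cov_sum; congr (_ * _).
by apply: eq_bigr => i _; rewrite mulrC.
Qed.

Lemma sum_boot_coef x j k : \sum_i boot_coef x i j k = 0.
Proof.
rewrite /boot_coef sumrB -mulr_sumr sumr_const card_ord -[_ *+ n]mulr_natl sample_cov_sum.
by rewrite /bessel; field.
Qed.

Lemma boot_coef_cov x j k l m :
  n%:R^-1 * \sum_i boot_coef x i j k * boot_coef x i l m =
  bessel ^+ 2 * (n%:R^-1 * \sum_i (centered x i j * centered x i k) *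
     (centered x i l * centered x i m)) - sample_cov x j k * sample_cov x l m.
Proof.
transitivity (n%:R^-1 * \sum_i (bessel ^+ 2 * ((centered x i j * centered x i k) *
     (centered x i l * centered x i m)) - bessel * sample_cov x l m *
     (centered x i j * centered x i k) - sample_cov x j k * boot_coef x i l m)).
  by congr (_ * _); apply: eq_bigr => i _; rewrite /boot_coef; ring.
rewrite sumrB sumrB -!mulr_sumr sum_boot_coef mulr0 subr0 !sample_cov_sum.
by rewrite /bessel; field; rewrite n0 n10.
Qed.

(** Centring makes the cross terms of the kernel vanish when summed over [l]; the term [l = i] is
    zero and may be included in the sum. *)
Lemma boot_matrixE x e j k :
  boot_matrix x e j k = (Num.sqrt n%:R)^-1 * (2^-1 * \sum_i boot_coef x i j k * e i).
Proof.
rewrite /boot_matrix mxE summxE; congr (_ * _); rewrite mulr_sumr; apply: eq_bigr => i _.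
rewrite mxE [_ * (_ * e i)]mulrA [in RHS]mulrC; congr (_ * _).
rewrite mxE [X in _ + X]mxE [X in X + _]mxE summxE.
have E : \sum_(l | l != i) cov_kernel (x i) (x l) j k =
   2^-1 * (n%:R * (centered x i j * centered x i k) + \sum_l centered x l j * centered x l k).
  transitivity (\sum_l 2^-1 * ((centered x i j - centered x l j) * (centered x i k - centered x l k))).
    rewrite [RHS](bigD1 i)//= !subrr mul0r mulr0 add0r.
    apply: eq_bigr => l _; rewrite /cov_kernel mxE outerE !mxE; congr (_ * (_ * _));
    by rewrite /centered; ring.
  rewrite -mulr_sumr; congr (_ * _).
  transitivity (\sum_l (centered x i j * centered x i k - centered x i j * centered x l k
      - centered x l j * centered x i k + centered x l j * centered x l k)).
    by apply: eq_bigr => l _; ring.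
  have e1 : \sum_l centered x i j * centered x l k = 0.
    by rewrite -mulr_sumr sum_centered mulr0.
  have e2 : \sum_l centered x l j * centered x i k = 0.
    by rewrite -mulr_suml sum_centered mul0r.
  rewrite big_split/= sumrB sumrB e1 e2 !subr0.
  by rewrite sumr_const card_ord -[_ *+ n]mulr_natl.
rewrite E /boot_coef sample_cov_sum /bessel; field.
exact: n10.
Qed.

(** The factor [2 n^(-1/2)] of [boot_max] and the factor [n^(-1/2) / 2] of [boot_matrixE] combine to
    [1 / n]. The condition [0 <= t] accounts for the value 0 from which the maximum starts. *)
Lemma boot_max_le x e t : (0 < p)%N -> 0 <= t ->
  (boot_max x e <= t <-> forall j k, `|n%:R^-1 * \sum_i boot_coef x i j k * e i| <= t).
Proof.
move=> p0 t0.
pose q : R := Num.sqrt n%:R; rewrite -/q.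
have s0 : 0 < q by rewrite sqrtr_gt0 ltr0n (leq_trans _ n2).
have ss : q * q = n%:R :> R by rewrite -expr2 sqr_sqrtr.
have E j k : 2 * q^-1 * `|boot_matrix x e j k| =
   `|n%:R^-1 * \sum_i boot_coef x i j k * e i|.
  rewrite boot_matrixE -/q -[X in X * `|_|](_ : `|2 * q^-1| = _); last first.
    by rewrite ger0_norm// mulr_ge0// invr_ge0 ltW.
  by rewrite -normrM; congr `|_|; rewrite -ss; field; rewrite gt_eqF.
have c0 : 0 < 2 * q^-1 :> R by rewrite mulr_gt0// invr_gt0.
rewrite /boot_max -/q -ler_pdivlMl//; split=> [h j k|h].
  rewrite -E -ler_pdivlMl//; apply: le_trans h.
  apply: le_trans (_ : \big[Num.max/0]_k' `|boot_matrix x e j k'| <= _).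
    exact: (@le_bigmax_cond _ _ _ 0 k xpredT (fun k => `|boot_matrix x e j k|)).
  exact: (@le_bigmax_cond _ _ _ 0 j xpredT (fun j => \big[Num.max/0]_k' `|boot_matrix x e j k'|)).
have d0 : 0 <= (2 * q^-1)^-1 * t by rewrite mulr_ge0// invr_ge0 ltW.
apply/bigmax_leP; split=> // j _; apply/bigmax_leP; split=> // k _.
by rewrite ler_pdivlMl// E.
Qed.

Lemma boot_max_ge0 x e : 0 <= boot_max x e.
Proof.
rewrite mulr_ge0// ?mulr_ge0 ?invr_ge0 ?sqrtr_ge0//.
by rewrite /max_abs_entry bigmax_ge_id.
Qed.

End SampleAlgebra.

(** * Deterministic consequences of accurate empirical moments *)

Section GoodSample.
Context {R : realType} {n p : nat}.
Hypothesis n2 : (2 <= n)%N.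
Variables (Sig : 'I_p -> 'I_p -> R) (Q4 : 'I_p -> 'I_p -> 'I_p -> 'I_p -> R).
Variables (c u eps : R).

Definition emp_avg (f : 'I_n -> R) : R := n%:R^-1 * \sum_i f i.

(** The right-hand sides are concentration scales: standard deviations of order at most [u] for
    entries and pair products and [u^3] for products of four, each times the precision [eps]. *)
Definition good_sample (x : 'I_n -> 'cV[R]_p) : Prop :=
  [/\ forall j, `|emp_mean x j| <= c * u * eps,
      forall j k, `|emp_prod x j k - Sig j k| <= c * u * eps &
      forall j k l m, `|emp_avg (fun i => (x i j 0 * x i k 0) * (x i l 0 * x i m 0)) - Q4 j k l m|
        <= c * u ^+ 3 * eps].

Hypotheses (c1 : 1 <= c) (u1 : 1 <= u) (eps0 : 0 <= eps) (u3eps : u ^+ 3 * eps <= 1).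
Hypothesis neps : n%:R^-1 <= eps ^+ 2.
Hypothesis SigK : forall j k, `|Sig j k| <= c * u.
Hypothesis Q4K : forall j k l m, `|Q4 j k l m| <= c * u ^+ 2.
Variable x : 'I_n -> 'cV[R]_p.
Hypothesis gx : good_sample x.

Let n0 : 0 < n%:R :> R. Proof. by rewrite ltr0n (leq_trans _ n2). Qed.
Let c0 : 0 <= c := le_trans ler01 c1.
Let u0 : 0 <= u := le_trans ler01 u1.
Let u2 : u <= u ^+ 2. Proof. by rewrite expr2 ler_peMl. Qed.
Let u12 : 1 <= u ^+ 2. Proof. exact: le_trans u1 u2. Qed.
Let u23 : u ^+ 2 <= u ^+ 3. Proof. by rewrite [leRHS]exprS ler_peMl// exprn_ge0. Qed.
Let uu : u <= u ^+ 3. Proof. exact: le_trans u2 u23. Qed.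
Let ue : u * eps <= 1. Proof. by apply: le_trans u3eps; rewrite ler_wpM2r. Qed.
Let eps1 : eps <= 1.
Proof. by apply: le_trans ue; rewrite -[leLHS]mul1r ler_wpM2r. Qed.
Let eps2 : eps ^+ 2 <= eps. Proof. by rewrite expr2 -[leRHS]mul1r ler_wpM2r. Qed.
Let c2 : c <= c ^+ 2. Proof. by rewrite expr2 ler_peMl. Qed.
Let c12 : 1 <= c ^+ 2. Proof. exact: le_trans c1 c2. Qed.
Let c24 : c ^+ 2 <= c ^+ 4.
Proof. by rewrite (exprD c 2 2) ler_peMl// sqr_ge0. Qed.
Let c23 : c ^+ 2 <= c ^+ 3. Proof. by rewrite [leRHS]exprS ler_peMl// exprn_ge0. Qed.
Let c34 : c ^+ 3 <= c ^+ 4. Proof. by rewrite [leRHS]exprS ler_peMl// exprn_ge0. Qed.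

Let s1 := c * u * eps.
Let s10 : 0 <= s1. Proof. by rewrite !mulr_ge0. Qed.
Let s1c : s1 <= c.
Proof. by rewrite /s1 -mulrA -[leRHS]mulr1 ler_wpM2l. Qed.

Lemma emp_avgD f g : emp_avg (fun i => f i + g i) = emp_avg f + emp_avg g.
Proof. by rewrite /emp_avg big_split mulrDr. Qed.

Lemma emp_avgZ (a : R) f : emp_avg (fun i => a * f i) = a * emp_avg f.
Proof. by rewrite /emp_avg -mulr_sumr mulrCA. Qed.

Lemma emp_avgB f g : emp_avg (fun i => f i - g i) = emp_avg f - emp_avg g.
Proof. by rewrite /emp_avg sumrB mulrBr. Qed.

Lemma emp_avg_cst (a : R) : emp_avg (fun=> a) = a.
Proof. by rewrite /emp_avg sumr_const card_ord -[a *+ n]mulr_natl mulKf// gt_eqF. Qed.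

Lemma le_emp_avg f g : (forall i, f i <= g i) -> emp_avg f <= emp_avg g.
Proof. by move=> fg; rewrite ler_wpM2l ?invr_ge0 ?(ltW n0)// ler_sum. Qed.

Lemma emp_avg_norm f : `|emp_avg f| <= emp_avg (fun i => `|f i|).
Proof.
by rewrite normrM ger0_norm ?invr_ge0 ?(ltW n0)// ler_wpM2l ?invr_ge0 ?(ltW n0)// ler_norm_sum.
Qed.

Let bessel1 : 0 <= bessel (R := R) (n := n) - 1 /\ bessel (R := R) (n := n) - 1 <= 2 * n%:R^-1.
Proof.
have pE : n.-1%:R = n%:R - 1 :> R by case: (n) n2 => // n' _; rewrite -natr1 addrK.
have n2R : 2 <= n%:R :> R by rewrite ler_nat.
have p0 : 0 < n%:R - 1 :> R by lra.
have -> : bessel (R := R) (n := n) - 1 = (n%:R - 1)^-1.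
  by rewrite /bessel pE; field; rewrite gt_eqF.
split; first by rewrite invr_ge0 ltW.
rewrite -[leLHS]mul1r ler_pdivrMr// mulrAC ler_pdivlMr//; lra.
Qed.

Let b := bessel (R := R) (n := n).
Let ninv : 2 * n%:R^-1 <= 2 * eps.
Proof. by rewrite ler_wpM2l// (le_trans neps). Qed.

Let fourth j : emp_avg (fun i => `|x i j 0| ^+ 4) <= 2 * (c * u ^+ 2).
Proof.
have [_ _ h4] := gx.
have := h4 j j j j; have := Q4K j j j j.
have -> : emp_avg (fun i => `|x i j 0| ^+ 4) =
   emp_avg (fun i => x i j 0 * x i j 0 * (x i j 0 * x i j 0)).
  congr (_ * _); apply: eq_bigr => i _.
  by rewrite (exprM _ 2 2) real_normK ?num_real//; ring.
rewrite !ler_norml => /andP[_ q] /andP[_ h].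
have : c * u ^+ 3 * eps <= c * u ^+ 2.
  rewrite -mulrA ler_wpM2l// (le_trans u3eps)//.
lra.
Qed.

(** Products of three factors reduce to cubes by the arithmetic-geometric mean inequality, and cubes
    of data shifted by at most [s1] reduce to fourth moments by [a^3 <= 1 + a^4]. *)
Let cube_avg (y1 y2 y3 : 'I_n -> R) :
  (forall y, List.In y [:: y1; y2; y3] -> exists j, forall i, `|y i| <= `|x i j 0| + s1) ->
  emp_avg (fun i => `|y1 i * (y2 i * y3 i)|) <= 16 * (c ^+ 3 * u ^+ 2).
Proof.
move=> hy.
have one y : List.In y [:: y1; y2; y3] -> emp_avg (fun i => `|y i| ^+ 3) <= 16 * (c ^+ 3 * u ^+ 2).
  move=> /hy[j hj].
  apply: (@le_trans _ _ (emp_avg (fun i => (4 + 4 * c ^+ 3) + 4 * `|x i j 0| ^+ 4))).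
    apply: le_emp_avg => i.
    have a0 := normr_ge0 (x i j 0); set a := `|x i j 0| in a0 *.
    apply: (@le_trans _ _ ((a + s1) ^+ 3)).
      by rewrite lerXn2r ?nnegrE ?addr_ge0.
    have t1 : (a + s1) ^+ 3 <= 4 * (a ^+ 3 + s1 ^+ 3).
      rewrite -subr_ge0; have -> : 4 * (a ^+ 3 + s1 ^+ 3) - (a + s1) ^+ 3 =
        3 * ((a - s1) ^+ 2 * (a + s1)) by ring.
      by rewrite mulr_ge0// mulr_ge0 ?sqr_ge0// addr_ge0.
    have t2 : s1 ^+ 3 <= c ^+ 3 by rewrite lerXn2r ?nnegrE.
    have t3 : a ^+ 3 <= 1 + a ^+ 4.
      have [l|l] := leP a 1.
        by apply: (@le_trans _ _ 1); [rewrite exprn_ile1|rewrite lerDl exprn_ge0].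
      by rewrite [a ^+ 4]exprS -[leLHS]add0r lerD// ler_peMl ?exprn_ge0// ltW.
    lra.
  rewrite emp_avgD emp_avg_cst emp_avgZ; have := fourth j.
  have k1 : 1 <= c ^+ 3 * u ^+ 2.
    by rewrite -[leLHS]mul1r ler_pM// (le_trans c12).
  have k2 : c ^+ 3 <= c ^+ 3 * u ^+ 2 by rewrite ler_peMr// exprn_ge0.
  have k3 : c * u ^+ 2 <= c ^+ 3 * u ^+ 2.
    by rewrite ler_wpM2r ?exprn_ge0// (le_trans c2).
  lra.
have h1 := one y1 (or_introl erefl); have h2 := one y2 (or_intror (or_introl erefl)).
have h3 := one y3 (or_intror (or_intror (or_introl erefl))).
apply: (@le_trans _ _ (emp_avg (fun i => 3^-1 * (`|y1 i| ^+ 3 + (`|y2 i| ^+ 3 + `|y3 i| ^+ 3))))).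
  apply: le_emp_avg => i; rewrite !normrM.
  have a0 := normr_ge0 (y1 i); have b0 := normr_ge0 (y2 i); have d0 := normr_ge0 (y3 i).
  set a := `|y1 i| in a0 *; set bb := `|y2 i| in b0 *; set dd := `|y3 i| in d0 *.
  rewrite -subr_ge0; have -> : 3^-1 * (a ^+ 3 + (bb ^+ 3 + dd ^+ 3)) - a * (bb * dd) =
    6^-1 * ((a + (bb + dd)) * ((a - bb) ^+ 2 + ((bb - dd) ^+ 2 + (a - dd) ^+ 2))) by field.
  by rewrite mulr_ge0// mulr_ge0// ?addr_ge0// ?sqr_ge0// addr_ge0// sqr_ge0.
rewrite emp_avgZ !emp_avgD; lra.
Qed.

Let mean_le j : `|emp_mean x j| <= s1. Proof. by case: gx. Qed.

Let raw_ok j i : `|x i j 0| <= `|x i j 0| + s1.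
Proof. by rewrite lerDl. Qed.

Let cen_ok j i : `|centered x i j| <= `|x i j 0| + s1.
Proof. by apply: le_trans (ler_normB _ _) _; rewrite lerD. Qed.

Let step_le (m : R) (y1 y2 y3 : 'I_n -> R) : `|m| <= s1 ->
  (forall y, List.In y [:: y1; y2; y3] -> exists j, forall i, `|y i| <= `|x i j 0| + s1) ->
  `|emp_avg (fun i => m * (y1 i * (y2 i * y3 i)))| <= 16 * c ^+ 4 * (u ^+ 3 * eps).
Proof.
move=> ms hy; rewrite emp_avgZ normrM.
apply: le_trans (ler_pM (normr_ge0 _) (normr_ge0 _) ms (le_trans (emp_avg_norm _) (cube_avg hy))) _.
by rewrite /s1 le_eqVlt; apply/orP; left; apply/eqP; ring.
Qed.

(** Centring is undone one factor at a time; each of the four differences is an empirical mean,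
    bounded by [s1], times a product of three factors. *)
Let centered4 j k l m : `|emp_avg (fun i => (centered x i j * centered x i k) *
     (centered x i l * centered x i m)) -
   emp_avg (fun i => (x i j 0 * x i k 0) * (x i l 0 * x i m 0))| <= 64 * c ^+ 4 * (u ^+ 3 * eps).
Proof.
rewrite -emp_avgB.
have -> : emp_avg (fun i => (centered x i j * centered x i k) * (centered x i l * centered x i m)
     - (x i j 0 * x i k 0) * (x i l 0 * x i m 0)) =
  emp_avg (fun i => - emp_mean x j * (centered x i k * (centered x i l * centered x i m))) +
  (emp_avg (fun i => - emp_mean x k * (x i j 0 * (centered x i l * centered x i m))) +
  (emp_avg (fun i => - emp_mean x l * (x i j 0 * (x i k 0 * centered x i m))) +
   emp_avg (fun i => - emp_mean x m * (x i j 0 * (x i k 0 * x i l 0))))).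
  rewrite -!emp_avgD; congr (_ * _); apply: eq_bigr => i _.
  by rewrite /centered; ring.
have mN q : `|- emp_mean x q| <= s1 by rewrite normrN.
have r q : exists q', forall i, `|x i q 0| <= `|x i q' 0| + s1 by exists q.
have cc q : exists q', forall i, `|centered x i q| <= `|x i q' 0| + s1 by exists q.
have h1 := @step_le _ (fun i => centered x i k) (fun i => centered x i l) (fun i => centered x i m) (mN j).
have h2 := @step_le _ (fun i => x i j 0) (fun i => centered x i l) (fun i => centered x i m) (mN k).
have h3 := @step_le _ (fun i => x i j 0) (fun i => x i k 0) (fun i => centered x i m) (mN l).
have h4 := @step_le _ (fun i => x i j 0) (fun i => x i k 0) (fun i => x i l 0) (mN m).
have {}h1 := h1 ltac:(by move=> y /= [<-|[<-|[<-|[]]]]).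
have {}h2 := h2 ltac:(by move=> y /= [<-|[<-|[<-|[]]]]).
have {}h3 := h3 ltac:(by move=> y /= [<-|[<-|[<-|[]]]]).
have {}h4 := h4 ltac:(by move=> y /= [<-|[<-|[<-|[]]]]).
apply: le_trans (ler_normD _ _) _.
apply: le_trans (lerD (lexx _) (ler_normD _ _)) _.
apply: le_trans (lerD (lexx _) (lerD (lexx _) (ler_normD _ _))) _.
lra.
Qed.

Let mm_le j k : `|emp_mean x j * emp_mean x k| <= c ^+ 2 * u ^+ 2 * eps ^+ 2.
Proof.
rewrite normrM (_ : c ^+ 2 * u ^+ 2 * eps ^+ 2 = s1 * s1); last by rewrite /s1; ring.
exact: ler_pM.
Qed.

Let quad_le : c ^+ 2 * u ^+ 2 * eps ^+ 2 <= c ^+ 2 * u * eps.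
Proof.
have -> : c ^+ 2 * u ^+ 2 * eps ^+ 2 = c ^+ 2 * u * eps * (u * eps) by ring.
by rewrite -[leRHS]mulr1 ler_wpM2l// !mulr_ge0// sqr_ge0.
Qed.

Let diff_le j k : `|emp_prod x j k - emp_mean x j * emp_mean x k| <= 3 * (c ^+ 2 * u).
Proof.
have [_ h2 _] := gx.
have t1 := h2 j k; have t2 := SigK j k; have t3 := mm_le j k; have t4 := quad_le.
have k1 : c * u <= c ^+ 2 * u by rewrite ler_wpM2r.
have k2 : c ^+ 2 * u * eps <= c ^+ 2 * u by rewrite -[leRHS]mulr1 ler_wpM2l// mulr_ge0// sqr_ge0.
have k3 : c * u * eps <= c * u by rewrite -[leRHS]mulr1 ler_wpM2l// mulr_ge0.
have -> : emp_prod x j k - emp_mean x j * emp_mean x k =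
  (emp_prod x j k - Sig j k) + Sig j k - emp_mean x j * emp_mean x k by ring.
apply: le_trans (ler_normB _ _) _.
apply: le_trans (lerD (ler_normD _ _) (lexx _)) _.
lra.
Qed.

Let b10 : 0 <= b - 1. Proof. by case: bessel1. Qed.
Let b1n : b - 1 <= 2 * n%:R^-1. Proof. by case: bessel1. Qed.
Let b1e : b - 1 <= 2 * eps. Proof. exact: le_trans b1n ninv. Qed.

(** The corrections by the empirical means and by [bessel] are both of order [eps^2]. Up to this
    remainder the sample covariance is a plain average over the sample. *)
Lemma sample_cov_lin j k :
  `|sample_cov x j k - emp_prod x j k| <= 7 * (c ^+ 2 * u ^+ 2 * eps ^+ 2).
Proof.
rewrite (sample_covE n2) -/b.
have -> : b * (emp_prod x j k - emp_mean x j * emp_mean x k) - emp_prod x j k =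
  (b - 1) * (emp_prod x j k - emp_mean x j * emp_mean x k) - emp_mean x j * emp_mean x k by ring.
apply: le_trans (ler_normB _ _) _; rewrite normrM (ger0_norm b10).
have t3 := mm_le j k.
have t : (b - 1) * `|emp_prod x j k - emp_mean x j * emp_mean x k| <=
   2 * eps ^+ 2 * (3 * (c ^+ 2 * u)).
  apply: (ler_pM b10 (normr_ge0 _) _ (diff_le _ _)).
  by apply: le_trans b1n _; rewrite ler_wpM2l.
have t4 : c ^+ 2 * u * eps ^+ 2 <= c ^+ 2 * u ^+ 2 * eps ^+ 2.
  by rewrite ler_wpM2r ?sqr_ge0// ler_wpM2l// sqr_ge0.
lra.
Qed.

Lemma sample_cov_close j k : `|sample_cov x j k - Sig j k| <= 8 * (c ^+ 2 * u * eps).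
Proof.
have [_ h2 _] := gx; have t1 := h2 j k; have t4 := quad_le.
have t3 := sample_cov_lin j k.
have k1 : c * u * eps <= c ^+ 2 * u * eps by rewrite ler_wpM2r// ler_wpM2r.
have -> : sample_cov x j k - Sig j k =
  (sample_cov x j k - emp_prod x j k) + (emp_prod x j k - Sig j k) by ring.
apply: le_trans (ler_normD _ _) _; lra.
Qed.

(** 541 is the sum of 396 for the factor [bessel^2], 64 for centring, 1 for the empirical fourth
    moment and 80 for the product of covariances. *)
Lemma boot_cov_close j k l m :
  `|emp_avg (fun i => boot_coef x i j k * boot_coef x i l m) -
    (Q4 j k l m - Sig j k * Sig l m)| <= 541 * c ^+ 4 * (u ^+ 3 * eps).
Proof.
rewrite {1}/emp_avg (boot_coef_cov n2) -/b.
set D := n%:R^-1 * _.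
have DE : D = emp_avg (fun i => (centered x i j * centered x i k) *
     (centered x i l * centered x i m)) by [].
have h1 := centered4 j k l m; rewrite -DE in h1.
have [_ _ h4] := gx; have {}h4 := h4 j k l m; have hQ := Q4K j k l m.
set Z := emp_avg _ in h1 h4.
have e3 : 0 <= u ^+ 3 * eps by rewrite mulr_ge0// exprn_ge0.
have c40 : 0 <= c ^+ 4 by rewrite exprn_ge0.
have cc4 : c <= c ^+ 4 by exact: le_trans c2 c24.
have k0 : c * u ^+ 3 * eps <= c ^+ 4 * (u ^+ 3 * eps) by rewrite -mulrA ler_wpM2r.
have hD : `|D| <= 66 * (c ^+ 4 * u ^+ 2).
  have -> : D = (D - Z) + (Z - Q4 j k l m) + Q4 j k l m by ring.
  apply: le_trans (ler_normD _ _) _.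
  apply: le_trans (lerD (ler_normD _ _) (lexx _)) _.
  have k1 : c * u ^+ 2 <= c ^+ 4 * u ^+ 2 by rewrite ler_wpM2r// exprn_ge0.
  have k2 : c ^+ 4 * (u ^+ 3 * eps) <= c ^+ 4 * u ^+ 2 by rewrite ler_wpM2l// (le_trans u3eps).
  lra.
have t2 : `|(b ^+ 2 - 1) * D| <= 396 * (c ^+ 4 * (u ^+ 3 * eps)).
  have -> : b ^+ 2 - 1 = (b - 1) * (b - 1 + 2) by ring.
  have b20 : 0 <= b - 1 + 2 by rewrite addr_ge0.
  rewrite normrM normrM (ger0_norm b10) (ger0_norm b20).
  apply: (@le_trans _ _ (2 * eps * 3 * (66 * (c ^+ 4 * u ^+ 2)))); last first.
    have -> : 2 * eps * 3 * (66 * (c ^+ 4 * u ^+ 2)) = 396 * (c ^+ 4 * (u ^+ 2 * eps)) by ring.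
    have : c ^+ 4 * (u ^+ 2 * eps) <= c ^+ 4 * (u ^+ 3 * eps) by rewrite ler_wpM2l// ler_wpM2r.
    lra.
  apply: (ler_pM (mulr_ge0 b10 b20) (normr_ge0 _) _ hD).
  apply: (ler_pM b10 b20 b1e).
  have : 2 * n%:R^-1 <= 1 :> R by rewrite ler_pdivrMr// mul1r ler_nat.
  by have := b1n; lra.
have S1 := sample_cov_close j k; have S2 := sample_cov_close l m.
have c2u : 0 <= c ^+ 2 * u by rewrite mulr_ge0// exprn_ge0.
have c2ue : 0 <= c ^+ 2 * u * eps by rewrite mulr_ge0.
have hS : `|sample_cov x l m| <= 9 * (c ^+ 2 * u).
  have -> : sample_cov x l m = (sample_cov x l m - Sig l m) + Sig l m by ring.
  apply: le_trans (ler_normD _ _) _; have := SigK l m.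
  have k1 : c * u <= c ^+ 2 * u by rewrite ler_wpM2r.
  have k2 : c ^+ 2 * u * eps <= c ^+ 2 * u by rewrite -[leRHS]mulr1 ler_wpM2l.
  lra.
have t3 : `|sample_cov x j k * sample_cov x l m - Sig j k * Sig l m| <= 80 * (c ^+ 4 * (u ^+ 3 * eps)).
  have -> : sample_cov x j k * sample_cov x l m - Sig j k * Sig l m =
    (sample_cov x j k - Sig j k) * sample_cov x l m +
    (sample_cov x l m - Sig l m) * Sig j k by ring.
  apply: le_trans (ler_normD _ _) _; rewrite !normrM.
  have p1 := ler_pM (normr_ge0 _) (normr_ge0 _) S1 hS.
  have p2 := ler_pM (normr_ge0 _) (normr_ge0 _) S2 (SigK j k).
  have k1 : c ^+ 3 * (u ^+ 2 * eps) <= c ^+ 4 * (u ^+ 3 * eps).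
    by rewrite ler_pM ?exprn_ge0 ?mulr_ge0 ?exprn_ge0// ler_wpM2r.
  have k2 : c ^+ 4 * (u ^+ 2 * eps) <= c ^+ 4 * (u ^+ 3 * eps).
    by rewrite ler_wpM2l// ler_wpM2r.
  have e1 : 8 * (c ^+ 2 * u * eps) * (9 * (c ^+ 2 * u)) = 72 * (c ^+ 4 * (u ^+ 2 * eps)) by ring.
  have e2 : 8 * (c ^+ 2 * u * eps) * (c * u) = 8 * (c ^+ 3 * (u ^+ 2 * eps)) by ring.
  rewrite e1 in p1; rewrite e2 in p2; lra.
have -> : b ^+ 2 * D - sample_cov x j k * sample_cov x l m - (Q4 j k l m - Sig j k * Sig l m) =
  (b ^+ 2 - 1) * D + (D - Z) + (Z - Q4 j k l m) -
  (sample_cov x j k * sample_cov x l m - Sig j k * Sig l m) by ring.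
apply: le_trans (ler_normB _ _) _.
apply: le_trans (lerD (ler_normD _ _) (lexx _)) _.
apply: le_trans (lerD (lerD (ler_normD _ _) (lexx _)) (lexx _)) _.
lra.
Qed.

End GoodSample.

(** * Concentration of empirical moments *)

Lemma sqrt2_le2 (R : realType) : Num.sqrt 2 <= 2 :> R.
Proof. by rewrite -[leRHS]ger0_norm// -sqrtr_sqr ler_sqrt// expr2; lra. Qed.

Section UnionBound.
Context {R : realType} {d : measure_display} {T : measurableType d} (P : probability T R).

Lemma union_bound (K : finType) (E : K -> set T) (c : R) :
  (forall k, measurable (E k)) -> (forall k, P (E k) <= c%:E)%E ->
  (P (\bigcup_(k in [set: K]) E k) <= (#|K|%:R * c)%:E)%E.
Proof.
move=> mE PE.
have step : forall s : seq K, measurable (\bigcup_(k in [set k | k \in s]) E k) /\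
    (P (\bigcup_(k in [set k | k \in s]) E k) <= ((size s)%:R * c)%:E)%E.
  elim=> [|k s [ms IH]].
    have -> : \bigcup_(k in [set k : K | k \in [::]]) E k = set0.
      by apply/seteqP; split => w // [].
    by rewrite measure0 mul0r.
  have -> : \bigcup_(k in [set l | l \in k :: s]) E k =
      E k `|` \bigcup_(k in [set k | k \in s]) E k.
    apply/seteqP; split => w.
      by move=> [l /=]; rewrite inE => /predU1P[->|ls] h; [left|right; exists l].
    move=> [h|[l /= ls h]]; first by exists k => //=; rewrite inE eqxx.
    by exists l => //=; rewrite inE ls orbT.
  split; first exact: measurableU.
  apply: le_trans (measureU2 _ _ _) _ => //=.
  by rewrite -natr1 mulrDl mul1r addrC EFinD leeD.
have [_] := step (enum K); rewrite -cardE.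
have -> : [set k | k \in enum K] = [set: K]; last by [].
by apply/seteqP; split => k //= _; rewrite mem_enum.
Qed.

End UnionBound.

(** * Exponential bounds for sums clipped from above *)

Section ClippedBernstein.
Context {R : realType} {d : measure_display} {T : measurableType d} (P : probability T R).
Context {d1 : measure_display} {T1 : measurableType d1} {n : nat}.
Variables (U : 'I_n -> {RV P >-> T1}) (i1 : 'I_n).
Hypothesis iid_U : iid U.

Lemma integral_same_law (g : T1 -> \bar R) i : measurable_fun setT g -> (forall y, 0 <= g y)%E ->
  (\int[P]_w g (U i w) = \int[P]_w g (U i1 w))%E.
Proof.
move=> mf f0.
transitivity (\int[distribution P (U i)]_y g y)%E.
  by rewrite (ge0_integral_distribution (U i) mf f0).
transitivity (\int[distribution P (U i1)]_y g y)%E.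
  by apply: eq_measure_integral => A mA _; exact: iid_U.2.
by rewrite (ge0_integral_distribution (U i1) mf f0).
Qed.

(** Through [expR z <= (1 - z)^-1]. Negative [z] of any size is allowed, so clipping from above
    suffices. *)
Lemma expR_le_quad (z : R) : z <= 2^-1 -> expR z <= 1 + z + 2 * z ^+ 2.
Proof.
move=> z2; have h := @expR_ge1Dx R (- z).
have p : 0 < 1 - z by lra.
rewrite -[z in expR z]opprK expRN.
apply: (@le_trans _ _ (1 - z)^-1); first by rewrite lef_pV2 ?posrE ?expR_gt0.
rewrite -[leLHS]mul1r ler_pdivrMr// -subr_ge0.
have -> : (1 + z + 2 * z ^+ 2) * (1 - z) - 1 = z ^+ 2 * (1 - 2 * z) by ring.
by rewrite mulr_ge0 ?sqr_ge0//; lra.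
Qed.

Variables (f : T1 -> R) (v lam M s : R).
Hypothesis mf : measurable_fun setT f.
Hypothesis fi : integrableR P (fun w => f (U i1 w)).
Hypothesis f2i : integrableR P (fun w => f (U i1 w) ^+ 2).
Hypothesis fv : expect P (fun w => f (U i1 w) ^+ 2) <= v.
Hypotheses (lam0 : 0 < lam) (M0 : 0 <= M) (lamM : lam * M <= 2^-1).
Let m := expect P (fun w => f (U i1 w)).
Let g (y : T1) : R := Num.min (f y) M.

Let mg : measurable_fun setT g. Proof. exact: measurable_minr. Qed.

(** Above the clipping level the quadratic bound at [lam * M] only increases when [M] is replaced by
    the value of [f], so the mean and second moment of the unclipped function enter. *)
Let mgf_le : (\int[P]_w (expR (lam * g (U i1 w)))%:E <= (expR (lam * m + 2 * lam ^+ 2 * v))%:E)%E.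
Proof.
have mU := @measurable_funPT _ _ _ _ (U i1).
pose h w := (1 + lam * f (U i1 w)) + 2 * lam ^+ 2 * f (U i1 w) ^+ 2.
have i1' : integrableR P (fun w => 1 + lam * f (U i1 w)).
  by apply: integrableRD; [exact: integrableR_cst|exact: integrableRZ].
have i2' : integrableR P (fun w => 2 * lam ^+ 2 * f (U i1 w) ^+ 2) by exact: integrableRZ.
have ih : integrableR P h by exact: integrableRD.
apply: (@le_trans _ _ (expect P h)%:E).
  rewrite -(expectE ih); apply: ge0_le_integral => //.
  - apply/measurable_EFinP; apply: measurableT_comp (@measurable_expR R) _.
    by apply: measurable_funM => //; exact: measurableT_comp mg mU.
  - by apply/measurable_EFinP; exact: integrableR_measurable ih.
  move=> w _; rewrite lee_fin /h /g; set y := f _.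
  have c0 : 0 <= lam ^+ 2 * y ^+ 2 by rewrite mulr_ge0 ?sqr_ge0.
  have [yM|My] := leP y M.
    have := @expR_le_quad (lam * y); rewrite exprMn mulrA => -> //.
    by apply: le_trans lamM; rewrite ler_wpM2l ?(ltW lam0).
  have q := expR_le_quad lamM.
  have l1 : lam * M <= lam * y by rewrite ler_wpM2l ?(ltW lam0)// ltW.
  have l2 : (lam * M) ^+ 2 <= (lam * y) ^+ 2.
    have := ltW My.
    by rewrite lerXn2r ?nnegrE ?mulr_ge0 ?(ltW lam0)// ltW// (le_lt_trans M0).
  rewrite (exprMn 2 lam y) in l2; lra.
have -> : expect P h = 1 + lam * m + 2 * lam ^+ 2 * expect P (fun w => f (U i1 w) ^+ 2).
  rewrite /h (expectD i1' i2') (expectD (integrableR_cst P 1) (integrableRZ lam fi)).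
  by rewrite (expect_cst P 1) (expectZ lam fi) (expectZ _ f2i).
rewrite lee_fin; apply: (@le_trans _ _ (1 + (lam * m + 2 * lam ^+ 2 * v))); last exact: expR_ge1Dx.
rewrite addrA lerD2l; apply: ler_wpM2l fv.
by rewrite mulr_ge0 ?sqr_ge0.
Qed.

Lemma clipped_mgf_sum : (\int[P]_w (expR (lam * \sum_i g (U i w)))%:E <=
  (expR (n%:R * (lam * m + 2 * lam ^+ 2 * v)))%:E)%E.
Proof.
set q := lam * m + _.
pose u (x : unit -> R) : \bar R := (expR (lam * x tt))%:E.
have mu : coord_measurable u.
  move=> d' T' v' mv; apply/measurable_EFinP; apply: measurableT_comp => //.
  exact: measurable_funM.
have hu : test_fun u by split => // x; rewrite lee_fin expR_ge0.
have := @avg_independent_sum R _ _ P _ _ _ U iid_U.1 unit (fun _ y _ => g y)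
  (index_enum 'I_n) u (fun=> 0) (fun _ _ => mg) (index_enum_uniq _) hu.
have -> : (\int[P]_w u (fun j => 0 + \sum_(k <- index_enum 'I_n) g (U k w))%R)%E =
  (\int[P]_w (expR (lam * \sum_i g (U i w)))%:E)%E.
  by apply: eq_integral => w _; rewrite /u add0r.
move=> ->.
have -> : expR (n%:R * q) = expR (lam * 0) * expR ((size (index_enum 'I_n))%:R * q).
  by rewrite mulr0 expR0 mul1r -sum1_size sum1_card card_ord.
have : forall x : unit -> R, (foldr (fun k v => avg P (fun w (_ : unit) => g (U k w)) v) u
    (index_enum 'I_n) x <= (expR (lam * x tt) * expR ((size (index_enum 'I_n))%:R * q))%:E)%E.
  elim: (index_enum 'I_n) => [|i r IH] x /=.
    by rewrite mul0r expR0 mulr1.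
  set F := foldr _ _ _ in IH *.
  have tF : test_fun F.
    rewrite /F; elim: (r) => //= k r' IH'; apply: test_fun_avg => // _.
    exact: measurableT_comp mg _.
  pose e0 := expR (lam * x tt) * expR ((size r)%:R * q).
  have e00 : 0 <= e0 by rewrite mulr_ge0 ?expR_ge0.
  have mE : measurable_fun setT (fun y => (expR (lam * g y))%:E).
    by apply/measurable_EFinP; apply: measurableT_comp => //; exact: measurable_funM.
  have mEU : measurable_fun setT (fun w => (expR (lam * g (U i w)))%:E).
    exact: measurableT_comp mE _.
  apply: (@le_trans _ _ (\int[P]_w (e0%:E * (expR (lam * g (U i w)))%:E))%E).
    apply: ge0_le_integral => //.
    - by move=> w _; exact: tF.2.
    - apply: (measurable_translate x tF.1) => _; exact: measurableT_comp mg _.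
    - exact: measurable_funeM.
    move=> w _; apply: le_trans (IH _) _.
    by rewrite -EFinM lee_fin mulrDr expRD /e0 -!mulrA [X in _ * X]mulrC.
  rewrite ge0_integralZl//.
  rewrite (@integral_same_law (fun y => (expR (lam * g y))%:E))//.
  apply: le_trans (lee_wpmul2l _ mgf_le) _; first by rewrite lee_fin.
  have -> : (size r).+1%:R * q = (size r)%:R * q + q by rewrite -natr1 mulrDl mul1r.
  by rewrite -EFinM lee_fin (expRD _ q) mulrA.
exact.
Qed.

Lemma measurable_clipped : measurable [set w | n%:R * m + s <= \sum_i Num.min (f (U i w)) M].
Proof.
rewrite -[X in measurable X]setTI.
have mS : measurable_fun setT (fun w => \sum_i g (U i w)).
  by apply: measurable_sum => i; exact: measurableT_comp mg _.
have -> : [set w | n%:R * m + s <= \sum_i Num.min (f (U i w)) M] =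
  (fun w => \sum_i g (U i w)) @^-1` [set` `[n%:R * m + s, +oo[%R].
  by apply/seteqP; split => w /=; rewrite in_itv/= andbT.
exact: mS.
Qed.

Lemma clipped_bernstein :
  (P [set w | (n%:R * m + s <= \sum_i Num.min (f (U i w)) M)%R] <=
   (expR (n%:R * (2 * lam ^+ 2 * v) - lam * s))%:E)%E.
Proof.
have mE := measurable_clipped.
have := @integral_indic _ T R P setT measurableT _ mE; rewrite setIT => <-.
pose e0 := expR (- (lam * (n%:R * m + s))).
have mS : measurable_fun setT (fun w => (expR (lam * \sum_i g (U i w)))%:E).
  apply/measurable_EFinP; apply: measurableT_comp => //; apply: measurable_funM => //.
  by apply: measurable_sum => i; exact: measurableT_comp mg _.
apply: (@le_trans _ _ (\int[P]_w (e0%:E * (expR (lam * \sum_i g (U i w)))%:E))%E).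
  apply: ge0_le_integral => //.
  - by apply/measurable_EFinP; exact: measurable_indic.
  - exact: measurable_funeM.
  move=> w _; rewrite indicE -EFinM lee_fin /e0 -expRD.
  case: (boolP (w \in _)) => [|_]; last exact: expR_ge0.
  rewrite inE /= => h; rewrite -[leLHS]expR0 ler_expR addrC subr_ge0.
  by rewrite ler_wpM2l ?(ltW lam0).
rewrite ge0_integralZl//; last by rewrite lee_fin expR_ge0.
apply: le_trans (lee_wpmul2l _ clipped_mgf_sum) _; first by rewrite lee_fin expR_ge0.
rewrite -EFinM lee_fin /e0 -expRD ler_expR le_eqVlt; apply/orP; left; apply/eqP; ring.
Qed.

End ClippedBernstein.

Section Concentration.
Context {R : realType} {d : measure_display} {T : measurableType d} (P : probability T R).
Context {d1 : measure_display} {T1 : measurableType d1} {n : nat}.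
Variables (U : 'I_n -> {RV P >-> T1}) (i1 : 'I_n).
Hypothesis iid_U : iid U.
Context {K : finType}.
Variables (f : K -> T1 -> R) (v theta : R).
Hypothesis mf : forall k, measurable_fun setT (f k).
Hypothesis f1i : forall k, integrableR P (fun w => f k (U i1 w)).
Hypothesis f2i : forall k, integrableR P (fun w => f k (U i1 w) ^+ 2).
Hypothesis fv : forall k, expect P (fun w => f k (U i1 w) ^+ 2) <= v.
Hypotheses (v0 : 0 < v) (theta0 : 0 < theta).

(** Bernstein's inequality with [lam = sqrt (theta / (n v))], clipping at [1 / (2 lam)] and
    deviation [3 theta / lam], which give the exponent [2 theta - 3 theta]. The exceptional event
    concerns clipped sums; boundedness is asked only of the outcome at hand. *)
Lemma concentration : exists B, [/\ measurable B,
  (P B <= (#|K|%:R * (2 * expR (- theta)))%:E)%E &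
  forall w, ~ B w -> forall k, (forall i, `|f k (U i w)| <= 2^-1 * Num.sqrt (n%:R * v / theta)) ->
    `|n%:R^-1 * \sum_i f k (U i w) - expect P (fun w => f k (U i1 w))| <=
      3 * Num.sqrt (theta * v / n%:R)].
Proof.
have n0 : 0 < n%:R :> R by rewrite ltr0n (leq_trans _ (ltn_ord i1)).
pose lam := Num.sqrt (theta / (n%:R * v)).
pose M := 2^-1 * Num.sqrt (n%:R * v / theta).
pose s := 3 * Num.sqrt (theta * v * n%:R).
have nv0 : 0 < n%:R * v by exact: mulr_gt0.
have lam0 : 0 < lam by rewrite sqrtr_gt0 divr_gt0.
have M0 : 0 <= M by rewrite mulr_ge0 ?sqrtr_ge0.
have lamM : lam * M <= 2^-1.
  rewrite /lam /M mulrCA -sqrtrM ?divr_ge0 ?(ltW theta0) ?(ltW nv0)//.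
  have -> : theta / (n%:R * v) * (n%:R * v / theta) = 1 by field; rewrite !gt_eqF.
  by rewrite sqrtr1 mulr1.
have lams : lam * s = 3 * theta.
  rewrite /lam /s mulrCA -sqrtrM ?divr_ge0 ?(ltW theta0) ?(ltW nv0)//.
  have -> : theta / (n%:R * v) * (theta * v * n%:R) = theta ^+ 2 by field; rewrite !gt_eqF.
  by rewrite sqrtr_sqr gtr0_norm.
have lam2 : n%:R * (2 * lam ^+ 2 * v) = 2 * theta.
  by rewrite /lam sqr_sqrtr ?divr_ge0 ?(ltW theta0) ?(ltW nv0)//; field; rewrite !gt_eqF.
have sn : s / n%:R = 3 * Num.sqrt (theta * v / n%:R).
  rewrite /s -mulrA; congr (_ * _).
  have -> : theta * v / n%:R = theta * v * n%:R * n%:R^-1 ^+ 2 by field; rewrite gt_eqF.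
  by rewrite [in RHS]sqrtrM ?mulr_ge0 ?(ltW theta0) ?(ltW v0) ?(ltW n0)// sqrtr_sqr ger0_norm// invr_ge0 ltW.
(* Both signs of each function are included to obtain two-sided deviations from a one-sided bound;
   hence the factor 2 in the probability. *)
pose sg (b : bool) (k : K) (y : T1) := (-1) ^+ b * f k y.
have msg b k : measurable_fun setT (sg b k) by exact: measurable_funM.
have sg1 b k : integrableR P (fun w => sg b k (U i1 w)) by exact: integrableRZ.
have sg2E b k : (fun w => sg b k (U i1 w) ^+ 2) = (fun w => f k (U i1 w) ^+ 2).
  by apply/funext => w; rewrite /sg exprMn sqrr_sign mul1r.
have sg2 b k : integrableR P (fun w => sg b k (U i1 w) ^+ 2) by rewrite sg2E.
have sgv b k : expect P (fun w => sg b k (U i1 w) ^+ 2) <= v by rewrite sg2E.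
pose E (kb : K * bool) := [set w | n%:R * expect P (fun w => sg kb.2 kb.1 (U i1 w)) + s <=
   \sum_i Num.min (sg kb.2 kb.1 (U i w)) M].
have mE kb : measurable (E kb) by exact: measurable_clipped.
have PE kb : (P (E kb) <= (expR (- theta))%:E)%E.
  apply: le_trans (@clipped_bernstein R _ _ P _ _ _ U i1 iid_U (sg kb.2 kb.1) v lam M s
     (msg _ _) (sg1 _ _) (sg2 _ _) (sgv _ _) lam0 M0 lamM) _.
  rewrite lam2 lams lee_fin ler_expR; lra.
exists (\bigcup_(kb in [set: K * bool]) E kb); split.
- by apply: fin_bigcup_measurable => [|kb _]; [exact: finite_finset|exact: mE].
- apply: le_trans (union_bound mE PE) _.
  by rewrite card_prod card_bool natrM lee_fin -mulrA.
move=> w nB k fM.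
have key b : \sum_i sg b k (U i w) < n%:R * expect P (fun w => sg b k (U i1 w)) + s.
  rewrite ltNge; apply/negP => h; apply: nB; exists (k, b) => //=.
  rewrite /E/=; apply: le_trans h _; apply: ler_sum => i _; rewrite le_min lexx /=.
  apply: le_trans (fM i); rewrite /sg; apply: le_trans (ler_norm _) _.
  by rewrite normrM normr_sign mul1r.
rewrite -sn; have := key false; have := key true.
rewrite /sg expr1 expr0 -!mulr_sumr !expectZ// => h1 h2.
rewrite ler_norml -(ler_pM2r n0) -[X in _ && X](ler_pM2r n0) mulNr divfK ?gt_eqF//.
rewrite mulrBl mulrAC mulVf ?gt_eqF// mul1r.
apply/andP; split; lra.
Qed.

End Concentration.

(** * Moments of a subgaussian vector *)

Section VectorLaw.
Context {R : realType} {d : measure_display} {T : measurableType d} (P : probability T R).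
Context {p : nat} (X : {RV P >-> p.-tuple R}).
Local Notation Y := (fun k w => tnth (X w) k).

Lemma measurable_coord k : measurable_fun setT (Y k).
Proof.
exact: (measurableT_comp (@measurable_tnth _ _ _ k) (@measurable_funPT _ _ _ _ X)).
Qed.

Lemma max_moment_expect (m : nat) (M : R) k : 0 <= M ->
  (max_moment P X m.+1%:R <= M%:E)%E ->
  (\int[P]_w (`|Y k w| ^+ m.+1)%:E <= (M ^+ m.+1)%:E)%E.
Proof.
move=> M0 h.
have hk : (Lnorm P m.+1%:R%:E (fun w => (Y k w)%:E) <= M%:E)%E.
  by apply: le_trans h; rewrite /max_moment; exact: le_bigmax.
have m0 : m.+1%:R != 0 :> R by rewrite pnatr_eq0.
have := poweR_Lnorm P (fun w => (Y k w)%:E) m0.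
have -> : (\int[P]_x (`|(Y k x)%:E| `^ (m.+1%:R : R)) = \int[P]_w (`|Y k w| ^+ m.+1)%:E)%E.
  by apply: eq_integral => w _; rewrite /= powR_mulrn.
move=> <-; rewrite -powR_mulrn// -poweR_EFin.
by apply: gt0_ler_poweR => //; rewrite in_itv/= ?leey ?andbT ?lee_fin// Lnorm_ge0.
Qed.

Variables (nu : R).
Hypothesis nu1 : 1 <= nu.
Hypothesis sub : forall k, subgaussian P (nu ^+ 2) (Y k).

Let nu0 : 0 < nu := lt_le_trans ltr01 nu1.

Lemma subgaussian_int k : integrableR P (fun w => expR (Y k w ^+ 2 / nu ^+ 2)).
Proof.
apply: integrableR_ge0 => [|w|]; last first.
- by have := sub k; rewrite /subgaussian unlock => /le_lt_trans; apply; exact: ltry.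
- exact: expR_ge0.
apply: measurableT_comp (@measurable_expR R) _; apply: measurable_funM => //.
by apply: measurable_funX; exact: measurable_coord.
Qed.

Lemma subgaussian_expect k : expect P (fun w => expR (Y k w ^+ 2 / nu ^+ 2)) <= Num.sqrt 2.
Proof.
by have := sub k; rewrite /subgaussian unlock -lee_fin -(expectE (subgaussian_int k)).
Qed.

(** By [q <= 1 + q^2] for [q = |Y|^m], it is enough to dominate even powers, and these are dominated
    by the exponential of the square. *)
Lemma coord_pow_int k m : integrableR P (fun w => `|Y k w| ^+ m).
Proof.
apply: (@integrableR_dom _ _ _ P _ (fun w => 1 + nu ^+ (2 * m) * (m`!%:R * expR (Y k w ^+ 2 / nu ^+ 2)))).
- apply: measurable_funX; apply: measurableT_comp (@normr_measurable R setT) _.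
  exact: measurable_coord.
- move=> w; rewrite normrX normr_id; set a := tnth _ _.
  have z0 : 0 <= a ^+ 2 / nu ^+ 2 by rewrite divr_ge0 ?sqr_ge0.
  have h := expR_ge_pow m z0.
  apply: (@le_trans _ _ (1 + nu ^+ (2 * m) * (a ^+ 2 / nu ^+ 2) ^+ m)); last first.
    by rewrite lerD2l ler_wpM2l// exprn_ge0// ltW.
  have -> : nu ^+ (2 * m) * (a ^+ 2 / nu ^+ 2) ^+ m = `|a| ^+ m * `|a| ^+ m.
    rewrite exprM -exprMn mulrCA divff ?mulr1 ?gt_eqF ?exprn_gt0//.
    by rewrite -exprMn -normrM -expr2 ger0_norm ?sqr_ge0.
  have q0 : 0 <= `|a| ^+ m by exact: exprn_ge0.
  set q := `|a| ^+ m in q0 *; rewrite -subr_ge0.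
  have -> : 1 + q * q - q = (q - 2^-1) ^+ 2 + 3 / 4 by field.
  by rewrite addr_ge0 ?sqr_ge0.
apply: integrableRD; first exact: integrableR_cst.
by apply: integrableRZ; apply: integrableRZ; exact: subgaussian_int.
Qed.

Lemma coord_int k : integrableR P (Y k).
Proof.
apply: (integrableR_dom _ _ (coord_pow_int k 1)) => [|w]; first exact: measurable_coord.
by rewrite expr1.
Qed.

Lemma measurable_coordM j k : measurable_fun setT (fun w => Y j w * Y k w).
Proof. by apply: measurable_funM; exact: measurable_coord. Qed.

Lemma prod2_le (a b : R) m : `|a * b| ^+ m <= `|a| ^+ (2 * m) + `|b| ^+ (2 * m).
Proof.
rewrite normrM exprMn mulnC !exprM.
have := normr_ge0 a; have := normr_ge0 b.
move=> /(exprn_ge0 m); set y := _ ^+ m; move=> y0 /(exprn_ge0 m); set x := _ ^+ m => x0.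
rewrite -subr_ge0; have -> : x ^+ 2 + y ^+ 2 - x * y = (x - y) ^+ 2 + x * y by ring.
by rewrite addr_ge0 ?sqr_ge0 ?mulr_ge0.
Qed.

Lemma prod2_pow_int j k m : integrableR P (fun w => `|Y j w * Y k w| ^+ m).
Proof.
apply: (@integrableR_dom _ _ _ P _ (fun w => `|Y j w| ^+ (2 * m) + `|Y k w| ^+ (2 * m))).
- apply: measurable_funX; apply: measurableT_comp (@normr_measurable R setT) _.
  exact: measurable_coordM.
- by move=> w; rewrite normrX normr_id prod2_le.
by apply: integrableRD; exact: coord_pow_int.
Qed.

Lemma prod2_int j k : integrableR P (fun w => Y j w * Y k w).
Proof.
apply: (integrableR_dom _ _ (prod2_pow_int j k 1)) => [|w]; first exact: measurable_coordM.
by rewrite expr1.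
Qed.

Lemma prod4_pow_int j k l m q :
  integrableR P (fun w => `|Y j w * Y k w * (Y l w * Y m w)| ^+ q).
Proof.
apply: (@integrableR_dom _ _ _ P _
  (fun w => `|Y j w * Y k w| ^+ (2 * q) + `|Y l w * Y m w| ^+ (2 * q))).
- apply: measurable_funX; apply: measurableT_comp (@normr_measurable R setT) _.
  by apply: measurable_funM; exact: measurable_coordM.
- by move=> w; rewrite normrX normr_id prod2_le.
by apply: integrableRD; exact: prod2_pow_int.
Qed.

Lemma prod4_int j k l m : integrableR P (fun w => Y j w * Y k w * (Y l w * Y m w)).
Proof.
apply: (integrableR_dom _ _ (prod4_pow_int j k l m 1)) => [|w].
  by apply: measurable_funM; exact: measurable_coordM.
by rewrite expr1.
Qed.

Lemma expect_prod2_pow j k m :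
  expect P (fun w => `|Y j w * Y k w| ^+ m) <=
  expect P (fun w => `|Y j w| ^+ (2 * m)) + expect P (fun w => `|Y k w| ^+ (2 * m)).
Proof.
have i1 := coord_pow_int j (2 * m); have i2 := coord_pow_int k (2 * m).
rewrite -(expectD i1 i2); apply: le_expect => [||w]; last exact: prod2_le.
  exact: prod2_pow_int.
exact: integrableRD.
Qed.

Lemma expect_prod4_pow j k l m q :
  expect P (fun w => `|Y j w * Y k w * (Y l w * Y m w)| ^+ q) <=
  expect P (fun w => `|Y j w * Y k w| ^+ (2 * q)) + expect P (fun w => `|Y l w * Y m w| ^+ (2 * q)).
Proof.
have i1 := prod2_pow_int j k (2 * q); have i2 := prod2_pow_int l m (2 * q).
rewrite -(expectD i1 i2); apply: le_expect => [||w]; last exact: prod2_le.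
  exact: prod4_pow_int.
exact: integrableRD.
Qed.

Section Moments.
Variables (u C2 C3 : R).
Hypotheses (u1 : 1 <= u) (uE : u ^+ 3 = nu ^+ 2) (C20 : 0 < C2) (C30 : 0 < C3).
Hypothesis h6 : (max_moment P X 6 <= (C2 * nu `^ (1 / 3))%:E)%E.
Hypothesis h8 : (max_moment P X 8 <= (C3 * nu `^ (1 / 2))%:E)%E.
(** The 2 absorbs the two interpolation steps from order 6 down to order 2. *)
Let c := C2 ^+ 6 + C3 ^+ 8 + 2.

Lemma moment8 k : expect P (fun w => `|Y k w| ^+ 8) <= c * u ^+ 6.
Proof.
have M0 : 0 <= C3 * nu `^ (1 / 2) by rewrite mulr_ge0 ?powR_ge0// ltW.
have := max_moment_expect k M0 h8; rewrite (expectE (coord_pow_int k 8)) lee_fin => /le_trans; apply.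
rewrite exprMn -[(nu `^ _) ^+ _]powR_mulrn ?powR_ge0// -powRrM.
have -> : 1 / 2 * 8 = 4%:R :> R by field.
rewrite powR_mulrn ?(ltW nu0)//.
have -> : u ^+ 6 = nu ^+ 4 by rewrite (exprM u 3 2) uE -exprM.
rewrite ler_wpM2r ?exprn_ge0 ?(ltW nu0)// /c.
have := exprn_ge0 6 (ltW C20); lra.
Qed.

Lemma moment6 k : expect P (fun w => `|Y k w| ^+ 6) <= C2 ^+ 6 * u ^+ 3.
Proof.
have M0 : 0 <= C2 * nu `^ (1 / 3) by rewrite mulr_ge0 ?powR_ge0// ltW.
have := max_moment_expect k M0 h6; rewrite (expectE (coord_pow_int k 6)) lee_fin => /le_trans; apply.
rewrite exprMn -[(nu `^ _) ^+ _]powR_mulrn ?powR_ge0// -powRrM.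
have -> : 1 / 3 * 6 = 2%:R :> R by field.
by rewrite powR_mulrn ?(ltW nu0)// uE.
Qed.

Let u0 : 0 < u := lt_le_trans ltr01 u1.

(** Interpolation at the level [u]: [a^4] is at most [u^2] if [a^2 <= u], and at most [a^6 / u]
    otherwise. *)
Lemma moment4 k : expect P (fun w => `|Y k w| ^+ 4) <= (C2 ^+ 6 + 1) * u ^+ 2.
Proof.
have i6 := coord_pow_int k 6; have i4 := coord_pow_int k 4.
have ic := integrableR_cst P (u ^+ 2).
have := le_expect i4 (integrableRD (integrableRZ u^-1 i6) ic).
rewrite (expectD (integrableRZ u^-1 i6) ic) (expectZ _ i6) (expect_cst P (u ^+ 2)).
move=> /(_ _)/le_trans; apply; last first.
  rewrite mulrDl mul1r lerD2r ler_pdivrMl//; apply: le_trans (moment6 k) _.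
  by rewrite le_eqVlt; apply/orP; left; apply/eqP; ring.
move=> w; set a := `|_|.
have E : u^-1 * a ^+ 6 = a ^+ 4 * (a ^+ 2 / u) by field; rewrite gt_eqF.
have [l|l] := leP (a ^+ 2) u.
  apply: (@le_trans _ _ (u ^+ 2)).
    by rewrite (exprM a 2 2) lerXn2r ?nnegrE ?sqr_ge0 ?(ltW u0).
  by rewrite lerDr E mulr_ge0 ?exprn_even_ge0// divr_ge0 ?sqr_ge0 ?(ltW u0).
rewrite E -[leLHS]addr0 lerD ?sqr_ge0// ler_peMr ?exprn_even_ge0//.
by rewrite ler_pdivlMr// mul1r ltW.
Qed.

Lemma moment2 k : expect P (fun w => `|Y k w| ^+ 2) <= c * u.
Proof.
have i4 := coord_pow_int k 4; have i2 := coord_pow_int k 2.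
have ic := integrableR_cst P u.
have := le_expect i2 (integrableRD (integrableRZ u^-1 i4) ic).
rewrite (expectD (integrableRZ u^-1 i4) ic) (expectZ _ i4) (expect_cst P u).
move=> /(_ _)/le_trans; apply; last first.
  apply: (@le_trans _ _ ((C2 ^+ 6 + 1) * u + u)).
    rewrite lerD2r ler_pdivrMl//; apply: le_trans (moment4 k) _.
    by rewrite le_eqVlt; apply/orP; left; apply/eqP; ring.
  rewrite /c; have := exprn_ge0 8 (ltW C30).
  by move=> /(mulr_ge0 (ltW u0)); lra.
move=> w; set a := `|_|.
have E : u^-1 * a ^+ 4 = a ^+ 2 * (a ^+ 2 / u) by field; rewrite gt_eqF.
have [l|l] := leP (a ^+ 2) u.
  apply: le_trans l _.
  by rewrite lerDr E mulr_ge0 ?sqr_ge0// divr_ge0 ?sqr_ge0 ?(ltW u0).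
rewrite E -[leLHS]addr0 lerD ?(ltW u0)// ler_peMr ?sqr_ge0//.
by rewrite ler_pdivlMr// mul1r ltW.
Qed.

Lemma moment4c k : expect P (fun w => `|Y k w| ^+ 4) <= c * u ^+ 2.
Proof.
apply: le_trans (moment4 k) _; rewrite ler_wpM2r ?sqr_ge0// /c.
have := exprn_ge0 8 (ltW C30); lra.
Qed.

Lemma moment6c k : expect P (fun w => `|Y k w| ^+ 6) <= c * u ^+ 3.
Proof.
apply: le_trans (moment6 k) _; rewrite ler_wpM2r ?exprn_ge0 ?(ltW u0)// /c.
have := exprn_ge0 8 (ltW C30); lra.
Qed.

End Moments.

Hypothesis mean0 : forall k, ('E_P[Y k] = 0)%E.

Lemma expect_coord k : expect P (Y k) = 0.
Proof. by have := mean0 k; rewrite unlock => /expect_eq. Qed.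

Lemma cov_mxE j k : cov_mx P X j k = expect P (fun w => Y j w * Y k w).
Proof.
have m l : ('E_P[fun w => tnth (X w) l] = 0)%E := mean0 l.
rewrite /cov_mx mxE unlock !m unlock /=; congr fine.
apply: eq_integral => w _; congr EFin.
by transitivity ((tnth (X w) j - 0) * (tnth (X w) k - 0)) => //; rewrite !subr0.
Qed.

Lemma hajekE x j k : hajek P X x j k = (x j 0 * x k 0 - cov_mx P X j k) / 2.
Proof.
have E : fine ('E_P[fun w => cov_kernel x (vec (X w)) j k])%E =
  expect P (fun w => (2^-1 * (x j 0 * x k 0) + (- (2^-1 * x j 0) * Y k w)) +
      (- (2^-1 * x k 0) * Y j w + 2^-1 * (Y j w * Y k w))).
  rewrite unlock; congr fine; apply: eq_integral => w _; congr EFin.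
  by rewrite /cov_kernel mxE outerE !mxE; ring.
rewrite /hajek mxE [X in X + _]mxE [X in _ + X]mxE E.
have c1 := integrableR_cst P (2^-1 * (x j 0 * x k 0)).
have i1 := integrableRZ (- (2^-1 * x j 0)) (coord_int k).
have i2 := integrableRZ (- (2^-1 * x k 0)) (coord_int j).
have i3 := integrableRZ 2^-1 (prod2_int j k).
rewrite (expectD (integrableRD c1 i1) (integrableRD i2 i3)) (expectD c1 i1) (expectD i2 i3).
rewrite (expect_cst P (2^-1 * (x j 0 * x k 0))) !(expectZ _ (coord_int _)) !expect_coord.
by rewrite (expectZ _ (prod2_int j k)) -cov_mxE; field.
Qed.

(** The factor 1/4 stems from the half in the kernel and is why lower bounds on this variance
    reappear as [4 * C1]. *)
Lemma hajek_covE j k : hajek_cov P X (j, k) (j, k) =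
  (4^-1 * (expect P (fun w => Y j w * Y k w * (Y j w * Y k w)) - cov_mx P X j k ^+ 2))%:E.
Proof.
have E w : hajek P X (vec (X w)) j k = 2^-1 * (Y j w * Y k w) - 2^-1 * cov_mx P X j k.
  by rewrite hajekE !mxE; field.
have i2 := prod2_int j k; have ic := integrableR_cst P (2^-1 * cov_mx P X j k).
have i4 := prod4_int j k j k.
have m0 : expect P (fun w => hajek P X (vec (X w)) j k) = 0.
  rewrite (_ : (fun w => _) = (fun w => 2^-1 * (Y j w * Y k w) - 2^-1 * cov_mx P X j k)); last exact/funext.
  rewrite (expectB (integrableRZ 2^-1 i2) ic) (expectZ _ i2) (expect_cst P (2^-1 * cov_mx P X j k)).
  by rewrite -cov_mxE subrr.
rewrite /hajek_cov unlock /= unlock.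
rewrite -[fine _]/(expect P _) m0.
pose S := cov_mx P X j k.
transitivity (\int[P]_w (4^-1 * (Y j w * Y k w * (Y j w * Y k w)) +
    (- (2^-1 * S) * (Y j w * Y k w) + 4^-1 * S ^+ 2))%:E)%E.
  apply: eq_integral => w _; congr EFin.
  transitivity ((hajek P X (vec (X w)) j k - 0) * (hajek P X (vec (X w)) j k - 0)) => //.
  by rewrite !subr0 E -/S; field.
have j1 := integrableRZ 4^-1 i4; have j2 := integrableRZ (- (2^-1 * S)) i2.
have jc := integrableR_cst P (4^-1 * S ^+ 2).
rewrite (expectE (integrableRD j1 (integrableRD j2 jc))); congr EFin.
rewrite (expectD j1 (integrableRD j2 jc)) (expectD j2 jc) (expect_cst P (4^-1 * S ^+ 2)).
by rewrite (expectZ _ i4) (expectZ _ i2) -cov_mxE -/S; field.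
Qed.

End VectorLaw.

(** * Probability of a good sample *)

Section GoodEvent.
Context {R : realType} {d : measure_display} {T : measurableType d} (P : probability T R).
Context {n p : nat} (X : 'I_n -> {RV P >-> p.-tuple R}) (i1 : 'I_n).
Hypothesis iid_X : iid X.
Local Notation Y := (fun k w => tnth (X i1 w) k).
Variables (nu u c ell : R).
Hypotheses (nu1 : 1 <= nu) (u1 : 1 <= u) (uE : u ^+ 3 = nu ^+ 2) (c1 : 1 <= c).
Hypothesis p0 : (0 < p)%N.
Hypothesis sub : forall i k, subgaussian P (nu ^+ 2) (fun w => tnth (X i w) k).
Hypothesis mean0 : forall k, ('E_P[Y k] = 0)%E.
Hypothesis mom2 : forall k, expect P (fun w => `|Y k w| ^+ 2) <= c * u.
Hypothesis mom4 : forall k, expect P (fun w => `|Y k w| ^+ 4) <= c * u ^+ 2.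
Hypothesis mom8 : forall k, expect P (fun w => `|Y k w| ^+ 8) <= c * u ^+ 6.
Hypotheses (ellE : ell = ln (n * p)%:R) (ell1 : 1 <= ell).
Hypothesis large_n : 80 * u ^+ 6 * ell ^+ 5 <= n%:R.

(** The factor 5 makes each deviation event as rare as [(n p)^-5], enough for a union over [p^4]
    quadruples of indices. *)
Definition sample_eps (l : R) : R := Num.sqrt (5 * l / n%:R).
Definition fourth_mx j k l m : R := expect P (fun w => Y j w * Y k w * (Y l w * Y m w)).

Let n0 : 0 < n%:R :> R. Proof. by rewrite ltr0n (leq_trans _ (ltn_ord i1)). Qed.
Let pR0 : 0 < p%:R :> R. Proof. by rewrite ltr0n. Qed.
Let nu0 : 0 < nu := lt_le_trans ltr01 nu1.
Let u0 : 0 < u := lt_le_trans ltr01 u1.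
Let c0 : 0 < c := lt_le_trans ltr01 c1.
Let ell0 : 0 < ell := lt_le_trans ltr01 ell1.
Let N : R := (n * p)%:R.
Let N0 : 0 < N. Proof. by rewrite /N natrM mulr_gt0. Qed.
Let expell : expR ell = N. Proof. by rewrite ellE lnK. Qed.
Let subi1 := sub i1.

Let le_pow (a b : nat) : (a <= b)%N -> u ^+ a <= u ^+ b.
Proof. by move=> ab; rewrite ler_weXn2l. Qed.

Let le_powl (a b : nat) : (a <= b)%N -> ell ^+ a <= ell ^+ b.
Proof. by move=> ab; rewrite ler_weXn2l. Qed.

Let large (a b : nat) (K : R) : (a <= 6)%N -> (b <= 5)%N -> 0 <= K -> K <= 80 ->
  K * u ^+ a * ell ^+ b <= n%:R * c.
Proof.
move=> a6 b5 K0 K80; apply: (@le_trans _ _ (80 * u ^+ 6 * ell ^+ 5)).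
  by rewrite !ler_pM ?mulr_ge0 ?exprn_ge0 ?(ltW u0) ?(ltW ell0) ?le_pow ?le_powl.
by apply: le_trans large_n _; rewrite ler_peMr// ltW.
Qed.

Lemma cov_le j k : `|cov_mx P (X i1) j k| <= 6 * c * u.
Proof.
have i2 := prod2_int nu1 subi1 j k.
rewrite (cov_mxE mean0); apply: le_trans (expect_norm i2) _.
have := expect_prod2_pow nu1 subi1 j k 1.
have -> : (fun w => `|Y j w * Y k w| ^+ 1) = (fun w => `|Y j w * Y k w|).
  by apply/funext => w; rewrite expr1.
move=> /le_trans; apply; rewrite -[(2 * 1)%N]/2%N.
have := mom2 j; have := mom2 k; have := mulr_ge0 (ltW c0) (ltW u0); lra.
Qed.

Lemma fourth_le j k l m : `|fourth_mx j k l m| <= 6 * c * u ^+ 2.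
Proof.
have i4 := prod4_int nu1 subi1 j k l m.
apply: le_trans (expect_norm i4) _.
have := expect_prod4_pow nu1 subi1 j k l m 1.
have -> : (fun w => `|Y j w * Y k w * (Y l w * Y m w)| ^+ 1) =
  (fun w => `|Y j w * Y k w * (Y l w * Y m w)|) by apply/funext => w; rewrite expr1.
move=> /le_trans; apply.
have h1 := expect_prod2_pow nu1 subi1 j k 2; have h2 := expect_prod2_pow nu1 subi1 l m 2.
have := mom4 j; have := mom4 k; have := mom4 l; have := mom4 m.
have := mulr_ge0 (ltW c0) (sqr_ge0 u); rewrite -[(2 * 1)%N]/2%N.
rewrite -[(2 * 2)%N]/4%N in h1 h2; lra.
Qed.

Lemma sample_eps_small : [/\ 0 <= sample_eps ell, u ^+ 3 * sample_eps ell <= 1 &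
   n%:R^-1 <= sample_eps ell ^+ 2].
Proof.
have q : 0 <= 5 * ell / n%:R by rewrite divr_ge0 ?mulr_ge0 ?(ltW ell0) ?(ltW n0).
split; first exact: sqrtr_ge0.
  have e0 : 0 <= u ^+ 3 * sample_eps ell by rewrite mulr_ge0 ?sqrtr_ge0// exprn_ge0// ltW.
  rewrite -(@ler_pXn2r _ 2) ?nnegrE// expr1n /sample_eps exprMn sqr_sqrtr// mulrA.
  rewrite ler_pdivrMr// mul1r; apply: le_trans large_n.
  have -> : (u ^+ 3) ^+ 2 * (5 * ell) = 5 * u ^+ 6 * ell ^+ 1 by ring.
  rewrite ler_pM ?mulr_ge0 ?exprn_ge0 ?(ltW u0) ?(ltW ell0) ?le_powl//.
  by rewrite ler_wpM2r ?exprn_ge0 ?(ltW u0)// ler_nat.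
rewrite /sample_eps sqr_sqrtr// -[leLHS]mul1r ler_wpM2r ?invr_ge0 ?(ltW n0)//.
by have := ell1; lra.
Qed.

Let clip (a v : R) : 0 <= a -> 0 < v -> 20 * ell * a ^+ 2 <= n%:R * v ->
  a <= 2^-1 * Num.sqrt (n%:R * v / (5 * ell)).
Proof.
move=> a0 v0 h; rewrite mulrC ler_pdivlMr// -[leLHS]ger0_norm ?mulr_ge0//.
rewrite -sqrtr_sqr ler_sqrt ?divr_ge0 ?mulr_ge0 ?(ltW n0) ?(ltW v0) ?(ltW ell0)//.
rewrite ler_pdivlMr ?mulr_gt0//; apply: le_trans h.
by rewrite le_eqVlt; apply/orP; left; apply/eqP; ring.
Qed.

Let dev (v s : R) : 0 <= s -> 0 <= v -> v <= s ^+ 2 -> 3 * Num.sqrt (5 * ell * v / n%:R) <= 3 * s * sample_eps ell.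
Proof.
move=> s0 v0 vs; rewrite -[3 * s * _]mulrA ler_wpM2l//.
have -> : 5 * ell * v / n%:R = v * (5 * ell / n%:R) by rewrite mulrAC [RHS]mulrC.
rewrite sqrtrM// ler_wpM2r ?sqrtr_ge0//.
by rewrite -[leRHS]ger0_norm// -sqrtr_sqr ler_sqrt ?sqr_ge0.
Qed.

(** An entry exceeds this level with probability at most [sqrt 2 / (n p)^2], small enough for a
    union over all [n p] entries. *)
Let bound : R := nu * Num.sqrt (2 * ell).

Let bound0 : 0 <= bound. Proof. by rewrite mulr_ge0 ?sqrtr_ge0 ?(ltW nu0). Qed.
Let bound2 : bound ^+ 2 = 2 * u ^+ 3 * ell.
Proof. by rewrite /bound exprMn sqr_sqrtr ?mulr_ge0 ?(ltW ell0)// uE; ring. Qed.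

Let tail i k : measurable [set w | bound < `|tnth (X i w) k|] /\
  (P [set w | (bound < `|tnth (X i w) k|)%R] <= (Num.sqrt 2 / N ^+ 2)%:E)%E.
Proof.
have mE : measurable [set w | bound < `|tnth (X i w) k|].
  rewrite -[X in measurable X]setTI.
  have -> : [set w | bound < `|tnth (X i w) k|] = (fun w => `|tnth (X i w) k|) @^-1` [set` `]bound, +oo[%R].
    by apply/seteqP; split => w /=; rewrite in_itv/= andbT.
  have mm : measurable_fun setT (fun w => `|tnth (X i w) k|).
    by apply: measurableT_comp (@normr_measurable R setT) _; exact: measurable_coord.
  exact: mm.
split=> //.
have := @integral_indic _ T R P setT measurableT _ mE; rewrite setIT => <-.
have isg := subgaussian_int (sub i) k.
apply: (@le_trans _ _ (\int[P]_w ((N ^+ 2)^-1%:E * (expR (tnth (X i w) k ^+ 2 / nu ^+ 2))%:E))%E).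
  apply: ge0_le_integral => //.
  - by apply/measurable_EFinP; exact: measurable_indic.
  - by apply: measurable_funeM; apply/measurable_EFinP; exact: integrableR_measurable isg.
  move=> w _; rewrite indicE -EFinM lee_fin.
  case: (boolP (w \in _)) => [|_]; last by rewrite mulr_ge0 ?expR_ge0// invr_ge0 sqr_ge0.
  rewrite inE /= => h; rewrite mulrC ler_pdivlMr ?exprn_gt0// mul1r.
  rewrite -expell -expRM_natl ler_expR ler_pdivlMr ?exprn_gt0//.
  apply: (@le_trans _ _ (bound ^+ 2)).
    by rewrite bound2 uE; rewrite le_eqVlt; apply/orP; left; apply/eqP; ring.
  by rewrite -[tnth _ _ ^+ 2]real_normK ?num_real// lerXn2r ?nnegrE// ltW.
rewrite ge0_integralZl//; last 2 first.
- by apply/measurable_EFinP; exact: integrableR_measurable isg.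
- by rewrite lee_fin invr_ge0 sqr_ge0.
rewrite (expectE isg) -EFinM lee_fin mulrC ler_wpM2r ?invr_ge0 ?sqr_ge0//.
exact: subgaussian_expect.
Qed.

Let mT (k : 'I_p) : measurable_fun setT (fun y : p.-tuple R => tnth y k).
Proof. exact: measurable_tnth. Qed.

(** Four exceptional events of probability at most [2 / n] each: a large entry, and failed
    concentration for entries, pair products and products of four. Off the first, the data stay
    below the clipping levels of the others. *)
Lemma good_event : exists B, [/\ measurable B, (P B <= (8 / n%:R)%:E)%E &
  forall w, ~ B w -> good_sample (fun j k => cov_mx P (X i1) j k) fourth_mx
     (6 * c) u (sample_eps ell) (fun i => vec (X i w))].
Proof.
have t0 : 0 < 5 * ell by rewrite mulr_gt0.
have v10 : 0 < c * u ^+ 2 by rewrite mulr_gt0 ?exprn_gt0.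
have v20 : 0 < 2 * (c * u ^+ 2) by rewrite mulr_gt0.
have v40 : 0 < 4 * (c * u ^+ 6) by rewrite mulr_gt0// mulr_gt0 ?exprn_gt0.
have sqE (f : T -> R) : (fun w => f w ^+ 2) = (fun w => `|f w| ^+ 2).
  by apply/funext => w; rewrite real_normK ?num_real.
have e4 (k : 'I_p * 'I_p * ('I_p * 'I_p)) : expect P (fun w => (tnth (X i1 w) k.1.1 * tnth (X i1 w) k.1.2 *
    (tnth (X i1 w) k.2.1 * tnth (X i1 w) k.2.2)) ^+ 2) <= 4 * (c * u ^+ 6).
  rewrite sqE; apply: le_trans (expect_prod4_pow nu1 subi1 k.1.1 k.1.2 k.2.1 k.2.2 2) _.
  have g1 := expect_prod2_pow nu1 subi1 k.1.1 k.1.2 4.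
  have g2 := expect_prod2_pow nu1 subi1 k.2.1 k.2.2 4.
  rewrite -[(2 * 4)%N]/8%N in g1 g2; rewrite -[(2 * 2)%N]/4%N.
  have := mom8 k.1.1; have := mom8 k.1.2; have := mom8 k.2.1; have := mom8 k.2.2; lra.
have i1' k : integrableR P (fun w => tnth (X i1 w) k ^+ 2).
  by rewrite sqE; exact: (coord_pow_int nu1 subi1 k 2).
have e1 k : expect P (fun w => tnth (X i1 w) k ^+ 2) <= c * u ^+ 2.
  by rewrite sqE; apply: le_trans (mom2 k) _; rewrite ler_wpM2l ?(ltW c0)// expr2 ler_peMl// ltW.
have [B1 [mB1 PB1 h1]] := @concentration R _ _ P _ _ n X i1 iid_X 'I_p
  (fun k y => tnth y k) (c * u ^+ 2) (5 * ell) mT (coord_int nu1 subi1) i1' e1 v10 t0.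
have i2' (k : 'I_p * 'I_p) : integrableR P (fun w => (tnth (X i1 w) k.1 * tnth (X i1 w) k.2) ^+ 2).
  by rewrite sqE; exact: (prod2_pow_int nu1 subi1 k.1 k.2 2).
have e2 (k : 'I_p * 'I_p) : expect P (fun w => (tnth (X i1 w) k.1 * tnth (X i1 w) k.2) ^+ 2) <= 2 * (c * u ^+ 2).
  rewrite sqE; apply: le_trans (expect_prod2_pow nu1 subi1 k.1 k.2 2) _.
  by rewrite mulrDl mul1r; apply: lerD; exact: mom4.
have [B2 [mB2 PB2 h2]] := @concentration R _ _ P _ _ n X i1 iid_X ('I_p * 'I_p)%type
  (fun k y => tnth y k.1 * tnth y k.2) (2 * (c * u ^+ 2)) (5 * ell)
  (fun k => measurable_funM (mT k.1) (mT k.2)) (fun k => prod2_int nu1 subi1 k.1 k.2) i2' e2 v20 t0.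
have i4' (k : 'I_p * 'I_p * ('I_p * 'I_p)) : integrableR P (fun w => (tnth (X i1 w) k.1.1 * tnth (X i1 w) k.1.2 *
    (tnth (X i1 w) k.2.1 * tnth (X i1 w) k.2.2)) ^+ 2).
  by rewrite sqE; exact: (prod4_pow_int nu1 subi1 k.1.1 k.1.2 k.2.1 k.2.2 2).
have [B4 [mB4 PB4 h4]] := @concentration R _ _ P _ _ n X i1 iid_X ('I_p * 'I_p * ('I_p * 'I_p))%type
  (fun k y => tnth y k.1.1 * tnth y k.1.2 * (tnth y k.2.1 * tnth y k.2.2)) (4 * (c * u ^+ 6)) (5 * ell)
  (fun k => measurable_funM (measurable_funM (mT k.1.1) (mT k.1.2)) (measurable_funM (mT k.2.1) (mT k.2.2)))
  (fun k => prod4_int nu1 subi1 k.1.1 k.1.2 k.2.1 k.2.2)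
  i4' e4 v40 t0.
pose E0 (ik : 'I_n * 'I_p) := [set w | bound < `|tnth (X ik.1 w) ik.2|].
pose B0 := \bigcup_(ik in [set: 'I_n * 'I_p]) E0 ik.
have mB0 : measurable B0.
  apply: fin_bigcup_measurable => [|ik _]; first exact: finite_finset.
  by case: (tail ik.1 ik.2).
have PB0 : (P B0 <= ((n * p)%:R * (Num.sqrt 2 / N ^+ 2))%:E)%E.
  have := @union_bound R _ T P _ E0 (Num.sqrt 2 / N ^+ 2)
    (fun ik => (tail ik.1 ik.2).1) (fun ik => (tail ik.1 ik.2).2).
  by rewrite card_prod !card_ord.
exists (B0 `|` (B1 `|` (B2 `|` B4))); split.
- by apply: measurableU => //; apply: measurableU => //; exact: measurableU.
- apply: le_trans (measureU2 _ _ _) _ => //.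
    by apply: measurableU => //; exact: measurableU.
  apply: le_trans (leeD PB0 (measureU2 _ _ _)) _ => //; first exact: measurableU.
  apply: le_trans (leeD (lexx _) (leeD PB1 (measureU2 _ _ _))) _ => //.
  apply: le_trans (leeD (lexx _) (leeD (lexx _) (leeD PB2 PB4))) _.
  rewrite !card_prod !card_ord -!EFinD lee_fin.
  have eN : expR (- (5 * ell)) = (N ^+ 5)^-1 by rewrite expRN expRM_natl expell.
  rewrite eN.
  have N1 : 1 <= N by rewrite /N ler1n muln_gt0 p0 andbT -(ltr0n R).
  have nR1 : 1 <= n%:R :> R by rewrite ler1n -(ltr0n R).
  have pR1 : 1 <= p%:R :> R by rewrite ler1n.
  have small q : q <= p%:R ^+ 4 -> q * (2 * (N ^+ 5)^-1) <= 2 / n%:R.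
    move=> q4; rewrite mulrA ler_pdivrMr ?exprn_gt0// mulrAC ler_pdivlMr//.
    have -> : N ^+ 5 = n%:R * (n%:R ^+ 4 * p%:R ^+ 5) by rewrite /N natrM; ring.
    have : q <= n%:R ^+ 4 * p%:R ^+ 5.
      apply: le_trans q4 _; rewrite -[leLHS]mul1r ler_pM ?exprn_ge0 ?exprn_ege1//.
      by rewrite ler_weXn2l.
    by move=> /(ler_wpM2l (ltW n0)); lra.
  have s1 := small p%:R; have s2 := small (p * p)%:R; have s4 := small (p * p * (p * p))%:R.
  have {}s1 := s1 (ler_eXnr (isT : (0 < 4)%N) pR1).
  have p2 : (p * p)%:R <= p%:R ^+ 4 :> R by rewrite natrM -expr2 ler_weXn2l.
  have p4 : (p * p * (p * p))%:R <= p%:R ^+ 4 :> R.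
    by rewrite !natrM le_eqVlt; apply/orP; left; apply/eqP; ring.
  have {}s2 := s2 p2; have {}s4 := s4 p4.
  have s0 : (n * p)%:R * (Num.sqrt 2 / N ^+ 2) <= 2 / n%:R.
    rewrite mulrA ler_pdivrMr ?exprn_gt0// mulrAC ler_pdivlMr// -/N.
    have sq2 := @sqrt2_le2 R.
    have h : Num.sqrt 2 * n%:R <= 2 * N.
      by rewrite ler_pM ?sqrtr_ge0 ?(ltW n0)// /N natrM ler_peMr// ltW.
    by have := ler_wpM2l (ltW N0) h; lra.
  lra.
move=> w nB.
have n0B : ~ B0 w by move=> h; apply: nB; left.
have n1B : ~ B1 w by move=> h; apply: nB; right; left.
have n2B : ~ B2 w by move=> h; apply: nB; right; right; left.
have n4B : ~ B4 w by move=> h; apply: nB; right; right; right.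
have bd i k : `|tnth (X i w) k| <= bound.
  by rewrite leNgt; apply/negP => h; apply: n0B; exists (i, k).
have bd2 i j k : `|tnth (X i w) j * tnth (X i w) k| <= bound ^+ 2.
  by rewrite normrM expr2; apply: ler_pM.
have bd4 i j k l m : `|tnth (X i w) j * tnth (X i w) k * (tnth (X i w) l * tnth (X i w) m)| <= bound ^+ 4.
  by rewrite normrM (exprD _ 2 2); apply: ler_pM.
have sc : 0 <= c * u by rewrite mulr_ge0// ltW.
have e0 := sqrtr_ge0 (5 * ell / n%:R); rewrite -/(sample_eps ell) in e0.
split=> [j|j k|j k l m].
- have k1 : forall i, `|tnth (X i w) j| <= 2^-1 * Num.sqrt (n%:R * (c * u ^+ 2) / (5 * ell)).
    move=> i; apply: le_trans (bd i j) _; apply: clip => //; rewrite bound2.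
    have -> : 20 * ell * (2 * u ^+ 3 * ell) = 40 * u ^+ 1 * ell ^+ 2 * u ^+ 2 by ring.
    rewrite [leRHS]mulrA ler_wpM2r ?sqr_ge0//; apply: large => //.
    by rewrite ler_nat.
  have := h1 w n1B j k1.
  rewrite -[expect _ _]/(expect P (Y j)) (expect_coord mean0) subr0.
  have -> : emp_mean (fun i => vec (X i w)) j = n%:R^-1 * \sum_i tnth (X i w) j.
    by congr (_ * _); apply: eq_bigr => i _; rewrite mxE.
  move=> /le_trans; apply.
  have vs : c * u ^+ 2 <= (c * u) ^+ 2.
    by rewrite exprMn ler_wpM2r ?sqr_ge0// expr2 ler_peMl// ltW.
  apply: le_trans (dev sc (ltW v10) vs) _; rewrite ler_wpM2r//; lra.
- have k2 : forall i, `|tnth (X i w) j * tnth (X i w) k| <= 2^-1 * Num.sqrt (n%:R * (2 * (c * u ^+ 2)) / (5 * ell)).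
    move=> i; apply: le_trans (bd2 i j k) _; apply: clip => //; first exact: exprn_ge0.
    rewrite bound2.
    have -> : 20 * ell * (2 * u ^+ 3 * ell) ^+ 2 = 40 * u ^+ 4 * ell ^+ 3 * (2 * u ^+ 2) by ring.
    have -> : n%:R * (2 * (c * u ^+ 2)) = n%:R * c * (2 * u ^+ 2) by ring.
    apply: ler_wpM2r; first by rewrite mulr_ge0// sqr_ge0.
    apply: large => //.
    by rewrite ler_nat.
  have := h2 w n2B (j, k) k2; rewrite -(cov_mxE mean0) /=.
  have -> : emp_prod (fun i => vec (X i w)) j k = n%:R^-1 * \sum_i tnth (X i w) j * tnth (X i w) k.
    by congr (_ * _); apply: eq_bigr => i _; rewrite !mxE.
  move=> /le_trans; apply.
  have vs : 2 * (c * u ^+ 2) <= (2 * (c * u)) ^+ 2.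
    have : c * u ^+ 2 <= (c * u) ^+ 2.
      by rewrite exprMn ler_wpM2r ?sqr_ge0// expr2 ler_peMl// ltW.
    by rewrite (exprMn 2 2 (c * u)); have := sqr_ge0 (c * u); lra.
  apply: le_trans (dev (mulr_ge0 (ler0n R 2) sc) (ltW v20) vs) _; rewrite ler_wpM2r//; lra.
- have k4 : forall i, `|tnth (X i w) j * tnth (X i w) k * (tnth (X i w) l * tnth (X i w) m)| <=
     2^-1 * Num.sqrt (n%:R * (4 * (c * u ^+ 6)) / (5 * ell)).
    move=> i; apply: le_trans (bd4 i j k l m) _; apply: clip => //; first exact: exprn_ge0.
    rewrite (exprM bound 2 2) bound2.
    (* The most demanding clipping condition: with [bound^8 = 16 u^12 ell^4] it reduces to
       [large_n]. *)
    have -> : 20 * ell * ((2 * u ^+ 3 * ell) ^+ 2) ^+ 2 = 80 * u ^+ 6 * ell ^+ 5 * (4 * u ^+ 6) by ring.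
    have -> : n%:R * (4 * (c * u ^+ 6)) = n%:R * c * (4 * u ^+ 6) by ring.
    apply: ler_wpM2r; first by rewrite mulr_ge0// exprn_ge0// ltW.
    exact: large.
  have := h4 w n4B ((j, k), (l, m)) k4 => /=.
  have -> : emp_avg (fun i => vec (X i w) j 0 * vec (X i w) k 0 * (vec (X i w) l 0 * vec (X i w) m 0)) =
    n%:R^-1 * \sum_i tnth (X i w) j * tnth (X i w) k * (tnth (X i w) l * tnth (X i w) m).
    by congr (_ * _); apply: eq_bigr => i _; rewrite !mxE.
  move=> /le_trans; apply.
  have sc3 : 0 <= 2 * (c * u ^+ 3) by rewrite !mulr_ge0 ?exprn_ge0 ?(ltW u0) ?(ltW c0).
  have vs : 4 * (c * u ^+ 6) <= (2 * (c * u ^+ 3)) ^+ 2.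
    have -> : (2 * (c * u ^+ 3)) ^+ 2 = 4 * (c * (c * u ^+ 6)) by ring.
    by rewrite ler_wpM2l// ler_wpM2l ?(ltW c0)// ler_peMl// exprn_ge0// ltW.
  apply: le_trans (dev sc3 (ltW v40) vs) _; rewrite ler_wpM2r//; lra.
Qed.

End GoodEvent.

(** * Comparison with the multiplier law *)

Section ProductThirdOrder.
Context {R : realType} {d : measure_display} {T : measurableType d} (P : probability T R).
Context {p : nat} (X : {RV P >-> p.-tuple R}).
Local Notation Y := (fun k w => tnth (X w) k).
Variables (nu u c : R).
Hypotheses (nu1 : 1 <= nu) (u1 : 1 <= u) (c1 : 1 <= c).
Hypothesis sub : forall k, subgaussian P (nu ^+ 2) (fun w => tnth (X w) k).
Hypothesis mean0 : forall k, ('E_P[Y k] = 0)%E.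
Hypothesis mom6 : forall k, expect P (fun w => `|Y k w| ^+ 6) <= c * u ^+ 3.
Hypothesis SigK : forall j k, `|cov_mx P X j k| <= 6 * c * u.

(* The boolean is a sign: a maximum over [pair_index] is a maximum of absolute values of entries. *)
Definition pair_index : finType := ('I_p * 'I_p * bool)%type.
Variables (rho : 'I_p -> 'I_p -> R) (rmax beta L : R).
Hypotheses (rho0 : forall j k, 0 < rho j k) (rho_max : forall j k, rho j k <= rmax).
Hypotheses (beta0 : 0 < beta) (L0 : 0 <= L) (JL : #|pair_index|%:R <= expR L).
Hypothesis small_rho : (4 + 2 * L) * beta * rmax * nu ^+ 2 <= 1.

Definition scaled_product (y : p.-tuple R) (a : pair_index) : R :=
  (-1) ^+ a.2 * (rho a.1.1 a.1.2 * (tnth y a.1.1 * tnth y a.1.2 - cov_mx P X a.1.1 a.1.2)).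

Definition scaled_cov (a b : pair_index) : R :=
  (-1) ^+ a.2 * rho a.1.1 a.1.2 * ((-1) ^+ b.2 * rho b.1.1 b.1.2) *
  (expect P (fun w => Y a.1.1 w * Y a.1.2 w * (Y b.1.1 w * Y b.1.2 w)) -
   cov_mx P X a.1.1 a.1.2 * cov_mx P X b.1.1 b.1.2).

(** The first term covers the part where the exponential factor is at most [expR 3], the second the
    exponential tail, damped by [expR (- L)]. *)
Definition product_third : R :=
  expR 3 * (900 * c ^+ 3 * u ^+ 3 * rmax ^+ 3) + 12 * expR 1 * expR (- L) / beta ^+ 3.

Let nu0 : 0 < nu := lt_le_trans ltr01 nu1.
Let u0 : 0 < u := lt_le_trans ltr01 u1.
Let c0 : 0 < c := lt_le_trans ltr01 c1.

(** From [x^2 + nu^2 <= nu^2 expR (x^2 / nu^2)] and [sqrt 2 <= 2]. A bound by [nu^2] is what the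
    exponent in [exp_dom] calls for. *)
Lemma cov_le_subgaussian j k : `|cov_mx P X j k| <= nu ^+ 2.
Proof.
have i2 := prod2_int nu1 sub j k.
have s2 := @sqrt2_le2 R.
have ij := subgaussian_int sub j; have ik := subgaussian_int sub k.
have hj := subgaussian_expect sub j; have hk := subgaussian_expect sub k.
have isg := integrableRZ (nu ^+ 2 / 2) (integrableRD ij ik).
have ic := integrableR_cst P (nu ^+ 2).
rewrite (cov_mxE mean0); apply: le_trans (expect_norm i2) _.
apply: (@le_trans _ _ (nu ^+ 2 / 2 * (2 + 2) - nu ^+ 2)); last lra.
have n2 : 0 <= nu ^+ 2 / 2 by rewrite divr_ge0 ?sqr_ge0.
apply: (@le_trans _ _ (nu ^+ 2 / 2 * (expect P (fun w => expR (Y j w ^+ 2 / nu ^+ 2)) +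
   expect P (fun w => expR (Y k w ^+ 2 / nu ^+ 2))) - nu ^+ 2)); last first.
  by rewrite lerD2r ler_wpM2l// lerD// (le_trans _ s2).
rewrite -(expectD ij ik) -(expectZ _ (integrableRD ij ik)) -[X in _ - X](expect_cst P (nu ^+ 2)).
rewrite -(expectB isg ic); apply: le_expect.
- exact: integrableR_norm.
- exact: integrableRB.
move=> w; set x := tnth (X w) j; set y := tnth (X w) k.
have v0 : 0 < nu ^+ 2 by rewrite exprn_gt0.
have hx : nu ^+ 2 + x ^+ 2 <= nu ^+ 2 * expR (x ^+ 2 / nu ^+ 2).
  have := ler_wpM2l (ltW v0) (expR_ge1Dx (x ^+ 2 / nu ^+ 2)).
  by rewrite mulrDr mulr1 mulrCA divff ?mulr1// gt_eqF.
have hy : nu ^+ 2 + y ^+ 2 <= nu ^+ 2 * expR (y ^+ 2 / nu ^+ 2).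
  have := ler_wpM2l (ltW v0) (expR_ge1Dx (y ^+ 2 / nu ^+ 2)).
  by rewrite mulrDr mulr1 mulrCA divff ?mulr1// gt_eqF.
apply: (@le_trans _ _ ((x ^+ 2 + y ^+ 2) / 2)); last lra.
rewrite normrM -[x ^+ 2]real_normK ?num_real// -[y ^+ 2]real_normK ?num_real//.
by have := sqr_ge0 (`|x| - `|y|); rewrite sqrrB; lra.
Qed.

Let xi (a : pair_index) w := scaled_product (X w) a.

Let xi_norm a w : `|xi a w| = rho a.1.1 a.1.2 * `|Y a.1.1 w * Y a.1.2 w - cov_mx P X a.1.1 a.1.2|.
Proof. by rewrite /xi /scaled_product normrM normr_sign mul1r normrM gtr0_norm. Qed.

Let measurable_xi a : measurable_fun setT (xi a).
Proof.
apply: measurable_funM => //; apply: measurable_funM => //; apply: measurable_funB => //.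
exact: measurable_coordM.
Qed.

Let mxi : coords_measurable (fun w => scaled_product (X w)).
Proof. by move=> a; exact: measurable_xi. Qed.

Let q := (4 + 2 * L) * beta.

(** By [small_rho], [q] times the scaled product is at most 1 plus the half-sum of [x^2 / nu^2] and
    [y^2 / nu^2]; the exponential of a half-sum is at most the mean of the exponentials. *)
Let exp_dom a w : expR (q * `|xi a w|) <=
  expR 1 * (2^-1 * (expR (Y a.1.1 w ^+ 2 / nu ^+ 2) + expR (Y a.1.2 w ^+ 2 / nu ^+ 2))).
Proof.
have v0 : 0 < nu ^+ 2 by rewrite exprn_gt0.
have q0 : 0 <= q by rewrite mulr_ge0 ?(ltW beta0)// addr_ge0// mulr_ge0.
have qr : q * rho a.1.1 a.1.2 <= (nu ^+ 2)^-1.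
  apply: (@le_trans _ _ (q * rmax)); first by rewrite ler_wpM2l.
  by rewrite -[leRHS]mul1r ler_pdivlMr.
set x := tnth (X w) a.1.1; set y := tnth (X w) a.1.2.
have h : q * `|xi a w| <= 1 + (x ^+ 2 / nu ^+ 2 + y ^+ 2 / nu ^+ 2) / 2.
  rewrite xi_norm mulrA.
  apply: (@le_trans _ _ ((nu ^+ 2)^-1 * (nu ^+ 2 + (x ^+ 2 + y ^+ 2) / 2))); last first.
    by rewrite le_eqVlt; apply/orP; left; apply/eqP; field; rewrite gt_eqF.
  apply: ler_pM => //; first by rewrite mulr_ge0// ltW.
  apply: le_trans (ler_normB _ _) _; rewrite addrC; apply: lerD; first exact: cov_le_subgaussian.
  rewrite normrM -[x ^+ 2]real_normK ?num_real// -[y ^+ 2]real_normK ?num_real//.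
  by have := sqr_ge0 (`|x| - `|y|); rewrite sqrrB -/x -/y; lra.
apply: (@le_trans _ _ (expR (1 + (x ^+ 2 / nu ^+ 2 + y ^+ 2 / nu ^+ 2) / 2))).
  by rewrite ler_expR.
rewrite expRD ler_wpM2l ?expR_ge0//.
set s := x ^+ 2 / _; set t := y ^+ 2 / _.
have -> : expR ((s + t) / 2) = expR (s / 2) * expR (t / 2) by rewrite [(s + t) / 2]mulrDl expRD.
have es : expR s = expR (s / 2) ^+ 2 by rewrite expr2 -expRD; congr expR; field.
have et : expR t = expR (t / 2) ^+ 2 by rewrite expr2 -expRD; congr expR; field.
rewrite es et; have := sqr_ge0 (expR (s / 2) - expR (t / 2)); rewrite sqrrB; lra.
Qed.

Let exp_int a : integrableR P (fun w => expR (q * `|xi a w|)).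
Proof.
have ij := subgaussian_int sub a.1.1; have ik := subgaussian_int sub a.1.2.
apply: (integrableR_dom _ _ (integrableRZ (expR 1) (integrableRZ 2^-1 (integrableRD ij ik)))) => [|w].
  apply: measurableT_comp (@measurable_expR R) _; apply: measurable_funM => //.
  exact: measurableT_comp (@normr_measurable R setT) (measurable_xi a).
by rewrite ger0_norm ?expR_ge0//; exact: exp_dom.
Qed.

Let exp_expect a : expect P (fun w => expR (q * `|xi a w|)) <= 2 * expR 1.
Proof.
have ij := subgaussian_int sub a.1.1; have ik := subgaussian_int sub a.1.2.
have hj := subgaussian_expect sub a.1.1; have hk := subgaussian_expect sub a.1.2.
have s2 := @sqrt2_le2 R.
have isg := integrableRZ 2^-1 (integrableRD ij ik).
apply: le_trans (le_expect (exp_int a) (integrableRZ (expR 1) isg) (exp_dom a)) _.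
rewrite (expectZ _ isg) (expectZ _ (integrableRD ij ik)) (expectD ij ik) mulrC.
by rewrite ler_wpM2r ?expR_ge0//; lra.
Qed.

Let cube_sub (x y : R) : `|x - y| ^+ 3 <= 4 * (`|x| ^+ 3 + `|y| ^+ 3).
Proof.
have x0 := normr_ge0 x; have y0 := normr_ge0 y.
apply: (@le_trans _ _ ((`|x| + `|y|) ^+ 3)).
  by rewrite lerXn2r ?nnegrE ?addr_ge0// ler_normB.
rewrite -subr_ge0; have -> : 4 * (`|x| ^+ 3 + `|y| ^+ 3) - (`|x| + `|y|) ^+ 3 =
  3 * ((`|x| - `|y|) ^+ 2 * (`|x| + `|y|)) by ring.
by rewrite mulr_ge0// mulr_ge0 ?sqr_ge0// addr_ge0.
Qed.

Let cube_dom a w : `|xi a w| ^+ 3 <= 4 * rho a.1.1 a.1.2 ^+ 3 *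
  (`|Y a.1.1 w * Y a.1.2 w| ^+ 3 + `|cov_mx P X a.1.1 a.1.2| ^+ 3).
Proof.
rewrite xi_norm exprMn [4 * _]mulrC -[leRHS]mulrA ler_wpM2l ?exprn_ge0 ?(ltW (rho0 _ _))//.
Qed.

Let cube_int a : integrableR P (fun w => `|xi a w| ^+ 3).
Proof.
have i3 := prod2_pow_int nu1 sub a.1.1 a.1.2 3.
have ic := integrableR_cst P (`|cov_mx P X a.1.1 a.1.2| ^+ 3).
apply: (integrableR_dom _ _ (integrableRZ (4 * rho a.1.1 a.1.2 ^+ 3) (integrableRD i3 ic))) => [|w].
  by apply: measurable_funX; exact: measurableT_comp (@normr_measurable R setT) (measurable_xi a).
by rewrite ger0_norm ?exprn_ge0//; exact: cube_dom.
Qed.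

Let cube_expect a : expect P (fun w => `|xi a w| ^+ 3) <= 900 * c ^+ 3 * u ^+ 3 * rmax ^+ 3.
Proof.
have i3 := prod2_pow_int nu1 sub a.1.1 a.1.2 3.
have ic := integrableR_cst P (`|cov_mx P X a.1.1 a.1.2| ^+ 3).
apply: le_trans (le_expect (cube_int a) (integrableRZ _ (integrableRD i3 ic)) (cube_dom a)) _.
rewrite (expectZ _ (integrableRD i3 ic)) (expectD i3 ic) (expect_cst P (`|cov_mx P X a.1.1 a.1.2| ^+ 3)).
have e3 := expect_prod2_pow nu1 sub a.1.1 a.1.2 3; rewrite -[(2 * 3)%N]/6%N in e3.
have S3 : `|cov_mx P X a.1.1 a.1.2| ^+ 3 <= 216 * c ^+ 3 * u ^+ 3.
  have -> : 216 * c ^+ 3 * u ^+ 3 = (6 * c * u) ^+ 3 by ring.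
  by rewrite lerXn2r ?nnegrE ?SigK// !mulr_ge0// ltW.
have cc : c <= c ^+ 3.
  by rewrite [leRHS]exprS ler_peMr ?(ltW c0)// exprn_ege1.
have cu : c * u ^+ 3 <= c ^+ 3 * u ^+ 3 by rewrite ler_wpM2r// exprn_ge0// ltW.
have cu0 : 0 <= c ^+ 3 * u ^+ 3 by rewrite mulr_ge0 ?exprn_ge0 ?(ltW c0) ?(ltW u0).
have := mom6 a.1.1; have := mom6 a.1.2 => m1 m2.
have r3 : rho a.1.1 a.1.2 ^+ 3 <= rmax ^+ 3.
  have rm0 : 0 <= rmax := le_trans (ltW (rho0 _ _)) (rho_max a.1.1 a.1.2).
  by rewrite lerXn2r ?nnegrE ?rm0 ?(ltW (rho0 _ _)).
have q3 : 0 <= rho a.1.1 a.1.2 ^+ 3 by rewrite exprn_ge0// ltW.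
apply: (@le_trans _ _ (4 * rmax ^+ 3 * (218 * (c ^+ 3 * u ^+ 3)))).
  apply: ler_pM => //; [by rewrite mulr_ge0| | |].
  - by rewrite addr_ge0 ?exprn_ge0//; apply: expect_ge0 => w; exact: exprn_ge0.
  - by rewrite ler_wpM2l.
  - lra.
have := mulr_ge0 (le_trans q3 r3) cu0; lra.
Qed.

(** Let [y] be the coordinate in the exponential and [z] the larger of the two. If [beta y > 1] then
    [z^3 expR (3 beta z) <= 6 beta^-3 expR (4 beta z)], and the part [2 L beta] of [q] yields a
    further factor [expR (- (2 L))], half of which pays for the sum over all indices. *)
Lemma product_third_order :
  third_order P beta (fun w => scaled_product (X w)) scaled_cov product_third.
Proof.
have i2 (a : pair_index) := prod2_int nu1 sub a.1.1 a.1.2.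
have iS (a : pair_index) := integrableR_cst P (cov_mx P X a.1.1 a.1.2).
have i1' (a : pair_index) : integrableR P (xi a).
  by apply: integrableRZ; apply: integrableRZ; exact: integrableRB.
have i4 (a b : pair_index) := prod4_int nu1 sub a.1.1 a.1.2 b.1.1 b.1.2.
have iS2 (a b : pair_index) := integrableR_cst P (cov_mx P X a.1.1 a.1.2 * cov_mx P X b.1.1 b.1.2).
have j1 (a b : pair_index) := integrableRD (integrableRZ (- cov_mx P X b.1.1 b.1.2) (i2 a)) (iS2 a b).
have j2 (a b : pair_index) := integrableRZ (- cov_mx P X a.1.1 a.1.2) (i2 b).
have pi (a b : pair_index) := integrableRD (i4 a b) (integrableRD (j1 a b) (j2 a b)).
have prodE (a b : pair_index) : (fun w => scaled_product (X w) a * scaled_product (X w) b) = (fun w =>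
    ((-1) ^+ a.2 * rho a.1.1 a.1.2 * ((-1) ^+ b.2 * rho b.1.1 b.1.2)) *
    (Y a.1.1 w * Y a.1.2 w * (Y b.1.1 w * Y b.1.2 w) +
     ((- cov_mx P X b.1.1 b.1.2 * (Y a.1.1 w * Y a.1.2 w) + cov_mx P X a.1.1 a.1.2 * cov_mx P X b.1.1 b.1.2) +
      - cov_mx P X a.1.1 a.1.2 * (Y b.1.1 w * Y b.1.2 w)))).
  by apply/funext => w; rewrite /scaled_product; ring.
split => //.
- move=> a; rewrite /scaled_product.
  rewrite (expectZ _ (integrableRZ _ (integrableRB (i2 a) (iS a)))) (expectZ _ (integrableRB (i2 a) (iS a))).
  rewrite (expectB (i2 a) (iS a)) (expect_cst P (cov_mx P X a.1.1 a.1.2)) -(cov_mxE mean0) subrr.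
  by rewrite !mulr0.
- by move=> a b; rewrite (prodE a b); exact: integrableRZ.
- move=> a b; rewrite (prodE a b) (expectZ _ (pi a b)) (expectD (i4 a b) (integrableRD (j1 a b) (j2 a b))).
  rewrite (expectD (j1 a b) (j2 a b)) (expectD (integrableRZ _ (i2 a)) (iS2 a b)).
  rewrite (expect_cst P (cov_mx P X a.1.1 a.1.2 * cov_mx P X b.1.1 b.1.2)).
  rewrite !(expectZ _ (i2 _)) -!(cov_mxE mean0) /scaled_cov; congr (_ * _); ring.
exists (fun a w => expR 3 * `|xi a w| ^+ 3 +
   6 * expR (- (2 * L)) / beta ^+ 3 * \sum_(b : pair_index) expR (q * `|xi b w|)) => a.
have isum := @integrableR_sum _ _ _ P _ (index_enum pair_index) (fun b w => expR (q * `|xi b w|)) exp_int.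
have h1 := integrableRZ (expR 3) (cube_int a).
have h2 := integrableRZ (6 * expR (- (2 * L)) / beta ^+ 3) isum.
split.
- exact: integrableRD.
- rewrite (expectD h1 h2) (expectZ _ (cube_int a)) (expectZ _ isum).
  rewrite (expect_sum (index_enum pair_index) exp_int) /product_third.
  apply: lerD; first by rewrite ler_wpM2l ?expR_ge0//; exact: cube_expect.
  have hs : \sum_(b <- index_enum pair_index) expect P (fun w => expR (q * `|xi b w|)) <=
     expR L * (2 * expR 1).
    apply: (@le_trans _ _ (\sum_(b : pair_index) 2 * expR 1)).
      by apply: ler_sum => b _; exact: exp_expect.
    by rewrite sumr_const -[_ *+ #|_|]mulr_natl ler_wpM2r// mulr_ge0// expR_ge0.
  apply: le_trans (ler_wpM2l _ hs) _.
    by rewrite divr_ge0 ?mulr_ge0 ?expR_ge0 ?exprn_ge0 ?(ltW beta0).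
  have -> : expR (- L) = expR (- (2 * L)) * expR L by rewrite -expRD; congr expR; ring.
  by rewrite le_eqVlt; apply/orP; left; apply/eqP; field; rewrite gt_eqF.
move=> b w; set S := \sum_(b0 <- _) _.
have S0 m : expR (q * `|xi m w|) <= S.
  by rewrite /S (bigD1 m)//= lerDl sumr_ge0// => *; exact: expR_ge0.
have S00 : 0 <= S by exact: le_trans (expR_ge0 _) (S0 a).
have K0 : 0 <= 6 * expR (- (2 * L)) / beta ^+ 3.
  by rewrite divr_ge0 ?mulr_ge0 ?expR_ge0 ?exprn_ge0 ?(ltW beta0).
rewrite -/(xi a w) -/(xi b w); set x : R := `|xi a w|; set y : R := `|xi b w|.
have x0 : 0 <= x := normr_ge0 _; have y0 : 0 <= y := normr_ge0 _.
have [by1|by1] := leP (beta * y) 1.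
  apply: (@le_trans _ _ (expR 3 * x ^+ 3)); last by rewrite lerDl mulr_ge0.
  rewrite mulrC ler_wpM2r ?exprn_ge0// ler_expR; lra.
have key m : x <= `|xi m w| -> y <= `|xi m w| ->
    x ^+ 3 * expR (3 * beta * y) <= expR 3 * x ^+ 3 + 6 * expR (- (2 * L)) / beta ^+ 3 * S.
  set z : R := `|xi m w| => xz yz.
  have z0 : 0 <= z := normr_ge0 _.
  have bz : 1 < beta * z by apply: lt_le_trans by1 _; rewrite ler_wpM2l// ltW.
  apply: (@le_trans _ _ (6 * expR (- (2 * L)) / beta ^+ 3 * expR (q * z))); last first.
    apply: (@le_trans _ _ (6 * expR (- (2 * L)) / beta ^+ 3 * S)).
      have := ler_wpM2l K0 (S0 m); rewrite -/z; exact.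
    by rewrite lerDr mulr_ge0 ?expR_ge0 ?exprn_ge0.
  apply: (@le_trans _ _ (z ^+ 3 * expR (3 * beta * z))).
    apply: ler_pM; rewrite ?exprn_ge0 ?expR_ge0//.
      by rewrite lerXn2r ?nnegrE.
    by rewrite ler_expR ler_wpM2l// mulr_ge0// ltW.
  have h3 := expR_ge_pow 3 (le_trans ler01 (ltW bz)).
  have z3 : z ^+ 3 <= 6 / beta ^+ 3 * expR (beta * z).
    rewrite mulrAC ler_pdivlMr ?exprn_gt0// mulrC -exprMn.
    by apply: le_trans h3 _; rewrite ler_wpM2r ?expR_ge0// -[3`!]/6%N.
  apply: (@le_trans _ _ (6 / beta ^+ 3 * expR (beta * z) * expR (3 * beta * z))).
    by rewrite ler_wpM2r ?expR_ge0.
  rewrite -[leLHS]mulrA -expRD.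
  have -> : 6 * expR (- (2 * L)) / beta ^+ 3 * expR (q * z) = 6 / beta ^+ 3 * expR (- (2 * L) + q * z).
    by rewrite expRD; ring.
  apply: ler_wpM2l; first by rewrite divr_ge0// exprn_ge0// ltW.
  rewrite ler_expR /q; have : 2 * L <= 2 * L * (beta * z).
    by rewrite ler_peMr ?mulr_ge0// ltW.
  lra.
by have [xy|/ltW yx] := leP x y; [exact: (key b)|exact: (key a)].
Qed.

End ProductThirdOrder.

Section Tuning.
Context {R : realType}.
(* [w] is the square root of [ln (n p)], [q] that of [n], [u] is [nu ^ (2/3)], and [rho] is
   the error rate [(nu^4 ln(n p)^7 / n) ^ (1/6)]. *)
Variables (w q u rho c0 kappa g3 D0 A0 : R).
Hypotheses (w1 : 1 <= w) (q0 : 0 < q) (u1 : 1 <= u) (rho0 : 0 < rho) (rho1 : rho <= 1).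
Hypothesis rhoE : rho ^+ 3 * q = u ^+ 3 * w ^+ 7.
Hypotheses (c00 : 0 < c0) (c01 : c0 <= 1) (kappa0 : 0 <= kappa) (g30 : 0 <= g3).
Hypotheses (D00 : 0 <= D0) (A00 : 0 <= A0).

Variable phi : R.
Hypothesis phiE : phi = c0 * w / rho.

Let w0 : 0 < w := lt_le_trans ltr01 w1.
Let u0 : 0 < u := lt_le_trans ltr01 u1.

Let phi0 : 0 < phi.
Proof. by rewrite phiE divr_gt0// mulr_gt0. Qed.

Let uE : u ^+ 3 = rho ^+ 3 * q / w ^+ 7.
Proof. by rewrite rhoE mulfK// gt_eqF// exprn_gt0. Qed.

Let q1 : 1 <= q.
Proof.
have : 1 <= rho ^+ 3 * q by rewrite rhoE -[leLHS]mul1r ler_pM// exprn_ege1.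
move=> /le_trans; apply; rewrite -[leRHS]mul1r ler_wpM2r ?(ltW q0)//.
by rewrite exprn_ile1// ltW.
Qed.

(** The balance behind [phi]: divided by [q], the left side is up to a constant the total
    third-order cost [n phi beta^2 E|xi|^3] with [beta = 2 w^2 phi], so a small [c0] makes this cost
    small. *)
Lemma tuned_cube : phi ^+ 3 * w ^+ 4 * u ^+ 3 = c0 ^+ 3 * q.
Proof. by rewrite uE phiE; field; rewrite !gt_eqF. Qed.

Let cube_le : phi ^+ 3 * w ^+ 4 <= c0 ^+ 3 * q.
Proof.
rewrite -tuned_cube ler_peMr ?exprn_ege1//.
by rewrite mulr_ge0// exprn_ge0// ltW.
Qed.

(** Up to constants the left side is [L * beta * nu^2 / q], which has to be small for the
    exponential domination of a single increment. *)
Lemma tuned_step : w ^+ 4 * phi * u ^+ 3 / q <= rho ^+ 2.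
Proof.
have x0 : 0 <= w ^+ 4 * phi * u ^+ 3 / q.
  by rewrite !mulr_ge0 ?exprn_ge0 ?invr_ge0 ?(ltW w0) ?(ltW u0) ?(ltW q0) ?(ltW phi0).
rewrite -(@ler_pXn2r _ 3) ?nnegrE ?exprn_ge0 ?(ltW rho0)//.
have -> : (w ^+ 4 * phi * u ^+ 3 / q) ^+ 3 = c0 ^+ 3 / w ^+ 6 * (rho ^+ 2) ^+ 3.
  by rewrite uE phiE; field; rewrite !gt_eqF.
rewrite -[leRHS]mul1r ler_wpM2r ?exprn_ge0 ?(ltW rho0)//.
rewrite ler_pdivrMr ?exprn_gt0// mul1r (@le_trans _ _ 1)// ?exprn_ege1//.
by rewrite exprn_ile1// ltW.
Qed.

Let step1 : w ^+ 4 * phi / q <= rho ^+ 2.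
Proof.
apply: le_trans tuned_step; rewrite ler_wpM2r ?invr_ge0 ?(ltW q0)//.
by rewrite ler_peMr ?exprn_ege1// mulr_ge0 ?exprn_ge0 ?(ltW w0) ?(ltW phi0).
Qed.

Let w2 : 1 <= w ^+ 2. Proof. exact: exprn_ege1. Qed.
Let w24 : w ^+ 2 <= w ^+ 4. Proof. by rewrite ler_weXn2l. Qed.

Lemma tuned_small_step : 16 * rho ^+ 2 <= 1 ->
  (6 + 2 * w ^+ 2) * (2 * w ^+ 2 * phi * q^-1) <= 1.
Proof.
move=> h; apply: le_trans h.
apply: (@le_trans _ _ (16 * (w ^+ 4 * phi / q))); last by rewrite ler_wpM2l.
have -> : (6 + 2 * w ^+ 2) * (2 * w ^+ 2 * phi * q^-1) =
  (12 * w ^+ 2 + 4 * w ^+ 4) * (phi / q) by ring.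
have -> : 16 * (w ^+ 4 * phi / q) = (16 * w ^+ 4) * (phi / q) by ring.
apply: ler_wpM2r; first exact: divr_ge0 (ltW phi0) (ltW q0).
by have := w24; lra.
Qed.

Lemma tuned_small_rho : 16 * kappa * rho ^+ 2 <= 1 ->
  (4 + 2 * (2 * w ^+ 2)) * (2 * w ^+ 2 * phi) * (kappa / q) * u ^+ 3 <= 1.
Proof.
move=> h; apply: le_trans h.
apply: (@le_trans _ _ (16 * kappa * (w ^+ 4 * phi * u ^+ 3 / q))); last first.
  by rewrite ler_wpM2l ?mulr_ge0//; exact: tuned_step.
have -> : (4 + 2 * (2 * w ^+ 2)) * (2 * w ^+ 2 * phi) * (kappa / q) * u ^+ 3 =
  (8 * w ^+ 2 + 8 * w ^+ 4) * (kappa * phi * u ^+ 3 / q) by ring.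
have -> : 16 * kappa * (w ^+ 4 * phi * u ^+ 3 / q) = (16 * w ^+ 4) * (kappa * phi * u ^+ 3 / q) by ring.
apply: ler_wpM2r; last by have := w24; lra.
by rewrite !mulr_ge0 ?exprn_ge0 ?invr_ge0 ?(ltW phi0) ?(ltW q0) ?(ltW u0).
Qed.

Lemma tuned_smallB : 16 * rho ^+ 2 <= 1 -> 272 * g3 * c0 ^+ 3 <= 1 ->
  3 / 2 * (2 * w ^+ 2 * phi) * phi * q^-1 ^+ 2 +
  17 * phi * (2 * w ^+ 2 * phi) ^+ 2 * (q^-1 ^+ 3 * g3) <= 2^-1.
Proof.
move=> h hg.
have t1 : 3 / 2 * (2 * w ^+ 2 * phi) * phi * q^-1 ^+ 2 <= 4^-1.
  apply: (@le_trans _ _ (3 * (w ^+ 4 * phi / q) ^+ 2)).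
    have -> : 3 / 2 * (2 * w ^+ 2 * phi) * phi * q^-1 ^+ 2 = 3 * (w ^+ 2 * (phi / q) ^+ 2) by field; rewrite gt_eqF.
    have -> : 3 * (w ^+ 4 * phi / q) ^+ 2 = 3 * (w ^+ 8 * (phi / q) ^+ 2) by ring.
    by rewrite ler_wpM2l// ler_wpM2r ?sqr_ge0// ler_weXn2l.
  have x0 : 0 <= w ^+ 4 * phi / q.
    by rewrite !mulr_ge0 ?exprn_ge0 ?invr_ge0 ?(ltW w0) ?(ltW q0) ?(ltW phi0).
  have x1 : w ^+ 4 * phi / q <= 16^-1 by apply: le_trans step1 _; lra.
  have : (w ^+ 4 * phi / q) ^+ 2 <= 16^-1 ^+ 2 by rewrite lerXn2r ?nnegrE.
  by set z := (_ / q) ^+ 2; lra.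
have t2 : 17 * phi * (2 * w ^+ 2 * phi) ^+ 2 * (q^-1 ^+ 3 * g3) <= 4^-1.
  have -> : 17 * phi * (2 * w ^+ 2 * phi) ^+ 2 * (q^-1 ^+ 3 * g3) =
    68 * g3 / q ^+ 3 * (phi ^+ 3 * w ^+ 4) by field; rewrite gt_eqF.
  apply: (@le_trans _ _ (68 * g3 / q ^+ 3 * (c0 ^+ 3 * q))).
    by rewrite ler_wpM2l// divr_ge0 ?mulr_ge0 ?exprn_ge0 ?(ltW q0).
  have -> : 68 * g3 / q ^+ 3 * (c0 ^+ 3 * q) = 68 * g3 * c0 ^+ 3 / q ^+ 2 by field; rewrite gt_eqF.
  rewrite ler_pdivrMr ?exprn_gt0//.
  apply: (@le_trans _ _ 4^-1); first lra.
  by rewrite ler_peMr// exprn_ege1.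
lra.
Qed.

(** Four contributions of at most 1/4 each: the covariance gap, the third moments of the data, their
    exponential tail, and the third moments of the Gaussian increments. *)
Lemma tuned_smallAB eps : eps <= 3 * w / q -> 272 * g3 * c0 ^+ 3 <= 1 -> 272 * A0 * c0 ^+ 3 <= 1 ->
  36 * D0 * c0 ^+ 2 <= 1 -> 408 * expR 1 * expR (- (2 * w ^+ 2)) * q ^+ 2 <= 1 ->
  q ^+ 2 * (3 / 2 * (2 * w ^+ 2 * phi) * phi * (D0 * u ^+ 3 * eps / q ^+ 2) +
    17 * phi * (2 * w ^+ 2 * phi) ^+ 2 *
    (A0 * u ^+ 3 / q ^+ 3 + 12 * expR 1 * expR (- (2 * w ^+ 2)) / (2 * w ^+ 2 * phi) ^+ 3 +
     q^-1 ^+ 3 * g3)) <= 1.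
Proof.
move=> he hg hA hD hx.
have -> : q ^+ 2 * (3 / 2 * (2 * w ^+ 2 * phi) * phi * (D0 * u ^+ 3 * eps / q ^+ 2) +
    17 * phi * (2 * w ^+ 2 * phi) ^+ 2 *
    (A0 * u ^+ 3 / q ^+ 3 + 12 * expR 1 * expR (- (2 * w ^+ 2)) / (2 * w ^+ 2 * phi) ^+ 3 +
     q^-1 ^+ 3 * g3)) =
  3 * D0 * (w ^+ 2 * phi ^+ 2 * u ^+ 3) * eps + 68 * A0 * (phi ^+ 3 * w ^+ 4 * u ^+ 3) / q +
  102 * expR 1 * expR (- (2 * w ^+ 2)) * q ^+ 2 / w ^+ 2 +
  68 * g3 * (phi ^+ 3 * w ^+ 4) / q.
  by field; rewrite !gt_eqF.
have t1 : 3 * D0 * (w ^+ 2 * phi ^+ 2 * u ^+ 3) * eps <= 4^-1.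
  apply: (@le_trans _ _ (3 * D0 * (w ^+ 2 * phi ^+ 2 * u ^+ 3) * (3 * w / q))).
    by rewrite ler_wpM2l// !mulr_ge0 ?exprn_ge0 ?(ltW w0) ?(ltW phi0) ?(ltW u0).
  have -> : 3 * D0 * (w ^+ 2 * phi ^+ 2 * u ^+ 3) * (3 * w / q) = 9 * D0 * c0 ^+ 2 * (rho / w ^+ 2).
    by rewrite uE phiE; field; rewrite !gt_eqF.
  apply: (@le_trans _ _ (9 * D0 * c0 ^+ 2 * 1)); last lra.
  rewrite ler_wpM2l ?mulr_ge0 ?exprn_ge0 ?(ltW c00)//.
  by rewrite ler_pdivrMr ?exprn_gt0// mul1r (le_trans rho1).
have t2 : 68 * A0 * (phi ^+ 3 * w ^+ 4 * u ^+ 3) / q <= 4^-1.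
  by rewrite tuned_cube mulrA mulfK ?gt_eqF//; lra.
have t3 : 102 * expR 1 * expR (- (2 * w ^+ 2)) * q ^+ 2 / w ^+ 2 <= 4^-1.
  rewrite ler_pdivrMr ?exprn_gt0//; apply: (@le_trans _ _ 4^-1); last by rewrite ler_peMr.
  lra.
have t4 : 68 * g3 * (phi ^+ 3 * w ^+ 4) / q <= 4^-1.
  rewrite ler_pdivrMr//; apply: (@le_trans _ _ (68 * g3 * (c0 ^+ 3 * q))).
    by rewrite ler_wpM2l ?mulr_ge0.
  by rewrite mulrA ler_wpM2r ?(ltW q0)//; lra.
lra.
Qed.

(** Keeps the quadratic remainder of [sample_cov_lin], of order [u^2 w^2 / n], below half of the
    shift [1 / (kappa q phi)]. *)
Lemma tuned_linear (cc : R) : 0 <= cc -> 70 * cc * kappa * rho ^+ 2 <= 1 ->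
  14 * (cc * u ^+ 2 * (5 * w ^+ 2 / q ^+ 2)) * kappa * (q * phi) <= 1.
Proof.
move=> cc0 h; apply: le_trans h.
have -> : 14 * (cc * u ^+ 2 * (5 * w ^+ 2 / q ^+ 2)) * kappa * (q * phi) =
  70 * cc * kappa * (w ^+ 2 * phi * u ^+ 2 / q) by field; rewrite gt_eqF.
apply: ler_wpM2l; first by rewrite !mulr_ge0.
apply: le_trans tuned_step; rewrite ler_wpM2r ?invr_ge0 ?(ltW q0)//.
apply: ler_pM; rewrite ?exprn_ge0 ?(ltW u0)//.
- exact: mulr_ge0 (exprn_ge0 _ (ltW w0)) (ltW phi0).
- exact: ler_wpM2r (ltW phi0) _ _ w24.
- by rewrite ler_weXn2l.
Qed.

Lemma tuned_large : 80 * rho ^+ 6 <= 1 -> 80 * u ^+ 6 * w ^+ 10 <= q ^+ 2.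
Proof.
move=> h.
have e : rho ^+ 6 * q ^+ 2 = u ^+ 6 * w ^+ 14.
  have -> : rho ^+ 6 * q ^+ 2 = (rho ^+ 3 * q) ^+ 2 by ring.
  by rewrite rhoE; ring.
apply: (@le_trans _ _ (80 * (u ^+ 6 * w ^+ 14))).
  by rewrite -mulrA ler_wpM2l// ler_wpM2l ?exprn_ge0 ?(ltW u0)// ler_weXn2l.
rewrite -e mulrA -[leRHS]mul1r ler_wpM2r ?sqr_ge0//.
Qed.

Lemma tuned_eps : u ^+ 3 * (w / q) <= rho ^+ 3.
Proof.
have -> : u ^+ 3 * (w / q) = rho ^+ 3 / w ^+ 6 by rewrite uE; field; rewrite !gt_eqF.
by rewrite ler_pdivrMr ?exprn_gt0// ler_peMr ?exprn_ege1// exprn_ge0// ltW.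
Qed.

End Tuning.

(** * The data maximum against the multiplier law of one good sample *)

Section GoodSampleComparison.
Context {R : realType} {d : measure_display} {T : measurableType d} (P : probability T R).
Context {n' p : nat}.
Let n := n'.+1.
Hypotheses (n2 : (2 <= n)%N) (p0 : (0 < p)%N).
Variables (X : 'I_n -> {RV P >-> p.-tuple R}) (e : 'I_n -> {RV P >-> R}) (i1 : 'I_n).
Hypotheses (iid_X : iid X) (iid_e : iid e) (std_e : forall i, standard_normal (e i)).
Variables (nu u c C1 w rho c0 phi : R).
Hypotheses (nu1 : 1 <= nu) (u1 : 1 <= u) (uE : u ^+ 3 = nu ^+ 2) (c1 : 1 <= c).
Hypothesis sub : forall k, subgaussian P (nu ^+ 2) (fun w => tnth (X i1 w) k).
Hypothesis mean0 : forall k, ('E_P[fun w => tnth (X i1 w) k] = 0)%E.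
Hypothesis mom6 : forall k, expect P (fun w => `|tnth (X i1 w) k| ^+ 6) <= c * u ^+ 3.
Hypothesis SigK : forall j k, `|cov_mx P (X i1) j k| <= 6 * c * u.
Hypothesis Q4K : forall j k l m, `|fourth_mx X i1 j k l m| <= 6 * c * u ^+ 2.
Hypothesis C10 : 0 < C1.
Hypothesis var_ge : forall j k, 4 * C1 <= fourth_mx X i1 j k j k - cov_mx P (X i1) j k ^+ 2.

Let q : R := Num.sqrt n%:R.
Let kappa := (Num.sqrt C1)^-1.
Let g3 : R := gauss3.
Let D0 := 541 * (6 * c) ^+ 4 * kappa ^+ 2.
Let A0 := expR 3 * (900 * c ^+ 3 * kappa ^+ 3).
Hypotheses (w1 : 1 <= w) (rho0 : 0 < rho) (rho1 : rho <= 1).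
Hypothesis rhoE : rho ^+ 3 * q = u ^+ 3 * w ^+ 7.
Hypotheses (c00 : 0 < c0) (c01 : c0 <= 1) (phiE : phi = c0 * w / rho).
Hypothesis JL : #|@pair_index p|%:R <= expR (2 * w ^+ 2).
Hypotheses (c0g : 272 * g3 * c0 ^+ 3 <= 1) (c0A : 272 * A0 * c0 ^+ 3 <= 1)
  (c0D : 36 * D0 * c0 ^+ 2 <= 1).
Hypotheses (rho16 : 16 * rho ^+ 2 <= 1) (rhok : 16 * kappa * rho ^+ 2 <= 1)
  (rhov : 541 * (6 * c) ^+ 4 * rho ^+ 3 <= C1)
  (exp_n : 408 * expR 1 * expR (- (2 * w ^+ 2)) * q ^+ 2 <= 1).

Let eps := @sample_eps R n (w ^+ 2).
Variable x : 'I_n -> 'cV[R]_p.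
Hypothesis gx : good_sample (fun j k => cov_mx P (X i1) j k) (fourth_mx X i1) (6 * c) u eps x.

Let n0 : 0 < n%:R :> R. Proof. by rewrite ltr0n. Qed.
Let q0 : 0 < q. Proof. by rewrite sqrtr_gt0. Qed.
Let qq : q ^+ 2 = n%:R. Proof. by rewrite sqr_sqrtr ?(ltW n0). Qed.
Let w0 : 0 < w := lt_le_trans ltr01 w1.
Let c0' : 0 < c := lt_le_trans ltr01 c1.
Let u0 : 0 < u := lt_le_trans ltr01 u1.
Let cc1 : 1 <= 6 * c. Proof. by have := c1; lra. Qed.
Let smin0 : 0 < Num.sqrt C1. Proof. by rewrite sqrtr_gt0. Qed.
Let kappa0 : 0 < kappa. Proof. by rewrite invr_gt0. Qed.
Let phi0 : 0 < phi. Proof. by rewrite phiE divr_gt0// mulr_gt0. Qed.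
Let g30 : 0 <= g3. Proof. by rewrite /g3 /gauss3 !addr_ge0 ?mulr_ge0 ?expR_ge0. Qed.
Let c60 : 0 <= 6 * c := le_trans ler01 cc1.
Let bigc0 : 0 <= 541 * (6 * c) ^+ 4 := mulr_ge0 (ler0n R 541) (exprn_ge0 4 c60).
Let D00 : 0 <= D0. Proof. exact: mulr_ge0 bigc0 (exprn_ge0 2 (ltW kappa0)). Qed.
Let A00 : 0 <= A0.
Proof.
exact: mulr_ge0 (expR_ge0 3) (mulr_ge0 (mulr_ge0 (ler0n R 900) (exprn_ge0 3 (ltW c0'))) (exprn_ge0 3 (ltW kappa0))).
Qed.

Let eps_arg : 0 <= 5 * w ^+ 2 / n%:R := divr_ge0 (mulr_ge0 (ler0n R 5) (sqr_ge0 w)) (ltW n0).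

Let eps_le : 0 <= eps /\ eps <= 3 * (w / q).
Proof.
have e0 : 0 <= eps by exact: sqrtr_ge0.
split=> //; rewrite -(@ler_pXn2r _ 2) ?nnegrE ?mulr_ge0 ?invr_ge0 ?(ltW w0) ?(ltW q0)//.
rewrite /eps /sample_eps (sqr_sqrtr eps_arg).
have -> : (3 * (w / q)) ^+ 2 = 9 * w ^+ 2 / n%:R by rewrite -qq; field; rewrite gt_eqF.
rewrite ler_wpM2r ?invr_ge0 ?(ltW n0)// ler_wpM2r ?sqr_ge0// ler_nat //.
Qed.

Let u3eps : u ^+ 3 * eps <= 3 * rho ^+ 3.
Proof.
have [e0 e1] := eps_le.
apply: (@le_trans _ _ (u ^+ 3 * (3 * (w / q)))); first by rewrite ler_wpM2l// exprn_ge0// ltW.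
by rewrite mulrCA ler_wpM2l//; exact: (tuned_eps w1 q0 rho0 rhoE).
Qed.

Let u3eps1 : u ^+ 3 * eps <= 1.
Proof.
apply: le_trans u3eps _.
have : rho ^+ 3 <= rho ^+ 2 by rewrite ler_wiXn2l// ltW.
by have := rho16; have := sqr_ge0 rho; lra.
Qed.

Let neps : n%:R^-1 <= eps ^+ 2.
Proof.
rewrite /eps /sample_eps (sqr_sqrtr eps_arg).
rewrite -[leLHS]mul1r ler_wpM2r ?invr_ge0 ?(ltW n0)//.
have : 1 <= w ^+ 2 by exact: exprn_ege1.
lra.
Qed.

Let boot_cov j k l m := @boot_cov_close R n p n2 _ _ _ _ _ cc1 u1 eps_le.1 u3eps1 neps SigK Q4K x gx j k l m.

Let sig2 j k : R := emp_avg (fun i => boot_coef x i j k * boot_coef x i j k).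

(** The target variance is at least [4 * C1], and the estimation error takes at most [3 * C1] of
    it. *)
Let sig2_ge j k : C1 <= sig2 j k.
Proof.
have := boot_cov j k j k; rewrite ler_norml -/(sig2 j k) => /andP[h _].
have := var_ge j k; rewrite expr2.
have : 541 * (6 * c) ^+ 4 * (u ^+ 3 * eps) <= 541 * (6 * c) ^+ 4 * (3 * rho ^+ 3).
  exact: ler_wpM2l bigc0 _ _ u3eps.
by have := rhov; lra.
Qed.

Let sig j k := Num.sqrt (sig2 j k).
Let sig0 j k : 0 < sig j k.
Proof. by rewrite sqrtr_gt0 (lt_le_trans C10)//; exact: sig2_ge. Qed.
Let sigE j k : sig j k ^+ 2 = sig2 j k.
Proof. by rewrite sqr_sqrtr// (le_trans (ltW C10))//; exact: sig2_ge. Qed.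
Let sig_ge j k : Num.sqrt C1 <= sig j k.
Proof. by rewrite ler_wsqrtr//; exact: sig2_ge. Qed.

Let r j k := (sig j k * q)^-1.
Let r0 j k : 0 < r j k. Proof. by rewrite invr_gt0 mulr_gt0. Qed.
Let r_max j k : r j k <= kappa / q.
Proof. by rewrite /r invfM ler_wpM2r ?invr_ge0 ?(ltW q0)// lef_pV2 ?posrE. Qed.

(** Data and multipliers are both standardised by the deviations [sig] of the fixed sample, so that
    the Gaussian side has variances exactly 1. *)
Let coef (i : 'I_n) (a : @pair_index p) : R :=
  (-1) ^+ a.2 * (r a.1.1 a.1.2 * boot_coef x i a.1.1 a.1.2).

Let sum_coef a b : \sum_i coef i a * coef i b =
  ((-1) ^+ a.2 * (sig a.1.1 a.1.2)^-1) * ((-1) ^+ b.2 * (sig b.1.1 b.1.2)^-1) *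
  emp_avg (fun i => boot_coef x i a.1.1 a.1.2 * boot_coef x i b.1.1 b.1.2).
Proof.
rewrite /emp_avg [RHS]mulrA mulr_sumr; apply: eq_bigr => i _.
rewrite /coef /r !invfM -qq expr2 invfM; ring.
Qed.

Let unit_coef a : \sum_i coef i a ^+ 2 = 1.
Proof.
transitivity (\sum_i coef i a * coef i a); first by apply: eq_bigr => i _; rewrite expr2.
rewrite sum_coef -/(sig2 _ _) -sigE.
set s := sig _ _; have s0 : s != 0 by rewrite gt_eqF// /s.
have sg : (-1) ^+ a.2 * (-1) ^+ a.2 = 1 :> R by rewrite -expr2 sqrr_sign.
have -> : (-1) ^+ a.2 / s * ((-1) ^+ a.2 / s) * s ^+ 2 = (-1) ^+ a.2 * (-1) ^+ a.2 by field.
exact: sg.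
Qed.

Let L := 2 * w ^+ 2.
Let beta := L * phi.
Let w2 : 1 <= w ^+ 2. Proof. exact: exprn_ege1. Qed.
Let L1 : 1 <= L. Proof. by rewrite /L; have := w2; lra. Qed.
Let L0 : 0 <= L. Proof. exact: le_trans L1. Qed.
Let beta0 : 0 < beta. Proof. by rewrite mulr_gt0// (lt_le_trans ltr01 L1). Qed.

Let small_rho : (4 + 2 * L) * beta * (kappa / q) * nu ^+ 2 <= 1.
Proof.
rewrite -uE; exact: (tuned_small_rho w1 q0 u1 rho0 rhoE c00 c01 (ltW kappa0) phiE rhok).
Qed.

Let to := product_third_order nu1 u1 c1 sub mean0 mom6 SigK r0 r_max beta0 L0 JL small_rho.

Let Delta := D0 * u ^+ 3 * eps / q ^+ 2.

Let cov_gap a b : `|scaled_cov (X i1) r a b - q^-1 ^+ 2 * gcov coef a b| <= Delta.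
Proof.
rewrite /gcov sum_coef /scaled_cov -/(fourth_mx X i1 _ _ _ _).
set F := fourth_mx _ _ _ _ _ _ - _; set B := emp_avg _.
have -> : (-1) ^+ a.2 * r a.1.1 a.1.2 * ((-1) ^+ b.2 * r b.1.1 b.1.2) * F -
   q^-1 ^+ 2 * ((-1) ^+ a.2 / sig a.1.1 a.1.2 * ((-1) ^+ b.2 / sig b.1.1 b.1.2) * B) =
  (-1) ^+ a.2 * ((-1) ^+ b.2 * (r a.1.1 a.1.2 * r b.1.1 b.1.2 * (F - B))).
  by rewrite /r !invfM; ring.
rewrite normrM normr_sign mul1r normrM normr_sign mul1r normrM ger0_norm; last first.
  by rewrite mulr_ge0// ltW.
apply: (@le_trans _ _ (kappa / q * (kappa / q) * (541 * (6 * c) ^+ 4 * (u ^+ 3 * eps)))).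
  apply: ler_pM => //; first by rewrite mulr_ge0// ltW.
    by apply: ler_pM; rewrite ?(ltW (r0 _ _)).
  by rewrite distrC; exact: boot_cov.
rewrite le_eqVlt; apply/orP; left; apply/eqP; rewrite /Delta /D0.
by field; rewrite gt_eqF.
Qed.

(** The level [t] enters as the starting point [- t q / sig] of each coordinate, which turns
    exceedance into positivity. The shift [phi^-1] of [tail_comparison] becomes [sig / (q phi)] in
    the original units, which is at least [sqrt C1 / (q phi)]. *)
Lemma good_sample_tail (t : R) : 0 <= t + Num.sqrt C1 / (q * phi) ->
  (P [set y | exists jk : 'I_p * 'I_p,
      (t < `|emp_prod (fun i => vec (X i y)) jk.1 jk.2 - cov_mx P (X i1) jk.1 jk.2|)%R] <=
   P [set y | (t + Num.sqrt C1 / (q * phi) < boot_max x (fun i => e i y))%R] +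
   (tail_const * (Num.sqrt L / phi))%:E)%E.
Proof.
move=> t0.
have j0 : @pair_index p := ((Ordinal p0, Ordinal p0), false).
have mxi : coords_measurable (fun y => scaled_product (X i1) r y).
  move=> a; rewrite /scaled_product; apply: measurable_funM => //; apply: measurable_funM => //.
  by apply: measurable_funB => //; apply: measurable_funM; exact: measurable_tnth.
have smallB : 3 / 2 * beta * phi * q^-1 ^+ 2 + 17 * phi * beta ^+ 2 * (q^-1 ^+ 3 * gauss3) <= 2^-1.
  exact: (tuned_smallB w1 q0 u1 rho0 rho1 rhoE c00 c01 g30 phiE rho16 c0g).
have smallAB : n%:R * swap_error beta phi (product_third u c (kappa / q) beta L) (q^-1 ^+ 3 * gauss3) Delta <= 1.
  have he : eps <= 3 * w / q by rewrite -[3 * w / q]mulrA; exact: eps_le.2.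
  have := tuned_smallAB w1 q0 u1 rho0 rho1 rhoE c00 g30 D00 phiE he c0g c0A c0D exp_n.
  have -> : product_third u c (kappa / q) beta L =
      A0 * u ^+ 3 / q ^+ 3 + 12 * expR 1 * expR (- L) / beta ^+ 3.
    by rewrite /product_third /A0; congr (_ + _); field; rewrite gt_eqF.
  by rewrite -[n%:R in X in _ -> X]qq; exact.
have small_step : (6 + L) * (beta * q^-1) <= 1.
  exact: (tuned_small_step w1 q0 u1 rho0 rhoE c00 c01 phiE rho16).
have := @tail_comparison R d T P n' e iid_e std_e _ _ X i1 iid_X (@pair_index p) j0
  (scaled_product (X i1) r) mxi coef unit_coef phi L phi0 L1 JL _ _ Delta to cov_gap small_step
  smallB smallAB (fun a => - t * q / sig a.1.1 a.1.2).
have sign_abs (z : R) : exists b : bool, (-1) ^+ b * z = `|z|.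
  by exists (z < 0); rewrite mulr_sign; case: ltrP => z0; [rewrite ltr0_norm|rewrite ger0_norm].
have rq j k : r j k * n%:R = q / sig j k.
  by rewrite /r -qq; field; rewrite !gt_eqF.
have sumX y a : \sum_i scaled_product (X i1) r (X i y) a = q / sig a.1.1 a.1.2 *
    ((-1) ^+ a.2 * (emp_prod (fun i => vec (X i y)) a.1.1 a.1.2 - cov_mx P (X i1) a.1.1 a.1.2)).
  rewrite /scaled_product -mulr_sumr -mulr_sumr sumrB sumr_const card_ord -rq.
  rewrite -[cov_mx _ _ _ _ *+ _]mulr_natl.
  have -> : emp_prod (fun i => vec (X i y)) a.1.1 a.1.2 =
      n%:R^-1 * \sum_i tnth (X i y) a.1.1 * tnth (X i y) a.1.2.
    by congr (_ * _); apply: eq_bigr => i _; rewrite !mxE.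
  by field; rewrite gt_eqF.
have sumE y a : gvec e coef y a = q / sig a.1.1 a.1.2 *
    ((-1) ^+ a.2 * (n%:R^-1 * \sum_i boot_coef x i a.1.1 a.1.2 * e i y)).
  transitivity ((-1) ^+ a.2 * (r a.1.1 a.1.2 * \sum_i boot_coef x i a.1.1 a.1.2 * e i y)).
    by rewrite /gvec !mulr_sumr; apply: eq_bigr => i _; rewrite /coef !mulrA.
  by rewrite -rq; field; rewrite gt_eqF.
pose mc y (jk : 'I_p * 'I_p) := n%:R^-1 * \sum_i boot_coef x i jk.1 jk.2 * e i y.
have bootE : [set y | t + Num.sqrt C1 / (q * phi) < boot_max x (fun i => e i y)] =
    [set y | exists jk, t + Num.sqrt C1 / (q * phi) < `|mc y jk|].
  apply/seteqP; split => y /=.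
    move=> hy; apply: contrapT => hn.
    move: hy; rewrite ltNge => /negP; apply; apply/(boot_max_le n2 _ _ p0 t0) => j k.
    by rewrite leNgt; apply/negP => hjk; apply: hn; exists (j, k).
  move=> [jk hjk]; rewrite ltNge; apply/negP => /(boot_max_le n2 _ _ p0 t0) /(_ jk.1 jk.2).
  by rewrite leNgt hjk.
have mboot : measurable [set y | t + Num.sqrt C1 / (q * phi) < boot_max x (fun i => e i y)].
  rewrite bootE; apply: measurable_exists => jk.
  apply: measurableT_comp (@normr_measurable R setT) _; apply: measurable_funM => //.
  by apply: measurable_sum => i; apply: measurable_funM => //; exact: measurable_funPT.
move=> h; apply: le_trans (le_trans _ h) _.
  apply: le_measure; rewrite ?inE.
  - apply: measurable_exists => jk.
    apply: measurableT_comp (@normr_measurable R setT) _; apply: measurable_funB => //.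
    apply: measurable_funM => //; apply: measurable_sum => i.
    have E l : (fun y => vec (X i y) l 0) = (fun y => tnth (X i y) l).
      by apply/funext => y; rewrite mxE.
    by apply: measurable_funM; rewrite E; exact: measurable_coord.
  - apply: measurable_exists => a; apply: measurable_funD => //.
    apply: measurable_sum => i; apply: measurableT_comp (mxi a) _; exact: measurable_funPT.
  move=> y /= [jk hjk]; have [b hb] := sign_abs
    (emp_prod (fun i => vec (X i y)) jk.1 jk.2 - cov_mx P (X i1) jk.1 jk.2).
  exists (jk, b); rewrite sumX /= hb.
  have -> : - t * q / sig jk.1 jk.2 = - (q / sig jk.1 jk.2 * t) by ring.
  rewrite addrC -mulrBr mulr_gt0 ?divr_gt0//; by rewrite subr_gt0.
apply: leeD => //; apply: le_measure; rewrite ?inE//.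
  apply: measurable_exists => a; apply: measurable_funD => //.
  exact: measurable_gvec.
rewrite bootE => y /= [a]; rewrite sumE => ha; exists a.1.
set z := n%:R^-1 * _ in ha.
have sp := sig0 a.1.1 a.1.2; set s := sig a.1.1 a.1.2 in ha sp.
have h1 : t + s / (q * phi) < (-1) ^+ a.2 * z.
  have : q / s * (t + s / (q * phi)) < q / s * ((-1) ^+ a.2 * z).
    have -> : q / s * (t + s / (q * phi)) = phi^-1 + t * q / s by field; rewrite !gt_eqF.
    by move: ha; rewrite mulNr mulNr -ltrBlDl opprK.
  by rewrite ltr_pM2l// divr_gt0.
apply: (@le_lt_trans _ _ (t + s / (q * phi))).
  rewrite lerD2l ler_wpM2r ?invr_ge0 ?mulr_ge0 ?(ltW q0) ?(ltW phi0)//; exact: sig_ge.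
apply: lt_le_trans h1 _; apply: le_trans (ler_norm _) _.
by rewrite normrM normr_sign mul1r.
Qed.

End GoodSampleComparison.

(** * Quantiles and measurability *)

Section MeasurableFromSublevels.
Context {R : realType} {d : measure_display} {T : measurableType d}.

Lemma measurable_fun_of_le (f : T -> R) :
  (forall t, measurable [set w | f w <= t]) -> measurable_fun setT f.
Proof.
move=> h; apply: (measurability _ (RGenOInfty.measurableE R)) => // _ [_ [t ->] <-].
rewrite setTI (_ : _ @^-1` _ = ~` [set w | f w <= t]); first exact: measurableC.
by apply/seteqP; split => w /=; rewrite in_itv/= andbT ltNge => /negP.
Qed.

End MeasurableFromSublevels.

Section Quantile.
Context {R : realType} {d : measure_display} {T : measurableType d} (P : probability T R).
Variables (Z : T -> R) (a : R).
Hypotheses (mZ : measurable_fun setT Z) (Z0 : forall w, 0 <= Z w) (a01 : 0 < a < 1).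

Definition quantile : R := inf [set t : R | (a%:E <= P [set w | (Z w <= t)%R])%E].

Let Z' : {RV P >-> R} := mfun_Sub (mem_set mZ).

Let PE t : P [set w | Z w <= t] = cdf Z' t.
Proof.
by [].
Qed.

Let ne : [set t : R | (a%:E <= P [set w | (Z w <= t)%R])%E] !=set0.
Proof.
have /andP[_ a1] := a01.
have h : \forall t \near +oo%R, (a%:E < cdf Z' t)%E.
  have a1e : (a%:E < 1)%E by rewrite lte_fin.
  exact: (@cvg_cdfy1 _ _ _ P Z' _ (open_ereal_gt' a1e)).
have [t [ht _]] := filter_ex (filterI h h).
by exists t; rewrite /= PE ltW.
Qed.

Let lb0 t : (a%:E <= P [set w | (Z w <= t)%R])%E -> 0 <= t.
Proof.
have /andP[a0 _] := a01.
move=> h; rewrite leNgt; apply/negP => t0; move: h.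
have -> : [set w | Z w <= t] = set0.
  by apply/seteqP; split => w //= wt; have := lt_le_trans t0 (Z0 w); rewrite ltNge wt.
by rewrite measure0 lee_fin leNgt a0.
Qed.

Lemma quantile_ge0 : 0 <= quantile.
Proof. by apply: lb_le_inf => [|t /= h]; [exact: ne|exact: lb0]. Qed.

Lemma quantile_le t : (a%:E <= P [set w | (Z w <= t)%R])%E -> quantile <= t.
Proof. by move=> h; apply: ge_inf => //; exists 0 => s /= hs; exact: lb0. Qed.

(** Right continuity of the distribution function: the infimum is attained. *)
Lemma quantile_prob : (a%:E <= P [set w | (Z w <= quantile)%R])%E.
Proof.
rewrite PE; have := @cdf_right_continuous _ _ _ P Z' quantile.
apply: cvge_ge; near=> t.
have tq : quantile < t by near: t; exact: nbhs_right_gt.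
have [s [hs st]] : exists s, (a%:E <= P [set w | (Z w <= s)%R])%E /\ s < t.
  have e0 : 0 < t - quantile by rewrite subr_gt0.
  have hi : has_inf [set t : R | (a%:E <= P [set w | (Z w <= t)%R])%E].
    by split; [exact: ne|exists 0 => s /= hs; exact: lb0].
  have [s hs sl] := inf_adherent e0 hi.
  by exists s; split => //; move: sl; rewrite -/quantile addrC subrK.
apply: le_trans hs _; rewrite PE; exact: (cdf_nondecreasing Z' (ltW st)).
Unshelve. all: by end_near.
Qed.

(** Galois correspondence between quantile and distribution function; it reduces measurability of a
    quantile to that of a probability. *)
Lemma quantile_leE t : (quantile <= t) = (a%:E <= P [set w | (Z w <= t)%R])%E.
Proof.
apply/idP/idP => [h|]; last exact: quantile_le.
apply: le_trans quantile_prob _; rewrite !PE; exact: (cdf_nondecreasing Z' h).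
Qed.

End Quantile.

Section BootQuantile.
Context {R : realType} {d : measure_display} {T : measurableType d} (P : probability T R).
Context {n p : nat}.
Hypotheses (n2 : (2 <= n)%N) (p0 : (0 < p)%N).

Lemma measurable_emp_mean d1 (T1 : measurableType d1) (g : T1 -> 'I_n -> 'cV[R]_p) j :
  (forall i j, measurable_fun setT (fun w => g w i j 0)) ->
  measurable_fun setT (fun w => emp_mean (g w) j).
Proof. by move=> mg; apply: measurable_funM => //; apply: measurable_sum => i. Qed.

Lemma measurable_sample_cov d1 (T1 : measurableType d1) (g : T1 -> 'I_n -> 'cV[R]_p) j k :
  (forall i j, measurable_fun setT (fun w => g w i j 0)) ->
  measurable_fun setT (fun w => sample_cov (g w) j k).
Proof.
move=> mg.
have -> : (fun w => sample_cov (g w) j k) = (fun w => bessel (R := R) (n := n) *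
    (emp_prod (g w) j k - emp_mean (g w) j * emp_mean (g w) k)).
  by apply/funext => w; rewrite (sample_covE n2).
apply: measurable_funM => //; apply: measurable_funB.
  by apply: measurable_funM => //; apply: measurable_sum => i; exact: measurable_funM.
by apply: measurable_funM; exact: measurable_emp_mean.
Qed.

Lemma measurable_boot_max_le d1 (T1 : measurableType d1) (g : T1 -> 'I_n -> 'cV[R]_p)
    (h : T1 -> 'I_n -> R) :
  (forall i j, measurable_fun setT (fun w => g w i j 0)) ->
  (forall i, measurable_fun setT (fun w => h w i)) ->
  forall t, measurable [set w | boot_max (g w) (h w) <= t].
Proof.
move=> mg mh t; have [t0|t0] := leP 0 t; last first.
  have -> : [set w | boot_max (g w) (h w) <= t] = set0.
    apply/seteqP; split => w //= wt.
    by have := lt_le_trans t0 (boot_max_ge0 (g w) (h w)); rewrite ltNge wt.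
  exact: measurable0.
pose v w (jk : 'I_p * 'I_p) := `|n%:R^-1 * \sum_i boot_coef (g w) i jk.1 jk.2 * h w i|.
have -> : [set w | boot_max (g w) (h w) <= t] = ~` [set w | exists jk, t < v w jk].
  apply/seteqP; split => w /=.
    move=> /(boot_max_le n2 _ _ p0 t0) hw [jk]; apply/negP; rewrite -leNgt; exact: hw.
  move=> hw; apply/(boot_max_le n2 _ _ p0 t0) => j k.
  by rewrite leNgt; apply/negP => hjk; apply: hw; exists (j, k).
apply: measurableC; apply: measurable_exists => jk.
apply: measurableT_comp (@normr_measurable R setT) _; apply: measurable_funM => //.
apply: measurable_sum => i; apply: measurable_funM => //.
apply: measurable_funB; last exact: measurable_sample_cov.
apply: measurable_funM => //.
by apply: measurable_funM; apply: measurable_funB => //; exact: measurable_emp_mean.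
Qed.

Lemma measurable_boot_max d1 (T1 : measurableType d1) (g : T1 -> 'I_n -> 'cV[R]_p)
    (h : T1 -> 'I_n -> R) :
  (forall i j, measurable_fun setT (fun w => g w i j 0)) ->
  (forall i, measurable_fun setT (fun w => h w i)) ->
  measurable_fun setT (fun w => boot_max (g w) (h w)).
Proof.
move=> mg mh.
apply: measurable_fun_of_le => t; exact: measurable_boot_max_le.
Qed.

Variable e : 'I_n -> T -> R.
Hypothesis me : forall i, measurable_fun setT (e i).

(** By [quantile_leE], a sublevel set of the quantile is a level set of the measure of sections of
    one measurable subset of the product of samples and multiplier outcomes. *)
Lemma measurable_boot_quantile d1 (T1 : measurableType d1) (g : T1 -> 'I_n -> 'cV[R]_p) a :
  (forall i j, measurable_fun setT (fun w => g w i j 0)) -> 0 < a < 1 ->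
  measurable_fun setT (fun w => boot_quantile P (g w) e a).
Proof.
move=> mg a01.
apply: measurable_fun_of_le => t.
have mz (x : 'I_n -> 'cV[R]_p) : measurable_fun setT (fun w => boot_max x (fun i => e i w)).
  by apply: (@measurable_boot_max _ T (fun=> x) (fun w i => e i w)).
have z0 (x : 'I_n -> 'cV[R]_p) w : 0 <= boot_max x (fun i => e i w) by exact: boot_max_ge0.
have -> : [set w | boot_quantile P (g w) e a <= t] =
    [set w | (a%:E <= P [set w' | (boot_max (g w) (fun i => e i w') <= t)%R])%E].
  by apply/seteqP; split => w /=; have := quantile_leE P (mz (g w)) (z0 (g w)) a01 t;
     rewrite /quantile /boot_quantile => ->.
pose A := [set z : T1 * T | boot_max (g z.1) (fun i => e i z.2) <= t].
have mA : measurable A.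
  apply: (@measurable_boot_max_le _ _ (fun z => g z.1) (fun z i => e i z.2)) => [i j|i].
    exact: measurableT_comp (mg i j) measurable_fst.
  exact: measurableT_comp (me i) measurable_snd.
have := @measurable_fun_xsection _ _ T1 T R P _ mA.
move=> /(_ measurableT _ (emeasurable_itv `[a%:E, +oo[)).
rewrite setTI; congr measurable.
apply/seteqP; split => w /=; rewrite in_itv/= andbT.
  by move=> h; apply: le_trans h _; rewrite le_eqVlt; apply/orP; left; apply/eqP; congr (P _);
     apply/seteqP; split => w' /=; rewrite /xsection/= inE.
move=> h; apply: le_trans h _; rewrite le_eqVlt; apply/orP; left; apply/eqP; congr (P _);
     by apply/seteqP; split => w' /=; rewrite /xsection/= inE.
Qed.

End BootQuantile.

(** * Measurability of the estimation errors *)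

Section SpectralNormMeasurable.
Context {R : realType} {p : nat}.
Implicit Types (A : 'M[R]_p) (t : R) (x : 'cV[R]_p).

Lemma euclidean_norm_scale (b : R) x : euclidean_norm (b *: x) = `|b| * euclidean_norm x.
Proof.
rewrite /euclidean_norm -sqrtr_sqr -sqrtrM ?sqr_ge0// mulr_sumr.
by congr Num.sqrt; apply: eq_bigr => k _; rewrite mxE exprMn.
Qed.

Lemma mulmx_norm_bounded A : exists2 L : R, 0 <= L &
  forall x, euclidean_norm (A *m x) <= L * euclidean_norm x.
Proof.
pose L := \sum_m \sum_k `|A m k|.
have L0 : 0 <= L by apply: sumr_ge0 => m _; apply: sumr_ge0.
exists L => // x; apply: mulmx_norm_le => // [m|k].
  rewrite /L [leRHS](bigD1 m)//= lerDl; apply: sumr_ge0 => m' _; exact: sumr_ge0.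
apply: ler_sum => m _; rewrite (bigD1 k)//= lerDl; exact: sumr_ge0.
Qed.

(** Homogeneity passes from the unit ball to all vectors. In this form the condition can be tested
    on a countable dense set. *)
Lemma spectral_norm_leP A t : spectral_norm A <= t <->
  0 <= t /\ forall x, euclidean_norm (A *m x) <= t * euclidean_norm x.
Proof.
have [L L0 hL] := mulmx_norm_bounded A.
have e0 : euclidean_norm (0 : 'cV[R]_p) = 0.
  by rewrite -[0](scale0r (0 : 'cV[R]_p)) euclidean_norm_scale normr0 mul0r.
have mem0 : [set euclidean_norm (A *m x) | x in [set x | euclidean_norm x <= 1]] 0.
  by exists 0 => /=; rewrite ?mulmx0 ?e0.
have ub : has_ubound [set euclidean_norm (A *m x) | x in [set x | euclidean_norm x <= 1]].
  exists L => _ [x /= x1 <-]; apply: le_trans (hL x) _.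
  by rewrite -[leRHS]mulr1 ler_wpM2l.
split=> [h|[t0 h]]; last first.
  apply: ge_sup; first by exists 0.
  move=> _ [x /= x1 <-]; apply: le_trans (h x) _.
  by rewrite -[leRHS]mulr1 ler_wpM2l.
have t0 : 0 <= t by apply: le_trans h; exact: ub_le_sup.
split=> // x.
have [x0|x0] := eqVneq (euclidean_norm x) 0.
  by apply: le_trans (hL x) _; rewrite x0 !mulr0.
have xp : 0 < euclidean_norm x by rewrite lt0r x0 sqrtr_ge0.
rewrite -ler_pdivrMr//; apply: le_trans h; apply: ub_le_sup => //.
exists ((euclidean_norm x)^-1 *: x) => /=.
  by rewrite euclidean_norm_scale ger0_norm ?invr_ge0 ?(ltW xp)// mulVf.
by rewrite -scalemxAr euclidean_norm_scale ger0_norm ?invr_ge0 ?(ltW xp)// mulrC.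
Qed.

Let quad A (y : 'I_p -> R) : R := \sum_m (\sum_k A m k * y k) ^+ 2.
Let sqn (y : 'I_p -> R) : R := \sum_k y k ^+ 2.

Let quadE A t x : 0 <= t ->
  (euclidean_norm (A *m x) <= t * euclidean_norm x) = (quad A (x ^~ 0) <= t ^+ 2 * sqn (x ^~ 0)).
Proof.
move=> t0; rewrite -(@ler_pXn2r _ 2) ?nnegrE ?mulr_ge0 ?sqrtr_ge0//.
rewrite exprMn !euclidean_norm_sqr; congr (_ <= _).
by apply: eq_bigr => m _; rewrite mxE.
Qed.

Let cvg_sum_ord (s : nat) (f : 'I_s -> nat -> R) (l : 'I_s -> R) :
  (forall i, (f i i0 @[i0 --> \oo]) --> l i) ->
  (\sum_i f i i0) @[i0 --> \oo] --> \sum_i l i.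
Proof.
move=> h; apply: cvg_big => [x|i _]; last exact: h.
exact: add_continuous.
Qed.

Let rat_dense A t : (forall y : {ffun 'I_p -> rat}, quad A (fun k => ratr (y k)) <=
    t ^+ 2 * sqn (fun k => ratr (y k))) ->
  forall y, quad A y <= t ^+ 2 * sqn y.
Proof.
move=> h y.
have [z hz] : exists z : nat -> {ffun 'I_p -> rat}, forall k, ratr (z i k) @[i --> \oo] --> y k.
  have ap i k : exists r : rat, y k - i.+1%:R^-1 < ratr r < y k.
    have yk : y k - i.+1%:R^-1 < y k by rewrite ltrBlDr ltrDl invr_gt0.
    by have [r] := rat_in_itvoo yk; rewrite in_itv; exists r.
  have [f hf] := choice (fun ik : nat * 'I_p => ap ik.1 ik.2).
  exists (fun i => [ffun k => f (i, k)]) => k.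
  apply: (@squeeze_cvgr _ _ _ _ (fun i => y k - i.+1%:R^-1) (fun=> y k)); last 2 first.
  - rewrite -[X in _ --> X]subr0; apply: cvgB; first exact: cvg_cst.
    exact: cvg_harmonic.
  - exact: cvg_cst.
  by near=> i; rewrite ffunE; have /andP[/ltW -> /ltW ->] := hf (i, k).
have c1 : quad A (fun k => ratr (z i k)) @[i --> \oo] --> quad A y.
  apply: cvg_sum_ord => m; apply: cvgM; last apply: cvg_sum_ord => k.
    by apply: cvg_sum_ord => k; apply: cvgM => //; exact: cvg_cst.
  by apply: cvgM => //; exact: cvg_cst.
have c2 : t ^+ 2 * sqn (fun k => ratr (z i k)) @[i --> \oo] --> t ^+ 2 * sqn y.
  apply: cvgM; first exact: cvg_cst.
  by apply: cvg_sum_ord => k; apply: cvgM.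
by apply: (ler_cvg_to c1 c2); near=> i; exact: h.
Unshelve. all: by end_near.
Qed.

(** By [rat_dense] a sublevel set is a countable intersection, enumerated by [unpickle]; numbers
    that encode no vector contribute the whole space. *)
Lemma measurable_spectral_norm d (T : measurableType d) (M : T -> 'M[R]_p) :
  (forall j k, measurable_fun setT (fun w => M w j k)) ->
  measurable_fun setT (fun w => spectral_norm (M w)).
Proof.
move=> mM; apply: measurable_fun_of_le => t.
have [t0|t0] := leP 0 t; last first.
  rewrite (_ : [set w | _] = set0)//; apply/seteqP; split => w //= /spectral_norm_leP [].
  by rewrite leNgt t0.
pose B (n : nat) := [set w | if @unpickle {ffun 'I_p -> rat} n is Some y then
   quad (M w) (fun k => ratr (y k)) <= t ^+ 2 * sqn (fun k => ratr (y k)) else true].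
have -> : [set w | spectral_norm (M w) <= t] = \bigcap_n B n.
  apply/seteqP; split => w /=.
    move=> /spectral_norm_leP[_ h] n _; rewrite /B /=.
    case: unpickle => // y; have := h (\col_k ratr (y k)); rewrite quadE//.
    rewrite (_ : (fun i => (\col_k ratr (y k)) i 0) = (fun k => ratr (y k)))//.
    by apply/funext => k; rewrite mxE.
  move=> h; apply/spectral_norm_leP; split => // x; rewrite quadE//.
  apply: rat_dense => y.
  by have := h (pickle y) Logic.I; rewrite /B /= pickleK.
apply: bigcapT_measurable => n; rewrite /B.
case: unpickle => [y|]; last by rewrite (_ : [set w | true] = setT)//; apply/seteqP.
rewrite -[X in measurable X]setTI; apply: measurable_fun_le => //.
by apply: measurable_sum => m; apply: measurable_funX; apply: measurable_sum => k; exact: measurable_funM.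
Qed.

Lemma measurable_frobenius_norm d (T : measurableType d) (M : T -> 'M[R]_p) :
  (forall j k, measurable_fun setT (fun w => M w j k)) ->
  measurable_fun setT (fun w => frobenius_norm (M w) ^+ 2).
Proof.
move=> mM.
have -> : (fun w => frobenius_norm (M w) ^+ 2) = (fun w => \sum_m \sum_k M w m k ^+ 2).
  by apply/funext => w; rewrite sqr_sqrtr// sumr_ge0// => m _; apply: sumr_ge0 => k _; exact: sqr_ge0.
by apply: measurable_sum => m; apply: measurable_sum => k; exact: measurable_funX.
Qed.

Lemma measurable_threshold d (T : measurableType d) (tau : T -> R) (M : T -> 'M[R]_p) j k :
  measurable_fun setT tau -> measurable_fun setT (fun w => M w j k) ->
  measurable_fun setT (fun w => threshold (tau w) (M w) j k).
Proof.
move=> mt mM.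
have -> : (fun w => threshold (tau w) (M w) j k) =
    (fun w => if tau w < `|M w j k| then M w j k else 0).
  by apply/funext => w; rewrite mxE.
apply: measurable_fun_ifT => //; apply: measurable_fun_ltr => //.
exact: measurableT_comp (@normr_measurable R setT) mM.
Qed.

End SpectralNormMeasurable.

(** * Coverage *)

Section Coverage.
Context {R : realType} {d : measure_display} {T : measurableType d} (P : probability T R).
Context {n' p : nat}.
Let n := n'.+1.
Hypotheses (n2 : (2 <= n)%N) (p0 : (0 < p)%N).
Variables (X : 'I_n -> {RV P >-> p.-tuple R}) (e : 'I_n -> {RV P >-> R}) (i1 : 'I_n).
Hypotheses (iid_X : iid X) (iid_e : iid e) (std_e : forall i, standard_normal (e i)).
Variables (nu u c C1 w rho c0 phi : R).
Hypotheses (nu1 : 1 <= nu) (u1 : 1 <= u) (uE : u ^+ 3 = nu ^+ 2) (c1 : 1 <= c).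
Hypothesis sub : forall i k, subgaussian P (nu ^+ 2) (fun w => tnth (X i w) k).
Hypothesis mean0 : forall k, ('E_P[fun w => tnth (X i1 w) k] = 0)%E.
Hypothesis mom2 : forall k, expect P (fun w => `|tnth (X i1 w) k| ^+ 2) <= c * u.
Hypothesis mom4 : forall k, expect P (fun w => `|tnth (X i1 w) k| ^+ 4) <= c * u ^+ 2.
Hypothesis mom8 : forall k, expect P (fun w => `|tnth (X i1 w) k| ^+ 8) <= c * u ^+ 6.
Hypothesis mom6 : forall k, expect P (fun w => `|tnth (X i1 w) k| ^+ 6) <= c * u ^+ 3.
Hypothesis C10 : 0 < C1.
Hypothesis var_ge : forall j k, 4 * C1 <= fourth_mx X i1 j k j k - cov_mx P (X i1) j k ^+ 2.

Let q : R := Num.sqrt n%:R.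
Let kappa := (Num.sqrt C1)^-1.
Let g3 : R := gauss3.
Let D0 := 541 * (6 * c) ^+ 4 * kappa ^+ 2.
Let A0 := expR 3 * (900 * c ^+ 3 * kappa ^+ 3).
Hypotheses (w1 : 1 <= w) (rho0 : 0 < rho) (rho1 : rho <= 1).
Hypothesis rhoE : rho ^+ 3 * q = u ^+ 3 * w ^+ 7.
Hypotheses (c00 : 0 < c0) (c01 : c0 <= 1) (phiE : phi = c0 * w / rho).
Hypothesis JL : #|@pair_index p|%:R <= expR (2 * w ^+ 2).
Hypotheses (c0g : 272 * g3 * c0 ^+ 3 <= 1) (c0A : 272 * A0 * c0 ^+ 3 <= 1)
  (c0D : 36 * D0 * c0 ^+ 2 <= 1).
Hypotheses (rho16 : 16 * rho ^+ 2 <= 1) (rhok : 16 * kappa * rho ^+ 2 <= 1)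
  (rhov : 541 * (6 * c) ^+ 4 * rho ^+ 3 <= C1)
  (exp_n : 408 * expR 1 * expR (- (2 * w ^+ 2)) * q ^+ 2 <= 1).
Hypothesis ellE : w ^+ 2 = ln (n * p)%:R.
Hypotheses (rho80 : 80 * rho ^+ 6 <= 1) (rhol : 70 * (6 * c) ^+ 2 * kappa * rho ^+ 2 <= 1).
Hypothesis n8 : (8 < n)%N.
Variable alpha : R.
Hypothesis alpha01 : 0 < alpha < 1.

Let n0 : 0 < n%:R :> R. Proof. by rewrite ltr0n. Qed.
Let q0 : 0 < q. Proof. by rewrite sqrtr_gt0. Qed.
Let qq : q ^+ 2 = n%:R. Proof. by rewrite sqr_sqrtr ?(ltW n0). Qed.
Let w0 : 0 < w := lt_le_trans ltr01 w1.
Let u0 : 0 < u := lt_le_trans ltr01 u1.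
Let phi0 : 0 < phi. Proof. by rewrite phiE divr_gt0// mulr_gt0. Qed.
Let cc1 : 1 <= 6 * c. Proof. by have := c1; lra. Qed.
Let cc0 : 0 <= 6 * c := le_trans ler01 cc1.
Let kappa0 : 0 <= kappa. Proof. by rewrite invr_ge0 sqrtr_ge0. Qed.
Let w2 : 1 <= w ^+ 2. Proof. exact: exprn_ege1. Qed.
Let eps := @sample_eps R n (w ^+ 2).
Let Sig j k := cov_mx P (X i1) j k.

Let large : 80 * u ^+ 6 * (w ^+ 2) ^+ 5 <= n%:R.
Proof. by rewrite -exprM -qq; exact: (tuned_large w1 u1 rhoE rho80). Qed.

Let SigK j k : `|Sig j k| <= 6 * c * u.
Proof. exact: (cov_le nu1 u1 c1 sub mean0 mom2). Qed.

Let Q4K j k l m : `|fourth_mx X i1 j k l m| <= 6 * c * u ^+ 2.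
Proof. exact: (fourth_le nu1 c1 sub mom4). Qed.

(** The shift of level gained in [good_sample_tail]: half is spent on linearising the sample
    covariance, half on choosing a comparison sample close to the infimum. *)
Let slack := Num.sqrt C1 / (q * phi).

Let lin_small (x : 'I_n -> 'cV[R]_p) : good_sample Sig (fourth_mx X i1) (6 * c) u eps x ->
  forall j k, `|sample_cov x j k - emp_prod x j k| <= slack / 2.
Proof.
move=> gx j k.
have [e0 e1 e2] := sample_eps_small i1 u1 w2 large.
apply: le_trans (sample_cov_lin n2 cc1 u1 e0 e1 e2 SigK gx j k) _.
have -> : @sample_eps R n (w ^+ 2) ^+ 2 = 5 * w ^+ 2 / q ^+ 2 :> R.
  rewrite /sample_eps -qq sqr_sqrtr//.
  exact: divr_ge0 (mulr_ge0 (ler0n R 5) (sqr_ge0 w)) (sqr_ge0 q).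
have cc2 : 0 <= (6 * c) ^+ 2 := sqr_ge0 _.
have := tuned_linear w1 q0 u1 rho0 rhoE c00 c01 kappa0 phiE cc2 rhol.
rewrite /slack /kappa; set z := (6 * c) ^+ 2 * u ^+ 2 * _ => h.
have sC : 0 < Num.sqrt C1 by rewrite sqrtr_gt0.
have qp : 0 < q * phi by exact: mulr_gt0.
have h1 : 14 * z * (q * phi) <= Num.sqrt C1.
  rewrite -[leRHS]mul1r -ler_pdivrMr//; apply: le_trans h.
  by rewrite le_eqVlt; apply/orP; left; apply/eqP; ring.
have h2 : 14 * z <= Num.sqrt C1 / (q * phi) by rewrite ler_pdivlMr.
lra.
Qed.

Let a y := boot_quantile P (fun i => vec (X i y)) e (1 - alpha).

(* The multiplier law is compared at one fixed good sample whose quantile is within [slack / 2] of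
   the infimum over good samples, so that conditioning on the data is never needed. *)
Lemma coverage (E : set T) : measurable E ->
  (forall y, (forall j k, `|sample_cov (fun i => vec (X i y)) j k - Sig j k| <= a y) -> E y) ->
  ((1 - alpha - (8 / n%:R + tail_const * (Num.sqrt (2 * w ^+ 2) / phi)))%:E <= P E)%E.
Proof.
move=> mE hE.
have [B [mB PB gB]] := good_event iid_X nu1 u1 uE c1 p0 sub mean0 mom2 mom4 mom8 ellE w2 large.
(* Good samples exist because [8 / n < 1]. *)
have [y0 ny0] : exists y, ~ B y.
  apply: contrapT => hn.
  have BT : B = setT.
    by apply/seteqP; split => y // _; apply: contrapT => hy; apply: hn; exists y.
  move: PB; rewrite BT probability_setT lee_fin ler_pdivlMr// mul1r ler_nat.
  by rewrite leqNgt n8.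
have a01 : 0 < 1 - alpha < 1 by move/andP: alpha01 => [? ?]; rewrite subr_gt0 gtrBl; apply/andP.
have me i : measurable_fun setT (e i) by exact: measurable_funPT.
have mz (x : 'I_n -> 'cV[R]_p) : measurable_fun setT (fun y => boot_max x (fun i => e i y)).
  by apply: (@measurable_boot_max _ _ _ n2 p0 _ T (fun=> x) (fun y i => e i y)).
have z0 (x : 'I_n -> 'cV[R]_p) y : 0 <= boot_max x (fun i => e i y) by exact: boot_max_ge0.
have a0 y : 0 <= a y by exact: (quantile_ge0 P (mz _) (z0 _) a01).
have slack0 : 0 < slack by rewrite divr_gt0 ?mulr_gt0// sqrtr_gt0.
pose A := [set a y | y in ~` B].
have hA : has_inf A by split; [exists (a y0); exists y0|exists 0 => _ [y _ <-]].
have s2 : 0 < slack / 2 by rewrite divr_gt0.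
have [_ [y1 nB1 <-] a1] := inf_adherent s2 hA.
have gx := gB y1 nB1.
pose V := [set y | exists jk : 'I_p * 'I_p, a y1 - slack <
   `|emp_prod (fun i => vec (X i y)) jk.1 jk.2 - cov_mx P (X i1) jk.1 jk.2|].
have mV : measurable V.
  apply: measurable_exists => jk.
  apply: measurableT_comp (@normr_measurable R setT) _; apply: measurable_funB => //.
  apply: measurable_funM => //; apply: measurable_sum => i.
  have EX l : (fun y => vec (X i y) l 0) = (fun y => tnth (X i y) l).
    by apply/funext => y; rewrite mxE.
  by apply: measurable_funM; rewrite EX; exact: measurable_coord.
have t0 : 0 <= a y1 - slack + slack by rewrite subrK.
have tail : (P V <= P [set y | (a y1 - slack + slack < boot_max (fun i => vec (X i y1)) (fun i => e i y))%R] +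
    (tail_const * (Num.sqrt (2 * w ^+ 2) / phi))%:E)%E.
  exact: (@good_sample_tail R d T P n' p n2 p0 X e i1 iid_X iid_e std_e nu u c C1 w rho c0 phi
  nu1 u1 uE c1 (sub i1) mean0 mom6 SigK Q4K C10 var_ge w1 rho0 rho1 rhoE c00 c01 phiE JL c0g c0A c0D
  rho16 rhok rhov exp_n _ gx (a y1 - slack) t0).
rewrite subrK in tail.
have mle : measurable [set y | boot_max (fun i => vec (X i y1)) (fun i => e i y) <= a y1].
  by apply: (@measurable_boot_max_le R n p n2 p0 _ T (fun=> (fun i => vec (X i y1))) (fun y i => e i y)).
have Pa : (P [set y | (a y1 < boot_max (fun i => vec (X i y1)) (fun i => e i y))%R] <= alpha%:E)%E.
  have -> : [set y | a y1 < boot_max (fun i => vec (X i y1)) (fun i => e i y)] =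
     ~` [set y | boot_max (fun i => vec (X i y1)) (fun i => e i y) <= a y1].
    by apply/seteqP; split => y /=; rewrite ltNge => /negP.
  rewrite probability_setC//.
  have := quantile_prob P (mz (fun i => vec (X i y1))) (z0 _) a01.
  rewrite -/(boot_quantile P (fun i => vec (X i y1)) e (1 - alpha)) -/(a y1).
  by rewrite -(fineK (fin_num_measure P _ mle)) -EFinB !lee_fin lerBlDl lerBlDr.
(* On a good outcome the quantile is at least [a y1 - slack / 2], so a linear part of at most
   [a y1 - slack] plus a linearisation error of at most [slack / 2] stays below it. *)
have sub_bad : ~` E `<=` B `|` V.
  move=> y nE; have [By|nB] := pselect (B y); first by left.
  right; apply: contrapT => nV; apply: nE; apply: hE => j k.
  have ay : a y1 - slack / 2 <= a y.
    rewrite lerBlDr; apply: le_trans (ltW a1) _; rewrite lerD2r.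
    by apply: ge_inf; [case: hA|exists y].
  have h1 : `|emp_prod (fun i => vec (X i y)) j k - Sig j k| <= a y1 - slack.
    by rewrite leNgt; apply/negP => hjk; apply: nV; exists (j, k).
  have h2 := lin_small (gB y nB) j k.
  have -> : sample_cov (fun i => vec (X i y)) j k - Sig j k =
    (sample_cov (fun i => vec (X i y)) j k - emp_prod (fun i => vec (X i y)) j k) +
    (emp_prod (fun i => vec (X i y)) j k - Sig j k) by ring.
  apply: le_trans (ler_normD _ _) _; apply: le_trans (lerD h2 h1) _; apply: le_trans ay.
  by rewrite le_eqVlt; apply/orP; left; apply/eqP; field.
have mC : measurable (~` E) by exact: measurableC.
have PC : (P (~` E) <= (8 / n%:R + (alpha + tail_const * (Num.sqrt (2 * w ^+ 2) / phi)))%:E)%E.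
  apply: le_trans (le_measure _ _ _ sub_bad) _; rewrite ?inE//; first exact: measurableU.
  apply: le_trans (measureU2 _ mB mV) _; rewrite EFinD; apply: leeD => //.
  by apply: le_trans tail _; rewrite EFinD; exact: (leeD Pa (lexx _)).
have := probability_setC P mE => EC; move: PC; rewrite EC.
rewrite -(fineK (fin_num_measure P _ mE)) -EFinB !lee_fin lerBlDr.
by rewrite -[1 - alpha - _]addrA -opprD lerBlDr [fine _ + _]addrC [alpha + (_ + _)]addrCA.
Qed.

End Coverage.

(** * Expectation of the bootstrap quantile *)

Section BootQuantileBound.
Context {R : realType} {d : measure_display} {T : measurableType d} (P : probability T R).
Context {n' p : nat}.
Let n := n'.+1.
Hypotheses (n2 : (2 <= n)%N) (p0 : (0 < p)%N).
Variable e : 'I_n -> {RV P >-> R}.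
Hypotheses (iid_e : iid e) (std_e : forall i, standard_normal (e i)).

Let n0 : 0 < n%:R :> R. Proof. by rewrite ltr0n. Qed.
Let pR0 : 0 < p%:R :> R. Proof. by rewrite ltr0n. Qed.

(** Chernoff bound for each of the [2 p^2] signed entries at the optimal [lam = n t / V], followed
    by a union bound: [t] solves [expR (- (n t^2 / (2 V))) = alpha / (2 p^2)]. *)
Lemma boot_quantile_le (x : 'I_n -> 'cV[R]_p) (V alpha : R) : 0 < V -> 0 < alpha < 1 ->
  (forall j k, emp_avg (fun i => boot_coef x i j k * boot_coef x i j k) <= V) ->
  boot_quantile P x e (1 - alpha) <= Num.sqrt (2 * V * ln (2 * p%:R ^+ 2 / alpha) / n%:R).
Proof.
move=> V0 /andP[a0 a1] hV.
set l := ln _; set t := Num.sqrt _.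
have p1 : 1 <= p%:R :> R by rewrite ler1n.
have arg1 : 1 < 2 * p%:R ^+ 2 / alpha.
  rewrite ltr_pdivlMr// mul1r (lt_le_trans a1)//.
  by have : 1 <= p%:R ^+ 2 :> R by [exact: exprn_ege1]; lra.
have l0 : 0 < l by exact: ln_gt0.
have arg0 : 0 < 2 * V * l / n%:R by rewrite divr_gt0 ?mulr_gt0.
have t0 : 0 < t by rewrite sqrtr_gt0.
have tt : t ^+ 2 = 2 * V * l / n%:R by rewrite sqr_sqrtr// ltW.
pose c (i : 'I_n) (a : @pair_index p) : R := (-1) ^+ a.2 * (n%:R^-1 * boot_coef x i a.1.1 a.1.2).
have vc a : \sum_i c i a ^+ 2 <= V / n%:R.
  have -> : \sum_i c i a ^+ 2 =
      emp_avg (fun i => boot_coef x i a.1.1 a.1.2 * boot_coef x i a.1.1 a.1.2) / n%:R.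
    rewrite /emp_avg mulrAC mulr_sumr; apply: eq_bigr => i _.
    by rewrite /c exprMn sqrr_sign; field; rewrite gt_eqF.
  by rewrite ler_wpM2r ?invr_ge0 ?(ltW n0).
pose lam := n%:R * t / V.
have lam0 : 0 < lam by rewrite divr_gt0 ?mulr_gt0.
pose E (a : @pair_index p) := [set y | t < gvec e c y a].
have mE a : measurable (E a).
  rewrite -[X in measurable X]setTI.
  have -> : E a = (fun y => gvec e c y a) @^-1` [set` `]t, +oo[].
    by apply/seteqP; split => y /=; rewrite in_itv/= andbT.
  exact: measurable_gvec.
have PE a : (P (E a) <= (alpha / (2 * p%:R ^+ 2))%:E)%E.
  have := @integral_indic _ T R P setT measurableT _ (mE a); rewrite setIT => <-.
  have mexp : measurable_fun setT (fun y => (expR (lam * gvec e c y a))%:E).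
    apply/measurable_EFinP; apply: measurableT_comp (@measurable_expR R) _.
    by apply: measurable_funM => //; exact: measurable_gvec.
  apply: (@le_trans _ _ (\int[P]_y ((expR (- (lam * t)))%:E * (expR (lam * gvec e c y a))%:E))%E).
    apply: ge0_le_integral => //.
    - by apply/measurable_EFinP; exact: measurable_indic.
    - exact: measurable_funeM.
    move=> y _; rewrite indicE -EFinM lee_fin -expRD.
    case: (boolP (y \in _)) => [|_]; last exact: expR_ge0.
    rewrite inE /E /= => h; rewrite -[leLHS]expR0 ler_expR addrC subr_ge0.
    by rewrite ler_wpM2l ?(ltW lam0)// ltW.
  rewrite ge0_integralZl//.
  rewrite (gvec_mgf iid_e std_e) -EFinM lee_fin -expRD.
  have -> : alpha / (2 * p%:R ^+ 2) = expR (- l).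
    by rewrite expRN lnK ?posrE ?(lt_trans ltr01 arg1)// invf_div.
  rewrite ler_expR.
  apply: (@le_trans _ _ (- (lam * t) + lam ^+ 2 / 2 * (V / n%:R))).
    by rewrite lerD2l ler_wpM2l ?divr_ge0 ?sqr_ge0.
  rewrite le_eqVlt; apply/orP; left; apply/eqP.
  have -> : - (lam * t) + lam ^+ 2 / 2 * (V / n%:R) = - (n%:R * t ^+ 2 / (2 * V)).
    by rewrite /lam; field; rewrite !gt_eqF.
  by rewrite tt; field; rewrite !gt_eqF.
have mle : measurable [set y | boot_max x (fun i => e i y) <= t].
  by apply: (@measurable_boot_max_le R n p n2 p0 _ T (fun=> x) (fun y i => e i y)).
apply: (@quantile_le R _ _ P _ (1 - alpha)) => [y||].
- exact: boot_max_ge0.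
- by rewrite subr_gt0 a1 gtrBl.
have sub_bad : ~` [set y | boot_max x (fun i => e i y) <= t] `<=` \bigcup_(a in [set: @pair_index p]) E a.
  move=> y /= hy; apply: contrapT => hn; apply: hy.
  apply/(boot_max_le n2 _ _ p0 (ltW t0)) => j k; rewrite leNgt; apply/negP => h; apply: hn.
  set z := n%:R^-1 * _ in h.
  exists ((j, k), z < 0) => //; rewrite /E /= /gvec.
  have -> : \sum_(i < n) c i (j, k, z < 0) * e i y = (-1) ^+ (z < 0)%R * z.
    by rewrite /z !mulr_sumr; apply: eq_bigr => i _; rewrite /c /= !mulrA.
  have -> : (-1) ^+ (z < 0)%R * z = `|z|.
    by rewrite mulr_sign; case: ltrP => z0; [rewrite ltr0_norm|rewrite ger0_norm].
  exact: h.
have PC : (P (~` [set y | (boot_max x (fun i => e i y) <= t)%R]) <= alpha%:E)%E.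
  have mB : measurable (\bigcup_(a in [set: @pair_index p]) E a).
    by apply: fin_bigcup_measurable => [|a _]; [exact: finite_finset|exact: mE].
  apply: le_trans (le_measure _ _ _ sub_bad) _; rewrite ?inE//; first exact: measurableC.
  apply: le_trans (union_bound mE PE) _.
  rewrite !card_prod card_bool !card_ord lee_fin le_eqVlt; apply/orP; left; apply/eqP.
  by rewrite !natrM; field; rewrite gt_eqF.
have := probability_setC P mle => EC; move: PC; rewrite EC.
by rewrite -(fineK (fin_num_measure P _ mle)) -EFinB !lee_fin lerBlDr lerBlDl.
Qed.

End BootQuantileBound.

Section BootVarianceBound.
Context {R : realType} {n p : nat}.
Hypothesis n2 : (2 <= n)%N.
Variables (x : 'I_n -> 'cV[R]_p) (D : R).
Hypothesis hD : forall j, emp_avg (fun i => x i j 0 ^+ 4) <= D.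

Let n0 : 0 < n%:R :> R. Proof. by rewrite ltr0n (leq_trans _ n2). Qed.

(** Jensen through the tangent of the fourth power at the mean. *)
Lemma emp_mean_pow4 j : emp_mean x j ^+ 4 <= emp_avg (fun i => x i j 0 ^+ 4).
Proof.
set m := emp_mean x j.
have h : emp_avg (fun i => m ^+ 4 + 4 * m ^+ 3 * (x i j 0 - m)) <= emp_avg (fun i => x i j 0 ^+ 4).
  apply: le_emp_avg => // i; rewrite -subr_ge0; set y := x i j 0.
  have -> : y ^+ 4 - (m ^+ 4 + 4 * m ^+ 3 * (y - m)) = (y - m) ^+ 2 * ((y + m) ^+ 2 + 2 * m ^+ 2) by ring.
  apply: mulr_ge0; first exact: sqr_ge0.
  by apply: addr_ge0; [exact: sqr_ge0|exact: mulr_ge0 (ler0n R 2) (sqr_ge0 m)].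
apply: le_trans h; rewrite emp_avgD (emp_avgZ _ (fun i => x i j 0 - m)) emp_avgB !emp_avg_cst//.
by rewrite -[emp_avg _]/m subrr mulr0 addr0.
Qed.

Lemma centered_pow4 j : emp_avg (fun i => centered x i j ^+ 4) <= 16 * D.
Proof.
apply: (@le_trans _ _ (emp_avg (fun i => 8 * (x i j 0 ^+ 4) + 8 * emp_mean x j ^+ 4))).
  apply: le_emp_avg => // i; rewrite /centered -subr_ge0.
  set y := x i j 0; set m := emp_mean x j.
  have -> : 8 * y ^+ 4 + 8 * m ^+ 4 - (y - m) ^+ 4 =
    4 * (y ^+ 2 - m ^+ 2) ^+ 2 + (y + m) ^+ 2 * (2 * (y ^+ 2 + m ^+ 2) + (y - m) ^+ 2) by ring.
  apply: addr_ge0; first by rewrite mulr_ge0// sqr_ge0.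
  apply: mulr_ge0; first exact: sqr_ge0.
  apply: addr_ge0; last exact: sqr_ge0.
  exact: mulr_ge0 (ler0n R 2) (addr_ge0 (sqr_ge0 y) (sqr_ge0 m)).
rewrite emp_avgD (emp_avgZ _ (fun i => x i j 0 ^+ 4)) emp_avg_cst//.
have := hD j; have := emp_mean_pow4 j; lra.
Qed.

(** 64 is [2^2], from [bessel <= 2], times the 16 lost in centring fourth powers. *)
Lemma boot_var_le j k : emp_avg (fun i => boot_coef x i j k * boot_coef x i j k) <= 64 * D.
Proof.
rewrite {1}/emp_avg (boot_coef_cov n2).
apply: (@le_trans _ _ (bessel ^+ 2 * (16 * D))).
  rewrite lerBlDr -[leLHS]addr0; apply: lerD; last by rewrite -expr2 sqr_ge0.
  apply: ler_wpM2l; first exact: sqr_ge0.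
  apply: (@le_trans _ _ (emp_avg (fun i => 2^-1 * (centered x i j ^+ 4 + centered x i k ^+ 4)))).
    apply: le_emp_avg => // i; set y := centered x i j; set z := centered x i k.
    rewrite -subr_ge0.
    have -> : 2^-1 * (y ^+ 4 + z ^+ 4) - y * z * (y * z) = 2^-1 * (y ^+ 2 - z ^+ 2) ^+ 2 by field.
    by rewrite mulr_ge0// sqr_ge0.
  rewrite (emp_avgZ _ (fun i => centered x i j ^+ 4 + centered x i k ^+ 4)) emp_avgD.
  have := centered_pow4 j; have := centered_pow4 k; lra.
have D0 : 0 <= D.
  apply: le_trans (hD j); rewrite -(@emp_avg_cst R n n2 0); apply: le_emp_avg => // i.
  by rewrite exprn_even_ge0.
have b0 : 0 <= @bessel R n by rewrite /bessel divr_ge0.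
have b2 : @bessel R n <= 2.
  rewrite /bessel ler_pdivrMr; last by rewrite ltr0n; case: (n) n2 => [|[]].
  rewrite -natrM ler_nat; case: (n) n2 => [|[|m]] //= _.
  by rewrite mul2n -addnn !addSn !addnS !ltnS leq_addr.
have -> : 64 * D = 2 ^+ 2 * (16 * D) by ring.
apply: ler_wpM2r; first by rewrite mulr_ge0.
by rewrite lerXn2r ?nnegrE.
Qed.

End BootVarianceBound.

(** * Expected size of the bootstrap quantile *)

Section QuantileExpectation.
Context {R : realType} {d : measure_display} {T : measurableType d} (P : probability T R).
Context {n' p : nat}.
Let n := n'.+1.
Hypotheses (n2 : (2 <= n)%N) (p2 : (2 <= p)%N).
Variables (X : 'I_n -> {RV P >-> p.-tuple R}) (e : 'I_n -> {RV P >-> R}) (i1 : 'I_n).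
Hypotheses (iid_X : iid X) (iid_e : iid e) (std_e : forall i, standard_normal (e i)).
Variables (nu c8 m4 ell C1 C4 alpha : R).
Hypothesis nu1 : 1 <= nu.
Hypothesis sub : forall i k, subgaussian P (nu ^+ 2) (fun w => tnth (X i w) k).
Hypothesis mom4 : forall k, expect P (fun w => `|tnth (X i1 w) k| ^+ 4) <= m4.
Hypothesis mom8 : forall k, expect P (fun w => `|tnth (X i1 w) k| ^+ 8) <= c8 * nu ^+ 4.
Hypotheses (ellE : ell = ln (n * p)%:R) (ell1 : 1 <= ell).
Hypotheses (C10 : 0 < C1) (C40 : 0 < C4) (c80 : 0 <= c8) (m4C : 4 * C1 <= m4).
Hypothesis rate : nu ^+ 4 * ell ^+ 7 <= C4 * n%:R.
Hypothesis alpha01 : 0 < alpha < 1.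

Let p0 : (0 < p)%N := ltnW p2.
Let n0 : 0 < n%:R :> R. Proof. by rewrite ltr0n. Qed.
Let pR0 : 0 < p%:R :> R. Proof. by rewrite ltr0n. Qed.
Let nu0 : 0 < nu := lt_le_trans ltr01 nu1.
Let ell0 : 0 < ell := lt_le_trans ltr01 ell1.
Let m40 : 0 < m4. Proof. by apply: lt_le_trans m4C; rewrite mulr_gt0. Qed.
Let nu40 : 0 < nu ^+ 4. Proof. exact: exprn_gt0. Qed.

(* Clipping [X^4] at [b] corresponds to [X^2 / nu^2 <= 2 ell], and beyond that level subgaussianity
   pays a factor [expR (- ell) = 1 / (n p)]. *)
Let b := 4 * ell ^+ 2 * nu ^+ 4.
Let lam := (2 * b)^-1.
Let b0 : 0 < b. Proof. by rewrite mulr_gt0// mulr_gt0// exprn_gt0. Qed.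
Let lam0 : 0 < lam. Proof. by rewrite invr_gt0 mulr_gt0. Qed.
Let lamb : lam * b <= 2^-1.
Proof. by rewrite le_eqVlt; apply/orP; left; apply/eqP; rewrite /lam; field; rewrite gt_eqF. Qed.
(** A level for averages of clipped fourth powers: the mean, the second-order term of the
    exponential moment, and [ln p / (n lam)] for the maximum over [p] coordinates. *)
Let cs := m4 + 2 * lam * (c8 * nu ^+ 4) + ln p%:R / (n%:R * lam).
Let lnp0 : 0 <= ln p%:R :> R. Proof. by rewrite ln_ge0// ler1n. Qed.
Let cs0 : 0 < cs.
Proof.
rewrite /cs -addrA; apply: ltr_pwDl => //; apply: addr_ge0.
  exact: mulr_ge0 (mulr_ge0 (ler0n R 2) (ltW lam0)) (mulr_ge0 c80 (ltW nu40)).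
exact: divr_ge0 lnp0 (mulr_ge0 (ltW n0) (ltW lam0)).
Qed.

Let S j w := \sum_i Num.min (tnth (X i w) j ^+ 4) b.

Let mS j : measurable_fun setT (S j).
Proof.
apply: measurable_sum => i; apply: measurable_minr => //; apply: measurable_funX.
exact: measurable_coord.
Qed.

Let pow_norm (y : R) : `|y| ^+ 4 = y ^+ 4.
Proof. by rewrite !(exprM _ 2 2) real_normK ?num_real. Qed.

Let S_mgf j : (\int[P]_w (expR (lam * S j w))%:E <=
  (expR (n%:R * (lam * m4 + 2 * lam ^+ 2 * (c8 * nu ^+ 4))))%:E)%E.
Proof.
have nE : (fun w => tnth (X i1 w) j ^+ 4) = (fun w => `|tnth (X i1 w) j| ^+ 4).
  by apply/funext => w; rewrite pow_norm.
have nE8 : (fun w => (tnth (X i1 w) j ^+ 4) ^+ 2) = (fun w => `|tnth (X i1 w) j| ^+ 8).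
  by apply/funext => w; rewrite -pow_norm -exprM.
have mf : measurable_fun setT (fun y : p.-tuple R => tnth y j ^+ 4).
  by apply: measurable_funX; exact: measurable_tnth.
have i4 : integrableR P (fun w => tnth (X i1 w) j ^+ 4).
  by rewrite nE; exact: (coord_pow_int nu1 (sub i1) j 4).
have i8 : integrableR P (fun w => (tnth (X i1 w) j ^+ 4) ^+ 2).
  by rewrite nE8; exact: (coord_pow_int nu1 (sub i1) j 8).
have e8 : expect P (fun w => (tnth (X i1 w) j ^+ 4) ^+ 2) <= c8 * nu ^+ 4 by rewrite nE8.
have := @clipped_mgf_sum R _ _ P _ _ n X i1 iid_X (fun y => tnth y j ^+ 4) (c8 * nu ^+ 4) lam b
  mf i4 i8 e8 lam0 (ltW b0) lamb.
move=> /le_trans; apply; rewrite lee_fin ler_expR ler_wpM2l ?(ltW n0)// lerD2r.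
by rewrite ler_wpM2l ?(ltW lam0)// nE.
Qed.

Let expS j w := expR (lam * S j w).
Let expS_int j : integrableR P (expS j).
Proof.
apply: integrableR_ge0 => [|w|].
- by apply: measurableT_comp (@measurable_expR R) _; apply: measurable_funM.
- exact: expR_ge0.
by apply: le_lt_trans (S_mgf j) _; exact: ltry.
Qed.

Let Sn := (n%:R * lam)^-1 * expR (- (n%:R * lam * cs)).
Let tl := n%:R^-1 * (8 * nu ^+ 4 * expR (- ell)).
Let G (ik : 'I_n * 'I_p) w := expR (tnth (X ik.1 w) ik.2 ^+ 2 / nu ^+ 2).
(** An integrable envelope of the largest empirical fourth moment: the level [cs], an exponential
    correction for clipped averages above it, and the parts cut off by clipping. *)
Let D w := cs + (Sn * \sum_j expS j w + tl * \sum_ik G ik w).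

Let Sn0 : 0 <= Sn.
Proof. by rewrite mulr_ge0 ?expR_ge0// invr_ge0 mulr_ge0 ?(ltW n0) ?(ltW lam0). Qed.
Let tl0 : 0 <= tl.
Proof.
rewrite mulr_ge0 ?invr_ge0 ?(ltW n0)//.
exact: mulr_ge0 (mulr_ge0 (ler0n R 8) (ltW nu40)) (expR_ge0 _).
Qed.

Let G_int ik : integrableR P (G ik).
Proof. exact: (subgaussian_int (sub ik.1) ik.2). Qed.

Let D_int : integrableR P D.
Proof.
apply: integrableRD; first exact: integrableR_cst.
by apply: integrableRD; apply: integrableRZ; exact: integrableR_sum.
Qed.

Let D_gt0 w : 0 < D w.
Proof.
rewrite /D; apply: ltr_pwDl => //; apply: addr_ge0; apply: mulr_ge0 => //; apply: sumr_ge0 => *; exact: expR_ge0.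
Qed.

(** Above [b] one has [z = y^2 / nu^2 >= 2 ell], hence [z^2 <= 8 expR (z / 2) <= 8 expR (z -
    ell)]. *)
Let tail_le (y : R) : y ^+ 4 <= Num.min (y ^+ 4) b + 8 * nu ^+ 4 * expR (- ell) * expR (y ^+ 2 / nu ^+ 2).
Proof.
have q0 : 0 <= 8 * nu ^+ 4 * expR (- ell) * expR (y ^+ 2 / nu ^+ 2).
  exact: mulr_ge0 (mulr_ge0 (mulr_ge0 (ler0n R 8) (ltW nu40)) (expR_ge0 _)) (expR_ge0 _).
have [yb|by_] := leP (y ^+ 4) b; first by rewrite lerDl.
apply: (@le_trans _ _ (8 * nu ^+ 4 * expR (- ell) * expR (y ^+ 2 / nu ^+ 2))); last by rewrite lerDr ltW.
set z := y ^+ 2 / nu ^+ 2.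
have z0 : 0 <= z by rewrite divr_ge0 ?sqr_ge0.
have yz : y ^+ 4 = nu ^+ 4 * z ^+ 2 by rewrite /z; field; rewrite gt_eqF.
have zl : 2 * ell <= z.
  have e0 : 0 <= 2 * ell := mulr_ge0 (ler0n R 2) (ltW ell0).
  rewrite -(@ler_pXn2r _ 2) ?nnegrE//.
  rewrite -(ler_pM2l nu40) -yz; apply: le_trans (ltW by_).
  by rewrite le_eqVlt; apply/orP; left; apply/eqP; rewrite /b; ring.
have h := @expR_ge_pow R 2 (z / 2) (divr_ge0 z0 (ler0n R 2)).
have z8 : z ^+ 2 <= 8 * expR (z / 2).
  have -> : z ^+ 2 = 4 * (z / 2) ^+ 2 by field.
  move: h; rewrite -[2`!]/2%N => h; lra.
rewrite yz; apply: (@le_trans _ _ (nu ^+ 4 * (8 * expR (z / 2)))); first by rewrite ler_wpM2l ?(ltW nu40).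
have -> : 8 * nu ^+ 4 * expR (- ell) * expR z = nu ^+ 4 * (8 * expR (z - ell)).
  by rewrite expRD; ring.
by rewrite ler_wpM2l ?(ltW nu40)// ler_wpM2l// ler_expR; lra.
Qed.

Let avg_le w j : emp_avg (fun i => vec (X i w) j 0 ^+ 4) <= D w.
Proof.
apply: (@le_trans _ _ (emp_avg (fun i => Num.min (tnth (X i w) j ^+ 4) b +
    8 * nu ^+ 4 * expR (- ell) * expR (tnth (X i w) j ^+ 2 / nu ^+ 2)))).
  by apply: le_emp_avg => // i; rewrite mxE; exact: tail_le.
rewrite emp_avgD (emp_avgZ _ (fun i => expR (tnth (X i w) j ^+ 2 / nu ^+ 2))) /D addrA; apply: lerD.
  rewrite -[emp_avg _]/(n%:R^-1 * S j w).
  have nl0 : 0 < n%:R * lam by exact: mulr_gt0.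
  have h := expR_ge1Dx (lam * S j w - n%:R * lam * cs).
  have h1 : n%:R^-1 * S j w <= cs + (n%:R * lam)^-1 * expR (lam * S j w - n%:R * lam * cs).
    have -> : n%:R^-1 * S j w = cs + (n%:R * lam)^-1 * (lam * S j w - n%:R * lam * cs).
      by field; rewrite !gt_eqF.
    rewrite lerD2l ler_wpM2l ?invr_ge0 ?(ltW nl0)//.
    by apply: le_trans h; rewrite lerDr.
  apply: le_trans h1 _; rewrite lerD2l addrC expRD mulrA -/Sn; apply: ler_wpM2l => //.
  by rewrite (bigD1 j)//= lerDl sumr_ge0// => *; exact: expR_ge0.
rewrite /emp_avg; set SS := \sum_(i < n) expR _.
have -> : 8 * nu ^+ 4 * expR (- ell) * (n%:R^-1 * SS) = tl * SS by rewrite /tl; ring.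
apply: ler_wpM2l => //.
have -> : \sum_ik G ik w = \sum_(i < n) \sum_(k < p) G (i, k) w.
  by rewrite pair_big_dep /=; apply: eq_bigr => -[i k].
by apply: ler_sum => i _; rewrite (bigD1 j)//= lerDl sumr_ge0// => *; exact: expR_ge0.
Qed.

Let expS_expect j : expect P (expS j) <= expR (n%:R * (lam * m4 + 2 * lam ^+ 2 * (c8 * nu ^+ 4))).
Proof. by rewrite -lee_fin -(expectE (expS_int j)); exact: S_mgf. Qed.

Let expell : expR ell = n%:R * p%:R.
Proof. by rewrite ellE lnK ?natrM// posrE ?mulr_gt0. Qed.

(** The term [ln p / (n lam)] of [cs] cancels the number [p] of summands exactly. *)
Let sum_expS : Sn * \sum_j expect P (expS j) <= (n%:R * lam)^-1.
Proof.
have nl0 : 0 < n%:R * lam by exact: mulr_gt0.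
apply: (@le_trans _ _ (Sn * (p%:R * expR (n%:R * (lam * m4 + 2 * lam ^+ 2 * (c8 * nu ^+ 4)))))).
  apply: ler_wpM2l => //.
  apply: (@le_trans _ _ (\sum_(j < p) expR (n%:R * (lam * m4 + 2 * lam ^+ 2 * (c8 * nu ^+ 4))))).
    by apply: ler_sum => j _; exact: expS_expect.
  by rewrite sumr_const card_ord -[_ *+ p]mulr_natl.
rewrite /Sn -[leLHS]mulrA -[leRHS]mulr1 ler_wpM2l ?invr_ge0 ?(ltW nl0)//.
rewrite mulrCA -expRD.
have -> : - (n%:R * lam * cs) + n%:R * (lam * m4 + 2 * lam ^+ 2 * (c8 * nu ^+ 4)) = - ln p%:R.
  by rewrite /cs; field; rewrite !gt_eqF.
by rewrite expRN lnK ?posrE// divff// gt_eqF.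
Qed.

(** The factor [expR (- ell)] is [1 / (n p)] and cancels the number of entries, leaving a multiple
    of [nu^4 / n], which [rate] bounds. *)
Let sum_G : tl * \sum_ik expect P (G ik) <= 16 * C4.
Proof.
have s2 := @sqrt2_le2 R.
apply: (@le_trans _ _ (tl * ((n%:R * p%:R) * 2))).
  apply: ler_wpM2l => //.
  apply: (@le_trans _ _ (\sum_(ik : 'I_n * 'I_p) 2)).
    by apply: ler_sum => ik _; apply: le_trans s2; exact: (subgaussian_expect (sub ik.1) ik.2).
  by rewrite sumr_const card_prod !card_ord -[_ *+ (n * p)]mulr_natl natrM.
rewrite /tl -expell expRN.
have -> : n%:R^-1 * (8 * nu ^+ 4 / expR ell) * (expR ell * 2) = 16 * (nu ^+ 4 / n%:R).
  by field; rewrite !gt_eqF ?expR_gt0.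
rewrite ler_wpM2l// ler_pdivrMr//; apply: le_trans rate.
by rewrite ler_peMr ?(ltW nu40)// exprn_ege1.
Qed.

Let lnp_le : ln p%:R <= ell.
Proof.
have np0 : 0 < (n * p)%:R :> R by rewrite natrM mulr_gt0.
by rewrite ellE ler_ln ?posrE// natrM ler_peMl ?(ltW pR0)// ler1n.
Qed.

Let cs_le : cs + (n%:R * lam)^-1 <= m4 + c8 + 16 * C4.
Proof.
have e2 : 1 <= ell ^+ 2 by exact: exprn_ege1.
have t1 : 2 * lam * (c8 * nu ^+ 4) <= c8.
  have -> : 2 * lam * (c8 * nu ^+ 4) = c8 * (4 * ell ^+ 2)^-1.
    by rewrite /lam /b; field; rewrite !gt_eqF.
  rewrite -[leRHS]mulr1 ler_wpM2l// invf_le1 ?mulr_gt0 ?exprn_gt0//; lra.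
have t2 : ln p%:R / (n%:R * lam) + (n%:R * lam)^-1 <= 16 * C4.
  have -> : ln p%:R / (n%:R * lam) + (n%:R * lam)^-1 =
    8 * (nu ^+ 4 * (ell ^+ 2 * (ln p%:R + 1)) / n%:R).
    by rewrite /lam /b; field; rewrite !gt_eqF.
  have -> : 16 * C4 = 8 * (2 * C4) by ring.
  rewrite ler_wpM2l// ler_pdivrMr//.
  apply: (@le_trans _ _ (2 * (nu ^+ 4 * ell ^+ 7))); last by rewrite -[leRHS]mulrA ler_wpM2l.
  rewrite [leRHS]mulrCA; apply: ler_wpM2l; first exact: ltW.
  apply: (@le_trans _ _ (ell ^+ 2 * (ell + ell))).
    by rewrite ler_wpM2l ?sqr_ge0// lerD.
  have -> : ell ^+ 2 * (ell + ell) = 2 * ell ^+ 3 by ring.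
  by rewrite ler_wpM2l// ler_weXn2l.
by rewrite /cs -!addrA lerD2l; apply: lerD.
Qed.

Let D_expect : expect P D <= m4 + c8 + 32 * C4.
Proof.
have iS := @integrableR_sum _ _ _ P _ (index_enum 'I_p) _ expS_int.
have iG := @integrableR_sum _ _ _ P _ (index_enum ('I_n * 'I_p)%type) _ G_int.
rewrite /D (expectD (integrableR_cst P cs) (integrableRD (integrableRZ Sn iS) (integrableRZ tl iG))).
rewrite (expectD (integrableRZ Sn iS) (integrableRZ tl iG)) (expect_cst P cs).
rewrite (expectZ Sn iS) (expectZ tl iG) (expect_sum _ expS_int) (expect_sum _ G_int).
apply: (@le_trans _ _ (cs + (n%:R * lam)^-1 + 16 * C4)).
  by rewrite -[leRHS]addrA; apply: lerD => //; apply: lerD; [exact: sum_expS|exact: sum_G].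
apply: (@le_trans _ _ (m4 + c8 + 16 * C4 + 16 * C4)); first by rewrite lerD2r; exact: cs_le.
by rewrite le_eqVlt; apply/orP; left; apply/eqP; ring.
Qed.

Let lnA := ln (2 * p%:R ^+ 2 / alpha) : R.
Let cA := 3 + ln alpha^-1 / ln 2.

(** As [p >= 2], the constants [ln 2] and [ln alpha^-1] are absorbed into multiples of [ln p]. *)
Let lnA_le : lnA <= cA * ln p%:R.
Proof.
have /andP[a0 a1] := alpha01.
have ln2 : 0 < ln 2 :> R by rewrite ln_gt0// ltr1n.
have lp : ln 2 <= ln p%:R :> R by rewrite ler_ln ?posrE// ler_nat.
have la : 0 <= ln alpha^-1 by rewrite ln_ge0// invf_ge1// ltW.
rewrite /lnA lnM ?posrE ?mulr_gt0 ?exprn_gt0 ?invr_gt0// lnM ?posrE ?exprn_gt0// lnXn// -[ln p%:R *+ 2]mulr_natl.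
have : ln alpha^-1 <= ln alpha^-1 / ln 2 * ln p%:R.
  by rewrite -mulrA ler_peMr// mulrC ler_pdivlMr// mul1r.
rewrite /cA mulrDl; lra.
Qed.

Let a y := boot_quantile P (fun i => vec (X i y)) e (1 - alpha).

(** The square root of the envelope is linearised by [sqrt D <= (D / s + s) / 2], where [s^2 = m4].
    The constants [c8 + 32 C4] become a multiple of [m4] because [4 * C1 <= m4]. *)
Lemma expect_boot_quantile (s : R) : 0 < s -> s ^+ 2 = m4 ->
  (\int[P]_y (a y)%:E <= (Num.sqrt (128 * (3 + ln alpha^-1 / ln 2)) *
     (2 + (c8 + 32 * C4) / (4 * C1)) / 2 * s * Num.sqrt (ln p%:R / n%:R))%:E)%E.
Proof.
move=> s0 sE; have /andP[al0 al1] := alpha01.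
have ln2 : 0 < ln 2 :> R by rewrite ln_gt0// ltr1n.
have cA0 : 0 <= cA by rewrite addr_ge0// divr_ge0 ?(ltW ln2)// ln_ge0// invf_ge1// ltW.
pose kap := Num.sqrt (128 * cA) * Num.sqrt (ln p%:R / n%:R).
have kap0 : 0 <= kap by rewrite mulr_ge0 ?sqrtr_ge0.
have aD y : a y <= kap * (2^-1 * (s^-1 * D y + s)).
  have V0 : 0 < 64 * D y by exact: mulr_gt0.
  apply: le_trans (boot_quantile_le n2 p0 iid_e std_e V0 alpha01 (boot_var_le n2 (avg_le y))) _.
  rewrite -/lnA.
  have sq : 0 <= ln p%:R / n%:R :> R by rewrite divr_ge0 ?(ltW n0).
  apply: (@le_trans _ _ (kap * Num.sqrt (D y))).
    have c0 : 0 <= 128 * cA := mulr_ge0 (ler0n R 128) cA0.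
    rewrite /kap -sqrtrM// -sqrtrM ?mulr_ge0//; apply: ler_wsqrtr.
    have -> : 2 * (64 * D y) * lnA / n%:R = lnA * (128 * D y / n%:R) by ring.
    have -> : 128 * cA * (ln p%:R / n%:R) * D y = cA * ln p%:R * (128 * D y / n%:R) by ring.
    apply: ler_wpM2r; last exact: lnA_le.
    exact: divr_ge0 (mulr_ge0 (ler0n R 128) (ltW (D_gt0 y))) (ltW n0).
  apply: ler_wpM2l => //.
  set r := Num.sqrt (D y); have rr : r ^+ 2 = D y by rewrite sqr_sqrtr// ltW.
  rewrite -rr -subr_ge0.
  have -> : 2^-1 * (s^-1 * r ^+ 2 + s) - r = (r - s) ^+ 2 / (2 * s) by field; rewrite gt_eqF.
  by rewrite divr_ge0 ?sqr_ge0// mulr_ge0// ltW.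
have ma : measurable_fun setT a.
  apply: (@measurable_boot_quantile R _ _ P n p n2 p0 (fun i => e i)) => [i|i j|].
  - exact: measurable_funPT.
  - rewrite (_ : (fun w => _) = (fun w => tnth (X i w) j)); first exact: measurable_coord.
    by apply/funext => w; rewrite mxE.
  - by rewrite subr_gt0 al1 gtrBl.
have mz (x : 'I_n -> 'cV[R]_p) : measurable_fun setT (fun y => boot_max x (fun i => e i y)).
  by apply: (@measurable_boot_max _ _ _ n2 p0 _ T (fun=> x) (fun y i => e i y)).
have a0 y : 0 <= a y.
  apply: (quantile_ge0 P (mz _)); first by move=> w; exact: boot_max_ge0.
  by rewrite subr_gt0 al1 gtrBl.
have iF1 := integrableRD (integrableRZ s^-1 D_int) (integrableR_cst P s).
have iF2 := integrableRZ 2^-1 iF1; have iF := integrableRZ kap iF2.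
apply: (@le_trans _ _ (\int[P]_y (kap * (2^-1 * (s^-1 * D y + s)))%:E)%E).
  apply: ge0_le_integral => //.
  - by move=> y _; rewrite lee_fin.
  - exact/measurable_EFinP.
  - by apply/measurable_EFinP; exact: integrableR_measurable iF.
  by move=> y _; rewrite lee_fin.
rewrite (expectE iF) lee_fin (expectZ kap iF2) (expectZ _ iF1).
rewrite (expectD (integrableRZ s^-1 D_int) (integrableR_cst P s)) (expectZ _ D_int) (expect_cst P s).
set rt := (c8 + 32 * C4) / (4 * C1).
have -> : Num.sqrt (128 * (3 + ln alpha^-1 / ln 2)) * (2 + rt) / 2 * s * Num.sqrt (ln p%:R / n%:R) =
  kap * (2^-1 * (s^-1 * (m4 + rt * m4) + s)).
  by rewrite /kap -sE -/cA; field; rewrite gt_eqF.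
rewrite ler_wpM2l// ler_wpM2l// lerD2r ler_wpM2l ?invr_ge0 ?(ltW s0)//.
apply: le_trans D_expect _; rewrite -addrA lerD2l /rt mulrAC ler_pdivlMr ?mulr_gt0//.
by apply: ler_wpM2l => //; rewrite addr_ge0// mulr_ge0// ltW.
Qed.

End QuantileExpectation.

(** * Choice of the constants *)

Section Assembly.
Context {R : realType}.
Variables (C1 C2 C3 C4 : R).
Hypotheses (C10 : 0 < C1) (C20 : 0 < C2) (C30 : 0 < C3) (C40 : 0 < C4).

Definition moment_const : R := C2 ^+ 6 + C3 ^+ 8 + 2.
Local Notation c := moment_const.
Let kappa := (Num.sqrt C1)^-1.
Let g3 : R := gauss3.
Let D0 := 541 * (6 * c) ^+ 4 * kappa ^+ 2.
Let A0 := expR 3 * (900 * c ^+ 3 * kappa ^+ 3).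
(** Reciprocal of a sum that starts with 1: it is at most 1, and each listed coefficient times a
    positive power of it is at most 1. [rate_cutoff] is built in the same way. *)
Definition smoothing_const : R := (1 + 272 * g3 + 272 * A0 + 36 * D0)^-1.
Local Notation c0 := smoothing_const.
Definition rate_cutoff : R :=
  (1 + 16 + 16 * kappa + 541 * (6 * c) ^+ 4 / C1 + 80 + 70 * (6 * c) ^+ 2 * kappa + 408 * expR 1)^-1.
(** The 8 pays for bad samples, the second term for the comparison error, and [rate_cutoff^-1] makes
    the bound trivial when [rho] exceeds the cutoff. *)
Definition coverage_const : R :=
  C4 `^ (1 / 6) * (8 + 2 * tail_const / c0 + rate_cutoff^-1).

Let inv_le1 (x : R) : 1 <= x -> x^-1 <= 1.
Proof. by move=> x1; rewrite invf_le1// (lt_le_trans ltr01). Qed.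
Let inv_gt0 (x : R) : 1 <= x -> 0 < x^-1.
Proof. by move=> x1; rewrite invr_gt0 (lt_le_trans ltr01). Qed.

Let c1 : 1 <= c.
Proof. by rewrite /c; have := exprn_ge0 6 (ltW C20); have := exprn_ge0 8 (ltW C30); lra. Qed.
Let kap0 : 0 < kappa. Proof. by rewrite invr_gt0 sqrtr_gt0. Qed.
Let g30 : 0 <= g3. Proof. by rewrite /g3 /gauss3 !addr_ge0 ?mulr_ge0 ?expR_ge0. Qed.
Let c60 : 0 <= 6 * c. Proof. by have := c1; lra. Qed.
Let big0 : 0 <= 541 * (6 * c) ^+ 4 := mulr_ge0 (ler0n R 541) (exprn_ge0 4 c60).
Let D00 : 0 <= D0. Proof. exact: mulr_ge0 big0 (exprn_ge0 2 (ltW kap0)). Qed.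
Let A00 : 0 <= A0.
Proof.
exact: mulr_ge0 (expR_ge0 3) (mulr_ge0 (mulr_ge0 (ler0n R 900) (exprn_ge0 3 (le_trans ler01 c1))) (exprn_ge0 3 (ltW kap0))).
Qed.
Let den1 : 1 <= 1 + 272 * g3 + 272 * A0 + 36 * D0.
Proof. by have := g30; have := A00; have := D00; lra. Qed.
Let c00 : 0 < c0 := inv_gt0 den1.
Let c01 : c0 <= 1 := inv_le1 den1.

Let c0_small K m : (0 < m)%N -> 0 <= K -> K <= 1 + 272 * g3 + 272 * A0 + 36 * D0 -> K * c0 ^+ m <= 1.
Proof.
move=> m0 K0 hK; apply: (@le_trans _ _ (K * c0)).
  by rewrite ler_wpM2l// ler_iXnr// ltW.
by rewrite ler_pdivrMr ?(lt_le_trans ltr01)// mul1r.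
Qed.

Let cut_den := 1 + 16 + 16 * kappa + 541 * (6 * c) ^+ 4 / C1 + 80 + 70 * (6 * c) ^+ 2 * kappa + 408 * expR 1.
Let t1 : 0 <= 541 * (6 * c) ^+ 4 / C1 := divr_ge0 big0 (ltW C10).
Let t2 : 0 <= 70 * (6 * c) ^+ 2 * kappa := mulr_ge0 (mulr_ge0 (ler0n R 70) (sqr_ge0 _)) (ltW kap0).
Let t3 : 0 <= 408 * expR 1 := mulr_ge0 (ler0n R 408) (expR_ge0 1).
Let den2 : 1 <= cut_den.
Proof. by rewrite /cut_den; have := t1; have := t2; have := t3; have := kap0; lra. Qed.
Let cut0 : 0 < rate_cutoff := inv_gt0 den2.
Let cut1 : rate_cutoff <= 1 := inv_le1 den2.

Let rho_small rho K m : 0 < rho -> rho <= rate_cutoff -> (0 < m)%N -> 0 <= K -> K <= cut_den -> K * rho ^+ m <= 1.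
Proof.
move=> r0 rc m0 K0 hK.
have r1 : rho <= 1 := le_trans rc cut1.
apply: (@le_trans _ _ (K * rho)); first by rewrite ler_wpM2l// ler_iXnr// ltW.
apply: (@le_trans _ _ (cut_den * rate_cutoff)); first by rewrite ler_pM// ltW.
by rewrite mulfV// gt_eqF// (lt_le_trans ltr01).
Qed.

Let e4 : expR 1 <= 4 :> R.
Proof.
have h := @expR_le_quad R (2^-1) (lexx _).
have -> : 1 = 2^-1 + 2^-1 :> R by field.
have h2 : expR 2^-1 <= 2 :> R by apply: le_trans h _; lra.
rewrite expRD; apply: (@le_trans _ _ (2 * 2)); last lra.
by rewrite ler_pM ?expR_ge0.
Qed.

Let tail0 : 0 <= tail_const :> R.
Proof. by rewrite /tail_const mulr_ge0// addr_ge0// mulr_ge0// expR_ge0. Qed.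

Lemma coverage_const_gt0 : 0 < coverage_const.
Proof.
rewrite mulr_gt0 ?powR_gt0//; apply: addr_gt0; last by rewrite invr_gt0.
apply: ltr_pwDl => //; exact: divr_ge0 (mulr_ge0 (ler0n R 2) tail0) (ltW c00).
Qed.

Definition expectation_const (alpha : R) : R :=
  Num.sqrt (128 * (3 + ln alpha^-1 / ln 2)) * (2 + (c + 32 * C4) / (4 * C1)) / 2.

Lemma expectation_const_gt0 alpha : 0 < alpha < 1 -> 0 < expectation_const alpha.
Proof.
move=> /andP[a0 a1]; have ln2 : 0 < ln 2 :> R by rewrite ln_gt0// ltr1n.
have h : 0 <= ln alpha^-1 / ln 2 by rewrite divr_ge0 ?(ltW ln2)// ln_ge0// invf_ge1// ltW.
have h2 : 0 <= (c + 32 * C4) / (4 * C1).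
  exact: divr_ge0 (addr_ge0 (le_trans ler01 c1) (mulr_ge0 (ler0n R 32) (ltW C40))) (mulr_ge0 (ler0n R 4) (ltW C10)).
rewrite /expectation_const; set y := ln _ / _ in h *; set z := _ / (4 * C1) in h2 *.
by rewrite divr_gt0// mulr_gt0 ?sqrtr_gt0 ?mulr_gt0//; lra.
Qed.

Section Instance.
Context {d : measure_display} {T : measurableType d} (P : probability T R).
Context {n' p : nat}.
Let n := n'.+1.
Hypotheses (n4 : (4 <= n)%N) (p2 : (2 <= p)%N).
Variables (X : 'I_n -> {RV P >-> p.-tuple R}) (e : 'I_n -> {RV P >-> R}) (i1 : 'I_n).
Hypotheses (iid_X : iid X) (iid_e : iid e) (std_e : forall i, standard_normal (e i)).
Variables (nu K : R).
Hypotheses (nu1 : 1 <= nu) (K01 : 0 < K < 1).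
Hypothesis sub : forall i k, subgaussian P (nu ^+ 2) (fun w => tnth (X i w) k).
Hypothesis mean0 : forall k, ('E_P[fun w => tnth (X i1 w) k] = 0)%E.
Hypothesis hvar : forall j k : 'I_p, (C1%:E <= hajek_cov P (X i1) (j, k) (j, k))%E.
Hypothesis h6 : (max_moment P (X i1) 6 <= (C2 * nu `^ (1 / 3))%:E)%E.
Hypothesis h8 : (max_moment P (X i1) 8 <= (C3 * nu `^ (1 / 2))%:E)%E.
Hypothesis hrate : nu ^+ 4 * ln (n * p)%:R ^+ 7 <= C4 * n%:R `^ (1 - K).
Variable alpha : R.
Hypothesis alpha01 : 0 < alpha < 1.

Let n0 : 0 < n%:R :> R. Proof. by rewrite ltr0n. Qed.
Let p0 : (0 < p)%N := ltnW p2.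
Let pR0 : 0 < p%:R :> R. Proof. by rewrite ltr0n. Qed.
Let nu0 : 0 < nu := lt_le_trans ltr01 nu1.
(** The natural scale of the moments: those of orders 2, 4 and 6 are of order [u], [u^2] and [u^3],
    while those of order 8 are of order [u^6]. *)
Let u := nu `^ (2 / 3).
Let uE : u ^+ 3 = nu ^+ 2.
Proof.
rewrite -powR_mulrn ?powR_ge0// -powRrM.
have -> : 2 / 3 * 3 = 2%:R :> R by field.
by rewrite powR_mulrn ?(ltW nu0).
Qed.
Let u1 : 1 <= u. Proof. by rewrite -[leLHS](powRr0 nu) ler_powR// divr_ge0. Qed.
Let u0 : 0 < u := lt_le_trans ltr01 u1.
Let ell := ln (n * p)%:R : R.
Let expell : expR ell = n%:R * p%:R.
Proof. by rewrite lnK ?natrM// posrE mulr_gt0. Qed.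
Let nR4 : 4 <= n%:R :> R. Proof. by rewrite ler_nat. Qed.
Let pR2 : 2 <= p%:R :> R. Proof. by rewrite ler_nat. Qed.
Let ell1 : 1 <= ell.
Proof.
rewrite -ler_expR expell; apply: le_trans e4 _.
by rewrite -[leLHS]mulr1 ler_pM//; have := pR2; lra.
Qed.
Let w := Num.sqrt ell.
Let w2E : w ^+ 2 = ell. Proof. by rewrite sqr_sqrtr// (le_trans ler01). Qed.
Let w1 : 1 <= w. Proof. by rewrite -[leLHS]sqrtr1 ler_wsqrtr. Qed.
Let w0 : 0 < w := lt_le_trans ltr01 w1.
Let q : R := Num.sqrt n%:R.
Let q0 : 0 < q. Proof. by rewrite sqrtr_gt0. Qed.
Let qq : q ^+ 2 = n%:R. Proof. by rewrite sqr_sqrtr ?(ltW n0). Qed.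
Let rate := nu ^+ 4 * ell ^+ 7 / n%:R.
Let rate0 : 0 < rate.
Proof. by rewrite divr_gt0// mulr_gt0 ?exprn_gt0// (lt_le_trans ltr01). Qed.
Let rho := rate `^ (1 / 6).
Let rho0 : 0 < rho. Proof. exact: powR_gt0. Qed.
Let rho6 : rho ^+ 6 = rate.
Proof.
rewrite -powR_mulrn ?powR_ge0// -powRrM.
have -> : 1 / 6 * 6 = 1 :> R by field.
by rewrite powRr1 ?(ltW rate0).
Qed.
Let rho6n : rho ^+ 6 * n%:R = u ^+ 6 * w ^+ 14.
Proof.
rewrite rho6 /rate divfK ?gt_eqF// (exprM u 3 2) uE (exprM w 2 7) w2E -exprM.
by [].
Qed.
Let rhoE : rho ^+ 3 * q = u ^+ 3 * w ^+ 7.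
Proof.
apply: (@pexpIrn _ 2) => //; rewrite ?nnegrE ?mulr_ge0 ?exprn_ge0 ?(ltW rho0) ?(ltW q0) ?(ltW u0) ?(ltW w0)//.
have -> : (rho ^+ 3 * q) ^+ 2 = rho ^+ 6 * q ^+ 2 by ring.
by rewrite qq rho6n; ring.
Qed.
(** Since [u] and [w] are at least 1, [rho] is never below [n^(-1/6)], so terms of order [1 / n] are
    absorbed into it. *)
Let rho_ge : n%:R^-1 <= rho ^+ 6.
Proof.
rewrite -[leLHS]mul1r ler_pdivrMr// rho6n -[leLHS]mul1r ler_pM// exprn_ege1//.
Qed.
Let delta := n%:R `^ (- (K / 6)) : R.
Let rho_le : rho <= C4 `^ (1 / 6) * delta.
Proof.
have rC : rate <= C4 * n%:R `^ (- K).
  rewrite ler_pdivrMr//; apply: le_trans hrate _.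
  rewrite -mulrA ler_wpM2l ?(ltW C40)// -[X in _ <= _ * X](powRr1 (ltW n0)) -powRD; last first.
    by apply/implyP => _; rewrite gt_eqF.
  by rewrite addrC.
apply: (@le_trans _ _ ((C4 * n%:R `^ (- K)) `^ (1 / 6))).
  by apply: ge0_ler_powR => //; rewrite nnegrE ?(ltW rate0)// mulr_ge0 ?powR_ge0// ltW.
rewrite powRM ?powR_ge0 ?(ltW C40)// -powRrM.
by have -> : - K * (1 / 6) = - (K / 6) by field.
Qed.

Let mom2 k : expect P (fun w => `|tnth (X i1 w) k| ^+ 2) <= c * u.
Proof. exact: (moment2 nu1 (sub i1) u1 uE C20 C30 h6). Qed.
Let mom4 k : expect P (fun w => `|tnth (X i1 w) k| ^+ 4) <= c * u ^+ 2.
Proof. exact: (moment4c nu1 (sub i1) u1 uE C20 C30 h6). Qed.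
Let mom6 k : expect P (fun w => `|tnth (X i1 w) k| ^+ 6) <= c * u ^+ 3.
Proof. exact: (moment6c nu1 (sub i1) u1 uE C20 C30 h6). Qed.
Let mom8 k : expect P (fun w => `|tnth (X i1 w) k| ^+ 8) <= c * u ^+ 6.
Proof. exact: (moment8 nu1 (sub i1) uE C20 C30 h8). Qed.

Let var_ge j k : 4 * C1 <= fourth_mx X i1 j k j k - cov_mx P (X i1) j k ^+ 2.
Proof.
have := hvar j k; rewrite (hajek_covE nu1 (sub i1) mean0) lee_fin /fourth_mx; lra.
Qed.

Let a y := boot_quantile P (fun i => vec (X i y)) e (1 - alpha).

Lemma coverage_rate (E : set T) : measurable E ->
  (forall y, (forall j k, `|sample_cov (fun i => vec (X i y)) j k - cov_mx P (X i1) j k| <= a y) -> E y) ->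
  ((1 - alpha - coverage_const * delta)%:E <= P E)%E.
Proof.
move=> mE hE.
have d0 : 0 <= delta by exact: powR_ge0.
have C0 : 0 < C4 `^ (1 / 6) by exact: powR_gt0.
have tc0 : 0 <= 2 * tail_const / c0 := divr_ge0 (mulr_ge0 (ler0n R 2) tail0) (ltW c00).
have cut : rate_cutoff^-1 * rho <= coverage_const * delta.
  apply: (@le_trans _ _ (rate_cutoff^-1 * (C4 `^ (1 / 6) * delta))).
    by apply: ler_wpM2l rho_le; rewrite invr_ge0 ltW.
  rewrite /coverage_const [leRHS]mulrAC [leLHS]mulrC; apply: ler_wpM2l.
    exact: mulr_ge0 (ltW C0) d0.
  by rewrite lerDr addr_ge0.
(* Above the cutoff the claimed lower bound on the probability is at most 0. *)
have [rc|rc] := leP rho rate_cutoff; last first.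
  apply: (@le_trans _ _ 0%E); last exact: measure_ge0.
  rewrite lee_fin subr_le0; apply: (@le_trans _ _ 1).
    by have /andP[al _] := alpha01; rewrite gerBl ltW.
  apply: le_trans cut.
  by rewrite mulrC ler_pdivlMr// mul1r ltW.
have phi_def : exists phi, phi = c0 * w / rho by exists (c0 * w / rho).
have [phi phiE] := phi_def.
have r1 : rho <= 1 := le_trans rc cut1.
(* The index set has [2 p^2] elements, at most [(n p)^2]; this is the origin of the exponent
   [2 ln (n p)]. *)
have JL : #|@pair_index p|%:R <= expR (2 * w ^+ 2).
  rewrite !card_prod card_bool !card_ord w2E expRM_natl expell !natrM.
  have -> : (n%:R * p%:R) ^+ 2 = p%:R * p%:R * n%:R ^+ 2 :> R by ring.
  apply: ler_wpM2l; first by rewrite mulr_ge0.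
  have := nR4; have : n%:R <= n%:R ^+ 2 :> R.
    by rewrite expr2 ler_peMl ?(ltW n0)//; have := nR4; lra.
  lra.
have en : expR (- (2 * w ^+ 2)) * q ^+ 2 <= rho ^+ 6.
  apply: le_trans rho_ge; rewrite expRN w2E expRM_natl expell qq exprMn invfM.
  have -> : (n%:R ^+ 2)^-1 * (p%:R ^+ 2)^-1 * n%:R = n%:R^-1 * (p%:R ^+ 2)^-1 :> R.
    by field; rewrite !gt_eqF.
  by rewrite ler_piMr ?invr_ge0 ?(ltW n0)// inv_le1// exprn_ege1// ler1n.
have k0 := kap0; have g0 := g30; have d00 := D00; have a00 := A00.
have s1 := t1; have s2 := t2; have s3 := t3.
have rs K' m (m0 : (0 < m)%N) (K0 : 0 <= K') (hK : K' <= cut_den) := rho_small rho0 rc m0 K0 hK.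
have c0g : 272 * g3 * c0 ^+ 3 <= 1.
  have hK : 272 * g3 <= 1 + 272 * g3 + 272 * A0 + 36 * D0 by lra.
  exact: (@c0_small _ 3 isT (mulr_ge0 (ler0n R 272) g30) hK).
have c0A : 272 * A0 * c0 ^+ 3 <= 1.
  have hK : 272 * A0 <= 1 + 272 * g3 + 272 * A0 + 36 * D0 by lra.
  exact: (@c0_small _ 3 isT (mulr_ge0 (ler0n R 272) A00) hK).
have c0D : 36 * D0 * c0 ^+ 2 <= 1.
  have hK : 36 * D0 <= 1 + 272 * g3 + 272 * A0 + 36 * D0 by lra.
  exact: (@c0_small _ 2 isT (mulr_ge0 (ler0n R 36) D00) hK).
have rho16 : 16 * rho ^+ 2 <= 1 by apply: rs => //; rewrite /cut_den; lra.
have rhok : 16 * kappa * rho ^+ 2 <= 1.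
  by apply: rs => //; [exact: mulr_ge0 (ler0n R 16) (ltW kap0)|rewrite /cut_den; lra].
have rhov : 541 * (6 * c) ^+ 4 * rho ^+ 3 <= C1.
  have : 541 * (6 * c) ^+ 4 / C1 * rho ^+ 3 <= 1 by apply: rs => //; rewrite /cut_den; lra.
  by rewrite mulrAC ler_pdivrMr// mul1r.
have rho80 : 80 * rho ^+ 6 <= 1 by apply: rs => //; rewrite /cut_den; lra.
have rhol : 70 * (6 * c) ^+ 2 * kappa * rho ^+ 2 <= 1 by apply: rs => //; rewrite /cut_den; lra.
have exp_n : 408 * expR 1 * expR (- (2 * w ^+ 2)) * q ^+ 2 <= 1.
  rewrite -mulrA; apply: (@le_trans _ _ (408 * expR 1 * rho ^+ 6)); first exact: ler_wpM2l.
  by apply: rs => //; rewrite /cut_den; lra.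
have n8 : (8 < n)%N.
  rewrite -(ltr_nat R); have := tuned_large w1 u1 rhoE rho80; rewrite qq.
  have : 80 <= 80 * u ^+ 6 * w ^+ 10.
    by rewrite -[leLHS]mulr1 ler_pM// ?exprn_ege1// -[leLHS]mulr1 ler_pM// exprn_ege1.
  lra.
have cov := @coverage R d T P n' p (ltnW (ltnW n4)) p0 X e i1 iid_X iid_e std_e nu u c C1 w rho c0 phi
  nu1 u1 uE c1 sub mean0 mom2 mom4 mom8 mom6 C10 var_ge w1 rho0 r1 rhoE c00 c01 phiE JL
  c0g c0A c0D rho16 rhok rhov exp_n w2E rho80 rhol n8 alpha alpha01 E mE hE.
apply: le_trans cov; rewrite lee_fin lerD2l lerN2.
have sq2 := @sqrt2_le2 R.
have e1 : 8 / n%:R <= 8 * rho.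
  rewrite ler_wpM2l//; apply: le_trans rho_ge _; by rewrite ler_iXnr// ltW.
have e2 : tail_const * (Num.sqrt (2 * w ^+ 2) / phi) <= 2 * tail_const / c0 * rho.
  rewrite sqrtrM// sqrtr_sqr ger0_norm ?(ltW w0)// phiE.
  have -> : tail_const * (Num.sqrt 2 * w / (c0 * w / rho)) = tail_const / c0 * rho * Num.sqrt 2.
    by field; rewrite !gt_eqF.
  have -> : 2 * tail_const / c0 * rho = tail_const / c0 * rho * 2 by ring.
  apply: ler_wpM2l sq2; exact: mulr_ge0 (divr_ge0 tail0 (ltW c00)) (ltW rho0).
apply: le_trans (lerD e1 e2) _; rewrite -mulrDl.
apply: (@le_trans _ _ ((8 + 2 * tail_const / c0) * (C4 `^ (1 / 6) * delta))).
  by apply: ler_wpM2l rho_le; rewrite addr_ge0.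
rewrite /coverage_const [leRHS]mulrAC [leLHS]mulrC; apply: ler_wpM2l.
  exact: mulr_ge0 (ltW C0) d0.
by rewrite lerDl invr_ge0 ltW.
Qed.

Lemma expectation_rate (s : R) : 0 <= s -> (max_moment P (X i1) 4 <= s%:E)%E ->
  (\int[P]_y (a y)%:E <= (expectation_const alpha * s ^+ 2 * Num.sqrt (ln p%:R / n%:R))%:E)%E.
Proof.
move=> s0 hs.
have m4 k : expect P (fun w => `|tnth (X i1 w) k| ^+ 4) <= s ^+ 4.
  rewrite -lee_fin -(expectE (coord_pow_int nu1 (sub i1) k 4)).
  exact: (@max_moment_expect _ _ _ P _ (X i1) 3 s k s0 hs).
(* The variance bound at a diagonal entry bounds a fourth moment from below. *)
have s4 : 4 * C1 <= s ^+ 4.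
  pose j := Ordinal p0; apply: le_trans (var_ge j j) _; apply: le_trans (m4 j).
  rewrite (_ : (fun w => `|tnth (X i1 w) j| ^+ 4) =
     (fun w => tnth (X i1 w) j * tnth (X i1 w) j * (tnth (X i1 w) j * tnth (X i1 w) j))).
    by rewrite gerBl sqr_ge0.
  by apply/funext => y; rewrite (exprM _ 2 2) real_normK ?num_real//; ring.
have sp : 0 < s ^+ 2.
  rewrite lt0r sqr_ge0 andbT; apply/eqP => s20; move: s4.
  by rewrite (exprM s 2 2) s20 expr0n /= leNgt mulr_gt0.
have u6 : u ^+ 6 = nu ^+ 4 by rewrite (exprM u 3 2) uE -exprM.
have m8 k : expect P (fun w => `|tnth (X i1 w) k| ^+ 8) <= c * nu ^+ 4 by rewrite -u6.
have rt : nu ^+ 4 * ell ^+ 7 <= C4 * n%:R.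
  apply: le_trans hrate _; rewrite ler_wpM2l ?(ltW C40)// -[leRHS](powRr1 (ltW n0)).
  have /andP[k0 _] := K01; apply: ler_powR; last by rewrite gerBl ltW.
  by have := nR4; lra.
have := @expect_boot_quantile R d T P n' p (ltnW (ltnW n4)) p2 X e i1 iid_X iid_e std_e nu c (s ^+ 4) ell
  C1 C4 alpha nu1 sub m4 m8 erefl ell1 C10 C40 (le_trans ler01 c1) s4 rt alpha01 (s ^+ 2) sp
  (esym (exprM s 2 2)).
exact.
Qed.

End Instance.
End Assembly.

Theorem theorem4p1 (R : realType) (C1 C2 C3 C4 : R)
    (hC1 : 0 < C1) (hC2 : 0 < C2) (hC3 : 0 < C3) (hC4 : 0 < C4) :
  exists2 C : R, 0 < C &
  forall alpha : R, 0 < alpha < 1 ->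
  exists2 C' : R, 0 < C' &
  forall (n p : nat) (i1 : 'I_n), (4 <= n)%N -> (3 <= p ^ 2)%N ->
    i1 = 0%N :> nat ->
  forall (d : measure_display) (T : measurableType d) (P : probability T R)
    (X : 'I_n -> {RV P >-> p.-tuple R}) (e : 'I_n -> {RV P >-> R})
    (nu r zeta beta K : R),
    1 <= nu ->
    0 <= r < 1 ->
    0 < zeta ->
    0 < beta < 1 ->
    0 < K < 1 ->
    iid X ->
    (forall i k, 'E_P[fun w => tnth (X i w) k] = 0)%E ->
    cov_mx P (X i1) \in sparse_class r zeta ->
    (forall i k, subgaussian P (nu ^+ 2) (fun w => tnth (X i w) k)) ->
    (forall j k : 'I_p, (C1%:E <= hajek_cov P (X i1) (j, k) (j, k))%E) ->
    (max_moment P (X i1) 6 <= (C2 * nu `^ (1 / 3))%:E)%E ->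
    (max_moment P (X i1) 8 <= (C3 * nu `^ (1 / 2))%:E)%E ->
    nu ^+ 4 * ln (n * p)%:R ^+ 7 <= C4 * n%:R `^ (1 - K) ->
    iid e ->
    (forall i, standard_normal (e i)) ->
    independent2 P (fun w => [tuple X i w | i < n])
                   (fun w => [tuple e i w | i < n]) ->
  let Sigma := cov_mx P (X i1) in
  let data w (i : 'I_n) := vec (X i w) in
  let a w := boot_quantile P (data w) e (1 - alpha) in
  let tau w := beta^-1 * a w in
  let Sigma_hat w := threshold (tau w) (sample_cov (data w)) in
  [/\ ((1 - alpha - C * n%:R `^ (- (K / 6)))%:E <=
       P [set w |
            (spectral_norm (Sigma_hat w - Sigma) <=
              ((3 + 2 * beta) / beta `^ (1 - r) + (beta / (1 - beta)) `^ r)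
              * zeta * a w `^ (1 - r))%R
          /\ (p%:R^-1 * frobenius_norm (Sigma_hat w - Sigma) ^+ 2 <=
              2 * ((4 + 3 * beta ^+ 2) / beta `^ (2 - r)
                   + 2 * (beta / (1 - beta)) `^ r)
              * zeta * a w `^ (2 - r))%R])%E,
      ('E_P[a] <=
         C'%:E * max_moment P (X i1) 4 ^+ 2
         * (Num.sqrt (ln p%:R / n%:R))%:E)%E &
      ('E_P[tau] <=
         (C' / beta)%:E * max_moment P (X i1) 4 ^+ 2
         * (Num.sqrt (ln p%:R / n%:R))%:E)%E].
Proof.
exists (coverage_const C1 C2 C3 C4); first exact: coverage_const_gt0.
move=> alpha alpha01.
exists (expectation_const C1 C2 C3 C4 alpha); first exact: expectation_const_gt0.
move=> n p i1 n4 pp _ d T P X e nu r zeta beta K nu1 r01 zeta0 beta01 K01 iid_X mean0 hS sub hvar h6 h8 hrate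
  iid_e std_e _.
case: n i1 n4 X e iid_X mean0 hS sub hvar h6 h8 hrate iid_e std_e => [//|n'] i1 n4 X e iid_X mean0 hS sub
  hvar h6 h8 hrate iid_e std_e Sigma data a tau Sigma_hat.
(* [p^2 >= 3] forces [p >= 2], which makes [ln p] positive. *)
have p2 : (2 <= p)%N by case: (p) pp => [|[]].
have n2 : (2 <= n'.+1)%N by exact: ltnW (ltnW n4).
have p0 : (0 < p)%N by exact: ltnW.
have /andP[al0 al1] := alpha01.
have a01 : 0 < 1 - alpha < 1 by rewrite subr_gt0 al1 gtrBl.
have /andP[be0 be1] := beta01.
have mdata i j : measurable_fun setT (fun w => data w i j 0).
  rewrite (_ : (fun w => _) = (fun w => tnth (X i w) j)); first exact: measurable_coord.
  by apply/funext => w; rewrite /data mxE.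
have me i : measurable_fun setT (e i : T -> R) by exact: measurable_funPT.
have ma : measurable_fun setT a by exact: (measurable_boot_quantile P n2 p0 me mdata a01).
have a0 w : 0 <= a w.
  apply: (quantile_ge0 P _ _ a01) => [|y]; last exact: boot_max_ge0.
  by apply: (@measurable_boot_max _ _ _ n2 p0 _ T (fun=> data w) (fun y i => e i y)).
have mSh j k : measurable_fun setT (fun w => (Sigma_hat w - Sigma) j k).
  rewrite (_ : (fun w => _) = (fun w => Sigma_hat w j k - Sigma j k)).
    apply: measurable_funB => //; apply: measurable_threshold; first exact: measurable_funM.
    exact: measurable_sample_cov.
  by apply/funext => w; rewrite !mxE.
have hE : ('E_P[a] <= (expectation_const C1 C2 C3 C4 alpha)%:E * max_moment P (X i1) 4 ^+ 2
         * (Num.sqrt (ln p%:R / n'.+1%:R))%:E)%E.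
  have C0 := expectation_const_gt0 hC1 hC2 hC3 hC4 alpha01.
  set C' := expectation_const _ _ _ _ _ in C0 *.
  have := @expectation_rate R C1 C2 C3 C4 hC1 hC2 hC3 hC4 d T P n' p n4 p2 X e i1 iid_X iid_e std_e nu K
    nu1 K01 sub (mean0 i1) hvar h8 hrate alpha alpha01.
  have : (0 <= max_moment P (X i1) 4)%E by exact: bigmax_ge_id.
  have np : 0 < Num.sqrt (ln p%:R / n'.+1%:R) :> R.
    by rewrite sqrtr_gt0 divr_gt0// ln_gt0// ltr1n.
  rewrite unlock; case: (max_moment P (X i1) 4) => [s| |].
  - rewrite lee_fin => s0 h; apply: le_trans (h s s0 (lexx _)) _.
    by rewrite -EFin_expe -!EFinM.
  (* An infinite fourth moment makes the right-hand side infinite, since its other factors are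
     positive. *)
  - by move=> _ _; rewrite expe2 mulyy gt0_muley ?lte_fin// gt0_mulye ?lte_fin// leey.
  - by rewrite leeNy_eq.
split => //.
- apply: (@coverage_rate R C1 C2 C3 C4 hC1 hC2 hC3 hC4 d T P n' p n4 p2 X e i1 iid_X iid_e std_e nu K
    nu1 sub (mean0 i1) hvar h6 h8 hrate alpha alpha01) => [|w close].
    have mpow (x : R) : measurable_fun setT (fun w => a w `^ x).
      exact: measurableT_comp (measurable_powR x) ma.
    apply: (@measurableI _ _ [set w | spectral_norm (Sigma_hat w - Sigma) <= _]
       [set w | p%:R^-1 * frobenius_norm (Sigma_hat w - Sigma) ^+ 2 <= _]);
      rewrite -[X in measurable X]setTI; apply: measurable_fun_le => //.
    - exact: measurable_spectral_norm.
    - exact: measurable_funM.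
    - by apply: measurable_funM => //; exact: measurable_frobenius_norm.
    - exact: measurable_funM.
  split.
    exact: (threshold_spectral r01 beta01 (a0 w) hS (sample_cov_sym (data w)) close (ltW zeta0)).
  exact: (threshold_frobenius r01 beta01 (a0 w) hS close (ltW zeta0)).
rewrite unlock /tau; move: hE; rewrite unlock => hE.
have -> : (\int[P]_w (beta^-1 * a w)%:E = beta^-1%:E * \int[P]_w (a w)%:E)%E.
  rewrite -ge0_integralZl//.
  - exact/measurable_EFinP.
  - by move=> w _; rewrite lee_fin.
  - by rewrite lee_fin invr_ge0 ltW.
apply: le_trans (lee_wpmul2l _ hE) _; first by rewrite lee_fin invr_ge0 ltW.
by rewrite !muleA -EFinM mulrC.
Qed.
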